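(* Let $\epsilon > 0$. There exists $\delta = \delta(\epsilon) > 0$ such that for all $a, F \in \mathbb{F}_q[T]$ with $\deg F = r$ and any positive integer $n$ satisfying $n > r(1/2 + \epsilon)$, $$\sum_{\substack{\deg x < n \\ (x,F) = 1}}\mu(x)\,e_F(a\overline{x}) \ll_\epsilon q^{n(1-\delta)}.$$
   Context: $q = p^\ell$ is a fixed odd prime power ($p$ prime). $F$ is an arbitrary (nonzero) polynomial in $\mathbb{F}_q[T]$, not assumed irreducible or square-free, and $a$ is not assumed coprime to $F$. Sums over $\deg x < n$ run over all polynomials $x\in\mathbb{F}_q[T]$ of degree less than $n$ (not necessarily monic), and $(x,F)$ denotes the gcd. The Möbius function on $\mathbb{F}_q[T]$ is: $\mu(x)=0$ if $x$ is not square-free (in particular $\mu(0)=0$), and $\mu(x)=(-1)^k$ if $x = hP_1\cdots P_k$ with $h\in\mathbb{F}_q^*$ and $P_1,\dots,P_k$ distinct monic irreducibles. On the field $\mathbb{F}_q(T)_\infty$ of Laurent series $\sum_{i=-\infty}^{N} a_i T^i$ in $1/T$ over $\mathbb{F}_q$, define $e\left(\sum_{i\le N} a_iT^i\right) = \exp\left(\frac{2\pi i}{p}\mathrm{Tr}(a_{-1})\right)$, where $\mathrm{Tr}:\mathbb{F}_q\to\mathbb{F}_p$ is the absolute trace, and set $e_F(x) = e(x/F)$, which depends only on $x$ modulo $F$. For $x$ coprime to $F$, $\overline{x}$ denotes the inverse of $x$ modulo $F$. $A\ll_\epsilon B$ means $|A|\le C B$ with $C$ depending only on $\epsilon$ (and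 on the fixed $q$). *)

(* Defs.v *)
From HB Require Import structures.
From mathcomp Require Import all_boot all_order all_algebra all_field.
From mathcomp Require Import complex.
From mathcomp Require Import all_classical all_reals all_analysis.
From mathcomp Require Import zify.

Set Implicit Arguments.
Unset Strict Implicit.
Unset Printing Implicit Defensive.

Import Order.TTheory GRing.Theory Num.Theory.

Local Open Scope classical_set_scope.
Local Open Scope complex_scope.
Local Open Scope ring_scope.

Section Mobius.
Variable K : finFieldType.
Implicit Types x P : {poly K}.

Definition squarefree x : Prop :=
  forall u : {poly K}, size u != 1%N -> ~~ (u ^+ 2 %| x).

(* Every divisor of a nonzero x has size at most [size x], so this is the set
   of all the monic irreducible divisors of x. *)
Definition prime_divisors x : {set {poly_(size x) K}} :=
  [set P : {poly_(size x) K} |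
    [&& (P : {poly K}) \is monic, irreducibleb P & (P : {poly K}) %| x]].

Definition mobius x : int :=
  if `[< squarefree x >] then (-1) ^+ #|prime_divisors x| else 0.

Lemma squarefree0 : ~ squarefree 0.
Proof. by move=> /(_ 0); rewrite size_poly0 dvdp0 => /(_ isT). Qed.

Lemma mobius_nsquarefree x : ~ squarefree x -> mobius x = 0.
Proof. by rewrite /mobius; case: asboolP. Qed.

Lemma monic_irr_dvd P Q : P \is monic -> Q \is monic ->
  irreducible_poly P -> irreducible_poly Q -> P %| Q -> P = Q.
Proof.
move=> mP mQ [sP _] [_ iQ] PQ; apply/eqP; rewrite -eqp_monic //.
by apply: iQ => //; rewrite gtn_eqF.
Qed.

Lemma irr_dvd_prod (s : seq {poly K}) P : irreducible_poly P ->
  P %| \prod_(Q <- s) Q -> exists2 Q, Q \in s & P %| Q.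
Proof.
move=> iP; elim: s => [|Q s IH].
  by rewrite big_nil dvdp1 => /eqP s1; case: iP; rewrite s1.
rewrite big_cons; have [PQ _|nPQ] := boolP (P %| Q).
  by exists Q; rewrite ?mem_head.
rewrite Gauss_dvdpr; last by rewrite irreducible_poly_coprime.
by move=> /IH[Q' Q's ?]; exists Q' => //; rewrite inE Q's orbT.
Qed.

Lemma mobius_prod (h : K) (s : seq {poly K}) :
  h != 0 -> uniq s ->
  (forall P, P \in s -> P \is monic /\ irreducible_poly P) ->
  mobius (h *: \prod_(P <- s) P) = (-1) ^+ size s.
Proof.
move=> h0 us irr; set x := h *: _.
have s0 : \prod_(P <- s) P != 0.
  rewrite prodf_seq_neq0; apply/allP => P /irr[mP _] /=.
  exact: monic_neq0.
have x0 : x != 0 by rewrite scaler_eq0 negb_or h0.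
have dvdx Q : (Q %| x) = (Q %| \prod_(P <- s) P) by rewrite dvdpZr.
have mem_s P : P \is monic -> irreducible_poly P -> P %| x -> P \in s.
  move=> mP iP; rewrite dvdx => /(irr_dvd_prod iP)[Q Qs PQ].
  by have [mQ iQ] := irr _ Qs; rewrite (monic_irr_dvd mP mQ iP iQ PQ).
have sqf : squarefree x.
  move=> u su; apply/negP => u2x.
  have ux : u %| x by apply: dvdp_trans u2x; rewrite expr2 dvdp_mulr.
  have [P Ps Pu] : exists2 P, P \in s & P %| u.
    apply: contrapT => nP; move: su; apply/negP; rewrite negbK.
    suff : coprimep u (\prod_(P <- s) P).
      by move=> cu; rewrite -coprimepp; apply: coprimep_dvdl cu; rewrite -dvdx.
    rewrite big_seq; elim/big_rec: _ => [|P Q Ps cQ]; first exact: coprimep1.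
    rewrite coprimepMr cQ andbT coprimep_sym.
    rewrite irreducible_poly_coprime; last by have [] := irr _ Ps.
    by apply/negP => Pu; apply: nP; exists P.
  have [mP iP] := irr _ Ps.
  have : P ^+ 2 %| x by apply: dvdp_trans u2x; rewrite dvdp_exp2r.
  rewrite dvdx (perm_big _ (perm_to_rem Ps)) big_cons expr2 dvdp_mul2l ?monic_neq0//.
  move=> /(irr_dvd_prod iP)[Q]; rewrite mem_rem_uniq // inE => /andP[QP Qs] PQ.
  have [mQ iQ] := irr _ Qs.
  by rewrite (monic_irr_dvd mP mQ iP iQ PQ) eqxx in QP.
rewrite /mobius asboolT //; congr (_ ^+ _).
rewrite cardE -(size_map val); apply/perm_size/uniq_perm => //.
  by rewrite map_inj_uniq ?enum_uniq //; exact: val_inj.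
move=> P; apply/mapP/idP => [[Q]|Ps].
  by rewrite mem_enum inE => /and3P[mQ /irreducibleP iQ Qx] ->; exact: mem_s.
have [mP iP] := irr _ Ps.
have Px : P %| x by rewrite dvdx (big_rem _ Ps) dvdp_mulr.
have sP : P \is a poly_of_size (size x) by rewrite qualifE/= dvdp_leq.
exists (NPoly sP) => //; rewrite mem_enum inE /= mP Px andbT.
exact/irreducibleP.
Qed.

End Mobius.

Section InverseModulo.
Variable K : finFieldType.

(* The representative of degree less than deg F; 0 if x is not invertible
   modulo F. *)
Definition inv_mod (F x : {poly K}) : {poly K} :=
  odflt 0 [pick u : {poly_((size F).-1) K} | F %| x * u - 1].

Lemma inv_modP (F x : {poly K}) :
  F != 0 -> coprimep x F -> F %| x * inv_mod F x - 1.
Proof.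
move=> F0 /Bezout_coprimepP[[u v]] /= /eqpP[[c d]] /= /andP[c0 d0] uv.
have Fu : F %| x * ((c / d) *: u) - 1.
  have uv1 : (c / d) *: (u * x) + (c / d) *: (v * F) = 1.
    by rewrite -scalerDr mulrC -scalerA uv scalerA mulVf // scale1r.
  rewrite -scalerAr (mulrC x) -uv1 opprD addrA subrr sub0r.
  by rewrite dvdpNr scalerAl dvdp_mull.
rewrite /inv_mod; case: pickP => //= nou.
have su : ((c / d) *: u) %% F \is a poly_of_size (size F).-1.
  by rewrite qualifE/= -ltnS prednK ?size_poly_gt0 // ltn_modp.
have /negP[] := negbT (nou (NPoly su)); rewrite /=.
move: Fu; rewrite {1}(divp_eq ((c / d) *: u) F) mulrDr -addrA mulrA.
by rewrite dvdp_addr // dvdp_mull.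
Qed.

End InverseModulo.

Section Laurent.
Variable K : fieldType.

(* A Laurent series in 1/T; [lcoef f i] is the coefficient of T^i. *)
Record laurent := Laurent {
  lcoef :> int -> K;
  lcoef_bounded : exists N : int, forall i : int, N < i -> lcoef i = 0
}.

HB.instance Definition _ := gen_eqMixin laurent.
HB.instance Definition _ := gen_choiceMixin laurent.

Lemma laurentP (f g : laurent) : f =1 g -> f = g.
Proof.
case: f g => [f hf] [g hg] /= /funext fg.
by move: hf; rewrite fg => hf; congr Laurent; exact: Prop_irrelevance.
Qed.

Definition poly_coefz (f : {poly K}) (i : int) : K :=
  if i is Posz n then f`_n else 0.

Fact poly_coefz_bounded (f : {poly K}) :
  exists N : int, forall i : int, N < i -> poly_coefz f i = 0.
Proof.
exists (size f)%:Z => -[n|n] //= ltn; apply: nth_default; lia.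
Qed.

Definition laurent_poly (f : {poly K}) : laurent :=
  Laurent (poly_coefz_bounded f).

(* The sum is finite: both factors vanish for large indices. *)
Definition conv (f g : int -> K) (k : int) : K :=
  \sum_(i \in [set: int]) f i * g (k - i).

Fact conv_bounded (f g : laurent) :
  exists N : int, forall k : int, N < k -> conv f g k = 0.
Proof.
have [M fM] := lcoef_bounded f; have [N gN] := lcoef_bounded g.
exists (M + N) => k hk; rewrite /conv fsbig1 // => i _.
have [Mi|iM] := ltP M i; first by rewrite fM ?mul0r.
by rewrite gN ?mulr0 //; lia.
Qed.

Definition laurent_mul (f g : laurent) : laurent := Laurent (conv_bounded f g).

Definition laurent_div (f g : laurent) : laurent :=
  xget (laurent_poly 0) [set h | laurent_mul g h = f].

Lemma laurent_mul_polyE (f : {poly K}) (g : laurent) (k : int) :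
  laurent_mul (laurent_poly f) g k =
  \sum_(i < size f) f`_i * g (k - i%:Z).
Proof.
rewrite /= /conv.
rewrite -(fsbig_widen [set` [seq Posz i | i <- iota 0 (size f)]]) //; last first.
  move=> [i|i] /= [_ ni]; last by rewrite mul0r.
  rewrite nth_default ?mul0r // leqNgt; apply/negP => lti; apply: ni.
  by rewrite mem_map ?mem_iota // => ? ? [].
rewrite -fsbig_seq; last by rewrite map_inj_uniq ?iota_uniq // => ? ? [].
by rewrite big_map /= -[X in iota 0 X]subn0 -/(index_iota _ _) big_mkord.
Qed.

(* Existence and uniqueness of x / F, so [laurent_div] is not the default. *)
Lemma laurent_div_polyP (x F : {poly K}) (h : laurent) : F != 0 ->
  laurent_mul (laurent_poly F) h = laurent_poly x <->
  h = laurent_div (laurent_poly x) (laurent_poly F).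
Proof.
move=> F0.
have uniqF (g g' : laurent) : laurent_mul (laurent_poly F) g =
    laurent_mul (laurent_poly F) g' -> g = g'.
  move=> gg'; apply/laurentP.
  have [M gM] := lcoef_bounded g; have [N gN] := lcoef_bounded g'.
  suff H n i : `|M| + `|N| - n%:Z < i -> g i = g' i.
    by move=> i; apply: (H (absz (`|M| + `|N| + `|i| + 1))); lia.
  elim: n i => [|n IH] i hi; first by rewrite gM ?gN //; lia.
  have := laurent_mul_polyE F g (i + (size F).-1%:Z).
  rewrite gg' laurent_mul_polyE.
  have : (0 < size F)%N by rewrite size_poly_gt0.
  case E : (size F) => [//|m] _; rewrite !big_ord_recr /= !addrK.
  have -> : \sum_(j < m) F`_j * g' (i + m%:Z - j%:Z) =
            \sum_(j < m) F`_j * g (i + m%:Z - j%:Z).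
    apply: eq_bigr => j _; congr (_ * _); apply/esym/IH.
    by have := ltn_ord j; lia.
  move=> /addrI/mulfI ->//.
  by rewrite -lead_coef_eq0 lead_coefE E in F0.
pose Q M := (x * 'X^M) %/ F.
have QS M k : (Q M.+1)`_k.+1 = (Q M)`_k.
  have -> : Q M.+1 = Q M * 'X + (((x * 'X^M) %% F * 'X) %/ F).
    rewrite /Q exprSr mulrA {1}(divp_eq (x * 'X^M) F) mulrDl divpD mulrAC.
    by rewrite mulpK.
  rewrite coefD coefMX /= [X in _ + X]nth_default ?addr0 //.
  rewrite size_divp // leq_subLR.
  have := ltn_modp (x * 'X^M) F; rewrite F0.
  have := size_polyMleq ((x * 'X^M) %% F) 'X; rewrite size_polyX.
  by move: (size _) (size _) (size _) => a b c; lia.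
have QD M n k : (Q (M + n)%N)`_(k + n) = (Q M)`_k.
  by elim: n => [|n IH]; rewrite ?addn0 // !addnS QS.
pose w (k : int) := match k with Posz n => (Q 0%N)`_n | Negz n => (Q n.+1)`_0 end.
have wE k M m : k + M%:Z = m%:Z -> w k = (Q M)`_m.
  case: k => [n|n] hk /=; first by rewrite -(QD 0%N M) add0n; congr (_`_ _); lia.
  have -> : M = (n.+1 + m)%N by lia.
  by rewrite -(QD n.+1 m) add0n.
have wB : exists N : int, forall i : int, N < i -> w i = 0.
  exists (size (Q 0%N))%:Z => -[n|n] //= ltn; apply: nth_default; lia.
pose W := Laurent wB.
have FW : laurent_mul (laurent_poly F) W = laurent_poly x.
  apply/laurentP => k; rewrite laurent_mul_polyE.
  pose M := (absz k + size F)%N; pose m := absz (k + M%:Z).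
  have mE : k + M%:Z = m%:Z by rewrite /m /M; lia.
  have sm : (size F <= m)%N by rewrite /m /M; lia.
  transitivity ((F * Q M)`_m).
    rewrite coefM (big_ord_widen _ (fun i => F`_i * W (k - i%:Z)) (leqW sm)).
    rewrite big_mkcond; apply: eq_bigr => i _; case: ltnP => hi; last first.
      by rewrite nth_default ?mul0r.
    by congr (_ * _); apply: wE; have := ltn_ord i; lia.
  have -> : F * Q M = x * 'X^M - (x * 'X^M) %% F.
    by rewrite {1}(divp_eq (x * 'X^M) F) addrK mulrC.
  rewrite coefB [X in _ - X]nth_default ?subr0; last first.
    by apply: leq_trans sm; apply: ltnW; rewrite ltn_modp.
  rewrite coefMXn; case: k @M @m mE sm => [n|n] M m mE sm /=.
    by rewrite ifF; [congr (_`_ _)|]; lia.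
  by rewrite ifT //; lia.
have DW : laurent_mul (laurent_poly F)
    (laurent_div (laurent_poly x) (laurent_poly F)) = laurent_poly x.
  by apply: (xgetPex _ (P := [set h | laurent_mul _ h = _])); exists W.
by split=> [Fh|->//]; apply: uniqF; rewrite Fh DW.
Qed.

End Laurent.

Section AbsTrace.
Variables (K : finFieldType) (p : nat) (pK : p \in [pchar K]).
Local Notation L := (pPrimeCharType pK).

(* [pPrimeCharType pK] is K seen as an extension of 'F_p, and [galTrace] takes
   its values in the line 'F_p * 1 of K; see [abs_traceP]. *)
Definition abs_trace (x : K) : 'F_p :=
  odflt 0 [pick t : 'F_p | t%:A == galTrace 1%AS {:L}%AS (x : L)].

Lemma abs_traceP (x : K) :
  (abs_trace x)%:A = galTrace 1%AS {:L}%AS (x : L) :> L.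
Proof.
rewrite /abs_trace; case: pickP => [t /eqP //|not_in].
have : galTrace 1%AS {:L}%AS (x : L) \in 1%AS.
  by apply: mem_galTrace; [apply/finField_galois/sub1v | apply: memvf].
by move=> /vlineP[t xt]; have := not_in t; rewrite xt eqxx.
Qed.

End AbsTrace.

Section Character.
Variables (R : realType) (K : finFieldType) (p : nat) (pK : p \in [pchar K]).

Definition expi (t : R) : R[i] := cos t +i* sin t.

Definition e_infty (f : laurent K) : R[i] :=
  expi (2 * pi / p%:R * (abs_trace pK (f (-1)) : nat)%:R).

Definition e_mod (F x : {poly K}) : R[i] :=
  e_infty (laurent_div (laurent_poly x) (laurent_poly F)).

End Character.

(* Main.v *)
(** Vaughan's identity writes the sum over monic x of degree n as a sum of
    triple products d1 d2 y.  If d1 and d2 are short, the sum over y is an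
    incomplete Kloosterman sum modulo F.  Otherwise one has a bilinear form in
    inverses modulo F, which Hölder's inequality bounds by the number of
    solutions of 1/x_1 + ... + 1/x_k = 1/x_(k+1) + ... + 1/x_(2k) modulo F;
    this is small when 2k deg x_i <= deg F, because the congruence is then an
    equation, and for k = 2 by a Dirichlet approximation of 1/x_1 + 1/x_2.
    This treats r (1/2 + eps) < n < A r.  For n >= A r one expands in the even
    Dirichlet characters modulo F, whose L-functions satisfy the Riemann
    hypothesis; the same hypothesis over residue fields bounds the Kloosterman
    sums.  It is proved by Stepanov's method: torsion of a rank one Drinfeld
    module provides a power series lambda on which the primes congruent to a
    constant multiple of c modulo E act by the same additive polynomial, and an
    auxiliary function of small degree vanishing at all of them bounds their
    number. *)

Require Import Defs.
From HB Require Import structures.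
From mathcomp Require Import all_boot all_order all_algebra all_field.
From mathcomp Require Import complex spectral mxred.
From mathcomp Require Import all_classical all_reals all_analysis.
From mathcomp Require Import qfpoly zify ring lra.

Set Implicit Arguments.
Unset Strict Implicit.
Unset Printing Implicit Defensive.

Import Order.TTheory GRing.Theory Num.Theory.

Local Open Scope complex_scope.
Local Open Scope ring_scope.

(** Frobenius at a prime f acts on the torsion point through f/f(0), so the torsion only sees
    residues up to constant factors. This is why the characters must be even; the sum over x is made
    even by averaging over the leading coefficient, which the Möbius function ignores. The degree k
    of lambda over K(y) is never computed. Stepanov's method gives k n N_c <= q^n + O(q^(n/2)) for
    the number N_c of primes of even degree n in class c, and N_c = 0 outside a set H of at most k
    classes. As about q^n/n primes exist in total, this is an equality up to O(q^(n/2)) on H. The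
    main term of a character sum has an unknown coefficient t, but t is never a negative integer, so
    no inverse root exceeds sqrt(q). When a/F is reduced to a'/F', the condition (x,F) = 1 is
    stronger than (x,F') = 1. The extra primes are removed by a recursion that needs a bound B T^n
    for every n; for short n only the trivial bound is available, and its cost is affordable because
    n exceeds r/2 by a fixed proportion. *)

Section Cabs.
Variable R : realType.
Implicit Types z : R[i].

(** A real-valued modulus: the norm of [R[i]] takes its values in [R[i]], whose order is only
    partial. *)
Definition cabs z : R := Normc.normc z.

Lemma normCE z : `|z| = (cabs z)%:C. Proof. by []. Qed.
Lemma cabs0 : cabs 0 = 0. Proof. exact: Normc.normc0. Qed.
Lemma cabs1 : cabs 1 = 1. Proof. exact: Normc.normc1. Qed.
Lemma cabsM z w : cabs (z * w) = cabs z * cabs w.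
Proof. exact: Normc.normcM. Qed.
Lemma cabsN z : cabs (- z) = cabs z.
Proof. by apply: complexI; rewrite -!normCE normrN. Qed.
Lemma cabs_ge0 z : 0 <= cabs z.
Proof. by case: z => a b; rewrite sqrtr_ge0. Qed.
Lemma cabsD z w : cabs (z + w) <= cabs z + cabs w.
Proof. by rewrite -lecR rmorphD /= -!normCE ler_normD. Qed.
Lemma cabs_sum I (r : seq I) (P : pred I) (F : I -> R[i]) :
  cabs (\sum_(i <- r | P i) F i) <= \sum_(i <- r | P i) cabs (F i).
Proof.
elim/big_rec2: _ => [|i y x _ le]; first by rewrite cabs0.
exact: le_trans (cabsD _ _) (lerD _ _).
Qed.
Lemma cabsX z n : cabs (z ^+ n) = cabs z ^+ n.
Proof. by elim: n => [|n IH]; rewrite ?expr0 ?cabs1 // !exprS cabsM IH. Qed.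
Lemma cabs_prod I (r : seq I) (P : pred I) (F : I -> R[i]) :
  cabs (\prod_(i <- r | P i) F i) = \prod_(i <- r | P i) cabs (F i).
Proof. by apply: (big_morph cabs cabsM cabs1). Qed.
Lemma cabs_real (x : R) : cabs x%:C = `|x|.
Proof. by rewrite /cabs /= expr0n addr0 sqrtr_sqr. Qed.
Lemma cabs_nat n : cabs n%:R = n%:R.
Proof. by rewrite -(rmorph_nat (real_complex R)) cabs_real ger0_norm. Qed.
Lemma cabs_int (n : int) : cabs n%:~R = `|n|%:~R.
Proof. by rewrite -(rmorph_int (real_complex R)) cabs_real -intr_norm. Qed.
Lemma cabs_eq0 z : (cabs z == 0) = (z == 0).
Proof. by rewrite -(inj_eq (@complexI R)) -normCE normr_eq0. Qed.
Lemma cabs_conj z : cabs (conjc z) = cabs z.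
Proof. by apply: complexI; rewrite -!normCE normcJ. Qed.
Lemma sqr_cabs z : (cabs z ^+ 2)%:C = z * conjc z.
Proof. by rewrite rmorphXn /= -normCE sqr_normc. Qed.

Lemma sumr_const_le I (r : seq I) (P : pred I) (F : I -> R) (c : R) :
  (forall i, P i -> F i <= c) -> \sum_(i <- r | P i) F i <= (count P r)%:R * c.
Proof.
move=> Fc; rewrite -sum1_count natr_sum big_distrl /=.
by apply: ler_sum => i /Fc; rewrite mul1r.
Qed.

End Cabs.

(** * The additive character of the finite field *)

Section AdditiveCharacter.
Variables (R : realType) (K : finFieldType) (p : nat) (pK : p \in [pchar K]).
Hypothesis p_odd : odd p.
Local Notation C := R[i].

Let p_pr : prime p. Proof. exact: pcharf_prime pK. Qed.

Lemma abs_traceD (x y : K) :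
  abs_trace pK (x + y) = abs_trace pK x + abs_trace pK y.
Proof.
have inj : injective (fun t : 'F_p => t%:A : pPrimeCharType pK).
  by move=> s t /eqP; rewrite -subr_eq0 -scalerBl scaler_eq0 oner_eq0 orbF subr_eq0 => /eqP.
by apply: inj; rewrite /= scalerDl !abs_traceP raddfD.
Qed.

(** A vanishing trace would be a linear relation, with all coefficients 1, between distinct
    automorphisms of the field. *)
Lemma abs_trace_neq0 : exists t : K, abs_trace pK t != 0.
Proof.
apply: contrapT => noT.
have tr0 (t : K) : abs_trace pK t = 0.
  by apply/eqP; apply: contrapT => h; apply: noT; exists t; apply/negP.
have tr0' (t : pPrimeCharType pK) : galTrace 1%AS {:pPrimeCharType pK}%AS t = 0.
  by rewrite -[LHS](abs_traceP pK t) [abs_trace pK t]tr0 scale0r.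
have one0 : (1 : pPrimeCharType pK) != 0 := oner_neq0 _.
move/eqP: one0; apply.
apply: (@gal_independent _ _ {:pPrimeCharType pK}%AS (mem 'Gal({:pPrimeCharType pK} / 1)%g) (fun _ => 1) _ 1%g (fingroup.group1 _)) => a _.
by rewrite -[RHS](tr0' a); apply: eq_bigr => f _; exact: mul1r.
Qed.

Definition psi (t : K) : C :=
  expi (2 * pi / p%:R * (abs_trace pK t : nat)%:R : R).

Let omega : C := expi (2 * pi / p%:R : R).

Lemma expiD (s t : R) : expi (s + t) = expi s * expi t.
Proof. by rewrite /expi cosD sinD; apply/eqP; rewrite eq_complex /= addrC eqxx [X in _ == X]addrC mulrC [X in _ + X]mulrC eqxx. Qed.

Lemma expi0 : expi (0 : R) = 1.
Proof. by rewrite /expi cos0 sin0. Qed.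

Lemma expi_nat (t : R) n : expi (t * n%:R) = expi t ^+ n.
Proof.
by elim: n => [|n IH]; rewrite ?mulr0 ?expi0 // mulrS mulrDr mulr1 expiD IH exprS.
Qed.

Lemma cabs_expi (t : R) : cabs (expi t) = 1.
Proof. by rewrite /cabs /= addrC sin2cos2 subrK sqrtr1. Qed.

Lemma omega_p : omega ^+ p = 1.
Proof.
rewrite -expi_nat divfK ?pnatr_eq0 -?lt0n ?prime_gt0 //.
by rewrite /expi mulrC mulr_natr cos2pi sin2pi.
Qed.

(** For odd p the angle 2 pi / p lies strictly between 0 and pi, so its sine is positive. *)
Lemma omega_neq1 : omega != 1.
Proof.
have p3 : (2 < p)%N by case: p p_pr p_odd => [|[|[|]]].
have p0 : (0 : R) < p%:R by rewrite ltr0n; apply: leq_trans p3.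
have : 0 < sin (2 * pi / p%:R : R).
  apply: sin_gt0_pi; apply/andP; split; first by rewrite divr_gt0 // mulr_gt0 ?pi_gt0.
  by rewrite ltr_pdivrMr // mulrC ltr_pM2l ?pi_gt0 // (ltr_nat _ 2).
by apply: contraTneq => /(congr1 (@complex.Im _)) /= ->; rewrite ltxx.
Qed.

Lemma psiE t : psi t = omega ^+ (abs_trace pK t : nat).
Proof. exact: expi_nat. Qed.

Lemma psiD s t : psi (s + t) = psi s * psi t.
Proof.
rewrite !psiE abs_traceD -exprD /=.
rewrite [in RHS](divn_eq (_ + _) p) exprD mulnC exprM omega_p expr1n mul1r.
by congr (_ ^+ (_ %% _)%N); rewrite (Fp_cast p_pr).
Qed.

Lemma psi0 : psi 0 = 1.
Proof.
have := psiD 0 0; rewrite addr0 => /eqP; rewrite -subr_eq0 -{1}(mulr1 (psi 0)) -mulrBr mulf_eq0.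
have : psi 0 != 0 by rewrite -cabs_eq0 cabs_expi oner_eq0.
by move=> /negPf -> /=; rewrite subr_eq0 => /eqP.
Qed.

Lemma psi_neq1 : exists t, psi t != 1.
Proof.
have [t t0] := abs_trace_neq0; exists t; rewrite psiE.
set k := nat_of_ord _; apply/negP => /eqP ok.
have k0 : (0 < k)%N by rewrite lt0n.
have kp : (k < p)%N by rewrite -[X in (_ < X)%N](Fp_cast p_pr) ltn_ord.
have cop : coprime k p.
  by rewrite coprime_sym prime_coprime // gtnNdvd.
have /eqP := omega_neq1; apply.
case: (egcdnP p k0) => u v uv _.
have : omega ^+ (u * k)%N = 1 by rewrite mulnC exprM ok expr1n.
by rewrite uv (eqP cop) exprD mulnC exprM omega_p expr1n mul1r expr1.
Qed.

End AdditiveCharacter.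

(* The same size can occur at syntactically different instances of the
   coefficient ring, which lia does not identify. *)
Ltac plia :=
  repeat match goal with H : context [@size _ _] |- _ => revert H end;
  repeat match goal with |- context [@size ?T ?s] =>
    let n := fresh "n" in move: (@size T s) => n end; lia.

(** * The residue of x/F and the additive characters modulo F *)

Section Residue.
Variables (K : finFieldType) (F : {poly K}).
Hypothesis F0 : F != 0.

Let r := (size F).-1.

Lemma laurent_div_coef (x : {poly K}) (k : int) :
  \sum_(i < size F) F`_i * laurent_div (laurent_poly x) (laurent_poly F) (k - i%:Z)
  = poly_coefz x k.
Proof.
rewrite -laurent_mul_polyE.
have [_ /(_ erefl) ->] := laurent_div_polyP x (laurent_div (laurent_poly x) (laurent_poly F)) F0.
by [].
Qed.

Fact laurent_add_bounded (f g : laurent K) :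
  exists N : int, forall i : int, N < i -> f i + g i = 0.
Proof.
have [M fM] := lcoef_bounded f; have [N gN] := lcoef_bounded g.
by exists (`|M| + `|N|) => i hi; rewrite fM ?gN ?addr0 //; lia.
Qed.

Lemma laurent_div_polyD (x y : {poly K}) k :
  laurent_div (laurent_poly (x + y)) (laurent_poly F) k =
  laurent_div (laurent_poly x) (laurent_poly F) k +
  laurent_div (laurent_poly y) (laurent_poly F) k.
Proof.
set f := laurent_div (laurent_poly x) _; set g := laurent_div (laurent_poly y) _.
pose h := Laurent (laurent_add_bounded f g).
suff <- : h = laurent_div (laurent_poly (x + y)) (laurent_poly F) by [].
apply/laurent_div_polyP => //; apply/laurentP => j; rewrite laurent_mul_polyE.
under eq_bigr do rewrite /= mulrDr.
by rewrite big_split /= !laurent_div_coef; case: j => [n|n] /=; rewrite ?coefD ?addr0.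
Qed.

Lemma laurent_div_polyMl (Q : {poly K}) k :
  laurent_div (laurent_poly (F * Q)) (laurent_poly F) k = poly_coefz Q k.
Proof.
suff <- : laurent_poly Q = laurent_div (laurent_poly (F * Q)) (laurent_poly F) by [].
apply/laurent_div_polyP => //; apply/laurentP => j; rewrite laurent_mul_polyE.
case: j => [n|n] /=.
  pose G (i : nat) := F`_i * Q`_(n - i).
  have G0 i : (n < i)%N -> F`_i * poly_coefz Q (n%:Z - i%:Z) = 0.
    move=> ni; have -> : n%:Z - i%:Z = Negz (i - n).-1 by lia.
    by rewrite mulr0.
  have GE i : (i <= n)%N -> F`_i * poly_coefz Q (n%:Z - i%:Z) = G i.
    by move=> ni; rewrite subzn.
  rewrite coefM -(big_mkord xpredT (fun i => F`_i * poly_coefz Q (n%:Z - i%:Z))).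
  rewrite -(big_mkord xpredT (fun i => F`_i * Q`_(n - i))).
  have [le|lt] := leqP (size F) n.+1.
    rewrite (big_cat_nat (n := size F) (leq0n _) le) /= [X in _ = _ + X]big_nat_cond.
    rewrite [X in _ = _ + X]big1 ?addr0 => [|i /andP[/andP[hi _] _]].
      rewrite !big_nat; apply: eq_bigr => i /andP[_ hi].
      by rewrite GE // -ltnS (leq_trans hi le).
    by rewrite nth_default ?mul0r.
  rewrite (big_cat_nat (n := n.+1) (leq0n _) (ltnW lt)) /= [X in _ + X = _]big_nat_cond.
  rewrite [X in _ + X = _]big1 ?addr0 => [|i /andP[/andP[hi _] _]].
    by rewrite !big_nat; apply: eq_bigr => i /andP[_ hi]; rewrite GE.
  by rewrite G0.
rewrite big1 // => i _; have -> : Negz n - i%:Z = Negz (n + i) by lia.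
by rewrite mulr0.
Qed.

(** Comparing coefficients in F h = x from the top, a descending induction kills every coefficient
    of h of nonnegative index; the coefficient of T^(r-1) then involves only the leading term of F
    and h(-1). *)
Lemma laurent_div_poly_small (x : {poly K}) : (size x < size F)%N ->
  laurent_div (laurent_poly x) (laurent_poly F) (-1) = x`_r.-1 / lead_coef F.
Proof.
move=> sx; set h := laurent_div _ _.
have sF : size F = r.+1 by rewrite prednK ?size_poly_gt0.
have hE k : (forall i, 0 <= i -> h (k + 1 + i) = 0) ->
    lead_coef F * h k = poly_coefz x (k + r%:Z).
  move=> h0; rewrite -laurent_div_coef sF big_ord_recr /= addrK -lead_coefE.
  rewrite big1 ?add0r // => i _; rewrite -/h.
  have -> : k + r%:Z - (i : nat)%:Z = k + 1 + (r - i - 1)%N%:Z.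
    by have := ltn_ord i; lia.
  by rewrite h0 ?mulr0.
have h0 i : 0 <= i -> h i = 0.
  have [N hN] := lcoef_bounded h.
  suff H n j : 0 <= j -> N - n%:Z < j -> h j = 0.
    by move=> i0; apply: (H (absz N + absz i).+1) => //; lia.
  elim: n j => [|n IH] j j0 hj; first by rewrite hN //; lia.
  have /hE : forall i, 0 <= i -> h (j + 1 + i) = 0.
    by move=> l l0; apply: IH; lia.
  case: j j0 {hj} => // j _; rewrite /= nth_default; last first.
    by rewrite (leq_trans _ (leq_addl _ _)) // -ltnS -sF.
  by move/eqP; rewrite mulf_eq0 lead_coef_eq0 (negPf F0) => /eqP.
have /hE : forall i, 0 <= i -> h (-1 + 1 + i) = 0.
  by move=> l l0; apply: h0; lia.
(* For constant [F] the index [r.-1] is 0 instead of -1; both sides vanish because x = 0. *)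
have [r0|r0] := posnP r.
  move=> h1; have := h1; rewrite r0 /= => /eqP.
  rewrite mulf_eq0 lead_coef_eq0 (negPf F0) /= => /eqP ->.
  by rewrite nth_default ?mul0r //; move: sx; rewrite sF r0; case: (size x).
have -> : -1 + r%:Z = r.-1%:Z by lia.
by move=> /= <-; rewrite [lead_coef F * _]mulrC mulfK // lead_coef_eq0.
Qed.

Lemma laurent_div_polyE (x : {poly K}) :
  laurent_div (laurent_poly x) (laurent_poly F) (-1) = (x %% F)`_r.-1 / lead_coef F.
Proof.
rewrite {1}(divp_eq x F) laurent_div_polyD mulrC laurent_div_polyMl /= add0r.
by rewrite laurent_div_poly_small // ltn_modp.
Qed.

End Residue.

Section Emod.
Variables (R : realType) (K : finFieldType) (p : nat) (pK : p \in [pchar K]).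
Hypothesis p_odd : odd p.
Local Notation C := R[i].
Local Notation e := (e_mod R pK).
Local Notation q := #|K|.
Implicit Types x y u F G : {poly K}.

Lemma e_modE F x : F != 0 ->
  e F x = psi R pK ((x %% F)`_(size F).-2 / lead_coef F).
Proof. by move=> F0; rewrite /e_mod /e_infty laurent_div_polyE. Qed.

Lemma e_modD F x y : F != 0 -> e F (x + y) = e F x * e F y.
Proof. by move=> F0; rewrite !e_modE // modpD coefD mulrDl psiD. Qed.

Lemma cabs_e_mod F x : cabs (e F x) = 1.
Proof. exact: cabs_expi. Qed.

Lemma e_mod_dvd F x : F != 0 -> F %| x -> e F x = 1.
Proof. by move=> F0 /modp_eq0P x0; rewrite e_modE // x0 coef0 mul0r psi0. Qed.

Lemma e_mod_mod F x y : F != 0 -> F %| x - y -> e F x = e F y.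
Proof. by move=> F0 xy; rewrite -[x](subrK y) e_modD // e_mod_dvd ?mul1r. Qed.

(** This is x/F = xG/(FG): the remainder of xG is (x mod F) G, whose relevant coefficient acquires
    the factor [lead_coef G], as does the denominator. *)
Lemma e_modM F G x : F != 0 -> G != 0 -> e (F * G) (x * G) = e F x.
Proof.
move=> F0 G0; rewrite !e_modE ?mulf_neq0 //.
have -> : (x * G) %% (F * G) = (x %% F) * G.
  rewrite {1}(divp_eq x F) mulrDl -mulrA modp_addl_mul_small //.
  have [->|x0] := eqVneq (x %% F) 0; first by rewrite mul0r size_poly0 size_poly_gt0 mulf_neq0.
  have sx : (size (x %% F)%R < size F)%N by rewrite ltn_modp.
  have g : (0 < size G)%N by rewrite size_poly_gt0.
  by have := size_polyMleq (x %% F) G; rewrite (size_mul F0 G0); plia.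
rewrite lead_coefM.
have [F1|F1] := leqP (size F) 1.
  have -> : x %% F = 0 by apply/eqP; rewrite -size_poly_leq0 -ltnS (leq_trans _ F1) // ltn_modp.
  by rewrite mul0r !coef0 !mul0r.
have sF : size F = (size F).-2.+2 by lia.
have sG : size G = (size G).-1.+1 by rewrite prednK ?size_poly_gt0.
have -> : (size (F * G)).-2 = ((size F).-2 + (size G).-1)%N.
  by rewrite size_mul //; plia.
have -> : ((x %% F) * G)`_((size F).-2 + (size G).-1) = (x %% F)`_(size F).-2 * lead_coef G.
  have : (size (x %% F)%R <= (size F).-2.+1)%N by rewrite -ltnS -sF ltn_modp.
  move: (x %% F) => y sy; rewrite lead_coefE coefM.
  have hi : ((size F).-2 < ((size F).-2 + (size G).-1).+1)%N by lia.
  rewrite (bigD1 (Ordinal hi)) //= addKn big1 ?addr0 // => i ine.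
  have {}ine : (i : nat) != (size F).-2 by apply: contra ine => /eqP h; apply/eqP/val_inj.
  case: (ltnP i (size F).-2) => h; last first.
    by rewrite nth_default ?mul0r // (leq_trans sy) // ltn_neqAle eq_sym ine.
  by rewrite [G`__]nth_default ?mulr0 //; plia.
by rewrite -mulf_div divff ?mulr1 // lead_coef_eq0.
Qed.

Lemma e_mod_sum F (I : Type) (s : seq I) (P : pred I) (f : I -> {poly K}) :
  F != 0 -> e F (\sum_(i <- s | P i) f i) = \prod_(i <- s | P i) e F (f i).
Proof.
move=> F0; apply: (big_morph _ (fun x y => e_modD x y F0)).
by rewrite e_mod_dvd.
Qed.

Lemma e_modN F x : F != 0 -> e F (- x) = conjc (e F x).
Proof.
move=> F0; have u : e F x * e F (- x) = 1 by rewrite -e_modD // subrr e_mod_dvd.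
have v : e F x * conjc (e F x) = 1.
  by rewrite -sqr_cabs cabs_e_mod expr1n.
have : e F x != 0 by rewrite -cabs_eq0 cabs_e_mod oner_eq0.
by move=> /mulfI; apply; rewrite u v.
Qed.

Lemma sum_e_mod F u N : F != 0 ->
  \sum_(v : {poly_N K}) e F (u * v) =
  if `[< forall v : {poly_N K}, e F (u * v) = 1 >] then (q ^ N)%:R else 0.
Proof.
move=> F0; case: asboolP => [all1|/existsNP[v0 nv0]].
  by under eq_bigr do rewrite all1; rewrite sumr_const card_npoly.
set S := \sum_ _ _.
have : e F (u * v0) * S = S.
  rewrite /S big_distrr /= [RHS](reindex_inj (addrI v0)) /=.
  by apply: eq_bigr => v _; rewrite mulrDr e_modD.
move=> /eqP; rewrite -subr_eq0 -{2}[S]mul1r -mulrBl mulf_eq0 subr_eq0.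
by case: eqP nv0 => //= _ _ /eqP.
Qed.

Lemma e_mod_trivialP F u N : F != 0 -> (N <= (size F).-1)%N ->
  (forall v : {poly_N K}, e F (u * v) = 1) <->
  (size (u %% F)%R <= (size F).-1 - N)%N.
Proof.
move=> F0 Nr; split=> [all1|su v]; last first.
  rewrite (e_mod_mod (y := (u %% F) * v)) //; last first.
    by rewrite -mulrBl dvdp_mulr // {1}(divp_eq u F) addrK dvdp_mull.
  have [->|v0] := eqVneq (v : {poly K}) 0; first by rewrite mulr0 e_mod_dvd ?dvdp0.
  have [->|u0] := eqVneq (u %% F) 0; first by rewrite mul0r e_mod_dvd ?dvdp0.
  have sv := size_npoly v.
  have f : (0 < size F)%N by rewrite size_poly_gt0.
  have uu : (0 < size (u %% F)%R)%N by rewrite size_poly_gt0.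
  have vv : (0 < size v)%N by rewrite size_poly_gt0.
  have suv := size_polyMleq (u %% F) v.
  rewrite e_modE // modp_small; last by plia.
  by rewrite nth_default ?mul0r ?psi0 //; plia.
rewrite leqNgt; apply/negP => su.
have r1 : (0 < (size F).-1)%N.
  have : (size (u %% F)%R < size F)%N by rewrite ltn_modp.
  plia.
set w := u %% F in su; have w0 : w != 0 by rewrite -size_poly_gt0; lia.
have sw : (size w < size F)%N by rewrite ltn_modp.
(* The monomial c T^k lifts the leading term of u mod F to degree r-1, and c is chosen so that the
   value fed to [psi] is [t]. *)
pose k := ((size F).-1 - size w)%N.
have [t tn1] := psi_neq1 R pK p_odd.
pose c := t * lead_coef F / lead_coef w.
have sv : (size (c *: 'X^k : {poly K}) <= N)%N.
  by apply: leq_trans (size_scale_leq _ _) _; rewrite size_polyXn /k; lia.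
have := all1 (NPoly sv); apply/eqP; rewrite /= (e_mod_mod (y := c *: (w * 'X^k))) //; last first.
  rewrite -scalerAr -scalerBr -mulrBl -mul_polyC dvdp_mull // dvdp_mulr //.
  by rewrite /w {1}(divp_eq u F) addrK dvdp_mull.
rewrite e_modE // modp_small; last first.
  by apply: leq_ltn_trans (size_scale_leq _ _) _; rewrite size_mulXn // /k; plia.
rewrite coefZ coefMXn ifF; last by apply/negbTE; rewrite -leqNgt /k; plia.
have -> : ((size F).-2 - k)%N = (size w).-1 by rewrite /k; plia.
by rewrite -lead_coefE /c divfK ?lead_coef_eq0 // mulfK ?lead_coef_eq0.
Qed.

Lemma sum_e_modE F u N : F != 0 -> (N <= (size F).-1)%N ->
  \sum_(v : {poly_N K}) e F (u * v) =
  if (size (u %% F)%R <= (size F).-1 - N)%N then (q ^ N)%:R else 0.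
Proof.
move=> F0 Nr; rewrite sum_e_mod //; case: asboolP => [/e_mod_trivialP -> //|h].
by case: ifPn => // /(e_mod_trivialP u F0 Nr) /h.
Qed.

Lemma sum_e_mod_full F u : F != 0 ->
  \sum_(v : {poly_((size F).-1) K}) e F (u * v) =
  if F %| u then (q ^ (size F).-1)%:R else 0.
Proof.
by move=> F0; rewrite sum_e_modE // subnn size_poly_leq0.
Qed.

End Emod.

(** * Formal power series over a field *)

Definition fps (K : fieldType) : Type := nat -> K.

Section Fps.
Variable K : fieldType.
Implicit Types f g h : fps K.

HB.instance Definition _ := gen_eqMixin (fps K).
HB.instance Definition _ := gen_choiceMixin (fps K).

Definition fps_add f g : fps K := fun n => f n + g n.
Definition fps_opp f : fps K := fun n => - f n.
Definition fps_zero : fps K := fun=> 0.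
Definition fps_one : fps K := fun n => (n == 0%N)%:R.
Definition fps_mul f g : fps K := fun n => \sum_(i < n.+1) f i * g (n - i)%N.

Fact fps_addA : associative fps_add.
Proof. by move=> f g h; apply/funext => n; exact: addrA. Qed.
Fact fps_addC : commutative fps_add.
Proof. by move=> f g; apply/funext => n; exact: addrC. Qed.
Fact fps_add0 : left_id fps_zero fps_add.
Proof. by move=> f; apply/funext => n; exact: add0r. Qed.
Fact fps_addN : left_inverse fps_zero fps_opp fps_add.
Proof. by move=> f; apply/funext => n; exact: addNr. Qed.
HB.instance Definition _ :=
  GRing.isZmodule.Build (fps K) fps_addA fps_addC fps_add0 fps_addN.

Definition agree n f (P : {poly K}) := forall k, (k < n)%N -> f k = P`_k.
Definition trunc n f : {poly K} := \poly_(i < n) f i.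

Lemma agree_trunc n f : agree n f (trunc n f).
Proof. by move=> k kn; rewrite coef_poly kn. Qed.

Lemma agree_mul n f g P Q :
  agree n f P -> agree n g Q -> agree n (fps_mul f g) (P * Q).
Proof.
move=> fP gQ k kn; rewrite coefM; apply: eq_bigr => i _.
by rewrite fP ?gQ //; have := ltn_ord i; lia.
Qed.

(** Transports identities from polynomials: the ring laws of power series are checked on
    truncations. *)
Lemma agree_fpsP f g : (forall n, exists2 P, agree n f P & agree n g P) -> f = g.
Proof.
by move=> fg; apply/funext => n; have [P fP gP] := fg n.+1; rewrite fP ?gP.
Qed.

Fact fps_mulA : associative fps_mul.
Proof.
move=> f g h; apply: agree_fpsP => n.
have F := agree_trunc (n := n) f; have G := agree_trunc (n := n) g.
have H := agree_trunc (n := n) h.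
exists (trunc n f * (trunc n g * trunc n h)); first by do !apply: agree_mul.
by rewrite mulrA; do !apply: agree_mul.
Qed.
Fact fps_mulC : commutative fps_mul.
Proof.
move=> f g; apply: agree_fpsP => n.
have F := agree_trunc (n := n) f; have G := agree_trunc (n := n) g.
exists (trunc n f * trunc n g); first exact: agree_mul.
by rewrite mulrC; exact: agree_mul.
Qed.
Fact fps_mul1 : left_id fps_one fps_mul.
Proof.
move=> f; apply: agree_fpsP => n; exists (1 * trunc n f).
  by apply: agree_mul; [move=> k _; rewrite coef1|exact: agree_trunc].
by rewrite mul1r; exact: agree_trunc.
Qed.
Fact fps_mulDl : left_distributive fps_mul fps_add.
Proof.
move=> f g h; apply/funext => n; rewrite /fps_mul /fps_add -big_split /=.
by apply: eq_bigr => i _; rewrite mulrDl.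
Qed.
Fact fps_1neq0 : fps_one != 0.
Proof. by apply/eqP => /(congr1 (@^~ 0%N)) /eqP; rewrite oner_eq0. Qed.
HB.instance Definition _ :=
  GRing.Zmodule_isComNzRing.Build (fps K) fps_mulA fps_mulC fps_mul1 fps_mulDl fps_1neq0.

Lemma agree_exp n f P m : agree n f P -> agree n (f ^+ m) (P ^+ m).
Proof.
move=> fP; elim: m => [|m IH]; first by move=> k _; rewrite !expr0 coef1.
by rewrite !exprS; exact: agree_mul.
Qed.

Lemma fpsDE f g n : (f + g) n = f n + g n. Proof. by []. Qed.
Lemma fpsNE f n : (- f) n = - f n. Proof. by []. Qed.
Lemma fps0E n : (0 : fps K) n = 0. Proof. by []. Qed.
Lemma fpsME f g n : (f * g) n = \sum_(i < n.+1) f i * g (n - i)%N.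
Proof. by []. Qed.
Lemma fps_sumE (I : Type) (s : seq I) (P : pred I) (F : I -> fps K) n :
  (\sum_(i <- s | P i) F i) n = \sum_(i <- s | P i) F i n.
Proof. by elim/big_rec2: _ => // i x y _ <-. Qed.

Definition fps_val f v := f v != 0 /\ forall i, (i < v)%N -> f i = 0.

Lemma fps_valP f : f != 0 -> exists v, fps_val f v.
Proof.
move=> f0; have ex : exists v, f v != 0.
  apply: contrapT => nex; move/eqP: f0; apply; apply/funext => n.
  by apply/eqP; apply: contrapT => fn; apply: nex; exists n; apply/negP.
exists (ex_minn ex); case: ex_minnP => v fv vmin; split => // i iv.
by apply/eqP; apply: contrapT => /negP /vmin; rewrite leqNgt iv.
Qed.

Lemma fps_val_neq0 f v : fps_val f v -> f != 0.
Proof. by case=> fv _; apply: contraNneq fv => ->. Qed.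

Lemma fps_val_mul f g v w : fps_val f v -> fps_val g w -> fps_val (f * g) (v + w).
Proof.
move=> [fv mv] [gw mw]; split=> [|i ivw].
  have hv : (v < (v + w).+1)%N by lia.
  rewrite fpsME (bigD1 (Ordinal hv)) //= addKn big1 ?addr0 ?mulf_neq0 // => i ine.
  have {}ine : (i : nat) != v by apply: contra ine => /eqP h; apply/eqP/val_inj.
  case: (ltngtP i v) ine => // h _; first by rewrite mv ?mul0r.
  by rewrite mw ?mulr0 //; have := ltn_ord i; lia.
rewrite fpsME big1 // => j _; case: (ltnP j v) => h; first by rewrite mv ?mul0r.
by case: j h => j hj /= h; rewrite mw ?mulr0 //; lia.
Qed.

Lemma fps_val_exp f v n : fps_val f v -> fps_val (f ^+ n) (n * v)%N.
Proof.
move=> fv; elim: n => [|n IH]; last by rewrite exprS mulSn; exact: fps_val_mul.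
by rewrite expr0; split => //=; exact: oner_neq0.
Qed.

Definition fps_unit : pred (fps K) := fun f => `[< exists g, g * f = 1 >].
Definition fps_inv f : fps K := if fps_unit f then xget 0 [set g | g * f = 1]%classic else f.

Fact fps_mulVr : {in fps_unit, left_inverse 1 fps_inv *%R}.
Proof.
move=> f fu; have /asboolP[g gf] := fu; rewrite /fps_inv ifT //.
by apply: (xgetPex 0 (P := [set g | g * f = 1]%classic)); exists g.
Qed.
Fact fps_unitP f g : g * f = 1 -> f \in fps_unit.
Proof. by move=> gf; apply/asboolP; exists g. Qed.
Fact fps_inv_out : {in [predC fps_unit], fps_inv =1 id}.
Proof. by move=> f; rewrite inE /= => fu; rewrite /fps_inv ifF //; apply/negbTE. Qed.
HB.instance Definition _ :=
  GRing.ComNzRing_hasMulInverse.Build (fps K) fps_mulVr fps_unitP fps_inv_out.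
Fact fps_idomain : GRing.integral_domain_axiom (fps K).
Proof.
move=> f g fg; case: (eqVneq f 0) => //= /fps_valP[v fv].
case: (eqVneq g 0) => //= /fps_valP[w gw].
by have := fps_val_neq0 (fps_val_mul fv gw); rewrite fg eqxx.
Qed.
HB.instance Definition _ := GRing.ComUnitRing_isIntegral.Build (fps K) fps_idomain.

Definition poly_fps (P : {poly K}) : fps K := fun n => P`_n.
Fact poly_fps_zmod : zmod_morphism poly_fps.
Proof. by move=> P Q; apply/funext => n; rewrite /poly_fps coefB. Qed.
HB.instance Definition _ := GRing.isZmodMorphism.Build {poly K} (fps K) poly_fps poly_fps_zmod.
Fact poly_fps_monoid : monoid_morphism poly_fps.
Proof.
split; first by apply/funext => n; rewrite /poly_fps coef1.
by move=> P Q; apply/funext => n; rewrite /poly_fps coefM.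
Qed.
HB.instance Definition _ := GRing.isMonoidMorphism.Build {poly K} (fps K) poly_fps poly_fps_monoid.

Lemma poly_fps_eq0 P : (poly_fps P == 0) = (P == 0).
Proof.
apply/eqP/eqP => [h|->]; last exact: rmorph0.
by apply/polyP => n; have := congr1 (@^~ n) h; rewrite coef0.
Qed.

Lemma poly_fps_val P v : fps_val (poly_fps P) v -> (v < size P)%N.
Proof. by case=> Pv _; rewrite ltnNge; apply: contra Pv => sP; rewrite /poly_fps nth_default. Qed.

Lemma fpsXM f n : (poly_fps 'X * f) n = if n is m.+1 then f m else 0.
Proof.
have /(_ n (ltnSn n)) := @agree_mul n.+1 (poly_fps 'X) f 'X _ (fun k _ => erefl) (@agree_trunc n.+1 f).
rewrite -[fps_mul _ _]/(poly_fps 'X * f) => ->.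
by rewrite coefXM; case: n => // n; rewrite coef_poly ltnW.
Qed.

End Fps.

(** * Powers of exponent q^s in characteristic p *)

Section FiniteFieldPowers.
Variable K : finFieldType.
Local Notation q := #|K|.

Lemma exprD_card (R : comNzRingType) (s : nat) (x y : R) :
  {subset [pchar K] <= [pchar R]} -> (x + y) ^+ (q ^ s) = x ^+ (q ^ s) + y ^+ (q ^ s).
Proof.
move=> sub; have [p p_pr pK] := finPcharP K; apply: exprDn_pchar.
rewrite pnatX; apply/orP; left; have pR := sub p pK.
have : p.-nat q.
  by have := abelian.abelem_pgroup (abelian.fin_ring_pchar_abelem pK); rewrite /pgroup.pgroup cardsT.
by apply: sub_in_pnat => p' _; rewrite inE => /eqP ->.
Qed.

Lemma exprN_card (R : comNzRingType) (s : nat) (x : R) :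
  {subset [pchar K] <= [pchar R]} -> (- x) ^+ (q ^ s) = - x ^+ (q ^ s).
Proof.
move=> sub; apply/eqP; rewrite -subr_eq0 opprK -exprD_card // addNr expr0n expn_eq0.
by rewrite -leqn0 leqNgt (ltn_trans _ (finRing_gt1 K)).
Qed.

Lemma exprB_card (R : comNzRingType) (s : nat) (x y : R) :
  {subset [pchar K] <= [pchar R]} -> (x - y) ^+ (q ^ s) = x ^+ (q ^ s) - y ^+ (q ^ s).
Proof. by move=> sub; rewrite exprD_card // exprN_card. Qed.

Lemma expr_sum_card (R : comNzRingType) (s : nat) (I : Type) (t : seq I) (P : pred I)
    (F : I -> R) : {subset [pchar K] <= [pchar R]} ->
  (\sum_(i <- t | P i) F i) ^+ (q ^ s) = \sum_(i <- t | P i) F i ^+ (q ^ s).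
Proof.
move=> sub; apply: (big_morph (fun x => x ^+ (q ^ s))) => [x y|].
  exact: exprD_card.
by apply/eqP; rewrite expr0n expn_eq0 -leqn0 leqNgt (ltn_trans _ (finRing_gt1 K)).
Qed.

Lemma poly_expr_card (R : comNzRingType) (s : nat) (P : {poly R}) :
  {subset [pchar K] <= [pchar R]} -> (forall i, P`_i ^+ (q ^ s) = P`_i) ->
  P ^+ (q ^ s) = P \Po 'X^(q ^ s).
Proof.
move=> sub fixP; have sub' : {subset [pchar K] <= [pchar {poly R}]}.
  by move=> p /sub; rewrite pchar_poly.
rewrite -{1}(coefK P) poly_def expr_sum_card // comp_polyE; apply: eq_bigr => i _.
by rewrite exprZn fixP -!exprM mulnC.
Qed.

Lemma fps_expq (f : fps K) n :
  (f ^+ q) n = if (q %| n)%N then f (n %/ q)%N else 0.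
Proof.
rewrite (agree_exp q (@agree_trunc _ n.+1 f)) // -[in LHS](expn1 q).
rewrite poly_expr_card // => [|i]; last by rewrite expn1 expf_card.
rewrite expn1 coef_comp_poly_Xn ?(ltn_trans _ (finRing_gt1 K)) //.
by case: ifP => // _; rewrite coef_poly ltnS leq_div.
Qed.

End FiniteFieldPowers.

Section Pigeonhole.

Lemma fin_pigeonhole (A B : finType) (f : A -> B) :
  (#|B| < #|A|)%N -> exists x, exists2 y, x != y & f x = f y.
Proof.
move=> BA; apply: contrapT => H; have inj : injective f.
  move=> x y fxy; apply/eqP; apply: contrapT => /negP xy.
  by apply: H; exists x, y.
by have := leq_card f inj; rewrite leqNgt BA.
Qed.

End Pigeonhole.

(** * Bivariate polynomials and pseudo-division *)

Section BivariateDegree.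
Variable K : fieldType.
Implicit Types h : {poly {poly K}}.

(** The outer variable X will be specialised to a torsion point, while the coefficients are
    polynomials in y. The degree in X is measured by [size], the degree in y by [degY]. *)
Definition degY D h := forall i, (size (h`_i)%R <= D.+1)%N.

Lemma size_sum_le (I : Type) (s : seq I) (P : pred I) (F : I -> {poly K}) n :
  (forall i, P i -> (size (F i) <= n)%N) -> (size (\sum_(i <- s | P i) F i)%R <= n)%N.
Proof.
move=> FP; elim/big_rec: _ => [|i x Pi sx]; first by rewrite size_poly0.
by apply: leq_trans (size_polyD _ _) _; rewrite geq_max FP.
Qed.

Lemma degY_mono D D' h : (D <= D')%N -> degY D h -> degY D' h.
Proof. by move=> DD hD i; apply: leq_trans (hD i) _. Qed.

Lemma degYD D h h' : degY D h -> degY D h' -> degY D (h + h').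
Proof.
by move=> hD hD' i; rewrite coefD (leq_trans (size_polyD _ _)) // geq_max hD hD'.
Qed.

Lemma degYN D h : degY D h -> degY D (- h).
Proof. by move=> hD i; rewrite coefN size_polyN. Qed.

Lemma degYB D h h' : degY D h -> degY D h' -> degY D (h - h').
Proof. by move=> hD hD'; apply: degYD => //; apply: degYN. Qed.

Lemma degYM D D' h h' : degY D h -> degY D' h' -> degY (D + D')%N (h * h').
Proof.
move=> hD hD' i; rewrite coefM; apply: size_sum_le => j _.
apply: leq_trans (size_polyMleq _ _) _.
by have := hD j; have := hD' (i - j)%N; plia.
Qed.

Lemma degYC D (P : {poly K}) : (size P <= D.+1)%N -> degY D P%:P.
Proof. by move=> sP i; rewrite coefC; case: ifP => // _; rewrite size_poly0. Qed.

Lemma degYXn n : degY 0 'X^n.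
Proof. by move=> i; rewrite coefXn; case: eqP => _; rewrite ?size_poly1 ?size_poly0. Qed.

Lemma degYX n D h : degY D h -> degY (n * D)%N (h ^+ n).
Proof.
move=> hD; elim: n => [|n IH]; first by rewrite expr0; exact: (degYXn 0).
by rewrite exprS mulSn; exact: degYM.
Qed.

Lemma degY_sum D (I : Type) (s : seq I) (P : pred I) (F : I -> {poly {poly K}}) :
  (forall i, P i -> degY D (F i)) -> degY D (\sum_(i <- s | P i) F i).
Proof.
by move=> FP j; rewrite coef_sum; apply: size_sum_le => i /FP /(_ j).
Qed.

Lemma degY_ex h : exists D, degY D h.
Proof.
exists (\max_(i < size h) size (h`_i)%R)%N => i.
have [hi|hi] := leqP (size h) i; first by rewrite nth_default ?size_poly0.
exact: leqW (leq_bigmax (Ordinal hi)).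
Qed.

(* Pseudo-division by m, with a prescribed number of steps so that the
   remainder is additive in the dividend. *)
Variable m : {poly {poly K}}.
Let l := lead_coef m.
Let k := (size m).-1.

Fixpoint prem (d : nat) h :=
  if d is d'.+1 then prem d' (l%:P * h - (h`_(k + d'))%:P * 'X^d' * m) else h.

Lemma premB d h h' : prem d (h - h') = prem d h - prem d h'.
Proof.
elim: d h h' => [|d IH] h h' //=; rewrite -IH; congr (prem d _).
by rewrite coefB polyCB; ring.
Qed.

Lemma size_prem d h : m != 0 -> (size h <= k + d)%N -> (size (prem d h) <= k)%N.
Proof.
move=> m0; elim: d h => [|d IH] h sh /=; first by rewrite addn0 in sh.
apply: IH; apply/leq_sizeP => j; rewrite leq_eqVlt => /orP[/eqP <-|dj].
  rewrite coefB coefCM -mulrA coefCM mulrC -[_ * m]mulrC coefMXn.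
  rewrite ifF ?addnK; last by apply/negbTE; rewrite -leqNgt leq_addl.
  by rewrite -/k -lead_coefE -/l subrr.
rewrite coefB coefCM nth_default ?mulr0 ?sub0r; last by rewrite (leq_trans sh) // addnS.
rewrite -mulrA coefCM ['X^d * m]mulrC coefMXn ifF; last by apply/negbTE; rewrite -leqNgt; lia.
rewrite [m`_ _]nth_default ?mulr0 ?oppr0 //.
have : (0 < size m)%N by rewrite size_poly_gt0.
by rewrite /k in dj *; plia.
Qed.

Lemma premP d h : exists quo, (l ^+ d)%:P * h = quo * m + prem d h.
Proof.
elim: d h => [|d IH] h /=; first by exists 0; rewrite mul0r add0r expr0 mul1r.
set h' := _ - _; have [quo eq] := IH h'.
exists (quo + (l ^+ d)%:P * ((h`_(k + d))%:P * 'X^d)).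
rewrite mulrDl addrAC -eq /h' exprSr polyCM; ring.
Qed.

Lemma degY_prem g d D h : degY g m -> degY D h -> degY (D + d * g)%N (prem d h).
Proof.
move=> gm; elim: d D h => [|d IH] D h hD /=; first by rewrite addn0.
rewrite mulSn addnA; apply: IH.
have lg : degY g l%:P by apply: degYC; rewrite /l lead_coefE.
apply: degYB; first by rewrite addnC; apply: degYM.
by rewrite -[D]addn0; do !apply: degYM => //; [exact: degYC|exact: degYXn].
Qed.

End BivariateDegree.

(** * Torsion points of a rank one Drinfeld module as power series *)

Section CarlitzTorsion.
Variables (K : finFieldType) (E : {poly K}).
Hypothesis E1 : (1 < size E)%N.
Local Notation q := #|K|.
Let r := (size E).-1.

Let q_gt1 : (1 < q)%N. Proof. exact: finRing_gt1. Qed.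
Let E0 : E != 0. Proof. by rewrite -size_poly_gt0 ltnW. Qed.
Let sE : size E = r.+1. Proof. by rewrite prednK // ltnW. Qed.

(* Coefficients of the power series prod_j (1 - T y^(q^j))^-1 in y. *)
Fixpoint part_poly (fuel n : nat) : {poly K} :=
  if n is n'.+1 then
    if fuel is t.+1 then
      (if (q %| n)%N then part_poly t (n %/ q)%N else 0) + 'X * part_poly t n'
    else 0
  else 1.

Lemma part_poly_fuel t n : (n <= t)%N -> part_poly t n = part_poly n n.
Proof.
have [N] := ubnP t; elim: N t n => // N IH [|t] [|n] // tN nt /=.
have lt : (n.+1 %/ q <= n)%N by rewrite -ltnS ltn_Pdiv.
rewrite (IH t n) //; congr (_ + _); case: ifP => // _.
rewrite (IH t) ?(leq_trans lt) // (IH n) //.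
by rewrite (leq_trans nt) // ltnW.
Qed.

(** With P(y) = prod_j 1/(1 - T y^(q^j)), the functional that reads the coefficient of T^(r-1)
    modulo E is applied to u P(y), one power of y at a time. *)
Definition lam (u : {poly K}) : fps K := fun n => ((u * part_poly n n) %% E)`_r.-1.

Fact lam_zmod : zmod_morphism lam.
Proof. by move=> u v; apply/funext => n; rewrite /lam mulrBl modpD modpN coefD coefN. Qed.
HB.instance Definition _ := GRing.isZmodMorphism.Build {poly K} (fps K) lam lam_zmod.

Lemma poly_fpsCM (c : K) (f : fps K) n : (poly_fps c%:P * f) n = c * f n.
Proof.
rewrite fpsME big_ord_recl /= subn0 /poly_fps coefC eqxx big1 ?addr0 // => i _.
by rewrite coefC mul0r.
Qed.

Lemma lamZ c u : lam (c *: u) = poly_fps c%:P * lam u.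
Proof. by apply/funext => n; rewrite poly_fpsCM /lam -scalerAl modpZl coefZ. Qed.

Lemma lam_dvd u : E %| u -> lam u = 0.
Proof. by move=> Eu; apply/funext => n; rewrite /lam (modp_eq0P _ _ (dvdp_mulr _ Eu)) coef0. Qed.

(** The q-th power substitutes y^q for y, since the coefficients lie in K, and P(y^q) = (1 - T y)
    P(y). So phi_T(X) = (X - X^q)/y sends [lam u] to [lam (u * 'X)]: the values of [lam] are
    E-torsion points of the module phi. *)
Lemma lam_frob u : lam u ^+ q = lam u - poly_fps 'X * lam (u * 'X).
Proof.
apply/funext => n; rewrite fps_expq fpsDE fpsNE fpsXM.
case: n => [|n]; first by rewrite dvdn0 div0n subr0.
rewrite {2}/lam [part_poly _ _]/=.
have lt : (n.+1 %/ q <= n)%N by rewrite -ltnS ltn_Pdiv.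
rewrite mulrDr modpD coefD /lam -mulrA addrK.
by case: ifP => _; rewrite ?mulr0 ?mod0p ?coef0 // (part_poly_fuel lt).
Qed.

(** By [lam_frob] the vanishing spreads to all u T^j. For a suitable j the leading term of u mod E
    reaches degree r-1, where the constant coefficient of [lam] reads it. *)
Lemma lam_inj u : lam u = 0 -> E %| u.
Proof.
move=> lu; have lX j : lam (u * 'X^j) = 0.
  elim: j => [|j IH]; first by rewrite expr0 mulr1.
  have := lam_frob (u * 'X^j); rewrite IH expr0n gtn_eqF ?(ltn_trans _ q_gt1) // sub0r.
  move/esym/eqP; rewrite oppr_eq0 -mulrA -exprSr mulf_eq0 poly_fps_eq0 polyX_eq0 /=.
  by move/eqP.
apply/modp_eq0P/eqP; apply: contrapT => /negP w0; set w := u %% E in w0.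
have sw : (size w < size E)%N by rewrite ltn_modp.
have sw0 : (0 < size w)%N by rewrite size_poly_gt0.
have := congr1 (@^~ 0%N) (lX (r - size w)%N); rewrite /lam /= mulr1 fps0E.
have -> : (u * 'X^(r - size w)) %% E = w * 'X^(r - size w).
  rewrite [in LHS](divp_eq u E) mulrDl modpD mulrAC modp_mull add0r modp_small //.
  by rewrite size_mulXn // sE; rewrite sE in sw; plia.
rewrite coefMXn ifF; last by apply/negbTE; rewrite -leqNgt; rewrite sE in sw; plia.
have -> : (r.-1 - (r - size w))%N = (size w).-1 by rewrite sE in sw; plia.
by move/eqP; rewrite -lead_coefE lead_coef_eq0 (negPf w0).
Qed.

Definition ev (h : {poly {poly K}}) : fps K := (map_poly (poly_fps (K := K)) h).[lam 1].
Fact ev_zmod : zmod_morphism ev.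
Proof. by move=> g h; rewrite /ev rmorphB hornerD hornerN. Qed.
HB.instance Definition _ := GRing.isZmodMorphism.Build {poly {poly K}} (fps K) ev ev_zmod.
Fact ev_monoid : monoid_morphism ev.
Proof. by split=> [|g h]; rewrite /ev ?rmorph1 ?hornerC // rmorphM hornerM. Qed.
HB.instance Definition _ := GRing.isMonoidMorphism.Build {poly {poly K}} (fps K) ev ev_monoid.

Lemma evC P : ev P%:P = poly_fps P.
Proof. by rewrite /ev map_polyC hornerC. Qed.
Lemma evX : ev 'X = lam 1.
Proof. by rewrite /ev map_polyX hornerX. Qed.

Lemma evB g h : ev (g - h) = ev g - ev h. Proof. exact: rmorphB. Qed.
Lemma evM g h : ev (g * h) = ev g * ev h. Proof. exact: rmorphM. Qed.
Lemma evXn h n : ev (h ^+ n) = ev h ^+ n. Proof. exact: rmorphXn. Qed.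
Lemma ev_sum (I : Type) (s : seq I) (P : pred I) (F : I -> {poly {poly K}}) :
  ev (\sum_(i <- s | P i) F i) = \sum_(i <- s | P i) ev (F i).
Proof. exact: rmorph_sum. Qed.
Lemma poly_fpsM (P Q : {poly K}) : poly_fps (P * Q) = poly_fps P * poly_fps Q.
Proof. exact: rmorphM. Qed.

(** The sum 1 + q + ... + q^(j-1), the exponent of y in the denominator of phi_{T^j}. *)
Fixpoint cexp j := if j is i.+1 then (q * cexp i).+1 else 0%N.

(* y^(cexp j) phi_{T^j}(X) for the Drinfeld module phi_T(X) = (X - X^q)/y. *)
Fixpoint cpoly j : {poly {poly K}} :=
  if j is i.+1 then ('X^(q.-1 * cexp i))%:P * cpoly i - cpoly i ^+ q else 'X.

Lemma ev_cpoly j : ev (cpoly j) = poly_fps 'X^(cexp j) * lam 'X^j.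
Proof.
elim: j => [|j IH] /=; first by rewrite evX !expr0 rmorph1 mul1r.
rewrite evB evM evXn IH evC exprMn lam_frob -exprSr mulrA -poly_fpsM -exprD.
have -> : (q.-1 * cexp j + cexp j = q * cexp j)%N by rewrite -mulSnr prednK ?(ltn_trans _ q_gt1).
rewrite -(rmorphXn (poly_fps (K := K))) -exprM [(cexp j * q)%N]mulnC mulrBr subKr.
by rewrite mulrA -poly_fpsM -exprSr.
Qed.

Lemma leq_cexp j : (j <= cexp j)%N.
Proof. by elim: j => //= j IH; rewrite ltnS (leq_trans IH) // leq_pmull // ltnW. Qed.

Lemma cexp_mono i j : (i <= j)%N -> (cexp i <= cexp j)%N.
Proof.
move=> ij; rewrite -(subnK ij); elim: (j - i)%N => //= d IH.
by rewrite (leq_trans IH) // leqW // leq_pmull // ltnW.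
Qed.

Lemma natr_card_poly : q%:R = 0 :> {poly {poly K}}.
Proof.
have [p p_pr pK] := finPcharP K.
have pq : (p %| q)%N.
  have := abelian.abelem_pgroup (abelian.fin_ring_pchar_abelem pK); rewrite /pgroup.pgroup cardsT.
  by move/p_natP => [[|k] qE]; [move: q_gt1; rewrite qE|rewrite qE dvdn_exp].
have pR : p \in [pchar {poly {poly K}}] by rewrite !pchar_poly.
by apply/eqP; rewrite -(dvdn_pcharf pR).
Qed.

(** Derivation kills q-th powers, so only the linear term in X contributes and the derivative is
    constant in X. This is the source of separability below. *)
Lemma deriv_cpoly j : (cpoly j)^`() = ('X^(cexp j - j))%:P.
Proof.
elim: j => [|j IH] /=; first by rewrite derivX expr0.
rewrite derivB derivM derivC mul0r add0r IH deriv_exp -mulr_natr natr_card_poly mulr0 subr0.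
rewrite -polyCM -exprD subSS; have jc := leq_cexp j.
have -> : (q.-1 * cexp j + (cexp j - j) = q * cexp j - j)%N.
  by rewrite addnBA // -mulSnr prednK ?(ltn_trans _ q_gt1).
by [].
Qed.

(** y^(cexp r) phi_u(X): one exponent clears the denominators for all u of degree at most r. The
    module phi is a twist of the Carlitz module with 1/y in the role of T. *)
Definition carlitz u := \sum_(j < r.+1) (u`_j *: 'X^(cexp r - cexp j))%:P * cpoly j.

Lemma ev_carlitz (u : {poly K}) : (size u <= r.+1)%N -> ev (carlitz u) = poly_fps 'X^(cexp r) * lam u.
Proof.
move=> su; rewrite ev_sum -[in RHS](coefK u) poly_def.
rewrite (big_ord_widen r.+1 (fun i => u`_i *: 'X^i) su) [in RHS]big_mkcond raddf_sum mulr_sumr.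
apply: eq_bigr => j _; rewrite evM ev_cpoly evC.
case: ltnP => [_|uj].
  2: by rewrite nth_default // scale0r !raddf0 mul0r mulr0.
rewrite [X in _ = _ * X]lamZ mulrA -poly_fpsM -scalerAl -exprD subnK; last by apply: cexp_mono; rewrite -ltnS.
by rewrite -mul_polyC poly_fpsM mulrCA mulrA.
Qed.

(** The right-hand side is y^(cexp r) E(1/y), named [disc] later; where it does not vanish, the
    torsion has a separable reduction. *)
Lemma deriv_carlitz : (carlitz E)^`() = (\sum_(j < r.+1) E`_j *: 'X^(cexp r - j))%:P.
Proof.
rewrite /carlitz raddf_sum /= rmorph_sum; apply: eq_bigr => j _.
rewrite derivM derivC mul0r add0r deriv_cpoly -polyCM -scalerAl -exprD.
have ja := leq_cexp j; have jb : (cexp j <= cexp r)%N by apply: cexp_mono; rewrite -ltnS.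
by have -> : (cexp r - cexp j + (cexp j - j) = cexp r - j)%N by lia.
Qed.

(** * Specialization at a place of degree n *)
Section Specialization.
Variables (L : fieldType) (rho0 : {rmorphism {poly K} -> L}).
Let y := rho0 'X.
Hypothesis y0 : y != 0.
Let rho := map_poly rho0.
Let rhoc := map_poly (rho0 \o polyC).

Let pcharL : {subset [pchar K] <= [pchar {poly L}]}.
Proof.
move=> p pK; rewrite pchar_poly; apply: (rmorph_pchar rho0).
by rewrite pchar_poly.
Qed.

Let rhoB g h : rho (g - h) = rho g - rho h. Proof. exact: rmorphB. Qed.
Let rhoM g h : rho (g * h) = rho g * rho h. Proof. exact: rmorphM. Qed.
Let rhoXn h n : rho (h ^+ n) = rho h ^+ n. Proof. exact: rmorphXn. Qed.
Let rhoC c : rho c%:P = (rho0 c)%:P. Proof. exact: map_polyC. Qed.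
Let rho_sum (I : Type) (s : seq I) (P : pred I) (F : I -> {poly {poly K}}) :
  rho (\sum_(i <- s | P i) F i) = \sum_(i <- s | P i) rho (F i).
Proof. exact: rmorph_sum. Qed.
Let rhocB g h : rhoc (g - h) = rhoc g - rhoc h. Proof. exact: rmorphB. Qed.
Let rhocM g h : rhoc (g * h) = rhoc g * rhoc h. Proof. exact: rmorphM. Qed.
Let rhocC c : rhoc c%:P = (rho0 c%:P)%:P. Proof. exact: map_polyC. Qed.
Let rho0X n : rho0 'X^n = y ^+ n. Proof. exact: rmorphXn. Qed.

(** The specialisation of phi_{T^j}(X) itself: y is invertible in L, so the denominators may
    return. *)
Definition sell j : {poly L} := y ^- cexp j *: rho (cpoly j).

Lemma sell0 : sell 0 = 'X.
Proof. by rewrite /sell expr0 invr1 scale1r /rho map_polyX. Qed.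

Lemma sellq j : sell j ^+ q = sell j - y *: sell j.+1.
Proof.
rewrite /sell /= rhoB rhoM rhoXn rhoC rho0X mul_polyC exprZn scalerA.
have -> : y * y ^- (q * cexp j).+1 = y ^- (q * cexp j).
  by rewrite exprS invfM mulrA divff ?mul1r.
rewrite scalerBr scalerA.
have -> : y ^- (q * cexp j) * y ^+ (q.-1 * cexp j) = y ^- cexp j.
  have -> : (q * cexp j = q.-1 * cexp j + cexp j)%N by rewrite -mulSnr prednK ?(ltn_trans _ q_gt1).
  by rewrite exprD invfM mulrAC mulVf ?mul1r ?expf_neq0.
by rewrite subKr -!exprVn -exprM mulnC.
Qed.

(** phi_{w T^i}(X), extended linearly to coefficients of w in L. Multiplication of w by T is the
    shift of [i]. *)
Definition act (w : {poly L}) i := \sum_(k < size w) w`_k *: sell (i + k).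

Lemma actE N (w : {poly L}) i : (size w <= N)%N ->
  act w i = \sum_(k < N) w`_k *: sell (i + k).
Proof.
move=> wN; rewrite /act (big_ord_widen N (fun k => w`_k *: sell (i + k)) wN).
rewrite big_mkcond; apply: eq_bigr => k _; case: ltnP => // wk.
by rewrite nth_default // scale0r.
Qed.

Lemma actB v w i : act (v - w) i = act v i - act w i.
Proof.
pose N := maxn (size v) (size w).
rewrite (@actE N v) ?leq_maxl // (@actE N w) ?leq_maxr // (@actE N) -?sumrB.
  by apply: eq_bigr => k _; rewrite coefB scalerBl.
by rewrite (leq_trans (size_polyD _ _)) // size_polyN.
Qed.

Lemma actZ c w i : act (c *: w) i = c *: act w i.
Proof.
rewrite (@actE (size w) (c *: w)) ?size_scale_leq // scaler_sumr.
by apply: eq_bigr => k _; rewrite coefZ scalerA.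
Qed.

Lemma actMX w i : act (w * 'X) i = act w i.+1.
Proof.
rewrite (@actE (size w).+1); last by rewrite (leq_trans (size_polyMleq _ _)) // size_polyX addn2.
rewrite big_ord_recl coefMX /= scale0r add0r; apply: eq_bigr => k _.
by rewrite coefMX /= addSnnS.
Qed.

Lemma act1 i : act 1 i = sell i.
Proof. by rewrite (@actE 1) ?size_poly1 // big_ord1 coef1 scale1r addn0. Qed.

(** By [sellq] one q-th power acts as the operator 1 - y T, and the following powers turn the scalar
    y into y^(q^j). When 1/y is a root of a prime f of degree n, the product is f/f(0). *)
Lemma sell_expq n i :
  sell i ^+ (q ^ n) = act (\prod_(j < n) (1 - y ^+ (q ^ j) *: 'X)) i.
Proof.
elim: n i => [|n IH] i; first by rewrite big_ord0 act1 expn0 expr1.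
rewrite expnS exprM sellq.
transitivity (sell i ^+ (q ^ n) - (y *: sell i.+1) ^+ (q ^ n)); first exact: exprB_card.
rewrite (exprZn y (sell i.+1)) !IH big_ord_recr /=.
by rewrite mulrBr mulr1 actB -scalerAr actZ actMX.
Qed.

Lemma act_carlitz (c : {poly K}) : (size c <= r.+1)%N ->
  act (rhoc c) 0 = y ^- cexp r *: rho (carlitz c).
Proof.
move=> sc; rewrite (@actE r.+1); last first.
  by rewrite (leq_trans _ sc) // size_poly.
rewrite rho_sum scaler_sumr; apply: eq_bigr => j _.
rewrite rhoM rhoC mul_polyC scalerA /sell add0n scalerA coef_map /=.
have -> : rho0 (c`_j *: 'X^(cexp r - cexp j)) = rho0 (c`_j)%:P * y ^+ (cexp r - cexp j).
  by rewrite -rho0X -rmorphM mul_polyC.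
congr (_ *: _); rewrite [RHS]mulrCA; congr (_ * _).
have jr : (cexp j <= cexp r)%N by apply: cexp_mono; rewrite -ltnS.
by rewrite -[in RHS](subnK jr) exprD invfM addnK mulrAC mulVf ?mul1r ?expf_neq0.
Qed.

Variable M : {poly L}.
Hypothesis M_carlitz : M %| rho (carlitz E).

Let torsion i := act (rhoc E) i.

(** The coefficients of E are fixed by the q-th power, so each torsion polynomial is obtained from
    the previous one as (t - t^q)/y, a multiple of t. *)
Lemma dvd_torsion i : M %| torsion i.
Proof.
elim: i => [|i IH].
  rewrite /torsion act_carlitz ?sE // dvdpZr // invr_eq0 expf_neq0 //.
suff -> : torsion i.+1 = y^-1 *: (torsion i - torsion i ^+ q).
  rewrite dvdpZr ?invr_eq0 // dvdp_sub // (dvdp_trans IH) // -(prednK (ltn_trans _ q_gt1)) //.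
  by rewrite exprS dvdp_mulr.
rewrite /torsion /act -[X in _ ^+ X]expn1 expr_sum_card // -sumrB scaler_sumr.
apply: eq_bigr => k _; rewrite exprZn expn1 sellq coef_map /= -!rmorphXn expf_card.
rewrite -[rho0 (polyC _)]/(rho0 (E`_k)%:P) addSn.
move: (rho0 _) (sell (i + k)) (sell (i + k).+1) => a s t.
by rewrite -scalerBr subKr !scalerA mulrAC mulVf // mul1r.
Qed.

Lemma dvd_act_mul (u : {poly K}) i : M %| act (rhoc (E * u)) i.
Proof.
have rhocX : rhoc 'X = 'X by exact: map_polyX.
elim/poly_ind: u i => [|u c IH] i.
  by rewrite mulr0 /rhoc map_poly0 /act size_poly0 big_ord0 dvdp0.
rewrite mulrDr mulrA -[_ * c%:P]opprK -mulrN rhocB rhocM rhocX actB actMX dvdp_sub //.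
rewrite -polyCN rhocM mulrC rhocC mul_polyC actZ.
by have [->|c0] := eqVneq (rho0 (- c)%:P) 0; rewrite ?scale0r ?dvdp0 // dvdpZr ?dvd_torsion.
Qed.

(** The reciprocity law: X^(q^n) is phi_g(X) by [sell_expq], and modulo a divisor of the E-torsion
    polynomial phi_g depends only on g modulo E. *)
Lemma frobenius_carlitz n (g c : {poly K}) :
  \prod_(j < n) (1 - y ^+ (q ^ j) *: 'X) = rhoc g ->
  E %| g - c -> (size c <= r.+1)%N ->
  M %| y ^+ cexp r *: 'X^(q ^ n) - rho (carlitz c).
Proof.
move=> Hg /dvdpP[u gc] sc.
have -> : y ^+ cexp r *: 'X^(q ^ n) - rho (carlitz c) =
    y ^+ cexp r *: act (rhoc (E * u)) 0.
  rewrite [E * u]mulrC -gc rhocB actB (act_carlitz sc) -Hg -sell_expq sell0 scalerBr.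
  by rewrite scalerA divff ?scale1r // expf_neq0.
by rewrite dvdpZr ?expf_neq0 // dvd_act_mul.
Qed.

End Specialization.

End CarlitzTorsion.

(** * The minimal equation of the torsion point and its reductions *)

Section MinimalPolynomial.
Variables (K : finFieldType) (E : {poly K}).
Hypothesis E1 : (1 < size E)%N.
Local Notation q := #|K|.
Let r := (size E).-1.
Local Notation e := (cexp K r).
Implicit Types h s t : {poly {poly K}}.

Let q_gt1 : (1 < q)%N. Proof. exact: finRing_gt1. Qed.
Let E0 : E != 0. Proof. by rewrite -size_poly_gt0 ltnW. Qed.
Let sE : size E = r.+1. Proof. by rewrite prednK // ltnW. Qed.

Definition disc : {poly K} := \sum_(j < r.+1) E`_j *: 'X^(e - j).

Lemma disc_neq0 : disc != 0.
Proof.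
have re : (r <= e)%N by exact: leq_cexp.
have : disc`_(e - r) != 0.
  rewrite coef_sum big_ord_recr /= big1 ?add0r => [|j _].
    by rewrite coefZ coefXn eqxx mulr1 -lead_coefE lead_coef_eq0.
  rewrite coefZ coefXn; case: eqP => [h|]; rewrite ?mulr0 //.
  by have := ltn_ord j; lia.
by apply: contraNneq => ->; rewrite coef0.
Qed.

Lemma carlitz_neq0 : carlitz E E != 0.
Proof.
apply: contraNneq disc_neq0 => c0; have := deriv_carlitz E1; rewrite c0 deriv0.
by move/esym/eqP; rewrite polyC_eq0.
Qed.

(** Only the degree in X is minimised, over the ring K[y]. Divisibility by m then holds up to powers
    of its leading coefficient, which the reductions below keep nonzero. *)
Lemma exists_minpoly : exists m : {poly {poly K}}, [/\ m != 0, ev E m = 0 &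
  forall h, h != 0 -> ev E h = 0 -> (size m <= size h)%N].
Proof.
have ex : exists n, `[< exists h : {poly {poly K}}, [/\ h != 0, ev E h = 0 & size h = n] >].
  exists (size (carlitz E E)); apply/asboolP; exists (carlitz E E); split => //.
    exact: carlitz_neq0.
  by rewrite ev_carlitz ?sE // lam_dvd ?dvdpp ?mulr0.
case: (ex_minnP ex) => d /asboolP[m [m0 evm sm]] dmin; exists m; split => // h h0 evh.
by rewrite sm; apply: dmin; apply/asboolP; exists h.
Qed.

Variable m : {poly {poly K}}.
Hypotheses (m0 : m != 0) (evm : ev E m = 0)
  (m_min : forall h, h != 0 -> ev E h = 0 -> (size m <= size h)%N).
Let k := (size m).-1.
Let l := lead_coef m.

Let l0 : l != 0. Proof. by rewrite lead_coef_eq0. Qed.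

Let ev_neq0 h : h != 0 -> (size h <= k)%N -> ev E h != 0.
Proof.
move=> h0 sh; apply/eqP => /m_min - /(_ h0).
have : (0 < size m)%N by rewrite size_poly_gt0.
by rewrite /k in sh; plia.
Qed.

Lemma minpoly_deg_gt0 : (0 < k)%N.
Proof.
rewrite lt0n; apply/negP => /eqP k0.
have : (size m <= 1)%N by rewrite /k in k0; have : (0 < size m)%N by [rewrite size_poly_gt0]; plia.
move=> /size1_polyC mC; move: evm; rewrite mC evC => /eqP; rewrite poly_fps_eq0 => /eqP c0.
by move: m0; rewrite mC c0 polyC0 eqxx.
Qed.

Lemma ev_prem d h : ev E (prem m d h) = poly_fps (l ^+ d) * ev E h.
Proof.
have [quo eq] := premP m d h; have := congr1 (ev E) eq.
by rewrite evM evC rmorphD /= evM evm mulr0 add0r => ->.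
Qed.

Lemma minpoly_dvd h : ev E h = 0 -> exists d quo, (l ^+ d)%:P * h = quo * m.
Proof.
move=> evh; have [quo eq] := premP m (size h) h; exists (size h), quo.
rewrite eq; suff -> : prem m (size h) h = 0 by rewrite addr0.
apply/eqP; apply: contrapT => /negP p0; have /eqP := ev_neq0 p0 (size_prem m0 (leq_addl _ _)).
by apply; rewrite ev_prem evh mulr0.
Qed.

(** y^(e N) s(phi_c(X)), homogenised so as to stay polynomial in y. *)
Definition chom N c (s : {poly {poly K}}) :=
  \sum_(i < N.+1) (s`_i * 'X^(e * (N - i)))%:P * carlitz E c ^+ i.

Lemma ev_chom N (c : {poly K}) s : (size c <= r.+1)%N ->
  ev E (chom N c s) = poly_fps 'X^(e * N) * \sum_(i < N.+1) poly_fps s`_i * lam E c ^+ i.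
Proof.
move=> sc; rewrite ev_sum mulr_sumr; apply: eq_bigr => i _.
rewrite evM evC evXn ev_carlitz // exprMn -(rmorphXn (poly_fps (K := K))) -exprM /=.
have iN : (i <= N)%N by rewrite -ltnS.
have -> : (e * N = e * (N - i) + e * i)%N by rewrite -mulnDr subnK.
rewrite exprD !poly_fpsM.
by rewrite [poly_fps s`_i * poly_fps _]mulrC mulrACA.
Qed.

Lemma degY_chom g N (c : {poly K}) D s : degY g (carlitz E c) -> degY D s ->
  degY (D + N * (e + g))%N (chom N c s).
Proof.
move=> gc Ds; apply: degY_sum => i _.
have iN : (i <= N)%N by rewrite -ltnS.
apply: (@degY_mono _ (D + e * (N - i) + i * g)%N).
  rewrite mulnDr -addnA leq_add2l mulnC leq_add // leq_mul //; lia.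
apply: degYM; last exact: degYX.
apply: degYC; apply: leq_trans (size_polyMleq _ _) _; rewrite size_polyXn.
by have := Ds i; move: (e * _)%N => w; plia.
Qed.

Section Reduction.
Variables (L : fieldType) (rho0 : {rmorphism {poly K} -> L}).
Let y := rho0 'X.
Hypothesis y0 : y != 0.
Let rho := map_poly rho0.
Hypotheses (rho_l : rho0 l != 0) (rho_disc : rho0 disc != 0).
Variable n : nat.
Local Notation Q := (q ^ n)%N.
Hypothesis LQ : forall a : L, a ^+ Q = a.
Variables (g c : {poly K}).
Hypothesis Hg : \prod_(j < n) (1 - y ^+ (q ^ j) *: 'X) = map_poly (rho0 \o polyC) g.
Hypotheses (gc : E %| g - c) (sc : (size c <= r.+1)%N).

Let pcharL : {subset [pchar K] <= [pchar L]}.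
Proof. by move=> p pK; apply: (rmorph_pchar rho0); rewrite pchar_poly. Qed.

Let rhoB h s : rho (h - s) = rho h - rho s. Proof. exact: rmorphB. Qed.
Let rhoM h s : rho (h * s) = rho h * rho s. Proof. exact: rmorphM. Qed.
Let rhoXn h d : rho (h ^+ d) = rho h ^+ d. Proof. exact: rmorphXn. Qed.
Let rhoC b : rho b%:P = (rho0 b)%:P. Proof. exact: map_polyC. Qed.
Let rho_sum (I : Type) (v : seq I) (P : pred I) (F : I -> {poly {poly K}}) :
  rho (\sum_(i <- v | P i) F i) = \sum_(i <- v | P i) rho (F i).
Proof. exact: rmorph_sum. Qed.
Let rho0Xn b d : rho0 (b ^+ d) = rho0 b ^+ d. Proof. exact: rmorphXn. Qed.

Lemma size_rho_minpoly : size (rho m) = k.+1.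
Proof. by rewrite /rho size_map_poly_id0 // /k prednK // size_poly_gt0. Qed.

Lemma rho_minpoly_dvd h : ev E h = 0 -> rho m %| rho h.
Proof.
move=> /minpoly_dvd[d [quo /(congr1 rho)]]; rewrite !rhoM rhoC rho0Xn.
move=> eq; have : rho m %| (rho0 l ^+ d)%:P * rho h.
  by rewrite eq dvdp_mull.
by rewrite mul_polyC dvdpZr ?expf_neq0.
Qed.

(** The reduction of m divides that of [carlitz E E], whose derivative is a nonzero constant; hence
    it has no repeated factor. *)
Lemma rho_minpoly_reduced (h : {poly L}) S : rho m %| h ^+ S.+1 -> rho m %| h.
Proof.
have sep : separable_poly (rho m).
  have h1 : ev E (carlitz E E) = 0 by rewrite ev_carlitz ?sE // lam_dvd ?dvdpp ?mulr0.
  apply: dvdp_separable (rho_minpoly_dvd h1) _.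
  rewrite separable_poly.unlock deriv_map (deriv_carlitz E1).
  rewrite -[map_poly _ (polyC _)]/(rho disc%:P) rhoC coprimep_sym.
  by rewrite -alg_polyC coprimepZl ?coprime1p.
move=> mh; set d := gcdp (rho m) h.
have dm : d %| rho m by exact: dvdp_gcdl.
have [w we] := dvdpP _ _ dm.
have cwd : coprimep w d by apply: (separable_coprime sep); rewrite -we dvdpp.
have cwh : coprimep w h.
  apply/coprimepP => t tw th; have td : t %| d.
    by rewrite dvdp_gcd th andbT we dvdp_mulr.
  by move/coprimepP: cwd => /(_ t tw td).
have : w %| h ^+ S.+1 by apply: dvdp_trans mh; rewrite we dvdp_mulr.
move=> wh; have : w %= 1.
  by rewrite -size_poly_eq1 -coprimepp (coprimep_dvdl wh) ?coprimep_expr.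
move=> /eqp_dvdl w1; rewrite we; have : d %| h by exact: dvdp_gcdr.
apply: dvdp_trans; rewrite -[X in _ %| X]mul1r; apply: dvdp_mul => //.
by rewrite w1 dvd1p.
Qed.

(** The coefficients of the reduced s are fixed by the Q-th power, so s(X)^Q = s(X^Q), and X^Q is
    phi_c(X) modulo m. *)
Lemma rho_chom N s : (size s <= N.+1)%N ->
  rho m %| y ^+ (e * N) *: rho s ^+ Q - rho (chom N c s).
Proof.
move=> sN; have fr : rho m %| y ^+ e *: 'X^Q - rho (carlitz E c).
  apply: (frobenius_carlitz E1 y0 _ Hg gc sc); apply: rho_minpoly_dvd.
  by rewrite ev_carlitz ?sE // lam_dvd ?dvdpp ?mulr0.
rewrite poly_expr_card // comp_polyE scaler_sumr.
rewrite (big_ord_widen N.+1 (fun i => y ^+ (e * N) *: ((rho s)`_i *: ('X^Q) ^+ i))); last first.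
  by rewrite (leq_trans (size_poly _ _)).
rewrite big_mkcond /chom rho_sum -sumrB /=.
apply: (big_ind (fun x => rho m %| x)) => [||i _]; [exact: dvdp0|by move=> a b; exact: dvdp_add|].
rewrite rhoM rhoXn rhoC rmorphM rho0Xn coef_map.
have iN : (i <= N)%N by rewrite -ltnS.
have -> : (if (i < size (map_poly rho0 s))%N then y ^+ (e * N) *: (rho0 s`_i *: ('X^Q) ^+ i) else 0)
    = (rho0 s`_i * y ^+ (e * (N - i)))%:P * (y ^+ e *: 'X^Q) ^+ i.
  have yE : y ^+ (e * N) = y ^+ (e * (N - i)) * (y ^+ e) ^+ i.
    by rewrite -exprM -exprD -mulnDr subnK.
  rewrite (exprZn (y ^+ e)) mul_polyC scalerA yE; case: ltnP => si.
    by rewrite scalerA [_ * rho0 _]mulrC mulrA.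
  by rewrite -coef_map [_`_i]nth_default // !mul0r scale0r.
by rewrite -mulrBr dvdp_mull // subrXX dvdp_mulr.
Qed.

End Reduction.

End MinimalPolynomial.

(** * Reduction of y at a prime f of degree n *)

Section ResidueField.
Variables (K : finFieldType) (f : {poly K}) (n : nat).
Local Notation q := #|K|.
Hypothesis hf : monic_irreducible_poly f.
Hypothesis sf : size f = n.+1.
Hypothesis f0 : f`_0 != 0.

Local Notation L := {poly %/ f with hf}.
Let theta : L := in_qpoly f 'X.

Let n_gt0 : (0 < n)%N.
Proof. by have [[]] := hf; rewrite sf. Qed.

Let q_gt1 : (1 < q)%N. Proof. exact: finRing_gt1. Qed.

Lemma in_qpoly_eq0 (g : {poly K}) : (in_qpoly f g == 0 :> L) = (f %| g).
Proof.
have [_ hM] := hf; apply/eqP/idP => [/val_eqP /= | fg].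
  by rewrite -Pdiv.IdomainMonic.modpE mk_monicE.
by apply/val_eqP; rewrite /= -Pdiv.IdomainMonic.modpE mk_monicE.
Qed.

Lemma in_qpolyE (g : {poly K}) : in_qpoly f g = (map_poly (qpolyC f) g).[theta] :> L.
Proof. by rewrite -in_qpoly_comp_horner comp_polyXr. Qed.

Lemma in_qpoly_val (a : L) : in_qpoly f (val a) = a :> L.
Proof. by apply: val_inj => /=; apply: Pdiv.CommonRing.rmodp_small; exact: size_mk_monic. Qed.

Lemma qfpoly_expq (a : L) : a ^+ (q ^ n) = a.
Proof. by rewrite -[X in a ^+ X](_ : #|L| = _) ?expf_card // card_qfpoly sf. Qed.

Lemma theta_neq0 : theta != 0.
Proof.
rewrite in_qpoly_eq0; apply/negP => fX.
have : coprimep f f.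
  by apply: (coprimep_dvdl fX); rewrite coprimepX rootE horner_coef0.
by rewrite coprimepp sf eqSS eqn0Ngt n_gt0.
Qed.

Let pcharL : {subset [pchar K] <= [pchar L]}.
Proof. by move=> p pK; apply: (rmorph_pchar (in_qpoly f : {rmorphism {poly K} -> L})); rewrite pchar_poly. Qed.

Lemma horner_qpoly_expq (P : {poly K}) (a : L) j :
  (map_poly (qpolyC f) P).[a ^+ (q ^ j)] = (map_poly (qpolyC f) P).[a] ^+ (q ^ j).
Proof.
rewrite !horner_coef expr_sum_card //; apply: eq_bigr => i _.
rewrite exprMn -!exprM [(_ * i)%N]mulnC coef_map /= -rmorphXn; congr (qpolyC f _ * _).
by elim: j => [|j IH]; rewrite ?expn0 ?expr1 // expnS exprM expf_card.
Qed.

(** Otherwise all q^n elements of the field would be roots of X^(q^d) - X. *)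
Lemma theta_expq_inj d : (0 < d < n)%N -> theta ^+ (q ^ d) != theta.
Proof.
move=> /andP[d0 dn]; apply/eqP => td.
have fixL (a : L) : a ^+ (q ^ d) = a.
  by rewrite -(in_qpoly_val a) in_qpolyE -horner_qpoly_expq td.
pose P : {poly L} := 'X^(q ^ d) - 'X.
have qd1 : (1 < q ^ d)%N by rewrite -(exp1n d) ltn_exp2r.
have sP : size P = (q ^ d).+1.
  by rewrite size_polyDl size_polyXn // size_polyN size_polyX ltnS.
have P0 : P != 0 by rewrite -size_poly_gt0 sP.
have := max_poly_roots P0 (rs := enum L); rewrite sP -cardE card_qfpoly sf.
have roots : all (root P) (enum L).
  by apply/allP => a _; rewrite rootE /P !hornerE fixL subrr.
by move=> /(_ roots (enum_uniq _)); rewrite ltnS leq_exp2l // leqNgt dn.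
Qed.

Lemma qfpoly_root : map_poly (qpolyC f) f = \prod_(j < n) ('X - (theta ^+ (q ^ j))%:P).
Proof.
have [_ hM] := hf.
rewrite -(big_mkord xpredT (fun j => 'X - (theta ^+ (q ^ j))%:P)) /index_iota subn0.
rewrite -(big_map (fun j => theta ^+ (q ^ j)) xpredT (fun z => 'X - z%:P)).
have inj0 : injective (qpolyC f) by move=> a b /(congr1 val) /polyC_inj.
rewrite [LHS](@all_roots_prod_XsubC _ _ [seq theta ^+ (q ^ j) | j <- iota 0 n]).
- rewrite lead_coef_map_inj //; last exact: rmorph0.
  by rewrite (monicP hM) rmorph1 scale1r.
- by rewrite size_map_inj_poly ?rmorph0 // sf size_map size_iota.
- apply/allP => _ /mapP[j _ ->]; rewrite rootE horner_qpoly_expq -in_qpolyE.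
  have /eqP -> : in_qpoly f f == 0 :> L by rewrite in_qpoly_eq0.
  by rewrite expr0n expn_eq0 eqn0Ngt (ltn_trans _ q_gt1).
rewrite uniq_rootsE map_inj_in_uniq ?iota_uniq // => i j.
rewrite !mem_iota !add0n => /= hi hj.
wlog ij : i j hi hj / (i <= j)%N.
  move=> W; case: (leqP i j) => [|/ltnW] ij h; first exact: W.
  by apply/esym; apply: W => //; exact: esym.
move=> tij; apply/eqP; rewrite eqn_leq ij /= leqNgt; apply/negP => ltij.
have := theta_expq_inj (d := (j - i)%N); rewrite subn_gt0 ltij /=.
rewrite (leq_ltn_trans _ hj) ?leq_subr // => /(_ isT)/eqP; apply.
apply/eqP; rewrite -subr_eq0.
have : (theta ^+ (q ^ (j - i)) - theta) ^+ (q ^ i) == 0.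
  by rewrite exprB_card // -exprM -expnD subnK // tij subrr.
by rewrite expf_eq0 => /andP[].
Qed.

(** y goes to 1/theta, not to theta, so that f/f(0) becomes the product of the 1 - y^(q^j) T that
    describes Frobenius. *)
Definition rho_f (P : {poly K}) : L := (map_poly (qpolyC f) P).[theta^-1].
Fact rho_f_zmod : zmod_morphism rho_f.
Proof. by move=> P Q; rewrite /rho_f rmorphB hornerD hornerN. Qed.
HB.instance Definition _ := GRing.isZmodMorphism.Build {poly K} L rho_f rho_f_zmod.
Fact rho_f_monoid : monoid_morphism rho_f.
Proof. by split=> [|P Q]; rewrite /rho_f ?rmorph1 ?hornerC // rmorphM hornerM. Qed.
HB.instance Definition _ := GRing.isMonoidMorphism.Build {poly K} L rho_f rho_f_monoid.

Lemma rho_fX : rho_f 'X = theta^-1.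
Proof. by rewrite /rho_f map_polyX hornerX. Qed.

Lemma rho_fX_neq0 : rho_f 'X != 0.
Proof. by rewrite rho_fX invr_eq0 theta_neq0. Qed.

Lemma rho_f_prod : \prod_(j < n) (1 - rho_f 'X ^+ (q ^ j) *: 'X) =
  map_poly (rho_f \o polyC) ((f`_0)^-1 *: f).
Proof.
have -> : map_poly (rho_f \o polyC) ((f`_0)^-1 *: f) = map_poly (qpolyC f) ((f`_0)^-1 *: f).
  by apply: eq_map_poly => c; rewrite /= /rho_f map_polyC hornerC.
rewrite -mul_polyC rmorphM /= map_polyC /= qfpoly_root mul_polyC.
have f0E : qpolyC f f`_0 = \prod_(j < n) - theta ^+ (q ^ j).
  have := congr1 (horner^~ 0) qfpoly_root; rewrite horner_prod horner_coef0 coef_map /= => ->.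
  by apply: eq_bigr => j _; rewrite !hornerE.
have -> : qpolyC f (f`_0)^-1 = \prod_(j < n) (- theta ^+ (q ^ j))^-1 :> L.
  by rewrite prodfV -f0E; apply: (fmorphV (qpolyC f : {rmorphism K -> L})).
rewrite -scaler_prod; apply: eq_bigr => j _.
have t0 : theta ^+ (q ^ j) != 0 by rewrite expf_neq0 // theta_neq0.
rewrite scalerBr rho_fX exprVn invrN scaleNr addrC; congr (_ + _).
by rewrite (scaleNr (theta ^- _)) opprK -mul_polyC -polyCM mulVf.
Qed.

Implicit Types e : {poly K}.

(** Reversal turns the vanishing of e at 1/theta into divisibility by f. *)
Definition revp D e : {poly K} := \poly_(i < D.+1) e`_(D - i).

Lemma revp_eq0 D e : (size e <= D.+1)%N -> revp D e = 0 -> e = 0.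
Proof.
move=> se r0; apply/polyP => i; rewrite coef0.
case: (leqP i D) => iD; last by rewrite nth_default // (leq_trans se).
have := congr1 (fun P : {poly K} => P`_(D - i)) r0; rewrite coef_poly coef0 ltnS leq_subr.
by rewrite subKn.
Qed.

Lemma rho_f_eq0 D e : (size e <= D.+1)%N -> rho_f e = 0 -> f %| revp D e.
Proof.
move=> se re; rewrite -in_qpoly_eq0 in_qpolyE horner_coef.
have sr : (size (map_poly (qpolyC f) (revp D e)) <= D.+1)%N.
  by rewrite (leq_trans (size_poly _ _)) // size_poly.
rewrite (big_ord_widen D.+1 (fun i => (map_poly (qpolyC f) (revp D e))`_i * theta ^+ i) sr).
have -> : \sum_(i < D.+1 | (i < size (map_poly (qpolyC f) (revp D e)))%N)
     (map_poly (qpolyC f) (revp D e))`_i * theta ^+ i = theta ^+ D * rho_f e; last by rewrite re mulr0.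
rewrite /rho_f horner_coef mulr_sumr.
have sE : (size (map_poly (qpolyC f) e) <= D.+1)%N by rewrite (leq_trans (size_poly _ _)).
rewrite (big_ord_widen D.+1 (fun i => theta ^+ D * ((map_poly (qpolyC f) e)`_i * theta^-1 ^+ i)) sE).
rewrite big_mkcond [RHS]big_mkcond (reindex_inj rev_ord_inj); apply: eq_bigr => i _ /=.
rewrite subSS.
have -> : (if (D - i < size (map_poly (qpolyC f) (revp D e)))%N
   then (map_poly (qpolyC f) (revp D e))`_(D - i) * theta ^+ (D - i) else 0) =
   (map_poly (qpolyC f) (revp D e))`_(D - i) * theta ^+ (D - i).
  by case: ltnP => // h; rewrite nth_default ?mul0r.
have -> : (if (i < size (map_poly (qpolyC f) e))%N
   then theta ^+ D * ((map_poly (qpolyC f) e)`_i * theta^-1 ^+ i) else 0) =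
   theta ^+ D * ((map_poly (qpolyC f) e)`_i * theta^-1 ^+ i).
  by case: ltnP => // h; rewrite nth_default ?mul0r ?mulr0.
have iD : (i <= D)%N by rewrite -ltnS.
rewrite !coef_map /= coef_poly ltnS leq_subr subKn // mulrCA; congr (_ * _).
have t0 : theta ^+ i != 0 by rewrite expf_neq0 // theta_neq0.
have -> : theta ^+ D = theta ^+ (D - i) * theta ^+ i by rewrite -exprD subnK.
by rewrite exprVn mulfK.
Qed.

End ResidueField.

Section DistinctIrreducibles.
Variable K : finFieldType.
Implicit Types (P f : {poly K}) (s : seq {poly K}).

Lemma prod_irr_dvd s P : uniq s ->
  (forall f, f \in s -> [/\ f \is monic, irreducible_poly f & f %| P]) ->
  \prod_(f <- s) f %| P.
Proof.
elim: s => [|f s IH] /=; first by rewrite big_nil dvd1p.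
move=> /andP[fs us] H; rewrite big_cons Gauss_dvdp.
  have [_ _ ->] := H f (mem_head _ _); apply: IH => // g gs.
  by apply: H; rewrite inE gs orbT.
have [mf jf _] := H f (mem_head _ _).
rewrite irreducible_poly_coprime //; apply/negP => /(irr_dvd_prod jf)[g gs fg].
have [mg ig _] : [/\ g \is monic, irreducible_poly g & g %| P] by apply: H; rewrite inE gs orbT.
by rewrite (monic_irr_dvd mf mg jf ig fg) gs in fs.
Qed.

Lemma irr_dvd_count s P n : P != 0 -> uniq s ->
  (forall f, f \in s -> [/\ f \is monic, irreducible_poly f & f %| P]) ->
  (forall f, f \in s -> size f = n.+1) -> (n * size s <= (size P).-1)%N.
Proof.
move=> P0 us H sz; have := dvdp_leq P0 (prod_irr_dvd us H).
suff -> : size (\prod_(f <- s) f)%R = (n * size s).+1.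
  by move=> h; rewrite -ltnS prednK ?size_poly_gt0.
elim: s us H sz => [|f s IH] /=; first by rewrite big_nil size_poly1 muln0.
move=> /andP[fs us] H sz; rewrite big_cons size_mul.
- rewrite (sz f) ?mem_head // IH //; first by rewrite addnS /= mulnS; lia.
    by move=> g gs; apply: H; rewrite inE gs orbT.
  by move=> g gs; apply: sz; rewrite inE gs orbT.
- by rewrite -size_poly_gt0 (sz f) ?mem_head.
rewrite prodf_seq_neq0; apply/allP => g gs /=.
by rewrite -size_poly_gt0 (sz g) // inE gs orbT.
Qed.

End DistinctIrreducibles.

Lemma pred_mul_le k y S : (y <= k)%N -> (y.-1 * S <= k.-1 * S)%N.
Proof. by move=> yk; rewrite leq_mul2r; apply/orP; right; lia. Qed.

Lemma stepanov_arith1 k S g x y z : (0 < k)%N -> (x <= k.-1 * g + 1)%N ->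
  (y <= k)%N -> (z <= y.-1 * S + 1)%N -> ((z + x).-1 <= k + k.-1 * (S + g))%N.
Proof.
move=> k0 hx /(pred_mul_le S) hy hz; rewrite mulnDr.
by move: hx hy hz; move: (_ * S)%N (_ * S)%N (_ * g)%N => a b c; lia.
Qed.

Lemma stepanov_arith2 k S x y z : (0 < k)%N -> (x <= k)%N ->
  (y <= k)%N -> (z <= x.-1 * S + 1)%N -> ((y + z).-1 <= k + k.-1 * S)%N.
Proof.
move=> k0 /(pred_mul_le S) hx hy hz.
by move: hx hy hz; move: (_ * S)%N (_ * S)%N => a b; lia.
Qed.

Lemma stepanov_arith3 S w x u y : (w < S)%N -> (x < y)%N -> (w + S * x < u + S * y)%N.
Proof.
move=> wS xy; apply: (@leq_trans (S * y)); last exact: leq_addl.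
by apply: (@leq_trans (S * x.+1)); [rewrite mulnS ltn_add2r|rewrite leq_mul].
Qed.

Lemma npolyp_eq (K : finFieldType) N (P Q : {poly K}) : (size P <= N)%N -> (size Q <= N)%N ->
  npolyp N P = npolyp N Q -> P = Q.
Proof. by move=> sP sQ /(congr1 val) /=; rewrite !npolypK. Qed.

(** * Stepanov's method for the torsion of the Carlitz module *)
Section Stepanov.
Variables (K : finFieldType) (E : {poly K}).
Hypothesis E1 : (1 < size E)%N.
Local Notation q := #|K|.
Let r := (size E).-1.
Local Notation e := (cexp K r).
Implicit Types h : {poly {poly K}}.

Let q_gt1 : (1 < q)%N. Proof. exact: finRing_gt1. Qed.
Let q_gt0 n : (0 < q ^ n)%N. Proof. by rewrite expn_gt0 ltnW. Qed.
Let E0 : E != 0. Proof. by rewrite -size_poly_gt0 ltnW. Qed.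
Let sE : size E = r.+1. Proof. by rewrite prednK // ltnW. Qed.

Variable m : {poly {poly K}}.
Hypotheses (m0 : m != 0) (evm : ev E m = 0)
  (m_min : forall h, h != 0 -> ev E h = 0 -> (size m <= size h)%N).
Let k := (size m).-1.
Let l := lead_coef m.
Variable g : nat.
Hypothesis gm : degY g m.
Hypothesis gc : forall c : {poly_r K}, degY g (carlitz E c) /\ (size (carlitz E c) <= g.+1)%N.

Let k_gt0 : (0 < k)%N. Proof. exact: (minpoly_deg_gt0 E1 m0 evm m_min). Qed.
Let sm : size m = k.+1. Proof. by rewrite prednK // size_poly_gt0. Qed.
Let l0 : l != 0. Proof. by rewrite lead_coef_eq0. Qed.

Let ev_neq0 h : h != 0 -> (size h <= k)%N -> ev E h != 0.
Proof. by move=> h0 sh; apply/eqP => /(m_min h0); rewrite sm ltnNge sh. Qed.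

Definition to_poly D (a : {ffun 'I_k -> {poly_D K}}) : {poly {poly K}} :=
  \sum_(i < k) (a i : {poly K})%:P * 'X^i.

Lemma coef_to_poly D (a : {ffun 'I_k -> {poly_D K}}) (i : 'I_k) :
  (to_poly a)`_i = a i.
Proof.
rewrite coef_sum (bigD1 i) //= coefCM coefXn eqxx mulr1 big1 ?addr0 // => j ji.
by rewrite coefCM coefXn (_ : (i == j :> nat) = false) ?mulr0 //; apply/negbTE; rewrite eq_sym.
Qed.

Lemma size_to_poly D (a : {ffun 'I_k -> {poly_D K}}) : (size (to_poly a) <= k)%N.
Proof.
apply/leq_sizeP => j kj; rewrite coef_sum big1 // => i _.
rewrite coefCM coefXn (_ : (j == i) = false) ?mulr0 //; apply/negbTE.
by rewrite neq_ltn orbC (leq_trans (ltn_ord i) kj).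
Qed.

Lemma degY_to_poly D (a : {ffun 'I_k -> {poly_D.+1 K}}) : degY D (to_poly a).
Proof.
apply: degY_sum => i _; apply: (@degY_mono _ (D + 0)%N); first by rewrite addn0.
by apply: degYM (degYXn _ _); apply: degYC; exact: size_npoly.
Qed.

Lemma to_poly_inj D : injective (@to_poly D).
Proof.
move=> a b ab; apply/ffunP => i; apply: val_inj => /=.
by rewrite -!coef_to_poly ab.
Qed.

Lemma card_coefs D : #|{: {ffun 'I_k -> {poly_D K}}}| = (q ^ (D * k))%N.
Proof. by rewrite card_ffun card_npoly card_ord -expnM. Qed.

(** A norm argument by pigeonhole: some nonzero G makes h G, pseudo-reduced modulo m, free of X. The
    order of h at y = 0 is then at most the degree in y of that polynomial. *)
Lemma val_bound D h v : h != 0 -> (size h <= k)%N -> degY D h ->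
  fps_val (ev E h) v -> (v <= k * D + k * k * g)%N.
Proof.
move=> h0 sh hD hv.
(* [D2] is the least degree for which the k (D2 + 1) coefficients of G outnumber the (k - 1) N
   coefficients to be cancelled. *)
pose X := (D + k.-1 * g)%N; pose D2 := (k.-1 * X)%N; pose N := (D2 + X).+1.
pose phi (a : {ffun 'I_k -> {poly_D2.+1 K}}) : {ffun 'I_k.-1 -> {poly_N K}} :=
  [ffun i : 'I_k.-1 => npolyp N (prem m k.-1 (h * to_poly a))`_i.+1].
have szp (a : {ffun 'I_k -> {poly_D2.+1 K}}) : (size (h * to_poly a)%R <= k + k.-1)%N.
  by apply: leq_trans (size_polyMleq _ _) _; have := size_to_poly a; move: sh; plia.
have dp (a : {ffun 'I_k -> {poly_D2.+1 K}}) : degY (D2 + X) (prem m k.-1 (h * to_poly a)).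
  rewrite /X addnA [(D2 + D)%N]addnC; apply: degY_prem gm _; apply: degYM => //.
  exact: degY_to_poly.
have [|a [b ab phiab]] := @fin_pigeonhole _ _ phi.
  rewrite card_coefs card_ffun card_npoly card_ord -expnM ltn_exp2l //.
  by rewrite /N /D2; move: k_gt0; case: (k) => // k' _ /=; nia.
pose G := to_poly a - to_poly b.
have G0 : G != 0 by rewrite subr_eq0; apply: contra ab => /eqP/to_poly_inj ->.
have sG : (size G <= k)%N.
  by apply: leq_trans (size_polyD _ _) _; rewrite size_polyN geq_max !size_to_poly.
pose P := prem m k.-1 (h * G).
have PE : P = prem m k.-1 (h * to_poly a) - prem m k.-1 (h * to_poly b).
  by rewrite -premB -mulrBr.
have P1 : P = (P`_0)%:P.
  apply/polyP => i; rewrite coefC; case: eqP => [->//|/eqP i0].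
  have sP : (size P <= k)%N.
    apply: size_prem => //; apply: leq_trans (size_polyMleq _ _) _.
    by move: sh sG; plia.
  have [ki|ik] := leqP k i; first by rewrite nth_default // (leq_trans sP).
  have ik1 : (i.-1 < k.-1)%N by lia.
  have /ffunP/(_ (Ordinal ik1)) := phiab; rewrite !ffunE => /(congr1 val) /=.
  rewrite prednK ?lt0n // PE coefB.
  rewrite -[val _]/(npolyp N _ : {poly K}) -[val (npolyp _ _`_i)]/(npolyp N _ : {poly K}) !npolypK ?dp // => ->.
  by rewrite subrr.
have evP : poly_fps (P`_0) = poly_fps (l ^+ k.-1) * (ev E h * ev E G).
  by rewrite -evM -(ev_prem evm) -/P [in RHS]P1 evC.
have dP : (size (P`_0)%R <= N)%N by rewrite PE coefB; apply: leq_trans (size_polyD _ _) _; rewrite size_polyN geq_max !dp.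
have [w Gw] := fps_valP (ev_neq0 G0 sG).
have [u lu] : exists u, fps_val (poly_fps (l ^+ k.-1)) u.
  by apply: fps_valP; rewrite poly_fps_eq0 expf_neq0.
have := fps_val_mul lu (fps_val_mul hv Gw); rewrite -evP => /poly_fps_val wv.
have : (v < N)%N by move: wv dP; plia.
by rewrite /N /D2 /X; move: k_gt0; case: (k) => // k' _ /=; nia.
Qed.

Section Counting.
Variables (s n : nat) (c : {poly_r K}).
Local Notation S := (q ^ s)%N.

Definition irr_class : {set {poly_n.+1 K}} :=
  [set f : {poly_n.+1 K} | [&& (f : {poly K}) \is monic, irreducibleb f,
    size f == n.+1, f`_0 != 0 & E %| (f`_0)^-1 *: (f : {poly K}) - c]].

Definition good_prime (f : {poly K}) h :=
  forall hf : monic_irreducible_poly f,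
    map_poly (rho_f hf) m %| map_poly (rho_f hf) h.

Lemma irr_classP (f : {poly_n.+1 K}) : f \in irr_class ->
  [/\ monic_irreducible_poly f, size f = n.+1, f`_0 != 0 &
      E %| (f`_0)^-1 *: (f : {poly K}) - c].
Proof.
by rewrite inE => /and5P[mf jf /eqP sf f0 fc]; split => //; split => //; apply/irreducibleP.
Qed.

(** A vanishing reduction would make f, of degree n > D, divide the reversal of P. *)
Lemma rho_f_neq0 (f : {poly_n.+1 K}) (hf : monic_irreducible_poly f) (P : {poly K}) D :
  size f = n.+1 -> f`_0 != 0 -> P != 0 -> (size P <= D.+1)%N -> (D < n)%N ->
  rho_f hf P != 0.
Proof.
move=> sf f0 P0 sP Dn; apply/eqP => /(rho_f_eq0 sf f0 sP) fP.
have : revp D P != 0 by apply: contra P0 => /eqP/(revp_eq0 sP) ->.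
move=> /dvdp_leq /(_ fP); rewrite sf leqNgt ltnS; apply/negP; rewrite negbK.
by apply: leq_trans Dn; apply: size_poly.
Qed.

Hypotheses (n_l : (size l < n)%N) (n_disc : (size (disc E) < n)%N).

(** At a good prime the reduction of h is a multiple of that of m and has smaller degree in X, so it
    vanishes. Hence each such f divides the reversal of a fixed nonzero coefficient of h, of degree
    at most D. *)
Lemma good_primes_count h D : (size h <= k)%N -> h != 0 -> degY D h ->
  (forall f : {poly_n.+1 K}, f \in irr_class -> good_prime f h) ->
  (n * #|irr_class| <= D)%N.
Proof.
move=> sh h0 hD good.
have [i hi] : exists i, h`_i != 0.
  by exists (size h).-1; rewrite -lead_coefE lead_coef_eq0.
have R0 : revp D h`_i != 0 by apply: contra hi => /eqP/(revp_eq0 (hD i)) ->.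
have := @irr_dvd_count K [seq (f : {poly_n.+1 K}) : {poly K} | f <- enum irr_class] _ n R0.
rewrite size_map -cardE => H; apply: leq_trans (H _ _ _) _.
- by rewrite map_inj_uniq ?enum_uniq //; exact: val_inj.
- move=> _ /mapP[f fc ->]; rewrite mem_enum in fc.
  have [hf sf f0 _] := irr_classP fc; split; [by case: hf|by case: hf|].
  have := good f fc hf; move: h0 => _.
  have rl : rho_f hf l != 0.
    apply: (rho_f_neq0 hf sf f0 l0 (D := (size l).-1)); first by rewrite leqSpred.
    by apply: leq_ltn_trans n_l; rewrite leq_pred.
  have srm : size (map_poly (rho_f hf) m) = k.+1.
    by have := size_rho_minpoly m0 rl; apply.
  move=> mh; have : map_poly (rho_f hf) h = 0.
    apply/eqP; apply: contraLR mh => rh; apply/negP => /(dvdp_leq rh).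
    by rewrite srm leqNgt ltnS (leq_trans (size_poly _ _)).
  move=> /(congr1 (fun P : {poly _} => P`_i)); rewrite coef_map coef0 /= => ri.
  exact: (rho_f_eq0 sf f0 (hD i) ri).
- move=> _ /mapP[f fc ->]; rewrite mem_enum in fc.
  by have [_ sf _ _] := irr_classP fc.
have : (size (revp D h`_i) <= D.+1)%N by apply: size_poly.
plia.
Qed.

Section Core.
Variables (D D' : nat).
Hypothesis nE : n = (s * 2)%N.
Hypothesis val_lt : (k * D' + k * k * g < S)%N.
Let Y := (S * D' + (D + k.-1 * (e + g)) + k.-1 * (S + g) * g)%N.
Hypothesis dim_lt : (Y.+1 < D'.+1 * (k * D.+1))%N.

Let B := (k * D + k * k * g).+1.
Let attained (v : nat) h := [/\ h != 0, (size h <= k)%N, degY D h & fps_val (ev E h) v].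
Let J : {set 'I_B} := [set v : 'I_B | `[< exists h, attained v h >]].

(** A difference of two elements of this space has its order in [J], so an element is determined by
    its coefficients at the indices in [J]; the dimension is k (D + 1). *)
Let card_J : (k * D.+1 <= #|J|)%N.
Proof.
pose phi (a : {ffun 'I_k -> {poly_D.+1 K}}) : {ffun {v | v \in J} -> K} :=
  [ffun v => ev E (to_poly a) (val v : 'I_B)].
have inj : injective phi.
  move=> a b ab; apply: to_poly_inj; apply/eqP; rewrite -subr_eq0.
  apply: contrapT => /negP h0; set h := _ - _ in h0.
  have sh : (size h <= k)%N.
    by apply: leq_trans (size_polyD _ _) _; rewrite size_polyN geq_max !size_to_poly.
  have dh : degY D h by apply: degYB; exact: degY_to_poly.
  have [v hv] := fps_valP (ev_neq0 h0 sh).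
  have vB : (v < B)%N by rewrite ltnS (val_bound h0 sh dh hv).
  have vJ : Ordinal vB \in J by rewrite inE; apply/asboolP; exists h.
  have /ffunP/(_ (Sub (Ordinal vB) vJ)) := ab; rewrite !ffunE /= => eqv.
  by have [/eqP] := hv; rewrite /h evB fpsDE fpsNE eqv subrr.
have := leq_card phi inj; rewrite card_coefs card_ffun card_sig.
by rewrite leq_exp2l // mulnC.
Qed.

(** Choose s_v of order v for each v in [J]. Since S-th powers are additive, a dimension count gives
    G_v, not all 0, for which [hG], the sum of the G_v^S [chom](s_v), vanishes at lambda. At a prime
    of the class, [chom](s_v) is a power of y times s_v^(S^2), so [hG] is that power times the S-th
    power of [ht], the sum of the G_v s_v^S. As m is reduced there, it divides [ht], and the primes
    are counted on [ht]. *)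
Lemma stepanov_core : (n * #|irr_class| <= D' + S * D + k.-1 * S * g)%N.
Proof.
have [sv svP] : exists sv : 'I_B -> {poly {poly K}}, forall v : 'I_B, v \in J -> attained v (sv v).
  have sel (v : 'I_B) : {h | v \in J -> attained v h}.
    apply: cid; have [|vJ] := boolP (v \in J); last by exists 0.
    by rewrite inE => /asboolP[h hv]; exists h.
  by exists (fun v => sval (sel v)) => v; exact: svalP (sel v).
have sJ (v : {v | v \in J}) := svP (val v) (valP v).
pose hst (F : {ffun {v | v \in J} -> {ffun 'I_k -> {poly_D'.+1 K}}}) :=
  \sum_v to_poly (F v) ^+ S * chom E k.-1 c (sv (val v)).
pose d := (k.-1 * (S + g))%N.
pose phi F : {ffun 'I_k -> {poly_Y.+1 K}} := [ffun i : 'I_k => npolyp Y.+1 (prem m d (hst F))`_i].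
have szc : (size c <= r.+1)%N by rewrite (leq_trans (size_npoly _)).
have [gcd gcs] := gc c.
have size_exp (h : {poly {poly K}}) t : (size (h ^+ t) <= (size h).-1 * t + 1)%N.
  by rewrite addn1 size_poly_exp_leq.
have size_sumk (T : finType) (F : T -> {poly {poly K}}) N :
    (forall i, size (F i) <= N)%N -> (size (\sum_i F i)%R <= N)%N.
  by move=> FN; elim/big_rec: _ => [|i x _ sx]; rewrite ?size_poly0 // (leq_trans (size_polyD _ _)) // geq_max FN.
have shom (h : {poly {poly K}}) : (size (chom E k.-1 c h) <= k.-1 * g + 1)%N.
  apply: size_sumk => i; apply: leq_trans (size_polyMleq _ _) _.
  have := size_exp (carlitz E c) i; have := size_polyC_leq1 ((h`_i * 'X^(e * (k.-1 - i)))).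
  have ik : (i <= k.-1)%N by rewrite -ltnS.
  have : ((size (carlitz E c)).-1 * i <= k.-1 * g)%N.
    by rewrite mulnC leq_mul //; move: gcs; plia.
  move=> h1 h2 h3; apply: (@leq_trans ((size (carlitz E c)).-1 * i + 1)%N); last by rewrite leq_add2r.
  by apply: leq_trans h3; rewrite -subn1 leq_subLR leq_add2r.
have shst F : (size (hst F) <= k + d)%N.
  apply: size_sumk => v; apply: leq_trans (size_polyMleq _ _) _.
  have := size_exp (to_poly (F v)) S; have := size_to_poly (F v); have := shom (sv (val v)).
  by move=> hx hy hz; exact: stepanov_arith1 k_gt0 hx hy hz.
have dhst F : degY Y (prem m d (hst F)).
  apply: degY_prem gm _; apply: degY_sum => v _; apply: degYM.
    by apply: degYX; exact: degY_to_poly.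
  have [_ _ dv _] := sJ v; have := degY_chom E1 m0 m_min; apply => //.
(* k (Y + 1) conditions against [#|J|] k (D' + 1) unknowns. *)
have [|F1 [F2 F12 phiF]] := @fin_pigeonhole _ _ phi.
  rewrite card_coefs card_ffun card_coefs card_sig -expnM ltn_exp2l //.
  apply: leq_trans (_ : D'.+1 * k * (k * D.+1) <= _)%N; last by rewrite leq_mul.
  by rewrite mulnAC mulnC [(_ * k)%N]mulnC ltn_mul2l k_gt0.
pose G v := to_poly (F1 v) - to_poly (F2 v).
pose hG := \sum_(v : {v | v \in J}) G v ^+ S * chom E k.-1 c (sv (val v)).
have hGE : hG = hst F1 - hst F2.
  rewrite /hG /hst -sumrB; apply: eq_bigr => v _; rewrite -mulrBl exprB_card //.
  by move=> p pK; rewrite !pchar_poly.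
have sG v : (size (G v) <= k)%N.
  by apply: leq_trans (size_polyD _ _) _; rewrite size_polyN geq_max !size_to_poly.
have dG v : degY D' (G v) by apply: degYB; exact: degY_to_poly.
have evhG : ev E hG = 0.
  have : prem m d hG = 0.
    apply/polyP => i; rewrite coef0.
    have sp : (size (prem m d hG) <= k)%N.
      apply: size_prem => //; rewrite hGE; apply: leq_trans (size_polyD _ _) _.
      by rewrite size_polyN geq_max !shst.
    have [ki|ik] := leqP k i; first by rewrite nth_default // (leq_trans sp).
    have /ffunP/(_ (Ordinal ik)) := phiF; rewrite !ffunE.
    move=> /(npolyp_eq (dhst F1 i) (dhst F2 i)) eqF.
    by rewrite hGE premB coefB eqF subrr.
  move=> /(congr1 (ev E)); rewrite (ev_prem evm) rmorph0 => /eqP.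
  by rewrite mulf_eq0 poly_fps_eq0 expf_eq0 (negPf l0) andbF => /eqP.
pose ht := \sum_(v : {v | v \in J}) G v * sv (val v) ^+ S.
have sht : (size ht <= k + k.-1 * S)%N.
  apply: size_sumk => v; apply: leq_trans (size_polyMleq _ _) _.
  have [_ ssv _ _] := sJ v; have := size_exp (sv (val v)) S; have := sG v.
  by move=> hy hz; exact: stepanov_arith2 k_gt0 ssv hy hz.
(* The term of index v has order w + S v with w < S by [val_bound], so the term of least v
   dominates. *)
have evht : ev E ht != 0.
  have [v0 Gv0] : exists v, G v != 0.
    apply: contrapT => allG; move/eqP: F12; apply; apply/ffunP => v.
    apply: to_poly_inj; apply/eqP; rewrite -subr_eq0.
    by apply: contrapT => /negP Gv; apply: allG; exists v.
  pose vn (v : {v | v \in J}) : nat := nat_of_ord (val v).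
  pose v1 := [arg min_(v < v0 | G v != 0) vn v].
  have [v1G v1min] : G v1 != 0 /\ forall v, G v != 0 -> (vn v1 <= vn v)%N.
    by rewrite /v1; case: arg_minnP => // v Gv vmin; split.
  have [w Gw] := fps_valP (ev_neq0 v1G (sG v1)).
  have wS (v : {v | v \in J}) u : fps_val (ev E (G v)) u -> (u < S)%N.
    move=> Gu; have G0 : G v != 0 by apply: contraTneq isT => G0; have := fps_val_neq0 Gu; rewrite G0 rmorph0 eqxx.
    exact: leq_ltn_trans (val_bound G0 (sG v) (dG v) Gu) val_lt.
  have [_ _ _ sv1] := sJ v1.
  have [t1 _] := fps_val_mul Gw (fps_val_exp S sv1).
  apply: contraNneq t1 => ev0.
  have := congr1 (fun f : fps K => f (w + S * vn v1)%N) ev0.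
  rewrite /ht ev_sum fps_sumE (bigD1 v1) //= big1 ?addr0.
    by rewrite evM evXn => ->.
  move=> v vv1; rewrite evM evXn.
  have [->|Gv] := eqVneq (G v) 0; first by rewrite rmorph0 mul0r.
  have [u Gu] := fps_valP (ev_neq0 Gv (sG v)); have [_ _ _ svv] := sJ v.
  have [_ ->] := fps_val_mul Gu (fps_val_exp S svv) => //.
  have lt : (vn v1 < vn v)%N.
    rewrite ltn_neqAle v1min // andbT; apply: contra vv1 => /eqP h.
    by apply/eqP/esym/val_inj/val_inj.
  exact: stepanov_arith3 (wS _ _ Gw) lt.
pose P := prem m (k.-1 * S) ht.
have P0 : P != 0.
  apply: contraNneq evht => P0; have := ev_prem evm (k.-1 * S) ht.
  rewrite -/P P0 rmorph0 => /esym/eqP; rewrite mulf_eq0 poly_fps_eq0 expf_eq0.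
  by rewrite (negPf l0) andbF.
apply: (good_primes_count (size_prem m0 sht) P0) => [|f fc hf].
  rewrite -/P; apply: degY_prem gm _; apply: degY_sum => v _; apply: degYM => //.
  by apply: degYX; have [] := sJ v.
have [_ sf f0 fE] := irr_classP fc; rewrite -/P.
pose rho := map_poly (rho_f hf).
have rhoM a b : rho (a * b) = rho a * rho b by exact: rmorphM.
have rhoX a t : rho (a ^+ t) = rho a ^+ t by exact: rmorphXn.
have rhoS (F : {v | v \in J} -> {poly {poly K}}) : rho (\sum_v F v) = \sum_v rho (F v) by exact: rmorph_sum.
have rl : rho_f hf l != 0.
  apply: (rho_f_neq0 hf sf f0 l0 (D := (size l).-1)); first by rewrite leqSpred.
  by apply: leq_ltn_trans n_l; rewrite leq_pred.
have rd : rho_f hf (disc E) != 0.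
  apply: (rho_f_neq0 hf sf f0 (disc_neq0 E1) (D := (size (disc E)).-1)); first by rewrite leqSpred.
  by apply: leq_ltn_trans n_disc; rewrite leq_pred.
have [quo PE] := premP m (k.-1 * S) ht.
suff : rho m %| rho ht.
  move=> mh; rewrite -/rho.
  have -> : rho P = rho (l ^+ (k.-1 * S))%:P * rho ht - rho quo * rho m.
    rewrite -!rhoM PE [rho (_ + _)](_ : _ = rho (quo * m) + rho P); last exact: rmorphD.
    by rewrite addrC addKr.
  by rewrite dvdp_sub ?dvdp_mull.
apply: (rho_minpoly_reduced E1 m0 evm m_min rl rd (S := S.-1)).
rewrite prednK //; have y0 := rho_fX_neq0 hf sf f0.
have yN : rho_f hf 'X ^+ (e * k.-1) != 0 by rewrite expf_neq0.
rewrite -(dvdpZr _ _ yN).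
have rhG : rho m %| rho hG by apply: (rho_minpoly_dvd E1 m0 evm m_min rl).
rewrite -[_ *: _](subrK (rho hG)) dvdp_add //.
have pL : {subset [pchar K] <= [pchar {poly {poly %/ f with hf}}]}.
  move=> p pK; rewrite pchar_poly; apply: (rmorph_pchar (rho_f hf : {rmorphism _ -> _})).
  by rewrite pchar_poly.
rewrite /ht /hG !rhoS expr_sum_card // scaler_sumr -sumrB.
apply: (big_ind (fun x => rho m %| x)) => [||v _]; [exact: dvdp0|by move=> a b; exact: dvdp_add|].
have [_ ssv _ _] := sJ v.
have := rho_chom E1 m0 evm m_min y0 rl (qfpoly_expq sf (hf := hf)) (rho_f_prod hf sf f0) fE szc (N := k.-1) (s := sv (val v)).
rewrite prednK // => /(_ ssv) dv.
rewrite !rhoM !rhoX exprMn -exprM -expnD addnn -muln2 -nE scalerAr -mulrBr.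
exact: dvdp_mull.
Qed.

End Core.

End Counting.

End Stepanov.

(** k D exceeds S by about 2 k^2 g; multiplied by D' = S/(2k), this surplus of about k g S pays for
    the (k - 1) S g in [Y]. The 2 in D' leaves room for k^2 g in the order bound. The last bound has
    leading constant 1 in front of S^2 = q^n, which the comparison with the total count requires. *)
Lemma stepanov_params k g e s q : (0 < k)%N -> (1 < q)%N ->
  (4 * k * (2 * k * g + k * (e + g + g * g) + k * k * g + 2) <= s)%N ->
  let S := (q ^ s)%N in let D := (S %/ k + 2 * k * g)%N in let D' := (S %/ (2 * k))%N in
  [/\ (k * D' + k * k * g < S)%N,
      ((S * D' + (D + k.-1 * (e + g)) + k.-1 * (S + g) * g).+1 < D'.+1 * (k * D.+1))%N &
      (k * (D' + S * D + k.-1 * S * g) <= S * S + (1 + 2 * k * k * g + k * k * g) * S)%N].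
Proof.
move=> k0 q1 hs S D D'; have sS : (s < S)%N by apply: ltn_expl.
have hD' : (2 * k * D' <= S)%N by rewrite mulnC leq_trunc_div.
have hD'1 : (S < 2 * k * D'.+1)%N by rewrite mulnC ltn_ceil // muln_gt0.
have hk : (k * (S %/ k) <= S)%N by rewrite mulnC leq_trunc_div.
have hk1 : (S < k * (S %/ k).+1)%N by rewrite mulnC ltn_ceil.
have hkS : (S %/ k <= S)%N by apply: leq_div.
rewrite /D; move: (S %/ k)%N hk hk1 hkS => t hk hk1 hkS.
rewrite -/D'; move: D' hD' hD'1 => d hd hd1; clearbody S.
case: k k0 hs hd hd1 hk hk1 {D} => // k _ hs hd hd1 hk hk1.
split.
- nia.
- rewrite /=; set A := (_ + 2)%N in hs.
  have hA : (2 * A < d.+1)%N.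
    rewrite -(@ltn_pmul2l (2 * k.+1)) //; apply: leq_ltn_trans (ltn_trans sS hd1).
    by apply: leq_trans hs; rewrite mulnACA mulnA.
  have h2 : (S * (k.+1 * g) <= 2 * k.+1 * d.+1 * (k.+1 * g))%N by rewrite leq_mul2r ltnW ?orbT.
  have h3 : (S.+1 * d.+1 <= d.+1 * (k.+1 * t.+1))%N by rewrite mulnC leq_mul2l hk1 orbT.
  have -> : (d.+1 * (k.+1 * (t + 2 * k.+1 * g).+1) = d.+1 * (k.+1 * t.+1) + 2 * k.+1 * d.+1 * (k.+1 * g))%N.
    by ring.
  apply: leq_trans (leq_add h3 h2).
  have h4 : (k.+1 * (e + g + g * g) = k * (e + g) + k * g * g + (e + g + g * g))%N by ring.
  have -> : (S * (k.+1 * g) = k * S * g + S * g)%N by ring.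
  have -> : (k * (S + g) * g = k * S * g + k * g * g)%N by ring.
  have -> : (S.+1 * d.+1 = S * d + S + d.+1)%N by ring.
  move: hA; rewrite /A h4.
  move: (S * g)%N (S * d)%N (k * S * g)%N (k * g * g)%N (k * (e + g))%N (2 * k.+1 * g)%N (k.+1 * k.+1 * g)%N (e + g + _)%N.
  lia.
- have h1 : (S * (k.+1 * t) <= S * S)%N by rewrite leq_mul2l hk orbT.
  have h2 : (k.+1 * d <= S)%N by apply: leq_trans hd; rewrite -mulnA mul2n -addnn leq_addr.
  have h3 : (k.+1 * (k * S * g) <= k.+1 * k.+1 * g * S)%N.
    have -> : (k.+1 * k.+1 * g * S = k.+1 * (k * S * g) + k.+1 * S * g)%N by ring.
    exact: leq_addr.
  have -> : (k.+1 * (d + S * (t + 2 * k.+1 * g) + k.+1.-1 * S * g) = k.+1 * d + S * (k.+1 * t) + 2 * k.+1 * k.+1 * g * S + k.+1 * (k * S * g))%N by rewrite /=; ring.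
  have -> : ((1 + 2 * k.+1 * k.+1 * g + k.+1 * k.+1 * g) * S = S + 2 * k.+1 * k.+1 * g * S + k.+1 * k.+1 * g * S)%N by ring.
  move: h1 h2 h3; move: (S * (k.+1 * t))%N (S * S)%N (2 * k.+1 * k.+1 * g * S)%N.
  move: (k.+1 * k.+1 * g * S)%N (k.+1 * (k * S * g))%N (k.+1 * d)%N; lia.
Qed.

Lemma size_chom (K : finFieldType) (E c : {poly K}) g N h : (size (carlitz E c) <= g.+1)%N ->
  (size (chom E N c h) <= N * g + 1)%N.
Proof.
move=> sg; rewrite /chom; elim/big_rec: _ => [|i x _ sx]; first by rewrite size_poly0.
rewrite (leq_trans (size_polyD _ _)) // geq_max sx andbT.
apply: leq_trans (size_polyMleq _ _) _.
have := size_poly_exp_leq (carlitz E c) i.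
have := size_polyC_leq1 (h`_i * 'X^(cexp K (size E).-1 * (N - i))).
have iN : (i <= N)%N by rewrite -ltnS.
have : ((size (carlitz E c)).-1 * i <= N * g)%N.
  by rewrite mulnC leq_mul //; move: sg; plia.
move=> h1 h2 h3; rewrite -subn1 leq_subLR; apply: leq_trans (leq_add h2 h3) _.
by rewrite leq_add2l addn1 ltnS.
Qed.

Section StepanovBound.
Variables (K : finFieldType) (E : {poly K}).
Hypothesis E1 : (1 < size E)%N.
Local Notation q := #|K|.
Let r := (size E).-1.
Local Notation e := (cexp K r).

Let q_gt1 : (1 < q)%N. Proof. exact: finRing_gt1. Qed.
Let q_gt0 n : (0 < q ^ n)%N. Proof. by rewrite expn_gt0 ltnW. Qed.

(** [H] consists of the c for which [lam c] is a root of m, that is a conjugate of [lam 1]; [lam] is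
    injective on residues, so there are at most k. For c outside [H], m(phi_c(X)) does not vanish at
    lambda, but at a prime of class c it is m^Q up to a power of y, hence divisible by m. Such
    primes satisfy n N <= D0 with D0 fixed, so there is none once n > D0. *)
Lemma stepanov_bound : exists (k : nat) (H : {set {poly_r K}}),
  [/\ (0 < k)%N, (#|H| <= k)%N, (exists2 c, c \in H & c = 1 :> {poly K}) &
  exists C s0 : nat, forall s, (s0 <= s)%N -> forall c : {poly_r K},
    (k * (s * 2 * #|irr_class (E := E) (s * 2) c|) <= q ^ (s * 2) + C * q ^ s)%N /\
    (c \notin H -> #|irr_class (E := E) (s * 2) c| = 0)].
Proof.
have [m [m0 evm m_min]] := exists_minpoly E1.
pose k := (size m).-1.
have k0 : (0 < k)%N := minpoly_deg_gt0 E1 m0 evm m_min.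
have sm : size m = k.+1 by rewrite prednK // size_poly_gt0.
have l0 : lead_coef m != 0 by rewrite lead_coef_eq0.
have [gm hgm] := degY_ex m.
have gex (c : {poly_r K}) : {g | degY g (carlitz E c)} by apply: cid; exact: degY_ex.
pose g := (maxn gm (\max_c maxn (sval (gex c)) (size (carlitz E c))))%N.
have gmg : degY g m by apply: degY_mono hgm; rewrite leq_maxl.
have gcg (c : {poly_r K}) : degY g (carlitz E c) /\ (size (carlitz E c) <= g.+1)%N.
  have h : (maxn (sval (gex c)) (size (carlitz E c)) <= g)%N.
    apply: leq_trans (leq_maxr _ _).
    by rewrite (bigD1 c) //= leq_maxl.
  move: h; rewrite geq_max => /andP[h1 h2]; split; last exact: leqW.
  by apply: degY_mono (svalP (gex c)).
pose vl (c : {poly K}) := (map_poly (poly_fps (K := K)) m).[lam E c].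
have vlE c : vl c = \sum_(i < k.+1) poly_fps m`_i * lam E c ^+ i.
  rewrite /vl (horner_coef_wide (n := k.+1)); last by rewrite (leq_trans (size_poly _ _)) ?sm.
  by apply: eq_bigr => i _; rewrite coef_map.
pose H : {set {poly_r K}} := [set c : {poly_r K} | vl c == 0].
have r0 : (0 < r)%N by rewrite /r; plia.
exists k, H; split => //.
- have mm0 : map_poly (poly_fps (K := K)) m != 0.
    apply: contraNneq l0 => /(congr1 (fun P : {poly fps K} => P`_k)).
    by rewrite coef_map coef0 /= => /eqP; rewrite poly_fps_eq0 lead_coefE.
  have := @max_poly_roots _ (map_poly (poly_fps (K := K)) m) [seq lam E (c : {poly_r K}) | c <- enum H] mm0.
  rewrite size_map -cardE => hr.
  rewrite -ltnS -sm; apply: leq_trans (hr _ _) (size_poly _ _).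
    by apply/allP => _ /mapP[c cH ->]; rewrite mem_enum inE in cH.
  rewrite map_inj_uniq ?enum_uniq // => c c' ll; apply: val_inj => /=.
  apply/eqP; rewrite -subr_eq0; apply: contrapT => /negP cc.
  have : E %| (c : {poly K}) - c'.
    by apply: lam_inj => //; rewrite [LHS](raddfB (lam E)) /= ll subrr.
  move=> /(dvdp_leq cc); have := size_polyD (c : {poly K}) (- (c' : {poly K})).
  rewrite size_polyN; have := size_npoly c; have := size_npoly c'; rewrite /r.
  move: E1; plia.
- have s1 : (1 : {poly K}) \is a poly_of_size r by rewrite qualifE /= size_poly1.
  by exists (NPoly s1) => //; rewrite inE; apply/eqP.
pose d := (k.-1 * g + k * g + e * k + k)%N.
pose D0 := (g + k * (e + g) + d * g)%N.
exists (1 + 2 * k * k * g + k * k * g)%N.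
exists (4 * k * (2 * k * g + k * (e + g + g * g) + k * k * g + 2) + size (lead_coef m) + size (disc E) + D0)%N.+1.
move=> s hs c.
have n_l : (size (lead_coef m) < s * 2)%N by move: hs; move: (4 * _ * _)%N => a; plia.
have n_d : (size (disc E) < s * 2)%N by move: hs; move: (4 * _ * _)%N => a; plia.
have n_D : (D0 < s * 2)%N by move: hs; move: (4 * _ * _)%N => a; plia.
have [] := @stepanov_params k g e s q k0 q_gt1.
  by move: hs; move: (4 * _ * _)%N => a; plia.
set S := (q ^ s)%N; set D := (S %/ k + _)%N; set D' := (S %/ _)%N => h1 h2 h3; split.
  have := stepanov_core E1 m0 evm m_min gmg gcg (s := s) c n_l n_d (D := D) (D' := D') erefl h1 h2.
  rewrite -/k -/S => hcore; rewrite muln2 -addnn expnD -/S addnn -muln2.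
  by apply: leq_trans h3; rewrite leq_mul2l hcore orbT.
rewrite inE => cH; have ev0 : ev E (chom E k c m) != 0.
  have sc : (size (c : {poly K}) <= r.+1)%N by apply: leqW; exact: size_npoly.
  by rewrite ev_chom // -vlE mulf_neq0 // poly_fps_eq0 expf_neq0 ?polyX_eq0.
pose h := chom E k c m.
have sh : (size h <= k + d)%N.
  have [_ sg] := gcg c; apply: leq_trans (size_chom k _ sg) _.
  by rewrite addnC leq_add // /d -!addnA addnCA leq_addr.
pose P := prem m d h.
have P0 : P != 0.
  apply: contraNneq ev0 => P0; have := ev_prem evm d h.
  rewrite -/P P0 rmorph0 => /esym/eqP; rewrite mulf_eq0 poly_fps_eq0 expf_eq0.
  by rewrite (negPf l0) andbF.
have dP : degY D0 P.
  have [gc _] := gcg c; apply: (degY_prem _ gmg); exact: (degY_chom E1 m0 m_min k gc gmg).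
have := good_primes_count E1 m0 evm m_min gcg (c := c) n_l n_d (size_prem m0 sh) P0 dP.
have [->//|N0] := posnP #|irr_class (E := E) (s * 2) c|.
move=> cnt; suff : (s * 2 * #|irr_class (E := E) (s * 2) c| <= D0)%N.
  by rewrite leqNgt (leq_trans n_D) // leq_pmulr.
apply: cnt => f fc hf; have [_ sf f0 fE] := irr_classP fc; rewrite -/P.
pose rho := map_poly (rho_f hf).
have rhoM a b : rho (a * b) = rho a * rho b by exact: rmorphM.
have rhoX a t : rho (a ^+ t) = rho a ^+ t by exact: rmorphXn.
have rl : rho_f hf (lead_coef m) != 0.
  apply: (rho_f_neq0 hf sf f0 l0 (D := (size (lead_coef m)).-1)); first by rewrite leqSpred.
  by apply: leq_ltn_trans n_l; rewrite leq_pred.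
have [quo PE] := premP m d h.
have mh : rho m %| rho h.
  have sc : (size (c : {poly K}) <= r.+1)%N by apply: leqW; exact: size_npoly.
  have y0 := rho_fX_neq0 hf sf f0.
  have := rho_chom E1 m0 evm m_min y0 rl (qfpoly_expq sf (hf := hf)) (rho_f_prod hf sf f0) fE sc (N := k) (s := m).
  rewrite sm leqnn => /(_ isT); rewrite -/k => /(dvdp_sub _).
  move=> /(_ (rho_f hf 'X ^+ (e * k) *: rho m ^+ (q ^ (s * 2)))).
  rewrite opprB addrC subrK; apply.
  by rewrite dvdpZr ?expf_neq0 // -(prednK (q_gt0 _)) exprS dvdp_mulr.
rewrite -/rho; have -> : rho P = rho (lead_coef m ^+ d)%:P * rho h - rho quo * rho m.
  rewrite -!rhoM PE [rho (_ + _)](_ : _ = rho (quo * m) + rho P); last exact: rmorphD.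
  by rewrite addrC addKr.
by rewrite dvdp_sub ?dvdp_mull.
Qed.

End StepanovBound.

(** * Monic polynomials and the Möbius function *)
Section Monics.
Variable K : finFieldType.
Local Notation q := #|K|.
Implicit Types x y d P Q F : {poly K}.

Definition mon n : seq {poly K} :=
  [seq val x | x : {poly_n.+1 K} <- enum {: {poly_n.+1 K}} & ((val x : {poly K}) \is monic) && (size (val x : {poly K}) == n.+1)].

Lemma mem_mon n x : (x \in mon n) = (x \is monic) && (size x == n.+1).
Proof.
apply/mapP/idP => [[y]|/andP[mx /eqP sx]].
  by rewrite mem_filter => /andP[h _] ->.
have s1 : x \is a poly_of_size n.+1 by rewrite qualifE /= sx.
by exists (NPoly s1) => //; rewrite mem_filter mem_enum /= mx sx eqxx.
Qed.

Lemma monP n x : x \in mon n -> x \is monic /\ size x = n.+1.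
Proof. by rewrite mem_mon => /andP[-> /eqP]. Qed.

Lemma mon_neq0 n x : x \in mon n -> x != 0.
Proof. by move=> /monP[/monic_neq0]. Qed.

Lemma uniq_mon n : uniq (mon n).
Proof. by rewrite map_inj_uniq; [rewrite filter_uniq ?enum_uniq|exact: val_inj]. Qed.

Lemma mem_mon_size x : x \is monic -> x \in mon (size x).-1.
Proof. by move=> mx; rewrite mem_mon mx prednK ?eqxx // size_poly_gt0 monic_neq0. Qed.

Lemma mon0 : mon 0 = [:: 1].
Proof.
apply: perm_small_eq => //; apply: uniq_perm; rewrite ?uniq_mon // => x.
rewrite mem_mon inE; apply/andP/eqP => [[mx sx]|->]; last by rewrite monic1 size_poly1.
by move: sx mx => /size_poly1P[c c0 ->]; rewrite monicE lead_coefC => /eqP->.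
Qed.

Lemma mem_monXn n (v : {poly K}) : (size v <= n)%N -> 'X^n + v \in mon n.
Proof.
move=> sv; have s : size ('X^n + v) = n.+1 by rewrite size_polyDl size_polyXn.
by rewrite mem_mon s eqxx monicE lead_coefDl ?size_polyXn // lead_coefXn eqxx.
Qed.

Lemma perm_monXn n : perm_eq (mon n) [seq 'X^n + val v | v : {poly_n K} <- enum {: {poly_n K}}].
Proof.
apply: uniq_perm; first exact: uniq_mon.
  by rewrite map_inj_uniq ?enum_uniq // => u v /addrI; exact: val_inj.
move=> x; apply/idP/mapP => [/monP[mx sx]|[v _ ->]]; last exact: mem_monXn (size_npoly v).
have sv : x - 'X^n \is a poly_of_size n.
  rewrite qualifE /=; apply/leq_sizeP => j; rewrite leq_eqVlt => /orP[/eqP<-|nj].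
    by move: mx; rewrite monicE lead_coefE sx => /eqP xn; rewrite coefB coefXn eqxx xn subrr.
  by rewrite coefB coefXn gtn_eqF // nth_default ?subr0 // sx.
by exists (NPoly sv); rewrite ?mem_enum //= addrC subrK.
Qed.

Lemma monM i j x y : x \in mon i -> y \in mon j -> x * y \in mon (i + j).
Proof.
move=> /monP[mx sx] /monP[my sy]; rewrite mem_mon monicMr // mx /=.
by rewrite size_mul ?monic_neq0 // sx sy addnS.
Qed.

Lemma mon_div k n d x : d \in mon k -> x \in mon n -> d %| x -> (k <= n)%N /\ x %/ d \in mon (n - k).
Proof.
move=> /monP[md sd] /monP[mx sx] dx.
have kn : (k <= n)%N by have := dvdp_leq (monic_neq0 mx) dx; rewrite sd sx.
split => //; rewrite mem_mon size_divp ?monic_neq0 // sd sx subSn //= eqxx andbT.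
by rewrite -(monicMr _ md) divpK.
Qed.

Lemma size_mon n : size (mon n) = (q ^ n)%N.
Proof. by rewrite (perm_size (perm_monXn n)) size_map -cardE card_npoly. Qed.

Section Sums.
Variable V : nmodType.

Lemma sum_mon_dvd k n d (f : {poly K} -> V) : d \in mon k -> (k <= n)%N ->
  \sum_(x <- mon n | d %| x) f x = \sum_(y <- mon (n - k)) f (d * y).
Proof.
move=> dk kn; rewrite -big_filter -(big_map (fun y => d * y) xpredT f).
apply: perm_big; apply: uniq_perm; first by rewrite filter_uniq ?uniq_mon.
  by rewrite map_inj_uniq ?uniq_mon //; apply: mulfI; exact: mon_neq0 dk.
move=> x; rewrite mem_filter; apply/andP/mapP => [[dx xn]|[y yn ->]].
  by have [_ h] := mon_div dk xn dx; exists (x %/ d) => //; rewrite mulrC divpK.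
by rewrite dvdp_mulr // -(subnKC kn) monM.
Qed.

Lemma sum_mon_ndvd k n d (f : {poly K} -> V) : d \in mon k -> (n < k)%N ->
  \sum_(x <- mon n | d %| x) f x = 0.
Proof.
move=> dk nk; rewrite big_seq_cond big1 // => x /andP[xn dx].
by have [] := mon_div dk xn dx; rewrite leqNgt nk.
Qed.

Lemma exchange_mon_dvd n (H : {poly K} -> {poly K} -> V) :
  \sum_(x <- mon n) \sum_(k < n.+1) \sum_(d <- mon k | d %| x) H d (x %/ d) =
  \sum_(k < n.+1) \sum_(d <- mon k) \sum_(y <- mon (n - k)) H d y.
Proof.
rewrite exchange_big; apply: eq_bigr => k _ /=.
rewrite (exchange_big_dep predT) //= !big_seq; apply: eq_bigr => d dk.
rewrite (sum_mon_dvd _ dk) -1?ltnS //; apply: eq_bigr => y _.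
by rewrite mulKp // (mon_neq0 dk).
Qed.

Lemma sum_monXn n (f : {poly K} -> V) :
  \sum_(x <- mon n) f x = \sum_(v : {poly_n K}) f ('X^n + v).
Proof. by rewrite (perm_big _ (perm_monXn n)) big_map big_enum. Qed.

(* A polynomial of degree [r + k] is determined by its residue and its
   quotient modulo F. *)
Lemma sum_mon_mod F r k (f : {poly K} -> V) : size F = r.+1 ->
  \sum_(x <- mon (r + k)) f (x %% F) = (\sum_(v : {poly_r K}) f v) *+ (q ^ k).
Proof.
move=> sF; have F0 : F != 0 by rewrite -size_poly_gt0 sF.
pose F1 := (lead_coef F)^-1 *: F.
have lF : lead_coef F != 0 by rewrite lead_coef_eq0.
have F1r : F1 \in mon r by rewrite mem_mon monicE lead_coefZ mulVf // size_scale ?invr_eq0 // sF !eqxx.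
have F10 := mon_neq0 F1r; have sF1 : size F1 = r.+1 by case/monP: F1r.
have modF1 x : x %% F = x %% F1 by rewrite modpZr ?invr_eq0.
have mod1 (u : {poly K}) (v : {poly_r K}) : (F1 * u + v) %% F1 = v.
  by rewrite modpD modp_mulr add0r modp_small // sF1 ltnS size_npoly.
have div1 (u : {poly K}) (v : {poly_r K}) : (F1 * u + v) %/ F1 = u.
  by rewrite divpD mulKp // divp_small ?addr0 // sF1 ltnS size_npoly.
have pe : perm_eq (mon (r + k)) [seq F1 * u + val v | u <- mon k, v : {poly_r K} <- enum {: {poly_r K}}].
  apply: uniq_perm; first exact: uniq_mon.
    apply: allpairs_uniq; rewrite ?uniq_mon ?enum_uniq // => -[u v] [u' v'] _ _ /= eq.
    congr (_, _); first by rewrite -(div1 u v) eq div1.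
    by apply: val_inj; rewrite /= -(mod1 u v) eq mod1.
  move=> x; apply/idP/allpairsP => [/monP[mx sx]|[[u v] /= [uk _ ->]]]; last first.
    have [mu su] := monP uk; have [mF _] := monP F1r.
    have lt : (size (v : {poly K}) < size (F1 * u)%R)%N.
      rewrite size_mul ?(mon_neq0 uk) // sF1 su addnS /= addSn ltnS.
      by apply: leq_trans (size_npoly _) (leq_addr _ _).
    have [mFu sFu] := monP (monM F1r uk).
    by rewrite mem_mon size_polyDl // sFu monicE lead_coefDl // -monicE mFu eqxx.
  have [mF _] := monP F1r.
  have sv : x %% F1 \is a poly_of_size r by rewrite qualifE /= -ltnS -sF1 ltn_modp.
  exists (x %/ F1, NPoly sv); split; rewrite /= ?mem_enum //; last by rewrite mulrC -divp_eq.
  have sd : size (x %/ F1) = k.+1 by rewrite size_divp // sF1 sx /= -addnS addKn.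
  rewrite mem_mon sd eqxx andbT -(monicMl _ mF).
  have lt : (size (x %% F1)%R < size (x %/ F1 * F1)%R)%N.
    by rewrite size_mul // -?size_poly_gt0 ?sd // sF1 addnS /= addSn ltnS (leq_trans sv) // leq_addl.
  by rewrite mulrC monicE -(lead_coefDl lt) -divp_eq -monicE.
rewrite (perm_big _ pe) big_allpairs_dep /= (eq_bigr (fun=> \sum_(v : {poly_r K}) f v)); last first.
  by move=> u _; rewrite big_enum; apply: eq_bigr => v _; rewrite modF1 mod1.
by rewrite big_const_seq count_predT size_mon iter_addr addr0.
Qed.

End Sums.

End Monics.

Section MobiusFunction.
Variable K : finFieldType.
Local Notation q := #|K|.
Implicit Types x y d P Q F : {poly K}.

Definition mprime P := (P \is monic) && irreducibleb P.

Lemma mprimeP P : reflect (P \is monic /\ irreducible_poly P) (mprime P).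
Proof. by apply: (iffP andP) => -[h1 /irreducibleP h2]. Qed.

Lemma exists_mprime x : (1 < size x)%N -> exists2 P, mprime P & P %| x.
Proof.
have [n] := ubnP (size x); elim: n x => // n IH x xn x1.
have x0 : x != 0 by rewrite -size_poly_gt0 ltnW.
have l0 : lead_coef x != 0 by rewrite lead_coef_eq0.
have [/irreducibleP ix|/irreducibleP nix] := boolP (irreducibleb x).
  exists ((lead_coef x)^-1 *: x); last by rewrite dvdpZl ?invr_eq0.
  apply/mprimeP; split; first by rewrite monicE lead_coefZ mulVf.
  split; first by rewrite size_scale ?invr_eq0.
  have [_ ix2] := ix.
  move=> y y1; rewrite dvdpZr ?invr_eq0 // => yx; apply: eqp_trans (ix2 y y1 yx) _.
  by rewrite eqp_sym eqp_scale ?invr_eq0.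
have [y [y1 yx nyx]] : exists y, [/\ size y != 1%N, y %| x & ~~ (y %= x)].
  apply: contrapT => ny; apply: nix; split => // y y1 yx.
  by apply: contrapT => /negP nyx; apply: ny; exists y.
have sy : (size y < size x)%N.
  rewrite ltn_neqAle (dvdp_leq x0 yx) andbT; apply: contra nyx => /eqP sxy.
  by rewrite -(dvdp_size_eqp yx) sxy.
have [|P pP Py] := IH y (leq_trans sy xn).
  by rewrite ltn_neqAle eq_sym y1 size_poly_gt0; apply: contraTneq yx => ->; rewrite dvd0p.
by exists P => //; exact: dvdp_trans yx.
Qed.

Lemma mprime_coprime P x : mprime P -> coprimep P x = ~~ (P %| x).
Proof. by move=> /mprimeP[_ iP]; rewrite irreducible_poly_coprime. Qed.

Lemma mprime_neq0 P : mprime P -> P != 0.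
Proof. by case/mprimeP => /monic_neq0. Qed.

Lemma mprime_size P : mprime P -> (1 < size P)%N.
Proof. by case/mprimeP => _ []. Qed.

Lemma mprime_dvdM P x y : mprime P -> P %| x * y = (P %| x) || (P %| y).
Proof.
move=> pP; have [Px|nPx] := boolP (P %| x); first by rewrite dvdp_mulr.
by rewrite Gauss_dvdpr // mprime_coprime.
Qed.

Lemma mprime_dvdX P x n : mprime P -> P %| x ^+ n -> P %| x.
Proof.
move=> pP; elim: n => [|n IH]; last by rewrite exprS mprime_dvdM // => /orP[|/IH].
by rewrite expr0 dvdp1 => /eqP h; have := mprime_size pP; rewrite h.
Qed.

Lemma mprime_dvd P Q : mprime P -> mprime Q -> P %| Q -> P = Q.
Proof. by move=> /mprimeP[mP iP] /mprimeP[mQ iQ]; exact: monic_irr_dvd. Qed.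

Lemma squarefree_dvd x y : y %| x -> squarefree x -> squarefree y.
Proof. by move=> yx sx u u1; apply: contra (sx u u1) => uy; exact: dvdp_trans yx. Qed.

Lemma squarefreeZ (h : K) x : h != 0 -> squarefree (h *: x) <-> squarefree x.
Proof. by move=> h0; split => sx u /sx; rewrite dvdpZr. Qed.

Lemma squarefree_factor x : x \is monic -> squarefree x -> exists s : seq {poly K},
  [/\ uniq s, forall P, P \in s -> mprime P & x = \prod_(P <- s) P].
Proof.
have [n] := ubnP (size x); elim: n x => // n IH x xn mx sx.
have x0 := monic_neq0 mx.
have [x1|x1] := leqP (size x) 1.
  exists [::]; split => //; rewrite big_nil; have : x \in mon K (size x).-1 by exact: mem_mon_size.
  have -> : (size x).-1 = 0%N by move: x1; rewrite -size_poly_gt0 in x0; plia.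
  by rewrite mon0 inE => /eqP.
have [P pP /dvdpP[y xE]] := exists_mprime x1.
have [mP _] := mprimeP _ pP.
have my : y \is monic by rewrite -(monicMr _ mP) -xE.
have sy : squarefree y by apply: squarefree_dvd sx; rewrite xE dvdp_mulr.
have syx : (size y < size x)%N.
  rewrite xE size_mul ?monic_neq0 //; have := mprime_size pP.
  by have := monic_neq0 my; rewrite -size_poly_gt0; plia.
have [s [us ps yE]] := IH y (leq_trans syx xn) my sy.
exists (P :: s); split => /=.
- rewrite us andbT; apply/negP => Ps; have : P ^+ 2 %| x.
    by rewrite xE expr2 dvdp_mul // yE (big_rem _ Ps) dvdp_mulr.
  by apply/negP/sx; rewrite gtn_eqF // mprime_size.
- by move=> Q; rewrite inE => /orP[/eqP->|/ps].
- by rewrite big_cons -yE mulrC.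
Qed.

Lemma mobius_seq (h : K) (s : seq {poly K}) : h != 0 -> uniq s -> (forall P, P \in s -> mprime P) ->
  mobius (h *: \prod_(P <- s) P) = (-1) ^+ size s.
Proof. by move=> h0 us ps; apply: mobius_prod => // P /ps/mprimeP. Qed.

Lemma mobiusZ (h : K) x : h != 0 -> x \is monic -> mobius (h *: x) = mobius x.
Proof.
move=> h0 mx; have [sx|nsx] := pselect (squarefree x); last first.
  by rewrite !mobius_nsquarefree // squarefreeZ.
have [s [us ps ->]] := squarefree_factor mx sx.
by rewrite -[in RHS](scale1r (\prod_(_ <- _) _)) !mobius_seq ?oner_neq0.
Qed.

Lemma mobius1 : mobius (1 : {poly K}) = 1.
Proof.
have := @mobius_seq 1 [::]; rewrite big_nil scale1r expr0; apply => //.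
exact: oner_neq0.
Qed.

Lemma mobius_le1 x : `|mobius x| <= 1.
Proof. by rewrite /mobius; case: ifP => _; rewrite ?normr0 // normrX normrN1 expr1n. Qed.

Lemma mobius_mprimeM P x : mprime P -> x \is monic ->
  mobius (P * x) = if P %| x then 0 else - mobius x.
Proof.
move=> pP mx; have [mP _] := mprimeP _ pP; case: ifPn => [Px|nPx].
  apply: mobius_nsquarefree => /(_ P); rewrite gtn_eqF ?mprime_size // => /(_ isT)/negP; apply.
  by rewrite expr2 dvdp_mul.
have [sx|nsx] := pselect (squarefree x); last first.
  rewrite !mobius_nsquarefree ?oppr0 // => sPx; apply: nsx.
  by apply: squarefree_dvd sPx; rewrite dvdp_mull.
have [s [us ps xE]] := squarefree_factor mx sx.
have nPs : P \notin s by apply: contra nPx => Ps; rewrite xE (big_rem _ Ps) dvdp_mulr.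
have pPs Q : Q \in P :: s -> mprime Q by rewrite inE => /orP[/eqP->|/ps].
have uPs : uniq (P :: s) by rewrite /= nPs.
have := mobius_seq (oner_neq0 _) uPs pPs; rewrite big_cons scale1r -xE => ->.
have := mobius_seq (oner_neq0 _) us ps; rewrite scale1r -xE => ->.
by rewrite exprS mulN1r.
Qed.

Definition monle n : seq {poly K} := flatten [seq mon K k | k <- iota 0 n.+1].

Lemma mem_monle n x : (x \in monle n) = (x \is monic) && (size x <= n.+1)%N.
Proof.
apply/flatten_mapP/andP => [[k]|[mx sx]].
  by rewrite mem_iota add0n /= => kn /monP[mx ->]; split.
exists (size x).-1; last exact: mem_mon_size.
by rewrite mem_iota add0n /=; move: sx; have := monic_neq0 mx; rewrite -size_poly_gt0; plia.
Qed.

Lemma sum_monle (V : nmodType) n (P : pred {poly K}) (f : {poly K} -> V) :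
  \sum_(x <- monle n | P x) f x = \sum_(k < n.+1) \sum_(x <- mon K k | P x) f x.
Proof. by rewrite big_flatten big_map -[iota 0 n.+1]/(index_iota 0 n.+1) big_mkord. Qed.

Lemma uniq_monle n : uniq (monle n).
Proof.
rewrite /monle; elim: n.+1 0%N => //= m IH k; rewrite cat_uniq uniq_mon IH andbT /=.
apply/hasPn => x /flatten_mapP[j]; rewrite mem_iota => /andP[kj _] /monP[mx sx].
by rewrite mem_mon sx eqSS gtn_eqF ?andbF.
Qed.

(** For a prime P dividing x, the divisors P d cancel against the divisors d prime to P. *)
Lemma sum_mobius_dvd n x : x \in mon K n ->
  \sum_(k < n.+1) \sum_(d <- mon K k | d %| x) mobius d = (n == 0%N)%:R.
Proof.
move=> xn; have [mx sx] := monP xn; rewrite -sum_monle.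
have [n0|n0] := posnP n.
  rewrite n0 in xn *; rewrite sum_monle big_ord1.
  rewrite -[mon K ord0]/(mon K 0) mon0 big_cons big_nil.
  by move: xn; rewrite mon0 inE => /eqP->; rewrite dvdpp mobius1 addr0.
have [|P pP Px] := @exists_mprime x; first by rewrite sx ltnS.
have [mP _] := mprimeP _ pP.
rewrite (bigID (fun d => P %| d)) /=.
have -> : \sum_(d <- monle n | (d %| x) && (P %| d)) mobius d =
          \sum_(d <- monle n | P * d %| x) mobius (P * d).
  rewrite -big_filter -[RHS]big_filter -(big_map (fun d => P * d) xpredT (@mobius K)).
  apply: perm_big; apply: uniq_perm; first by rewrite filter_uniq ?uniq_monle.
    rewrite map_inj_uniq ?filter_uniq ?uniq_monle //.
    by apply: mulfI; exact: monic_neq0.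
  move=> d; rewrite mem_filter; apply/andP/mapP => [[/andP[dx Pd] dn]|[y]].
    exists (d %/ P); last by rewrite mulrC divpK.
    rewrite mem_filter mulrC divpK // dx; move: dn; rewrite !mem_monle => /andP[md sd].
    by rewrite -(monicMr _ mP) divpK // md (leq_trans _ sd) // leq_divp.
  rewrite mem_filter mem_monle => /and3P[Pyx my sy] ->.
  rewrite Pyx dvdp_mulr // mem_monle monicMl // my.
  by rewrite -sx dvdp_leq // monic_neq0.
rewrite [X in X + _ = _](_ : _ = - \sum_(d <- monle n | (d %| x) && ~~ (P %| d)) mobius d) ?addNr //.
rewrite -sumrN [LHS]big_seq_cond [RHS]big_seq_cond [LHS]big_mkcond [RHS]big_mkcond.
apply: eq_bigr => d _; case dn: (d \in monle n) => //=.
have /andP[md _] : (d \is monic) && (size d <= n.+1)%N by rewrite -mem_monle.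
rewrite mobius_mprimeM //; have [Pd|nPd] := boolP (P %| d); first by rewrite andbF; case: ifP.
by rewrite andbT Gauss_dvdp ?mprime_coprime // Px.
Qed.

(** The exponent of P in x, cut off at N, as a sum of indicators: the form in which it enters the
    logarithmic derivative. *)
Definition mult N P x := (\sum_(i < N) (P ^+ i.+1 %| x)%R)%N.

Lemma multM N P Q x : mprime P -> mprime Q -> x != 0 -> (size (Q * x)%R <= N.+1)%N ->
  mult N P (Q * x) = (mult N P x + (P == Q))%N.
Proof.
move=> pP pQ x0 sx; rewrite /mult; have [<-|PQ] := eqVneq P Q; last first.
  rewrite addn0; apply: eq_bigr => i _; rewrite Gauss_dvdpr //.
  rewrite coprimep_expl // mprime_coprime //; apply: contra PQ => /mprime_dvd -> //.
case: N sx => [|N] sx.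
  have := leq_trans (dvdp_leq (mulf_neq0 (mprime_neq0 pQ) x0) (dvdp_mulr x (dvdpp Q))) sx.
  by rewrite leqNgt mprime_size.
have last0 : (P ^+ N.+1 %| x) = false.
  apply/negbTE/negP => /(dvdp_leq x0); apply/negP; rewrite -ltnNge.
  have sP := mprime_size pP; have P0 := mprime_neq0 pP.
  move: sx; rewrite (size_mul (mprime_neq0 pQ)) // => sx.
  have sPN : (size (P ^+ N.+1)%R).-1 = ((size P).-1 * N.+1)%N by rewrite size_exp.
  have : (N.+1 <= (size P).-1 * N.+1)%N by rewrite leq_pmull //; move: sP; plia.
  rewrite -sPN; have := mprime_size pQ; move: sx sP; plia.
rewrite big_ord_recl /= expr1 dvdp_mulr ?dvdpp // [in RHS]big_ord_recr /= last0 addn0 addnC.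
by congr (_ + _)%N; apply: eq_bigr => i _; rewrite exprS dvdp_mul2l // mprime_neq0.
Qed.

Lemma sum_mult N x : x \is monic -> (size x <= N.+1)%N ->
  (\sum_(P <- monle N | mprime P) mult N P x * (size P).-1 = (size x).-1)%N.
Proof.
have [n] := ubnP (size x); elim: n x => // n IH x xn mx sx.
have x0 := monic_neq0 mx.
have [x1|x1] := leqP (size x) 1.
  have -> : x = 1.
    have : x \in mon K (size x).-1 by exact: mem_mon_size.
    have -> : (size x).-1 = 0%N by move: x1; rewrite -size_poly_gt0 in x0; plia.
    by rewrite mon0 inE => /eqP.
  rewrite size_poly1 big1 // => P pP; rewrite /mult big1 // => i _.
  rewrite (_ : (_ %| _) = false) //; apply/negbTE/negP => h.
  have := dvdp_trans (dvdp_mulr (P ^+ i) (dvdpp P)) _; rewrite -exprS => /(_ _ h).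
  by rewrite dvdp1 => /eqP sP; have := mprime_size pP; rewrite sP.
have [Q pQ /dvdpP[y xE]] := exists_mprime x1.
have [mQ _] := mprimeP _ pQ.
have my : y \is monic by rewrite -(monicMr _ mQ) -xE.
have y0 := monic_neq0 my.
have sE : (size x = (size y).-1 + size Q)%N.
  by rewrite xE size_mul ?monic_neq0 //; have := y0; rewrite -size_poly_gt0; plia.
have sQ := mprime_size pQ.
rewrite (eq_bigr (fun P => mult N P y * (size P).-1 + (P == Q) * (size P).-1)%N); last first.
  by move=> P pP; rewrite xE mulrC multM ?mulnDl // mulrC -xE.
rewrite big_split /= IH //; last 2 first.
- by move: xn sE sQ; rewrite -size_poly_gt0 in y0; plia.
- by move: sx sE sQ; rewrite -size_poly_gt0 in y0; plia.
rewrite (big_rem Q) /=; last first.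
  by rewrite mem_monle mQ; move: sx sE; rewrite -size_poly_gt0 in y0; plia.
rewrite pQ eqxx mul1n big1_seq ?addn0; last first.
  move=> P /andP[_]; rewrite mem_rem_uniq ?uniq_monle // inE => /andP[PQ _].
  by rewrite (negPf PQ).
by move: sE sQ; plia.
Qed.

End MobiusFunction.

(** * L-functions of even Dirichlet characters *)
Lemma sum_ord_widen (V : nmodType) (F : nat -> V) n N : (n <= N)%N ->
  (forall i, (n <= i)%N -> F i = 0) -> \sum_(i < N) F i = \sum_(i < n) F i.
Proof.
move=> nN F0; rewrite (big_ord_widen N F nN) [RHS]big_mkcond; apply: eq_bigr => i _.
by case: ltnP => // /F0.
Qed.

Section EulerFactors.
Variables (K : finFieldType) (F : fieldType) (chi : {poly K} -> F).
Local Notation q := #|K|.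
Hypotheses (chi1 : chi 1 = 1) (chiM : forall f g, chi (f * g) = chi f * chi g).

Definition lseries : fps F := fun n => \sum_(f <- mon K n) chi f.
Definition mu_series : fps F := fun n => \sum_(f <- mon K n) (mobius f)%:~R * chi f.
Definition euler_factor d i := d%:R * \sum_(P <- mon K d | mprime P) chi P ^+ i.
(** Coefficients of the logarithmic derivative of the L-series: prime powers P^i of degree n,
    weighted by deg(P) chi(P)^i. This is the von Mangoldt sum. *)
Definition psi_series : fps F := fun n =>
  \sum_(d < n.+1) \sum_(i < n | (d * i.+1)%N == n) euler_factor d i.+1.
Definition fps_D (f : fps F) : fps F := fun n => n%:R * f n.

Lemma lseries0 : lseries 0 = 1.
Proof. by rewrite /lseries mon0 big_cons big_nil addr0. Qed.

Lemma mu_seriesM : mu_series * lseries = 1.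
Proof.
apply/funext => n; rewrite fpsME.
transitivity (\sum_(k < n.+1) \sum_(d <- mon K k) \sum_(y <- mon K (n - k)) ((mobius d)%:~R * chi d) * chi y).
  by apply: eq_bigr => k _; rewrite mulr_suml; apply: eq_bigr => d _; rewrite mulr_sumr.
rewrite -exchange_mon_dvd.
transitivity (\sum_(x <- mon K n) chi x * (n == 0%N)%:R).
  rewrite !big_seq; apply: eq_bigr => x xn.
  have -> : (n == 0%N)%:R = ((n == 0%N)%:R : int)%:~R :> F by case: eqP.
  rewrite -(sum_mobius_dvd xn) rmorph_sum mulr_sumr; apply: eq_bigr => k _.
  rewrite rmorph_sum mulr_sumr; apply: eq_bigr => d dx /=.
  by rewrite -[in RHS](divpK dx) chiM /=; ring.
rewrite -mulr_suml -/(lseries n); case: n => [|n]; first by rewrite lseries0 mulr1.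
by rewrite mulr0.
Qed.

Lemma psi_series_widen n N : (n <= N)%N -> psi_series n =
  \sum_(d < N.+1) \sum_(i < N | (d * i.+1)%N == n) euler_factor d i.+1.
Proof.
move=> nN; pose T d i := (if (d * i.+1 == n)%N then euler_factor d i.+1 else 0) : F.
have T0 d : (n < d)%N -> forall i, T d i = 0.
  by move=> nd i; rewrite /T gtn_eqF // mulnS (leq_trans nd) // leq_addr.
have T1 d i : (n <= i)%N -> T d i = 0.
  move=> ni; rewrite /T; case: eqP => // dn; have d0 : d = 0%N by move: dn; case: (d) => // d'; nia.
  by rewrite d0 /euler_factor mul0r.
rewrite [RHS](eq_bigr (fun d : 'I_N.+1 => \sum_(i < n) T d i)); last first.
  by move=> d _; rewrite big_mkcond (sum_ord_widen nN (T1 d)).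
rewrite (@sum_ord_widen _ (fun d => \sum_(i < n) T d i) n.+1 N.+1) //; last first.
  by move=> d nd; rewrite big1 // => i _; exact: T0.
by apply: eq_bigr => d _; rewrite big_mkcond.
Qed.

Lemma chiX f n : chi (f ^+ n) = chi f ^+ n.
Proof. by elim: n => [|n IH]; rewrite ?expr0 // !exprS chiM IH. Qed.

(** The degree of f is the sum of deg P over all prime powers P^i dividing f; then f = P^i y. *)
Lemma lseries_D : fps_D lseries = psi_series * lseries.
Proof.
apply/funext => n; rewrite fpsME.
transitivity (\sum_(d < n.+1) \sum_(i < n) if (d * i.+1 <= n)%N then euler_factor d i.+1 * lseries (n - d * i.+1)%N else 0); last first.
  rewrite [RHS](eq_bigr (fun k : 'I_n.+1 => \sum_(d < n.+1) \sum_(i < n | (d * i.+1)%N == k) euler_factor d i.+1 * lseries (n - k)%N)); last first.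
    move=> k _; rewrite (@psi_series_widen k n) -1?ltnS // mulr_suml; apply: eq_bigr => d _.
    by rewrite mulr_suml.
  rewrite [RHS]exchange_big /=; apply: eq_bigr => d _.
  rewrite [RHS](exchange_big_dep predT) //=; apply: eq_bigr => i _.
  case: leqP => din; last first.
    by rewrite big_pred0 // => k; apply: gtn_eqF; apply: leq_trans din; rewrite ltnS -ltnS.
  by rewrite (big_pred1 (Ordinal (din : (_ < n.+1)%N))).
transitivity (\sum_(f <- mon K n) \sum_(d < n.+1) \sum_(P <- mon K d | mprime P) \sum_(i < n) if P ^+ i.+1 %| f then d%:R * chi f else 0).
  rewrite /fps_D mulr_sumr !big_seq; apply: eq_bigr => f fn; have [mf sf] := monP fn.
  have := sum_mult mf (eq_leq sf); rewrite sf /= sum_monle => {1}<-.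
  rewrite natr_sum mulr_suml; apply: eq_bigr => d _.
  rewrite natr_sum mulr_suml [LHS]big_seq_cond [RHS]big_seq_cond; apply: eq_bigr => P /andP[/monP[_ ->] _].
  rewrite /mult natrM natr_sum -!mulrA mulr_suml; apply: eq_bigr => i _.
  by case: ifP => _; rewrite ?mul1r ?mul0r.
rewrite exchange_big; apply: eq_bigr => d _ /=.
rewrite exchange_big /= [LHS](eq_bigr (fun P => \sum_(i < n) \sum_(f <- mon K n) (if P ^+ i.+1 %| f then d%:R * chi f else 0))); last first.
  by move=> P _; rewrite exchange_big.
rewrite exchange_big /=; apply: eq_bigr => i _.
have Pd P : P \in mon K d -> P ^+ i.+1 \in mon K (d * i.+1).
  move=> Pd; elim: (i.+1) => [|j IH]; first by rewrite muln0 mon0 inE expr0.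
  by rewrite exprS mulnS monM.
rewrite big_seq_cond; case: leqP => din; last first.
  rewrite big1 // => P /andP[/Pd Pm _]; rewrite -big_mkcond.
  exact: (sum_mon_ndvd (fun f => d%:R * chi f) Pm din).
rewrite /euler_factor -mulrA mulr_suml mulr_sumr [RHS]big_seq_cond.
apply: eq_bigr => P /andP[/Pd Pm _]; rewrite -big_mkcond (sum_mon_dvd (fun f => d%:R * chi f) Pm din).
rewrite /lseries !mulr_sumr; apply: eq_bigr => y _.
by rewrite chiM chiX.
Qed.

Lemma psi_series1 : lseries 1 = psi_series 1.
Proof.
have := congr1 (fun f : fps F => f 1%N) lseries_D; rewrite /fps_D mul1r => ->.
rewrite fpsME !big_ord_recl big_ord0 lseries0 mulr1 addr0.
by rewrite [psi_series _]big1 ?mul0r ?add0r // => d _; rewrite big_ord0.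
Qed.

Lemma psi_seriesE n : (0 < n)%N ->
  psi_series n = \sum_(d < n.+1 | (d %| n)%N) euler_factor d (n %/ d).
Proof.
move=> n0; rewrite /psi_series [RHS]big_mkcond; apply: eq_bigr => -[d dn] _ /=.
case: ifP => [dvd|ndvd]; last first.
  by rewrite big_pred0 // => i; apply/negbTE/negP => /eqP dE; rewrite -dE dvdn_mulr in ndvd.
have d0 : (0 < d)%N by move: dvd; case: (d) => //; rewrite dvd0n eqn0Ngt n0.
have ltn : ((n %/ d).-1 < n)%N.
  by rewrite prednK ?divn_gt0 // ?leq_div // dvdn_leq.
rewrite (big_pred1 (Ordinal ltn)) /= => [|i].
  by rewrite prednK // divn_gt0 // dvdn_leq.
have -> : pred1 (Ordinal ltn) i = ((i : nat) == (n %/ d).-1) by [].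
apply/eqP/eqP => [dE|->]; first by have := mulKn i.+1 d0; rewrite dE => ->.
have nd0 : (0 < n %/ d)%N by rewrite divn_gt0 // dvdn_leq.
by rewrite (prednK nd0) mulnC; exact: divnK.
Qed.

End EulerFactors.

Section Newton.
Variable F : fieldType.
Implicit Types (f g : fps F) (s : seq F).

Lemma fps_DM f g : fps_D (f * g) = fps_D f * g + f * fps_D g.
Proof.
apply/funext => n; rewrite fpsDE /fps_D !fpsME mulr_sumr -big_split /=.
apply: eq_bigr => i _; have ni : n = (i + (n - i))%N by rewrite subnKC // -ltnS.
by rewrite {1}ni natrD; ring.
Qed.

Lemma poly_fps_linM (a : F) f n : (poly_fps (1 - a *: 'X) * f) n =
  f n - a * (if n is k.+1 then f k else 0).
Proof.
have -> : poly_fps (1 - a *: 'X) * f = f - poly_fps a%:P * (poly_fps 'X * f).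
  by rewrite rmorphB rmorph1 mulrBl mul1r -mul_polyC rmorphM mulrA.
rewrite fpsDE fpsNE fpsME big_ord_recl /= subn0 fpsXM [poly_fps _ _]coefC eqxx big1 ?addr0 // => i _.
by rewrite [poly_fps _ _]coefC mul0r.
Qed.

(** The series a X / (1 - a X), without constant term: minus the logarithmic derivative of 1 - a
    X. *)
Definition geom (a : F) : fps F := fun n => if n is k.+1 then a ^+ n else 0.

Lemma geomM a : poly_fps (1 - a *: 'X) * geom a = poly_fps (a *: 'X).
Proof.
apply/funext => n; rewrite poly_fps_linM [RHS]coefZ coefX.
case: n => [|[|n]] /=; first by rewrite !mulr0 subr0.
  by rewrite mulr0 subr0 expr1 mulr1.
by rewrite -exprS subrr mulr0.
Qed.

Definition lpoly s := \prod_(a <- s) (1 - a *: 'X).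

Lemma lpoly_cons a s : poly_fps (lpoly (a :: s)) = poly_fps (1 - a *: 'X) * poly_fps (lpoly s).
Proof. by rewrite /lpoly big_cons [LHS]rmorphM. Qed.

Lemma fps_D_lpoly s :
  fps_D (poly_fps (lpoly s)) = - (\sum_(a <- s) geom a) * poly_fps (lpoly s).
Proof.
elim: s => [|a s IH].
  rewrite /lpoly !big_nil oppr0 mul0r; apply/funext => n; rewrite /fps_D [poly_fps _ _]coef1.
  by case: n => [|n]; rewrite ?mul0r ?mulr0.
rewrite lpoly_cons fps_DM IH big_cons opprD mulrDl.
have -> : fps_D (poly_fps (1 - a *: 'X)) = - (poly_fps (1 - a *: 'X) * geom a).
  rewrite geomM; apply/funext => n; rewrite fpsNE /fps_D /poly_fps coefB coef1 coefZ coefX.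
  by case: n => [|[|n]] /=; rewrite ?mulr0 ?mulr1; ring.
by ring.
Qed.

End Newton.

Section LFactorization.
Variables (K : finFieldType) (F : closedFieldType) (chi : {poly K} -> F) (r : nat).
Hypotheses (chi1 : chi 1 = 1) (chiM : forall f g, chi (f * g) = chi f * chi g).
Hypothesis lseries_eq0 : forall k, (r <= k)%N -> lseries chi k = 0.

Lemma lseries_factor : exists2 s : seq F, (size s <= r.-1)%N &
  lseries chi = poly_fps (lpoly s).
Proof.
pose A := \poly_(i < r) lseries chi i.
have LA : lseries chi = poly_fps A.
  apply/funext => n; rewrite /poly_fps coef_poly; case: ltnP => // /lseries_eq0 //.
have A0 : A`_0 = 1 by rewrite -(lseries0 chi1) LA.
have [s sE] := closed_field_poly_normal A.
have Aneq : A != 0 by apply: contra_eq_neq A0 => ->; rewrite coef0 eq_sym oner_neq0.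
have l0 : lead_coef A != 0 by rewrite lead_coef_eq0.
have p0 : lead_coef A * \prod_(z <- s) - z = 1.
  rewrite -[RHS]A0 [in RHS]sE coefZ -horner_coef0 horner_prod; congr (_ * _).
  by apply: eq_bigr => z _; rewrite !hornerE.
exists [seq z^-1 | z <- s].
  rewrite size_map; have := size_poly r (lseries chi); rewrite -/A sE size_scale // size_prod_XsubC; plia.
rewrite LA; congr poly_fps; rewrite /lpoly big_map {1}sE.
transitivity ((lead_coef A * \prod_(z <- s) - z)%:P * \prod_(z <- s) (1 - z^-1 *: 'X)); last by rewrite p0 polyC1 mul1r.
rewrite polyCM -mulrA mul_polyC; congr (_ *: _); rewrite rmorph_prod -big_split /=.
have : all (fun z => z != 0) s.
  have := oner_neq0 F; rewrite -p0 mulf_eq0 negb_or => /andP[_].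
  by rewrite prodf_seq_neq0; apply: sub_all => z /=; rewrite oppr_eq0.
elim: s {sE p0} => [|z s IH] /=; first by rewrite !big_nil.
move=> /andP[z0 s0]; rewrite !big_cons IH //; congr (_ * _).
by rewrite mul_polyC scalerBr scalerA mulNr mulfV // scaleN1r opprK addrC alg_polyC polyCN.
Qed.

Lemma psi_series_roots s n : lseries chi = poly_fps (lpoly s) -> (0 < n)%N ->
  psi_series chi n = - \sum_(a <- s) a ^+ n.
Proof.
move=> Ls n0; have L0 : lseries chi != 0.
  by apply: contra_eq_neq (lseries0 chi1) => ->; rewrite eq_sym oner_neq0.
have := lseries_D chi1 chiM; rewrite Ls fps_D_lpoly -Ls => /(mulIf L0) <-.
rewrite fpsNE fps_sumE; congr (- _); apply: eq_bigr => a _.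
by case: (n) n0.
Qed.

End LFactorization.

Section InverseCoefficients.
Variable R : realType.
Local Notation C := R[i].
Implicit Type s : seq C.

(** Each factor 1/(1 - a X) sums a geometric progression of ratio at most Q/T relative to T^n.
    Giving up Q for a larger T replaces a polynomial factor in n by a constant to the power of the
    number of roots. *)
Lemma inv_lpoly_bound s (M : fps C) (Q T : R) n : 0 <= Q -> Q < T ->
  {in s, forall a, cabs a <= Q} -> M * poly_fps (lpoly s) = 1 ->
  cabs (M n) <= T ^+ n * (1 - Q / T)^-1 ^+ size s.
Proof.
move=> Q0 QT; have T0 : 0 < T by apply: le_lt_trans QT.
have QT1 : 0 < 1 - Q / T by rewrite subr_gt0 ltr_pdivrMr // mul1r.
elim: s M n => [|a s IH] M n sQ Ms.
  move: Ms; rewrite /lpoly big_nil rmorph1 mulr1 => ->; rewrite expr0 mulr1.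
  case: n => [|n]; first by rewrite expr0 cabs1.
  by rewrite [X in cabs X](_ : _ = 0) // cabs0 exprn_ge0 ?ltW.
pose M' := poly_fps (1 - a *: 'X) * M.
have IHM k : cabs (M' k) <= T ^+ k * (1 - Q / T)^-1 ^+ size s.
  apply: IH => [b bs|]; first by apply: sQ; rewrite inE bs orbT.
  by rewrite /M' mulrAC -lpoly_cons mulrC.
have ME k : M k = M' k + a * (if k is j.+1 then M j else 0).
  by rewrite /M' poly_fps_linM subrK.
set B := (1 - Q / T)^-1 ^+ size s in IHM *; rewrite /= exprS -/B.
have B0 : 0 <= B by rewrite exprn_ge0 // invr_ge0 ltW.
have BE : (1 - Q / T)^-1 * B = B + Q / T * ((1 - Q / T)^-1 * B).
  by field; rewrite !gt_eqF //= subr_gt0.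
elim: n => [|n IHn].
  rewrite ME mulr0 addr0 (le_trans (IHM 0%N)) // expr0 !mul1r BE lerDl.
  by rewrite !mulr_ge0 // ?invr_ge0 ltW.
rewrite ME (le_trans (cabsD _ _)) // cabsM BE mulrDr lerD // exprS.
apply: (@le_trans _ _ (Q * (T ^+ n * ((1 - Q / T)^-1 * B)))).
  by rewrite ler_pM ?cabs_ge0 // sQ // mem_head.
by rewrite le_eqVlt; apply/orP; left; apply/eqP; field; rewrite !gt_eqF //= subr_gt0.
Qed.

End InverseCoefficients.

(** * Power sums and the size of their bases *)

Section ExponentialSums.
Variable R : realType.
Local Notation C := R[i].

Lemma bernoulli (h : R) m : 0 <= h -> 1 + h *+ m <= (1 + h) ^+ m.
Proof.
move=> h0; elim: m => [|m IH]; first by rewrite mulr0n addr0.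
rewrite exprS (le_trans _ (ler_wpM2l _ IH)) ?addr_ge0 //.
rewrite mulrDl mul1r mulrDr mulr1 mulrS addrA -addrA [h + h *+ m]addrC addrA.
by rewrite -!addrA lerD2l lerD2l lerDl mulr_ge0 // mulrn_wge0.
Qed.

Lemma geometric_le (x B C0 : R) m0 : 0 < B ->
  (forall m, (m0 <= m)%N -> x ^+ m <= C0 * B ^+ m) -> x <= B.
Proof.
move=> B0 H; rewrite leNgt; apply/negP => Bx.
pose h := x / B - 1; have h0 : 0 < h by rewrite subr_gt0 ltr_pdivlMr // mul1r.
pose m := maxn m0 (Num.truncn (C0 / h)).+1.
have := H m (leq_maxl _ _); rewrite -ler_pdivrMr ?exprn_gt0 // -expr_div_n.
have -> : x / B = 1 + h by rewrite /h addrC subrK.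
apply/negP; rewrite -ltNge; apply: lt_le_trans (bernoulli m (ltW h0)).
apply: (@lt_trans _ _ (h *+ m)); last by rewrite ltrDr.
rewrite -mulr_natr -ltr_pdivrMl // mulrC; apply: lt_le_trans (truncnS_gt _) _.
by rewrite ler_nat leq_maxr.
Qed.

(** A polynomial L vanishing at every base except b0 combines shifts of the sum into a multiple of
    b0^m alone, which inherits the growth B^m. *)
Lemma exp_sum_indep (u : seq C) (c : C -> C) (B C0 : R) m0 : uniq u -> 0 < B ->
  (forall m, (m0 <= m)%N -> cabs (\sum_(b <- u) c b * b ^+ m) <= C0 * B ^+ m) ->
  {in u, forall b, c b != 0 -> cabs b <= B}.
Proof.
move=> uu B0 H b0 b0u cb0.
pose L := \prod_(b <- rem b0 u) ('X - b%:P).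
have Lb0 : L.[b0] != 0.
  rewrite horner_prod prodf_seq_neq0; apply/allP => b.
  rewrite mem_rem_uniq // inE => /andP[bb0 _] /=; rewrite hornerXsubC subr_eq0.
  by rewrite eq_sym.
have Lb b : b \in u -> b != b0 -> L.[b] = 0.
  move=> bu bb0; apply/eqP; rewrite -/(root L b) root_prod_XsubC.
  by rewrite mem_rem_uniq // inE bb0.
have E m : \sum_(i < size L) L`_i * \sum_(b <- u) c b * b ^+ (m + i) = c b0 * L.[b0] * b0 ^+ m.
  transitivity (\sum_(b <- u) c b * b ^+ m * L.[b]).
    under eq_bigr do rewrite mulr_sumr.
    rewrite exchange_big /=; apply: eq_bigr => b _; rewrite horner_coef mulr_sumr.
    by apply: eq_bigr => i _; rewrite exprD; ring.
  rewrite (big_rem b0) //= big_seq big1 ?addr0; first by ring.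
  move=> b; rewrite mem_rem_uniq // inE => /andP[bb0 bu].
  by rewrite Lb // mulr0.
have D0 : 0 < cabs (c b0 * L.[b0]).
  by rewrite lt_def cabs_ge0 cabs_eq0 mulf_neq0.
pose C1 := (\sum_(i < size L) cabs L`_i * (C0 * B ^+ i)) / cabs (c b0 * L.[b0]).
apply: (@geometric_le _ _ C1 m0) => // m mm.
rewrite /C1 mulrAC ler_pdivlMr // mulrC -cabsX -cabsM -E.
apply: le_trans (cabs_sum _ _ _) _; rewrite mulr_suml; apply: ler_sum => i _.
rewrite cabsM -mulrA; apply: ler_wpM2l; first exact: cabs_ge0.
by rewrite -mulrA -exprD addnC; apply: H; rewrite (leq_trans mm) // leq_addl.
Qed.

Lemma sum_count (u l : seq C) (f : C -> C) : uniq u -> {subset l <= u} ->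
  \sum_(x <- l) f x = \sum_(b <- u) (count_mem b l)%:R * f b.
Proof.
move=> uu; elim: l => [|x l IH] lu; first by rewrite big_nil big1 // => b _; rewrite mul0r.
rewrite big_cons IH => [|y yl]; last by apply: lu; rewrite inE yl orbT.
rewrite [RHS](eq_bigr (fun b => (x == b)%:R * f b + (count_mem b l)%:R * f b)); last first.
  by move=> b _; rewrite /= natrD mulrDl.
rewrite big_split /=; congr (_ + _).
rewrite (big_rem x) ?lu ?mem_head //= eqxx mul1r big_seq big1 ?addr0 // => b.
by rewrite mem_rem_uniq // inE eq_sym => /andP[/negPf-> _]; rewrite mul0r.
Qed.

(* The even power sums of the inverse roots of an L-function determine the
   size of the roots. *)
Lemma root_bound (s : seq C) (q : nat) (t : C) (C0 : R) m0 : (1 < q)%N ->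
  (forall N, (0 < N)%N -> t != - N%:R) ->
  (forall m, (m0 <= m)%N ->
     cabs (\sum_(a <- s) a ^+ (m * 2) + t * (q ^ (m * 2))%:R) <= C0 * (q ^ m)%:R) ->
  {in s, forall a, cabs a <= Num.sqrt q%:R}.
Proof.
move=> q1 tN H; pose l := [seq a ^+ 2 | a <- s]; pose Q : C := (q ^ 2)%:R.
pose u := undup (Q :: l); pose c b : C := (count_mem b l)%:R + t * (b == Q)%:R.
have q0 : 0 < q%:R :> R by rewrite ltr0n ltnW.
have lu : {subset l <= u} by move=> x xl; rewrite mem_undup inE xl orbT.
have Qu : Q \in u by rewrite mem_undup mem_head.
have cu : {in u, forall b, c b != 0 -> cabs b <= q%:R}.
  apply: (@exp_sum_indep _ _ _ C0 m0); rewrite ?undup_uniq // => m mm.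
  rewrite -natrX; apply: le_trans (H m mm); rewrite le_eqVlt; apply/orP; left; apply/eqP.
  congr cabs; rewrite [LHS](eq_bigr (fun b => (count_mem b l)%:R * b ^+ m + t * ((b == Q)%:R * b ^+ m))); last first.
    by move=> b _; rewrite /c; ring.
  rewrite big_split /= -(sum_count (fun b => b ^+ m)) ?undup_uniq // big_map -mulr_sumr.
  congr (_ + t * _); first by apply: eq_bigr => a _; rewrite -exprM mulnC.
  rewrite (big_rem Q) //= eqxx mul1r big_seq big1 ?addr0; last first.
    by move=> b; rewrite mem_rem_uniq ?undup_uniq // inE => /andP[/negPf-> _]; rewrite mul0r.
  by rewrite /Q -natrX -expnM mulnC.
(* The base q^2 exceeds the bound q, so its total coefficient vanishes: t is minus the multiplicity
   of q^2 among the a^2, and [tN] forces that multiplicity to be 0. *)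
have cQ : c Q = 0.
  apply/eqP; apply: contrapT => /negP /(cu _ Qu); rewrite cabs_nat ler_nat.
  by rewrite leqNgt expnS expn1 ltn_Pmull // ltnW.
have l0 : count_mem Q l = 0%N.
  apply/eqP; rewrite -leqn0 leqNgt; apply/negP => lp; have /eqP := tN _ lp; apply.
  by move: cQ; rewrite /c eqxx mulr1 addrC => /eqP; rewrite addr_eq0 => /eqP.
move=> a sa; have al : a ^+ 2 \in l by apply/mapP; exists a.
have aQ : a ^+ 2 != Q by apply: contra_eq_neq l0 => <-; rewrite -lt0n -has_count has_pred1.
have : c (a ^+ 2) != 0.
  by rewrite /c (negPf aQ) mulr0 addr0 pnatr_eq0 -lt0n -has_count has_pred1.
move=> /(cu _ (lu _ al)); rewrite cabsX => h.
by rewrite -(@ler_pXn2r _ 2) ?nnegrE ?cabs_ge0 ?sqrtr_ge0 // sqr_sqrtr // ltW.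
Qed.

End ExponentialSums.

(** * Counting primes of given degree *)

Section PrimeCounts.
Variables (K : finFieldType) (R : realType).
Local Notation q := #|K|.

Let q_gt1 : (1 < q)%N. Proof. exact: finRing_gt1. Qed.

Lemma psi_series_triv : psi_series (fun _ : {poly K} => 1 : R) = geom q%:R.
Proof.
set chi := fun _ => _.
have chi1 : chi 1 = 1 by []. 
have chiM f g : chi (f * g) = chi f * chi g by rewrite mulr1.
have Lq : poly_fps (1 - q%:R *: 'X) * lseries chi = 1.
  apply/funext => n; rewrite poly_fps_linM /lseries /chi.
  have H k : \sum_(f <- mon K k) (1 : R) = q%:R ^+ k.
    by rewrite big_const_seq count_predT iter_addr addr0 size_mon natrX.
  by case: n => [|n]; rewrite !H ?mulr0 ?subr0 // exprS subrr.
have := congr1 (@fps_D R) Lq; rewrite fps_DM lseries_D //.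
have -> : fps_D (1 : fps R) = 0.
  by apply/funext => -[|n]; rewrite /fps_D ?mul0r // [(1 : fps R) _](_ : _ = 0) // mulr0.
have := fps_D_lpoly [:: q%:R : R]; rewrite /lpoly !big_seq1 => ->.
set A := poly_fps _ in Lq *; set G := geom _; set L := lseries _ in Lq *; set P := psi_series _.
move=> h; have : (P - G) * (A * L) = 0 by rewrite -h; ring.
by rewrite Lq mulr1 => /eqP; rewrite subr_eq0 => /eqP.
Qed.

Definition prime_count d : nat := count (@mprime K) (mon K d).

Lemma sum_prime_count n : (0 < n)%N ->
  (\sum_(d < n.+1 | (d %| n)%N) d * prime_count d = q ^ n)%N.
Proof.
move=> n0; apply/eqP; rewrite -(eqr_nat R); apply/eqP.
have := congr1 (fun f : fps R => f n) psi_series_triv; rewrite psi_seriesE // natr_sum.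
have -> : geom (q%:R : R) n = (q ^ n)%:R by rewrite natrX; case: (n) n0.
move=> <-; apply: eq_bigr => d _; rewrite natrM /euler_factor; congr (_ * _).
under eq_bigr do rewrite expr1n.
by rewrite /prime_count -sum1_count natr_sum.
Qed.

Lemma prime_count_le n : (n * prime_count n <= q ^ n)%N.
Proof.
case: n => [//|n]; rewrite -(sum_prime_count (ltn0Sn n)).
by rewrite (bigD1 ord_max) //= leq_addr.
Qed.

Lemma sum_expn_le s : (\sum_(d < s.+1) q ^ d <= 2 * q ^ s)%N.
Proof.
elim: s => [|s IH]; first by rewrite big_ord1.
rewrite big_ord_recr /= (leq_trans (leq_add IH (leqnn _))) // expnS [X in (_ <= X)%N]mul2n -addnn.
by rewrite leq_add2r leq_mul2r q_gt1 orbT.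
Qed.

(** A proper divisor of 2 s is at most s. *)
Lemma sum_small_divisors s : (0 < s)%N ->
  (\sum_(d < s * 2 | d %| s * 2) d * prime_count d <= 2 * q ^ s)%N.
Proof.
move=> s0; apply: leq_trans (sum_expn_le s).
have ss : (s.+1 <= s * 2)%N by lia.
rewrite (big_ord_widen _ (fun d => q ^ d)%N ss) [X in (X <= _)%N]big_mkcond [X in (_ <= X)%N]big_mkcond.
apply: leq_sum => -[d dn] _ /=; case: ifP => // /dvdnP[k dk].
have -> : (d < s.+1)%N by move: dn dk; case: k => [|[|k]]; nia.
exact: prime_count_le.
Qed.

End PrimeCounts.

(** Used with x = q^n, y = q^(n/2) and a equal to k times the weighted count of one class: the upper
    bounds on the other k - 1 classes become a lower bound on this one. *)
Lemma class_count_arith k x a c y : (0 < k)%N ->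
  (k * x <= a + (k - 1) * (x + c * y) + k * (2 * y))%N -> (x <= a + (2 * k + k * c) * y)%N.
Proof.
case: k => // k _; rewrite subn1 /=.
have -> : (k.+1 * x = k * x + x)%N by ring.
have -> : (k * (x + c * y) = k * x + k * c * y)%N by ring.
have -> : ((2 * k.+1 + k.+1 * c) * y = k.+1 * (2 * y) + k * c * y + c * y)%N by ring.
by move: (k * x)%N (k * c * y)%N (k.+1 * (2 * y))%N (c * y)%N; lia.
Qed.

(** * The Riemann hypothesis for even characters *)
Section EvenCharacter.
Variables (R : realType) (K : finFieldType) (E : {poly K}).
Local Notation C := R[i].
Local Notation q := #|K|.
Hypothesis E1 : (1 < size E)%N.
Let r := (size E).-1.
Variable chi : {poly K} -> C.
Hypotheses (chi1 : chi 1 = 1) (chiM : forall f g, chi (f * g) = chi f * chi g)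
  (chiE : forall f g, E %| f - g -> chi f = chi g)
  (chiZ : forall (c : K) f, c != 0 -> chi (c *: f) = chi f)
  (chi_le1 : forall f, cabs (chi f) <= 1)
  (chi_nontriv : exists2 u, coprimep u E & chi u != 1).

Let q_gt1 : (1 < q)%N. Proof. exact: finRing_gt1. Qed.
Let E0 : E != 0. Proof. by rewrite -size_poly_gt0 ltnW. Qed.
Let sE : size E = r.+1. Proof. by rewrite prednK // ltnW. Qed.

Lemma lseries_large k : (r <= k)%N -> lseries chi k = 0.
Proof.
move=> rk; rewrite /lseries -(subnKC rk).
rewrite (eq_bigr (fun x => chi (x %% E))); last first.
  by move=> x _; apply: chiE; rewrite {1}(divp_eq x E) addrK dvdp_mull.
rewrite (sum_mon_mod _ _ sE); set S := \sum_v _; suff -> : S = 0 by rewrite mul0rn.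
have [u uE u1] := chi_nontriv.
have su (v : {poly_r K}) : (u * v) %% E \is a poly_of_size r.
  by rewrite qualifE /= -ltnS -sE ltn_modp.
pose h v : {poly_r K} := NPoly (su v).
have hinj : injective h.
  move=> v w /(congr1 val) /= /eqP; rewrite -subr_eq0 -modpN -modpD -mulrBr => uvw.
  have : E %| (v : {poly K}) - w by move/eqP/modp_eq0P: uvw; rewrite Gauss_dvdpr // coprimep_sym.
  move=> Evw; apply: val_inj => /=; apply/eqP; rewrite -subr_eq0.
  apply: contraT => vw0; have := dvdp_leq vw0 Evw; rewrite sE leqNgt ltnS.
  by rewrite (leq_trans (size_polyD _ _)) // size_polyN geq_max !size_npoly.
have : chi u * S = S.
  rewrite {2}/S (reindex_inj hinj) mulr_sumr; apply: eq_bigr => v _.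
  by rewrite -chiM; apply: chiE; rewrite /= {1}(divp_eq (u * v) E) addrK dvdp_mull.
move=> /eqP; rewrite -subr_eq0 -{2}(mul1r S) -mulrBl mulf_eq0 subr_eq0 (negPf u1).
by move=> /eqP.
Qed.

Lemma sum_irr_class (V : nmodType) n (h : {poly K} -> V) : (1 < n)%N ->
  (forall (c : {poly_r K}) (f : {poly_n.+1 K}), f \in irr_class n c -> h f = h c) ->
  \sum_(P <- mon K n | mprime P) h P = \sum_(c : {poly_r K}) h c *+ #|irr_class (E := E) n c|.
Proof.
move=> n1 hh.
rewrite [RHS](eq_bigr (fun c : {poly_r K} => \sum_(f in irr_class (E := E) n c) h f)); last first.
  move=> c _; rewrite -sumr_const; apply: eq_bigr => f fc; exact/esym/hh.
rewrite (exchange_big_dep predT) //= /mon big_map big_filter_cond big_enum_cond /=.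
rewrite big_mkcond; apply: eq_bigr => f _ /=.
case: ifP => [/andP[/andP[mf /eqP sf]] /andP[_ jf]|nf]; last first.
  rewrite big_pred0 // => c; apply: contraFF nf; rewrite inE => /and5P[mf jf sf _ _].
  by rewrite mf sf /mprime mf jf.
(* The only monic prime with f(0) = 0 is T, which n > 1 excludes. *)
have f0 : (f : {poly K})`_0 != 0.
  apply/negP => /eqP f0; have Xf : 'X %| (f : {poly K}).
    by rewrite -['X]subr0 -polyC0 dvdp_XsubCl rootE horner_coef0 f0.
  have [_ /(_ 'X)] := irreducibleP _ jf; rewrite size_polyX => /(_ isT Xf) /eqp_size.
  by rewrite size_polyX sf => -[n1']; rewrite -n1' in n1.
have sc : ((f`_0)^-1 *: (f : {poly K})) %% E \is a poly_of_size r.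
  by rewrite qualifE /= -ltnS -sE ltn_modp.
rewrite (big_pred1 (NPoly sc)) // => c; rewrite inE mf jf sf eqxx f0 /=.
apply/idP/eqP => [Ec|->]; last by rewrite /= {1}(divp_eq (_ *: _) E) addrK dvdp_mull.
apply: val_inj => /=; rewrite -[LHS](modp_small (_ : (size (c : {poly K}) < size E)%N)); last first.
  by rewrite sE ltnS size_npoly.
by apply/eqP; rewrite eq_sym -subr_eq0 -modpN -modpD; apply/eqP/modp_eq0P.
Qed.

Lemma psi_series_prime s : (0 < s)%N ->
  cabs (psi_series chi (s * 2) - (s * 2)%:R * \sum_(P <- mon K (s * 2) | mprime P) chi P)
  <= 2 * (q ^ s)%:R.
Proof.
move=> s0; rewrite psi_seriesE ?muln_gt0 ?s0 // big_mkcond big_ord_recr /= dvdnn.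
rewrite divnn muln_gt0 s0 /euler_factor.
under [\sum_(P <- mon K (s * 2) | _) _]eq_bigr do rewrite expr1.
rewrite addrK -big_mkcond; apply: le_trans (cabs_sum _ _ _) _.
rewrite -natrM; apply: le_trans (_ : (\sum_(d < s * 2 | (d %| s * 2)%N) d * prime_count K d)%:R <= _); last first.
  by rewrite ler_nat sum_small_divisors.
rewrite natr_sum; apply: ler_sum => d _; rewrite cabsM cabs_nat natrM ler_wpM2l //.
apply: le_trans (cabs_sum _ _ _) _; rewrite -[X in _ <= X]mulr1.
by apply: sumr_const_le => P _; rewrite cabsX exprn_ile1 // cabs_ge0.
Qed.

(** Every class in [H] receives q^n/k up to O(q^(n/2)), weighted by n, so t is the sum of chi over
    [H] divided by k. *)
Lemma psi_series_asymp : exists2 t : C, (forall N, (0 < N)%N -> t != - N%:R) &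
  exists C0 s0, forall s, (s0 <= s)%N ->
   cabs (psi_series chi (s * 2) - t * (q ^ (s * 2))%:R) <= C0 * (q ^ s)%:R.
Proof.
have [k [H [k0 Hk [c1 c1H c1E] [C1 [s0 HS]]]]] := stepanov_bound E1.
pose t : C := (\sum_(c in H) chi c) / k%:R.
have kC : k%:R != 0 :> C by rewrite pnatr_eq0 -lt0n.
exists t.
  (* The sum over [H] contains chi(1) = 1 and at most k - 1 further terms of modulus at most 1, so
     it cannot equal -N k. *)
  move=> N N0; apply/eqP => tN.
  have : \sum_(c in H) chi (c : {poly_r K}) = - (N * k)%:R.
    by rewrite -[LHS](divfK kC) -/t tN natrM mulNr.
  rewrite (bigD1 c1) //= c1E chi1 => eS.
  have {}eS : \sum_(c in H | c != c1) chi (c : {poly_r K}) = - (N * k).+1%:R.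
    by apply: (addrI 1); rewrite eS -natr1 opprD; ring.
  have : cabs (\sum_(c in H | c != c1) chi (c : {poly_r K})) <= #|H :\ c1|%:R.
    apply: le_trans (cabs_sum _ _ _) _; rewrite -sum1_card natr_sum.
    rewrite [X in _ <= X](eq_bigl (fun c => (c \in H) && (c != c1))); last first.
      by move=> c; rewrite !inE andbC.
    by apply: ler_sum => c _; exact: chi_le1.
  rewrite eS cabsN cabs_nat ler_nat => h.
  have := cardsD1 c1 H; rewrite c1H => cH; move: h Hk; rewrite cH.
  by move: #|_ :\ _| => x; case: (N) N0 => // N' _; rewrite mulSn; lia.
pose D := (2 * k + k * C1)%N; exists (D + 2)%:R, s0.+1 => s ss.
have s0' : (0 < s)%N by apply: leq_trans ss.
have {}HS := HS s (ltnW ss).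
pose n := (s * 2)%N; have n1 : (1 < n)%N by rewrite /n; lia.
pose A (c : {poly_r K}) := (n * #|irr_class (E := E) n c|)%N.
have tot : (\sum_c A c = n * prime_count K n)%N.
  rewrite -big_distrr /=; congr muln; rewrite /prime_count -sum1_count.
  rewrite (@sum_irr_class nat n (fun=> 1%N)) //; apply: eq_bigr => c _.
  exact/esym/natn.
have lo : (q ^ n <= \sum_c A c + 2 * q ^ s)%N.
  rewrite tot -(sum_prime_count K R (ltnW n1)) big_mkcond big_ord_recr /= dvdnn -big_mkcond addnC leq_add2l.
  exact: sum_small_divisors.
have AH : (\sum_c A c = \sum_(c in H) A c)%N.
  rewrite [RHS]big_mkcond; apply: eq_bigr => c _; case: ifPn => // /(proj2 (HS c)).
  by rewrite /A => ->; rewrite muln0.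
have up c : (k * A c <= q ^ n + C1 * q ^ s)%N := proj1 (HS c).
(* The upper half is Stepanov's bound; for the lower half, the other classes of [H] together take at
   most (k - 1)/k of the total, up to O(q^s). *)
have dist c : c \in H -> `|(k * A c)%:R - (q ^ n)%:R| <= (D * q ^ s)%:R :> R.
  move=> cH.
  have h : (k * q ^ n <= k * A c + (k - 1) * (q ^ n + C1 * q ^ s) + k * (2 * q ^ s))%N.
    apply: leq_trans (leq_mul (leqnn k) lo) _; rewrite mulnDr leq_add2r AH (bigD1 c) //= mulnDr leq_add2l.
    rewrite big_distrr /=; apply: leq_trans (_ : #|H :\ c| * (q ^ n + C1 * q ^ s) <= _)%N.
      rewrite -sum_nat_const [X in (_ <= X)%N](eq_bigl (fun c' => (c' \in H) && (c' != c))); last first.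
        by move=> c'; rewrite !inE andbC.
      by apply: leq_sum => c' _; exact: up.
    rewrite leq_mul2r; apply/orP; right; have := cardsD1 c H; rewrite cH; move: Hk; move: #|_| #|_|; lia.
  rewrite ler_norml; apply/andP; split; last first.
    rewrite lerBlDr -natrD ler_nat; apply: leq_trans (up c) _; rewrite addnC leq_add2r leq_mul2r.
    by apply/orP; right; rewrite (leq_trans (leq_pmull C1 k0)) // leq_addl.
  by rewrite lerNl opprB lerBlDr -natrD ler_nat addnC; exact: class_count_arith k0 h.
pose X := n%:R * \sum_(P <- mon K n | mprime P) chi P.
have -> : psi_series chi (s * 2) - t * (q ^ (s * 2))%:R =
  (psi_series chi (s * 2) - X) + (X - t * (q ^ n)%:R) by ring.
apply: le_trans (cabsD _ _) _; rewrite addnC natrD mulrDl lerD //; first exact: psi_series_prime.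
rewrite /X.
rewrite (@sum_irr_class _ n chi) //; last first.
  move=> c f; rewrite inE => /and5P[_ _ _ f0 /chiE <-]; by rewrite chiZ ?invr_eq0.
have -> : n%:R * (\sum_(c : {poly_r K}) chi c *+ #|irr_class (E := E) n c|) = \sum_(c in H) chi c * (A c)%:R.
  rewrite mulr_sumr [RHS]big_mkcond; apply: eq_bigr => c _; case: ifPn => [_|/(proj2 (HS c)) ->].
    by rewrite /A natrM -mulr_natr; ring.
  by rewrite mulr0n mulr0.
have kR : 0 < k%:R :> R by rewrite ltr0n.
rewrite -(ler_pM2l kR) -{1}(cabs_nat R k) -cabsM.
have -> : k%:R * (\sum_(c in H) chi (c : {poly K}) * (A c)%:R - t * (q ^ n)%:R) =
    \sum_(c in H) (k%:R * (chi (c : {poly K}) * (A c)%:R) - chi (c : {poly K}) * (q ^ n)%:R).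
  by rewrite mulrBr mulrA [k%:R * t]mulrC divfK // mulr_sumr mulr_suml sumrB.
apply: le_trans (cabs_sum _ _ _) _.
apply: le_trans (_ : \sum_(c in H) (D * q ^ s)%:R <= _).
  apply: ler_sum => c cH; rewrite mulrCA -mulrBr cabsM -[X in _ <= X]mul1r.
  rewrite ler_pM ?cabs_ge0 // -natrM -[(_)%:R - _](_ : ((k * A c)%:R - (q ^ n)%:R)%:C = _); last first.
    by rewrite rmorphB !rmorph_nat.
  by rewrite cabs_real; exact: dist.
by rewrite sumr_const natrM -[X in X <= _]mulr_natl ler_wpM2r ?mulr_ge0 // ler_nat.
Qed.

Lemma chi_roots : exists2 s : seq C, (size s <= r.-1)%N &
  lseries chi = poly_fps (lpoly s) /\ {in s, forall a, cabs a <= Num.sqrt q%:R}.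
Proof.
have [s ss Ls] := lseries_factor chi1 lseries_large; exists s => //; split => //.
have [t tN [C0 [s0 Hs]]] := psi_series_asymp.
apply: (@root_bound _ _ q t C0 s0.+1) => // m sm.
have := Hs m (ltnW sm); rewrite (psi_series_roots chi1 chiM Ls) ?muln_gt0 ?(leq_trans _ sm) //.
by rewrite -opprD cabsN.
Qed.

(** The coefficient of degree 1 is minus the sum of the inverse roots. This form is what yields
    Kloosterman sums. *)
Lemma cabs_sum_chi_deg1 : cabs (\sum_(f <- mon K 1) chi f) <= r%:R * Num.sqrt q%:R.
Proof.
have [s ss [Ls sb]] := chi_roots; rewrite -[X in cabs X]/(lseries chi 1).
rewrite psi_series1 // (psi_series_roots chi1 chiM Ls) // cabsN.
apply: le_trans (cabs_sum _ _ _) _; rewrite big_seq.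
have h a : a \in s -> cabs (a ^+ 1) <= Num.sqrt q%:R by rewrite expr1; exact: sb.
apply: (@le_trans _ _ ((count (mem s) s)%:R * Num.sqrt q%:R)); first exact: sumr_const_le.
by rewrite ler_wpM2r ?sqrtr_ge0 // ler_nat (leq_trans (count_size _ _)) // (leq_trans ss) // leq_pred.
Qed.

Lemma cabs_sum_mobius_chi (T : R) n : Num.sqrt q%:R < T ->
  cabs (\sum_(f <- mon K n) (mobius f)%:~R * chi f) <= T ^+ n * (1 - Num.sqrt q%:R / T)^-1 ^+ r.
Proof.
move=> qT; have [s ss [Ls sb]] := chi_roots; rewrite -[X in cabs X]/(mu_series chi n).
have T0 : 0 < T by apply: le_lt_trans qT; apply: sqrtr_ge0.
have Ms : mu_series chi * poly_fps (lpoly s) = 1 by rewrite -Ls mu_seriesM.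
apply: le_trans (inv_lpoly_bound n (sqrtr_ge0 _) qT sb Ms) _.
have QT1 : 0 < 1 - Num.sqrt q%:R / T by rewrite subr_gt0 ltr_pdivrMr // mul1r.
apply: ler_wpM2l; first by rewrite exprn_ge0 // ltW.
apply: ler_weXn2l; last by rewrite (leq_trans ss) ?leq_pred.
by rewrite invr_ge1 ?unitfE ?gt_eqF // gerBl divr_ge0 ?sqrtr_ge0 // ltW.
Qed.

End EvenCharacter.

Section Conjugation.
Variables (C : numClosedFieldType) (n : nat).
Implicit Types (A B D W : 'M[C]_n).

Lemma conj_mulmx W A B : W \in unitmx ->
  W *m (A *m B) *m invmx W = (W *m A *m invmx W) *m (W *m B *m invmx W).
Proof. by move=> WU; rewrite !mulmxA -[_ *m invmx W *m W]mulmxA mulVmx // mulmx1. Qed.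

Lemma conj_mxK W A D : W \in unitmx -> W *m A *m invmx W = D -> A = invmx W *m D *m W.
Proof. by move=> WU <-; rewrite !mulmxA mulVmx // mul1mx -mulmxA mulVmx // mulmx1. Qed.

Lemma conj_mxKV W A D : W \in unitmx -> A = invmx W *m D *m W -> W *m A *m invmx W = D.
Proof. by move=> WU ->; rewrite !mulmxA mulmxV // mul1mx -mulmxA mulmxV // mulmx1. Qed.

Lemma adj_conj_mx W A : W \is unitarymx ->
  map_mx Num.conj (W *m A *m invmx W)^T = W *m map_mx Num.conj A^T *m invmx W.
Proof.
by move=> uW; rewrite invmx_unitary // trmx_mul map_mxM trmx_mul map_mxM trmxCK mulmxA.
Qed.

End Conjugation.

(** * Fourier analysis on the residues modulo F *)
Section Fourier.
Variables (R : realType) (K : finFieldType) (F : {poly K}).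
Local Notation C := R[i].
Local Notation q := #|K|.
Hypothesis F1 : (1 < size F)%N.
Let r := (size F).-1.
Let F0 : F != 0. Proof. by rewrite -size_poly_gt0 ltnW. Qed.
Let sF : size F = r.+1. Proof. by rewrite prednK // ltnW. Qed.
Local Notation I := {poly_r K}.
Implicit Types x y u v : {poly K}.

Fact residue_size x : x %% F \is a poly_of_size r.
Proof. by rewrite qualifE /= -ltnS -sF ltn_modp. Qed.
Definition residue x : I := NPoly (residue_size x).

Lemma residueE x : residue x = x %% F :> {poly K}. Proof. by []. Qed.

Lemma eq_residue x y : (residue x == residue y) = (F %| x - y).
Proof.
rewrite -val_eqE /= -subr_eq0 -modpN -modpD.
by apply/eqP/idP => [/modp_eq0P|/modp_eq0P].
Qed.

Lemma dvd_residue x : F %| (residue x : {poly K}) - x.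
Proof. by rewrite residueE -opprB {1}(divp_eq x F) addrK dvdpNr dvdp_mull. Qed.

Lemma residueK (v : I) : residue v = v.
Proof. by apply: val_inj; rewrite /= modp_small // sF ltnS size_npoly. Qed.

Lemma coprimep_residue x : coprimep (residue x) F = coprimep x F.
Proof. by rewrite residueE coprimep_modl. Qed.

Local Notation N := #|{: I}|.
Definition mul_mx x : 'M[C]_N :=
  \matrix_(i, j) (enum_val j == residue (x * (enum_val i : I)))%:R.

Lemma mul_mxE x (f : I -> C) i :
  \sum_j mul_mx x i j * f (enum_val j) = f (residue (x * (enum_val i : I))).
Proof.
rewrite (bigD1 (enum_rank (residue (x * (enum_val i : I))))) //= !mxE enum_rankK eqxx mul1r.
rewrite big1 ?addr0 // => j ji; rewrite mxE (_ : (_ == _) = false) ?mul0r //.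
by apply: contra_neqF ji => /eqP <-; rewrite enum_valK.
Qed.

Lemma mul_mxM x y : mul_mx x *m mul_mx y = mul_mx (x * y).
Proof.
apply/matrixP => i j; rewrite mxE.
pose f (v : I) : C := (enum_val j == residue (y * (v : {poly K})))%:R.
transitivity (\sum_k mul_mx x i k * f (enum_val k)).
  by apply: eq_bigr => k _; congr (_ * _); rewrite mxE.
rewrite mul_mxE mxE; congr (_ == _)%:R.
apply/eqP; rewrite eq_residue; set e := enum_val i : {poly K}.
have -> : y * residue (x * e) - x * y * e = y * ((residue (x * e) : {poly K}) - x * e) by ring.
by rewrite dvdp_mull // dvd_residue.
Qed.

Lemma mul_mx1 : mul_mx 1 = 1%:M.
Proof.
apply/matrixP => i j; rewrite !mxE mul1r residueK eq_sym; congr (_%:R).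
by rewrite (inj_eq enum_val_inj).
Qed.

Lemma mul_mx_residue x y : F %| x - y -> mul_mx x = mul_mx y.
Proof.
move=> xy; apply/matrixP => i j; rewrite !mxE; congr (_ == _)%:R.
by apply/eqP; rewrite eq_residue -mulrBl dvdp_mulr.
Qed.

(** A unit permutes the residues, so its matrix is a permutation matrix. *)
Lemma mul_mx_adj x y : F %| x * y - 1 -> map_mx Num.conj (mul_mx x)^T = mul_mx y.
Proof.
move=> xy1; apply/matrixP => i j; rewrite !mxE rmorph_nat; congr (_%:R : C).
rewrite -[enum_val i in LHS]residueK -[enum_val j in RHS]residueK !eq_residue.
have e (a b : {poly K}) : F %| a - x * b -> F %| b - y * a.
  move=> ab; have -> : b - y * a = - (y * (a - x * b)) - (x * y - 1) * b by ring.
  by apply: dvdp_sub; rewrite ?dvdpNr; [exact: dvdp_mull|exact: dvdp_mulr].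
have e' (a b : {poly K}) : F %| b - y * a -> F %| a - x * b.
  move=> ab; have -> : a - x * b = - (x * (b - y * a)) - (x * y - 1) * a by ring.
  by apply: dvdp_sub; rewrite ?dvdpNr; [exact: dvdp_mull|exact: dvdp_mulr].
by congr nat_of_bool; apply/idP/idP => [/e|/e'].
Qed.

(* A unitary basis in which all the multiplications by residues are triangular;
   the multiplications by units are then diagonal. *)
Lemma exists_mul_mx_basis : exists2 W : 'M[C]_N, W \in unitmx &
  [/\ forall i j, cabs (W i j) <= 1, forall i j, cabs (invmx W i j) <= 1 &
   exists D : {poly K} -> 'rV[C]_N, forall x, coprimep x F ->
     mul_mx x = invmx W *m diag_mx (D x) *m W /\ forall i, cabs (D x 0 i) = 1].
Proof.
have [|W uW /allP /= trigW] := @cotrigonalization C N [seq mul_mx (val v) | v : I <- enum {: I}].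
  move=> _ _ /mapP[u _ ->] /mapP[v _ ->].
  by rewrite /comm_mx !mul_mxM mulrC.
have WV := invmx_unitary uW; have WU := unitarymx_unit uW.
have trig x : is_trig_mx (W *m mul_mx x *m invmx W).
  rewrite -conjumx // (mul_mx_residue (y := residue x)); last by rewrite -opprB dvdpNr dvd_residue.
  by apply: trigW; apply/mapP; exists (residue x); rewrite // mem_enum.
have row1 i : \sum_j W i j * Num.conj (W i j) = 1.
  have /unitarymxP/matrixP/(_ i i) := uW; rewrite !mxE eqxx => h; apply: (etrans _ h).
  by apply: eq_bigr => j _; rewrite !mxE.
have Wle i j : cabs (W i j) <= 1.
  have : (cabs (W i j) ^+ 2)%:C <= (1 : C).
    rewrite -(row1 i) (bigD1 j) //= sqr_cabs lerDl sumr_ge0 // => k _.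
    exact: mul_conjC_ge0.
  by rewrite lecR expr_le1 // cabs_ge0.
exists W => //; split => // [i j|].
  by rewrite WV !mxE cabs_conj.
pose D x : 'rV[C]_N := \row_i (W *m mul_mx x *m invmx W) i i.
exists D => x xF.
have [y xy] : exists y, F %| x * y - 1 by exists (inv_mod F x); exact: inv_modP.
(* The conjugated matrix and its adjoint, which belongs to the inverse [y], are both triangular. *)
have dg : W *m mul_mx x *m invmx W = diag_mx (D x).
  apply/matrixP => i j; rewrite [RHS]mxE; case: (ltngtP i j) => ij.
  - by have /is_trig_mxP -> := trig x; rewrite // [_ == _](_ : _ = false) // -val_eqE ltn_eqF.
  - have -> : (i == j) = false by rewrite -val_eqE gtn_eqF.
    have := trig y => /is_trig_mxP/(_ j i ij); rewrite -(mul_mx_adj xy) -adj_conj_mx //.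
    by rewrite mxE [(_^T) _ _]mxE => /eqP; rewrite conjC_eq0 mulr0n => /eqP.
  - by move/val_inj: ij => <-; rewrite eqxx mulr1n [in RHS]mxE.
split; first exact: conj_mxK dg.
move: (D x) dg => d dg i.
have : diag_mx d *m map_mx Num.conj (diag_mx d)^T = 1%:M.
  rewrite -dg adj_conj_mx // (mul_mx_adj xy) -conj_mulmx // mul_mxM (mul_mx_residue xy).
  by rewrite mul_mx1 mulmx1 mulmxV.
move=> /matrixP/(_ i i); rewrite !mxE (bigD1 i) //= !mxE !eqxx mulr1n big1 => [|j ji]; last first.
  by rewrite !mxE [i == j]eq_sym (negPf ji) mul0r.
rewrite addr0 => h; have /eqP : (cabs (d 0 i) ^+ 2)%:C = 1 by rewrite sqr_cabs.
by rewrite -[X in _ == X]/((1 : R)%:C) (inj_eq (@complexI R)) sqrp_eq1 ?cabs_ge0 // => /eqP.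
Qed.

Definition even_char (chi : {poly K} -> C) : Prop :=
  [/\ chi 1 = 1, forall x y, chi (x * y) = chi x * chi y,
      forall x y, F %| x - y -> chi x = chi y,
      forall (c : K) x, c != 0 -> chi (c *: x) = chi x &
      (forall x, ~~ coprimep x F -> chi x = 0) /\ (forall x, cabs (chi x) <= 1)].

(** g(x) is the entry at the residue 1 of [mul_mx x] applied to the vector of values of g;
    diagonalisation writes it as a sum of characters. Constants fix that vector, so every component
    present in it carries an even character. *)
Lemma fourier (g : {poly K} -> C) :
  (forall x y, F %| x - y -> g x = g y) ->
  (forall (c : K) x, c != 0 -> g (c *: x) = g x) ->
  (forall x, cabs (g x) <= 1) ->
  exists (w : 'I_N -> C) (chi : 'I_N -> {poly K} -> C),
   [/\ forall i, cabs (w i) <= N%:R, forall i, w i != 0 -> even_char (chi i) &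
       forall x, coprimep x F -> g x = \sum_i w i * chi i x].
Proof.
move=> gF gZ g1; have [W WU [Wle Vle [D HD]]] := exists_mul_mx_basis.
pose i1 := enum_rank (residue 1).
pose gv : 'cV[C]_N := \col_j g (enum_val j : I).
pose w i := invmx W i1 i * (W *m gv) i 0.
pose chi i x := if coprimep x F then D x 0 i else 0.
have mulg x i : (mul_mx x *m gv) i 0 = g (x * (enum_val i : I)).
  pose g' (v : I) := g v.
  rewrite mxE; transitivity (\sum_j mul_mx x i j * g' (enum_val j)).
    by apply: eq_bigr => j _; congr (_ * _); rewrite mxE.
  by rewrite mul_mxE; apply: gF; exact: dvd_residue.
have DE x : coprimep x F -> W *m mul_mx x *m invmx W = diag_mx (D x).
  by move=> /HD[eq _]; exact: conj_mxKV eq.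
have Dii x i : coprimep x F -> D x 0 i = (W *m mul_mx x *m invmx W) i i.
  by move=> /DE ->; rewrite mxE eqxx.
have DM x y i : coprimep x F -> coprimep y F -> D (x * y) 0 i = D x 0 i * D y 0 i.
  move=> xF yF; rewrite Dii ?coprimepMl ?xF // -mul_mxM.
  have -> : W *m (mul_mx x *m mul_mx y) *m invmx W = diag_mx (D x) *m diag_mx (D y).
    by apply: etrans (conj_mulmx _ _ WU) _; congr (_ *m _); exact: DE.
  by rewrite mulmx_diag !mxE eqxx.
exists w, chi; split.
- move=> i; rewrite cabsM -[X in _ <= X]mul1r ler_pM ?cabs_ge0 //.
  rewrite mxE; apply: le_trans (cabs_sum _ _ _) _.
  have -> : N%:R = \sum_(j < N) 1 :> R by rewrite sumr_const card_ord.
  apply: ler_sum => j _.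
  by rewrite cabsM mxE -[X in _ <= X]mulr1 ler_pM ?cabs_ge0.
- move=> i wi; have Wgi : (W *m gv) i 0 != 0.
    by apply: contra_neq wi => Wg0; rewrite /w Wg0 mulr0.
  have Dc (c : K) : c != 0 -> D c%:P 0 i = 1.
    move=> c0; have cF : coprimep c%:P F by rewrite -alg_polyC coprimepZl // coprime1p.
    have : mul_mx c%:P *m gv = gv.
      by apply/matrixP => j k; rewrite ord1 mulg mul_polyC gZ // mxE.
    move=> fx; have : diag_mx (D c%:P) *m (W *m gv) = W *m gv.
      by rewrite -DE // -[in RHS]fx -mulmxA (mulKmx WU) mulmxA.
    move=> /matrixP/(_ i 0); rewrite mul_diag_mx mxE => h.
    by apply: (mulIf Wgi); rewrite mul1r.
  have chiM x y : chi i (x * y) = chi i x * chi i y.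
    rewrite /chi coprimepMl; case xF: (coprimep x F); case yF: (coprimep y F) => /=; rewrite ?mulr0 ?mul0r //.
    exact: DM.
  split => //.
  + by rewrite /chi coprime1p -polyC1 Dc ?oner_neq0.
  + move=> x y xy; have cxy : coprimep x F = coprimep y F.
      by rewrite -coprimep_residue -[RHS]coprimep_residue; congr (coprimep (val _) F); apply/eqP; rewrite eq_residue.
    rewrite /chi cxy; case: ifP => // yF.
    have cx : coprimep x F by rewrite cxy.
    apply: etrans (Dii x i cx) _; apply: etrans _ (esym (Dii y i yF)).
    pose Q (A : 'M[C]_N) := (W *m A *m invmx W) i i.
    exact: (congr1 Q (mul_mx_residue xy)).
  + by move=> c x c0; rewrite -mul_polyC chiM /chi -{1}alg_polyC coprimepZl // coprime1p Dc // mul1r.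
  + split=> x; first by rewrite /chi => /negPf->.
    by rewrite /chi; case: ifP => [/HD[_ ->]|_]; rewrite ?cabs0.
- move=> x xF; have := mulg x i1; rewrite /i1 enum_rankK.
  rewrite (gF (x * residue 1) x) => [<-|]; last first.
    rewrite -[X in _ - X]mulr1 -mulrBr dvdp_mull //; exact: dvd_residue.
  rewrite (proj1 (HD _ xF)) -!mulmxA mxE; apply: eq_bigr => i _.
  by rewrite mul_diag_mx mxE /w /chi xF; ring.
Qed.

End Fourier.

(** * Multiplicative growth *)
Section RealPowers.
Variables (R : realType) (K : finFieldType).
Local Notation q := #|K|.

Definition qpow (x : R) : R := q%:R `^ x.

Let q_gt1 : (1 < q)%N. Proof. exact: finRing_gt1. Qed.

Lemma qpow_gt0 x : 0 < qpow x. Proof. by rewrite powR_gt0 // ltr0n ltnW. Qed.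
Lemma qpow_ge0 x : 0 <= qpow x. Proof. exact/ltW/qpow_gt0. Qed.
Lemma qpowD x y : qpow (x + y) = qpow x * qpow y.
Proof. by rewrite /qpow powRD // pnatr_eq0 (gtn_eqF (ltnW q_gt1)) implybT. Qed.
Lemma qpow_nat n : qpow n%:R = (q ^ n)%:R.
Proof. by rewrite /qpow powR_mulrn // natrX. Qed.
Lemma qpow0 : qpow 0 = 1. Proof. exact: powRr0. Qed.
Lemma ler_qpow x y : x <= y -> qpow x <= qpow y.
Proof. by move=> xy; rewrite ler_powR // ler1n ltnW. Qed.
Lemma qpow_ge1 x : 0 <= x -> 1 <= qpow x.
Proof. by move=> x0; rewrite -qpow0 ler_qpow. Qed.
Lemma qpowX x n : qpow x ^+ n = qpow (x * n%:R).
Proof. by rewrite -powR_mulrn ?qpow_ge0 // -powRrM. Qed.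
Lemma qpow_gt1 x : 0 < x -> 1 < qpow x.
Proof.
move=> x0; rewrite /qpow /powR gt_eqF ?ltr0n ?(ltnW q_gt1) //.
by rewrite expR_gt1 mulr_gt0 // ln_gt0 // ltr1n.
Qed.

(** Bernoulli's inequality for the square root of y, squared, gives quadratic growth. *)
Lemma exp_beats_linear (A y : R) : 0 <= A -> 1 < y ->
  exists D : nat, forall k, (D <= k)%N -> A * k.+1%:R <= y ^+ k.
Proof.
move=> A0 y1; pose z := Num.sqrt y; have z1 : 1 < z by rewrite -sqrtr1 ltr_sqrt // (lt_trans ltr01).
pose h := z - 1; have h0 : 0 < h by rewrite subr_gt0.
exists (Num.truncn (2 * A / h ^+ 2)).+1 => k kD.
have kA : 2 * A <= k%:R * h ^+ 2.
  rewrite -ler_pdivrMr ?exprn_gt0 //; apply/ltW/(lt_le_trans (truncnS_gt _)).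
  by rewrite ler_nat.
have k1 : 1 <= k%:R :> R by rewrite ler1n (leq_trans _ kD).
have -> : y = z ^+ 2 by rewrite sqr_sqrtr // ltW // (lt_trans ltr01).
rewrite -exprM mulnC exprM.
have zk : k%:R * h <= z ^+ k.
  have zh : 1 + h = z by rewrite /h addrC subrK.
  have := bernoulli k (ltW h0); rewrite zh => /(le_trans _); apply.
  by rewrite mulr_natl lerDr.
apply: (@le_trans _ _ ((k%:R * h) ^+ 2)).
  rewrite exprMn expr2 -mulrA -natr1.
  apply: (@le_trans _ _ (k%:R * (2 * A))); last by rewrite ler_wpM2l.
  by nra.
by rewrite ler_pXn2r ?nnegrE // ?mulr_ge0 ?exprn_ge0 // ?sqrtr_ge0 // ltW.
Qed.

End RealPowers.

Section Growth.
Variables (R : realType) (K : finFieldType).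
Local Notation q := #|K|.
Local Notation qpow := (@qpow R K).
Implicit Types (P N : {poly K}) (x y : R).

Definition dg N : R := (size N).-1%:R.

Lemma dgM P N : P != 0 -> N != 0 -> dg (P * N) = dg P + dg N.
Proof.
move=> P0 N0; rewrite /dg -natrD size_mul //; congr (_%:R).
by move: P0 N0; rewrite -!size_poly_gt0; plia.
Qed.

Lemma dgX P e : dg (P ^+ e) = e%:R * dg P.
Proof. by rewrite /dg -natrM size_exp mulnC. Qed.

Lemma mprime_deg_gt0 P : mprime P -> (0 < (size P).-1)%N.
Proof. by move=> /mprime_size; case: (size P) => [|[|n]]. Qed.

Lemma monic_size_le1 N : N \is monic -> (size N <= 1)%N -> N = 1.
Proof.
move=> mN N1; have : N \in mon K (size N).-1 by exact: mem_mon_size.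
have -> : (size N).-1 = 0%N by lia.
by rewrite mon0 inE => /eqP.
Qed.

Lemma exists_valuation P N : mprime P -> N \is monic -> P %| N ->
  exists e N', [/\ (0 < e)%N, N' \is monic, ~~ (P %| N') & N = P ^+ e * N'].
Proof.
move=> pP; have [mP _] := mprimeP _ pP.
have [n] := ubnP (size N); elim: n N => // n IH N Nn mN /dvdpP[N1 NE].
have mN1 : N1 \is monic by rewrite -(monicMr _ mP) -NE.
have [PN1|nPN1] := boolP (P %| N1); last first.
  by exists 1%N, N1; split; rewrite // expr1 mulrC.
have [|e [N' [e0 mN' nPN' N1E]]] := IH N1 _ mN1 PN1.
  move: Nn; rewrite NE size_mul ?monic_neq0 //.
  have := mprime_size pP; have := monic_neq0 mN1; rewrite -size_poly_gt0; plia.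
by exists e.+1, N'; split; rewrite // NE N1E exprS mulrC mulrA.
Qed.

(** The argument behind the divisor bound, for an arbitrary quantity [Pr] that loses A (e+1) q^(th e
    deg P) for each prime power. Primes of degree above D have A (e+1) <= q^(eta e deg P); each of
    the finitely many smaller ones costs one factor [M], counted by [nsmall]. It serves divisors,
    radicals, the sieve and Kloosterman sums. *)
Lemma growth (A th eta : R) : 1 <= A -> 0 < eta -> exists2 C : R, 1 <= C &
  forall (Pr : {poly K} -> R -> Prop) (B : R), 0 <= B ->
  (forall N x y, x <= y -> Pr N x -> Pr N y) ->
  Pr 1 B ->
  (forall P N e x, mprime P -> N \is monic -> ~~ (P %| N) -> (0 < e)%N -> 0 <= x ->
     Pr N x -> Pr (P ^+ e * N) (A * e.+1%:R * qpow (th * (e%:R * dg P)) * x)) ->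
  forall N, N \is monic -> Pr N (C * qpow ((th + eta) * dg N) * B).
Proof.
move=> A1 eta0; have A0 : 0 <= A by rewrite (le_trans ler01).
have [D HD] := exp_beats_linear A0 (qpow_gt1 K eta0).
have {}HD k : (D <= k)%N -> A * k.+1%:R <= qpow (eta * k%:R).
  by move=> Dk; rewrite -qpowX; exact: HD.
pose M := A * D.+1%:R; have M1 : 1 <= M.
  by apply: le_trans A1 _; rewrite ler_peMr // ler1n.
have M0 : 0 <= M by rewrite (le_trans ler01).
have small e : A * e.+1%:R <= M * qpow (eta * e%:R).
  have [/HD h|eD] := leqP D e.
    by apply: le_trans h _; rewrite ler_peMl // qpow_ge0.
  apply: (@le_trans _ _ M); first by rewrite ler_wpM2l // ler_nat ltnS ltnW.
  by rewrite ler_peMr // qpow_ge1 // mulr_ge0 // ltW.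
pose nsmall N := count (fun P => mprime P && (P %| N)) (monle K D).
exists (M ^+ size (monle K D)); first exact: exprn_ege1.
move=> Pr B B0 mono Pr1 step N mN.
apply: (mono _ (M ^+ nsmall N * qpow ((th + eta) * dg N) * B)).
  by rewrite ler_wpM2r // ler_wpM2r ?qpow_ge0 // ler_weXn2l // count_size.
have [n] := ubnP (size N); elim: n N mN => // n IH N mN Nn.
have [N1|N1] := leqP (size N) 1.
  rewrite (monic_size_le1 mN N1).
  apply: mono Pr1; rewrite /dg size_poly1 mulr0 qpow0 mulr1 ler_peMl //.
  exact: exprn_ege1.
have [P pP PN] := exists_mprime N1; have [mP _] := mprimeP _ pP.
have [e [N' [e0 mN' nPN' NE]]] := exists_valuation pP mN PN.
have sN' : (size N' < size N)%N.
  have Pe0 : P ^+ e != 0 by rewrite expf_neq0 ?monic_neq0.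
  have sPe : (1 < size (P ^+ e)%R)%N.
    by apply: leq_trans (mprime_size pP) _; rewrite dvdp_leq // dvdp_exp.
  rewrite NE (size_mul Pe0 (monic_neq0 mN')).
  by have := monic_neq0 mN'; rewrite -size_poly_gt0; move: sPe; clear; plia.
have PrN' := IH N' mN' (leq_trans sN' Nn).
have pos : 0 <= M ^+ nsmall N' * qpow ((th + eta) * dg N') * B.
  by rewrite mulr_ge0 // mulr_ge0 ?qpow_ge0 // exprn_ge0.
have := step P N' e _ pP mN' nPN' e0 pos PrN'; rewrite -NE; apply: mono.
have -> : dg N = e%:R * dg P + dg N'.
  by rewrite NE dgM ?dgX // ?expf_neq0 ?monic_neq0.
have dP1 : 1 <= dg P by rewrite ler1n mprime_deg_gt0.
have subN Q : mprime Q && (Q %| N') -> mprime Q && (Q %| N).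
  by move=> /andP[-> QN']; rewrite NE dvdp_mull.
suff H : A * e.+1%:R * M ^+ nsmall N' <= M ^+ nsmall N * qpow (eta * (e%:R * dg P)).
  rewrite !mulrDr !mulrDl !qpowD !mulrA ler_wpM2r // ler_wpM2r ?qpow_ge0 // ler_wpM2r ?qpow_ge0 //.
  move: H; rewrite mulrA; set u := A * _ * _; set v := qpow (eta * _ * _).
  rewrite [X in _ -> X <= _]mulrAC -/u [X in _ -> _ <= X]mulrAC => h.
  by apply: ler_wpM2r => //; exact: qpow_ge0.
have e_le : eta * e%:R <= eta * (e%:R * dg P).
  by rewrite (ler_wpM2l (ltW eta0)) // ler_peMr.
have [PD|PD] := boolP (P \in monle K D).
  have ns : (nsmall N' < nsmall N)%N.
    have -> : (nsmall N').+1 = count [predU (fun Q => mprime Q && (Q %| N')) & pred1 P] (monle K D).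
      have := count_predUI (fun Q => mprime Q && (Q %| N')) (pred1 P) (monle K D).
      rewrite count_uniq_mem ?uniq_monle // PD addn1 => <-.
      rewrite [X in (_ + X)%N](_ : _ = 0%N) ?addn0 //; apply/eqP; rewrite -leqn0 leqNgt -has_count.
      by apply/hasPn => Q _ /=; apply/negP => /andP[/andP[_ QN'] /eqP QP]; rewrite QP (negPf nPN') in QN'.
    apply: sub_count => Q /= /orP[/subN//|/eqP->]; by rewrite pP PN.
  apply: le_trans (_ : M * qpow (eta * e%:R) * M ^+ nsmall N' <= _).
    by rewrite ler_wpM2r ?exprn_ge0.
  rewrite mulrAC -exprS ler_pM ?exprn_ge0 ?qpow_ge0 //; last exact: ler_qpow.
  exact: ler_weXn2l.
have ns : (nsmall N' <= nsmall N)%N by apply: sub_count.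
have De : (D <= e * (size P).-1)%N.
  move: PD; rewrite mem_monle mP /= -ltnNge => PD.
  have DP : (D <= (size P).-1)%N by case: (size P) PD => // s /ltnW.
  by apply: (leq_trans DP); rewrite leq_pmull.
rewrite mulrC ler_pM ?exprn_ge0 ?mulr_ge0 //; first exact: ler_weXn2l.
rewrite /dg -natrM; apply: le_trans (HD _ De); rewrite ler_wpM2l // ler_nat ltnS leq_pmulr //.
exact: mprime_deg_gt0.
Qed.

Lemma divisor_bound (eta : R) : 0 < eta -> exists2 C : R, 1 <= C &
  forall N n, N \is monic ->
    (count (fun d => d %| N) (monle K n))%:R <= C * qpow (eta * dg N).
Proof.
move=> eta0; have [C C1 HC] := @growth 1 0 eta (lexx 1) eta0; exists C => // N n mN.
pose Pr N (x : R) := forall n, (count (fun d => d %| N) (monle K n))%:R <= x.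
have := HC Pr 1 ler01 _ _ _ N mN; rewrite add0r mulr1; apply => {N n mN}.
- by move=> N x y xy Nx n; apply: le_trans xy.
- move=> n; rewrite lern1; apply: (@leq_trans (count_mem 1 (monle K n))); last first.
    by rewrite count_uniq_mem ?uniq_monle // leq_b1.
  rewrite -!size_filter; apply: uniq_leq_size; first by rewrite filter_uniq ?uniq_monle.
  move=> d; rewrite !mem_filter => /andP[d1 dn]; rewrite dn andbT /=.
  move: dn; rewrite mem_monle => /andP[md _].
  by rewrite -eqp_monic ?monic1 // -size_poly_eq1 -dvdp1.
- move=> P N e x pP mN nPN e0 x0 Nx n; rewrite mul0r qpow0 mul1r mulr1.
  apply: (@le_trans _ _ (e.+1%:R * (count (fun d => d %| N) (monle K n))%:R)); last by rewrite ler_wpM2l.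
  have [mP _] := mprimeP _ pP.
  rewrite -natrM ler_nat -!size_filter.
  rewrite -[e.+1](size_iota 0) -(size_allpairs (fun j d => P ^+ j * d)).
  apply: uniq_leq_size; first by rewrite filter_uniq ?uniq_monle.
  move=> d; rewrite mem_filter mem_monle => /and3P[dPN md sd].
  have [j [d' [dE md' nPd']]] : exists j d', [/\ d = P ^+ j * d', d' \is monic & ~~ (P %| d')].
    have [Pd|nPd] := boolP (P %| d); last by exists 0%N, d; rewrite expr0 mul1r.
    by have [j [d' [_ ? ? ?]]] := exists_valuation pP md Pd; exists j, d'.
  apply/allpairsP; exists (j, d') => /=; split => //.
    rewrite -[_ :: _]/(iota 0 e.+1) mem_iota /= add0n ltnS; case: leqP => // ej.
    have : P ^+ e.+1 %| P ^+ e * N.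
      apply: dvdp_trans dPN; rewrite dE dvdp_mulr // dvdp_exp2l //.
    by rewrite exprSr dvdp_mul2l ?expf_neq0 ?monic_neq0 // (negPf nPN).
  rewrite mem_filter mem_monle md' /=; apply/andP; split.
    have : d' %| P ^+ e * N by apply: dvdp_trans dPN; rewrite dE dvdp_mull.
    by rewrite Gauss_dvdpr // coprimep_sym coprimep_expl // mprime_coprime.
  by apply: leq_trans sd; rewrite dvdp_leq ?monic_neq0 // dE dvdp_mull.
Qed.

(** The polynomials composed of primes of N are counted with weight T^(-deg), where T = q^eta. A new
    prime P either does not divide d or can be divided out, and A = 1/(1 - 1/T) solves A = 1 +
    A/T. *)
Lemma radical_count_bound (eta : R) : 0 < eta -> exists2 C : R, 1 <= C &
  forall N n, N \is monic ->
    (count (fun d => `[< forall P, mprime P -> P %| d -> P %| N >]) (mon K n))%:R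
      <= C * qpow (eta * (n%:R + dg N)).
Proof.
move=> eta0; pose T := qpow eta; have T1 : 1 < T := qpow_gt1 K eta0.
have T0 : 0 < T by apply: lt_trans T1.
have iT : 0 < 1 - T^-1 by rewrite subr_gt0 invf_lt1.
pose A := (1 - T^-1)^-1; have A1 : 1 <= A.
  by rewrite /A invr_ge1 ?unitfE ?gt_eqF // gerBl invr_ge0 ltW.
have A0 : 0 <= A by rewrite (le_trans ler01).
have [C C1 HC] := @growth A 0 eta A1 eta0; exists C => // N n mN.
pose cnt N n := count (fun d => `[< forall P, mprime P -> P %| d -> P %| N >]) (mon K n).
pose Pr N (x : R) := forall n, (cnt N n)%:R <= x * T ^+ n.
have : Pr N (C * qpow ((0 + eta) * dg N) * 1).
  apply: HC => // {N n mN}.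
  - by move=> N x y xy Nx n; apply: le_trans (Nx n) _; rewrite ler_wpM2r // exprn_ge0 // ltW.
  - move=> n; rewrite mul1r; apply: (@le_trans _ _ 1); last by rewrite exprn_ege1 // ltW.
    rewrite lern1; apply: (@leq_trans (count_mem 1 (mon K n))); last first.
      by rewrite count_uniq_mem ?uniq_mon // leq_b1.
    rewrite /cnt -!size_filter; apply: uniq_leq_size; first by rewrite filter_uniq ?uniq_mon.
    move=> d; rewrite !mem_filter => /andP[/asboolP dP dn]; rewrite dn andbT /=.
    have [d1|d1] := leqP (size d) 1.
      by have [md _] := monP dn; rewrite (monic_size_le1 md d1).
    have [P pP Pd] := exists_mprime d1; have := dP P pP Pd; rewrite dvdp1 => /eqP sP.
    by have := mprime_size pP; rewrite sP.
  - move=> P N e x pP mN nPN e0 x0 Nx; rewrite mul0r qpow0 mulr1.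
    have [mP _] := mprimeP _ pP.
    move=> n; have Tn0 : 0 <= T ^+ n by rewrite exprn_ge0 // ltW.
    apply: le_trans (_ : A * x * T ^+ n <= _); last first.
      by rewrite (ler_wpM2r Tn0) // (ler_wpM2r x0) // ler_peMr // ler1n.
    clear Tn0.
    have [m] := ubnP n; elim: m n => // m IH n nm.
    have [p p0 Pp] : exists2 p, (0 < p)%N & P \in mon K p.
      exists (size P).-1; last exact: mem_mon_size.
      exact: mprime_deg_gt0.
    have step : (cnt (P ^+ e * N)%R n <= cnt N n + (if p <= n then cnt (P ^+ e * N)%R (n - p) else 0))%N.
      rewrite [X in (X <= _)%N]/cnt -size_filter -(count_predC [pred d | P %| d]) !count_filter addnC.
      apply: leq_add.
        apply: sub_count => d /= /andP[nPd /asboolP dP]; apply/asboolP => Q pQ Qd.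
        have := dP Q pQ Qd; rewrite mprime_dvdM // => /orP[/(mprime_dvdX pQ)/(mprime_dvd pQ pP) QP|//].
        by rewrite QP (negPf nPd) in Qd.
      case: ifP => [pn|/negbT]; last first.
        rewrite -ltnNge => pn; rewrite leqNgt -has_count; apply/hasPn => d dn /=.
        apply/negP => /andP[Pd _]; have [] := mon_div Pp dn Pd; by rewrite leqNgt pn.
      rewrite /cnt -!size_filter -[X in (_ <= X)%N](size_map (fun d => P * d)); apply: uniq_leq_size.
        by rewrite filter_uniq ?uniq_mon.
      move=> d; rewrite mem_filter => /andP[/andP[Pd /asboolP dP] dn].
      have [_ dPn] := mon_div Pp dn Pd.
      apply/mapP; exists (d %/ P); last by rewrite mulrC divpK.
      rewrite mem_filter dPn andbT; apply/asboolP => Q pQ Qd; apply: dP => //.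
      by rewrite -(divpK Pd) dvdp_mulr.
    apply: (@le_trans _ _ (x * T ^+ n + A * x * T ^+ n / T)); last first.
      have AE : A = 1 + A / T by rewrite /A; field; rewrite !gt_eqF //= subr_gt0.
      by rewrite {2}AE le_eqVlt; apply/orP; left; apply/eqP; ring.
    apply: (le_trans (_ : _ <= _%:R)); first by rewrite ler_nat; exact: step.
    rewrite natrD lerD //; case: leqP => pn; last by rewrite divr_ge0 ?mulr_ge0 ?exprn_ge0 // ltW.
    have np : (n - p < n)%N by rewrite ltn_subrL p0 (leq_trans p0 pn).
    apply: le_trans (IH _ (leq_trans np nm)) _.
    rewrite -[X in _ <= X]mulrA; apply: ler_wpM2l; first by rewrite mulr_ge0.
    by rewrite ler_pdivlMr // -exprSr; apply: ler_weXn2l; first exact: ltW.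
move=> /(_ n) /le_trans -> //; rewrite mulr1 add0r /T qpowX -mulrA -qpowD.
by rewrite mulrDr addrC.
Qed.

(* Removing the coprimality condition prime by prime: the multiples of P are
   [P * y] with [mobius (P * y) = - mobius y]. *)
Lemma mobius_sieve (T eta : R) : 3 / 2 <= T -> 0 < eta -> exists2 C : R, 1 <= C &
  forall (Fam : ({poly K} -> R[i]) -> Prop) (B : R), 0 <= B ->
  (forall f P, mprime P -> Fam f -> Fam (fun d => f (P * d))) ->
  (forall f n, Fam f -> cabs (\sum_(d <- mon K n) (mobius d)%:~R * f d) <= B * T ^+ n) ->
  forall G f n, G \is monic -> Fam f ->
   cabs (\sum_(d <- mon K n | coprimep d G) (mobius d)%:~R * f d)
     <= C * qpow (eta * dg G) * B * T ^+ n.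
Proof.
move=> T32 eta0; have T0 : 0 < T by lra.
(* The factor 3 reproduces itself under the recursion because 1 + 3/T <= 3 for T >= 3/2. *)
have [C C1 HC] := @growth 3 0 eta (ler_nat R 1 3) eta0; exists C => // Fam B B0 FamP base.
pose S G f n := \sum_(d <- mon K n | coprimep d G) (mobius d)%:~R * f d : R[i].
pose Pr G x := forall f n, Fam f -> cabs (S G f n) <= x * T ^+ n.
move=> G f n mG Ff; suff : Pr G (C * qpow ((0 + eta) * dg G) * B) by rewrite add0r; exact.
apply: HC => // {G f n mG Ff}.
- by move=> G x y xy Gx f n Ff; apply: le_trans (Gx f n Ff) _; rewrite ler_wpM2r // exprn_ge0 // ltW.
- move=> f n Ff; apply: le_trans (base f n Ff); rewrite /S.
  by rewrite (eq_bigl xpredT) // => x; rewrite coprimep1.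
- move=> P G e x pP mG nPG e0 x0 Gx f n Ff; rewrite mul0r qpow0 mulr1.
  have Tn0 : 0 <= T ^+ n by rewrite exprn_ge0 // ltW.
  apply: le_trans (_ : 3 * x * T ^+ n <= _); last first.
    by rewrite (ler_wpM2r Tn0) // (ler_wpM2r x0) // ler_peMr // ler1n.
  clear Tn0.
  have [p p0 Pp] : exists2 p, (0 < p)%N & P \in mon K p.
    exists (size P).-1; last exact: mem_mon_size (proj1 (mprimeP _ pP)).
    exact: mprime_deg_gt0.
  have [m] := ubnP n; elim: m n f Ff => // m IH n f Ff nm.
  have cop d : coprimep d (P ^+ e * G) = ~~ (P %| d) && coprimep d G.
    rewrite coprimepMr; congr andb; rewrite coprimep_sym -mprime_coprime //.
    by case: (e) e0 => // e' _; rewrite coprimep_pexpl.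
  have SE : S (P ^+ e * G) f n = S G f n + (if (p <= n)%N then S (P ^+ e * G) (fun d => f (P * d)) (n - p)%N else 0).
    rewrite {2}/S (bigID (fun d => P %| d)) /=.
    have -> : \sum_(d <- mon K n | coprimep d G && ~~ (P %| d)) (mobius d)%:~R * f d = S (P ^+ e * G) f n.
      by apply: eq_bigl => d; rewrite cop andbC.
    rewrite addrAC; set s1 := \sum_(_ <- _ | _) _; set s2 := if _ then _ else _.
    suff -> : s1 = - s2 by rewrite addNr add0r.
    rewrite /s1 (eq_bigl (fun d => (P %| d) && coprimep d G)); last by move=> d; rewrite andbC.
    rewrite big_mkcondr /s2; case: leqP => pn; last by rewrite oppr0 (sum_mon_ndvd _ Pp pn).
    rewrite (sum_mon_dvd _ Pp pn) /S -sumrN [RHS]big_mkcond [LHS]big_seq [RHS]big_seq.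
    apply: eq_bigr => d dn; have [md _] := monP dn.
    rewrite coprimepMl mprime_coprime // nPG /= cop mobius_mprimeM //.
    by case: (P %| d); case: (coprimep d G); rewrite ?mul0r ?rmorphN ?mulNr.
  rewrite SE; apply: le_trans (cabsD _ _) _.
  apply: (@le_trans _ _ (x * T ^+ n + 3 * x * T ^+ n / T)); last first.
    have -> : 3 * x * T ^+ n = x * T ^+ n + x * T ^+ n * 2 by ring.
    rewrite lerD2l ler_pdivrMr //.
    have : 0 <= x * T ^+ n by rewrite mulr_ge0 // exprn_ge0 // ltW.
    by move: (x * _) => z z0; nra.
  rewrite lerD //; first exact: Gx.
  case: leqP => pn; last by rewrite cabs0 divr_ge0 ?mulr_ge0 ?exprn_ge0 // ltW.
  have np : (n - p < n)%N by rewrite ltn_subrL p0 (leq_trans p0 pn).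
  apply: le_trans (IH _ _ (FamP _ _ pP Ff) (leq_trans np nm)) _.
  rewrite -[X in _ <= X]mulrA; apply: ler_wpM2l; first by rewrite mulr_ge0.
  by rewrite ler_pdivlMr // -exprSr; apply: ler_weXn2l; first by lra.
Qed.

End Growth.

(** * Sums over long intervals *)
Section LongRange.
Variables (R : realType) (K : finFieldType).
Local Notation C := R[i].
Local Notation q := #|K|.
Local Notation qpow := (@qpow R K).

Let q_gt1 : (1 < q)%N. Proof. exact: finRing_gt1. Qed.
(** The exponent 3/4 lies strictly between the 1/2 of the Riemann hypothesis and 1, and (3/2)^4 <=
    2^3 makes T admissible in [mobius_sieve]. *)
Let T : R := qpow (3 / 4).

Lemma sqrt_card : Num.sqrt q%:R = qpow (1 / 2).
Proof.
apply/eqP; rewrite -(@eqrXn2 _ 2) ?sqrtr_ge0 ?qpow_ge0 // sqr_sqrtr // qpowX.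
by have -> : 1 / 2 * 2%:R = 1%:R :> R; [lra|rewrite qpow_nat expn1].
Qed.

Lemma three_halves : 3 / 2 <= T.
Proof.
have h32 : 0 <= 3 / 2 :> R by lra.
rewrite -(@ler_pXn2r _ 4) ?nnegrE ?qpow_ge0 //.
rewrite /T qpowX; have -> : 3 / 4 * 4%:R = 3%:R :> R by lra.
rewrite qpow_nat.
have : (2 ^ 3 <= q ^ 3)%N by rewrite leq_exp2r.
by rewrite -(ler_nat R); lra.
Qed.
Let T0 : 0 < T. Proof. exact: qpow_gt0. Qed.
Let T1 : 1 <= T. Proof. by apply: le_trans three_halves; lra. Qed.

Lemma cabs_sum_mobius n : cabs (\sum_(x <- mon K n) (mobius x)%:~R : C) <= q%:R * T ^+ n.
Proof.
pose one := fun _ : {poly K} => 1 : C.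
have Lq : poly_fps (1 - q%:R *: 'X) * lseries one = 1.
  have H k : \sum_(f <- mon K k) (1 : C) = q%:R ^+ k.
    by rewrite big_const_seq count_predT iter_addr addr0 size_mon natrX.
  apply/funext => k; rewrite poly_fps_linM /lseries /one.
  by case: k => [|k]; rewrite !H ?mulr0 ?subr0 // exprS subrr.
have M1 : mu_series one * lseries one = 1 by apply: mu_seriesM => // f g; rewrite mulr1.
have ME : mu_series one = poly_fps (1 - q%:R *: 'X).
  have L0 : lseries one != 0 by apply: contra_eq_neq Lq => ->; rewrite mulr0 eq_sym oner_neq0.
  by apply: (mulIf L0); rewrite M1 Lq.
have -> : \sum_(x <- mon K n) (mobius x)%:~R = mu_series one n.
  by apply: eq_bigr => x _; rewrite mulr1.
have Tn m : 1 <= T ^+ m by exact: exprn_ege1.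
rewrite ME /poly_fps coefB coef1 coefZ coefX.
have q1 : 1 <= q%:R :> R by rewrite ler1n ltnW.
case: n => [|[|n]] /=.
- by rewrite mulr0 subr0 cabs1 expr0 mulr1.
- by rewrite mulr1 sub0r cabsN cabs_nat ler_peMr.
- by rewrite mulr0 subrr cabs0 mulr_ge0 // exprn_ge0 // ltW.
Qed.

(** In the expansion of g, characters equal to 1 on all units reduce to the Möbius sum with
    coprimality sieved out, and the others to [cabs_sum_mobius_chi]. Both the number of residues and
    the constant to the power r are absorbed by a power of q^r. *)
Lemma long_range : exists2 c : R, 0 <= c & exists A : nat, forall (F : {poly K}) (g : {poly K} -> C) n,
  F != 0 -> (forall x y, F %| x - y -> g x = g y) ->
  (forall (h : K) x, h != 0 -> g (h *: x) = g x) -> (forall x, cabs (g x) <= 1) ->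
  cabs (\sum_(x <- mon K n | coprimep x F) (mobius x)%:~R * g x)
    <= c * qpow (A%:R * dg R F) * T ^+ n.
Proof.
have [c1 c11 Hc1] := @mobius_sieve R K T 1 three_halves ltr01.
have c10 : 0 <= c1 by apply: le_trans c11.
pose B := (1 - Num.sqrt q%:R / T)^-1.
have sT : Num.sqrt q%:R < T.
  rewrite sqrt_card /T [X in _ < X](_ : _ = qpow (1 / 2 + 1 / 4)); last by congr qpow; lra.
  by rewrite qpowD ltr_pMr ?qpow_gt0 // qpow_gt1 //; lra.
have B1 : 1 <= B.
  have QT1 : 0 < 1 - Num.sqrt q%:R / T by rewrite subr_gt0 ltr_pdivrMr // mul1r.
  by rewrite /B invr_ge1 ?unitfE ?gt_eqF // gerBl divr_ge0 ?sqrtr_ge0 // ltW.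
pose a := (Num.truncn B).+1.
have Ba : B <= qpow a%:R.
  apply/ltW/(lt_trans (truncnS_gt _)); rewrite qpow_nat ltr_nat; exact: ltn_expl.
pose b := maxn a 1.
have triv F n : F != 0 -> cabs (\sum_(x <- mon K n | coprimep x F) (mobius x)%:~R : C)
   <= c1 * qpow (dg R F) * q%:R * T ^+ n.
  move=> F0; have lF : lead_coef F != 0 by rewrite lead_coef_eq0.
  pose F1 := (lead_coef F)^-1 *: F.
  have mF1 : F1 \is monic by rewrite monicE lead_coefZ mulVf.
  have dF1 : dg R F1 = dg R F by rewrite /dg size_scale // invr_eq0.
  have q0 : 0 <= q%:R :> R by rewrite ler0n.
  have h : cabs (\sum_(d <- mon K n | coprimep d F1) (mobius d)%:~R * (1 : C)) <= c1 * qpow (1 * dg R F1) * q%:R * T ^+ n.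
    apply: (Hc1 (fun f => f = (fun _ => 1 : C)) q%:R q0 _ _ F1 (fun _ => 1 : C)) => //.
      by move=> f P _ ->.
    by move=> f m ->; under eq_bigr do rewrite mulr1; exact: cabs_sum_mobius.
  rewrite -dF1 -[dg R F1]mul1r; apply: le_trans h; rewrite le_eqVlt; apply/orP; left; apply/eqP; congr cabs.
  by apply: eq_big => [x|x _]; rewrite ?mulr1 // coprimepZr // invr_eq0.
exists (c1 * q%:R); first by rewrite mulr_ge0.
exists (2 + b)%N => F g n F0 gF gZ g1.
(* The Fourier expansion is set up for nonconstant moduli; for constant F the function g is
   constant. *)
have [F1|F1] := leqP (size F) 1.
  have Fu x : F %| x by apply: dvdp_trans (dvd1p x); rewrite dvdp1 eqn_leq F1 size_poly_gt0.
  have gE x : g x = g 1 by apply: gF.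
  under eq_bigr do rewrite gE; rewrite -mulr_suml cabsM.
  apply: le_trans (_ : (c1 * qpow (dg R F) * q%:R * T ^+ n) * 1 <= _).
    by rewrite ler_pM ?cabs_ge0 ?triv.
  rewrite mulr1; apply: ler_wpM2r; first by rewrite exprn_ge0 // ltW.
  rewrite mulrAC; apply: ler_wpM2l; first by rewrite mulr_ge0.
  by rewrite ler_qpow // ler_peMl ?ler0n // ler1n.
have [w [chi [wN chiP gE]]] := fourier F1 gF gZ g1.
have sF0 : (0 < size F)%N by rewrite size_poly_gt0.
pose N := #|{: {poly_((size F).-1) K}}|.
have NE : N%:R = qpow (dg R F) by rewrite /N card_npoly /dg qpow_nat.
have dF : 0 <= dg R F by rewrite ler0n.
pose M := c1 * q%:R * qpow (b%:R * dg R F) * T ^+ n.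
have M0 : 0 <= M by rewrite mulr_ge0 ?exprn_ge0 ?mulr_ge0 ?qpow_ge0 // ltW.
have main i : w i != 0 -> cabs (\sum_(x <- mon K n | coprimep x F) (mobius x)%:~R * chi i x) <= M.
  move=> /chiP[ch1 chM chE chZ [ch0 chle]].
  have [[u uF u1]|nt] := pselect (exists2 u, coprimep u F & chi i u != 1).
    have -> : \sum_(x <- mon K n | coprimep x F) (mobius x)%:~R * chi i x = \sum_(x <- mon K n) (mobius x)%:~R * chi i x.
      rewrite big_mkcond; apply: eq_bigr => x _; case: ifPn => // /ch0 ->; by rewrite mulr0.
    apply: le_trans (cabs_sum_mobius_chi F1 ch1 chM chE chZ chle _ n sT) _; first by exists u.
    rewrite mulrC /M; apply: ler_wpM2r; first by rewrite exprn_ge0 // ltW.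
    apply: le_trans (_ : qpow (b%:R * dg R F) <= _); last first.
      rewrite ler_peMl ?qpow_ge0 //; apply: le_trans c11 _.
      by rewrite ler_peMr // ler1n ltnW.
    rewrite -/B /dg -qpowX; apply: lerXn2r; rewrite ?nnegrE ?qpow_ge0 //.
    exact: le_trans ler01 B1.
  have -> : \sum_(x <- mon K n | coprimep x F) (mobius x)%:~R * chi i x = \sum_(x <- mon K n | coprimep x F) (mobius x)%:~R.
    apply: eq_bigr => x xF; rewrite [chi i x](_ : _ = 1) ?mulr1 //; apply/eqP; apply: contrapT => /negP xn.
    by apply: nt; exists x.
  apply: le_trans (triv _ _ F0) _; rewrite /M; apply: ler_wpM2r; first by rewrite exprn_ge0 // ltW.
  by rewrite mulrAC ler_wpM2l ?mulr_ge0 // ler_qpow // ler_peMl // ler1n leq_maxr.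
have -> : \sum_(x <- mon K n | coprimep x F) (mobius x)%:~R * g x =
   \sum_i w i * \sum_(x <- mon K n | coprimep x F) (mobius x)%:~R * chi i x.
  under [RHS]eq_bigr do rewrite mulr_sumr; rewrite exchange_big /=; apply: eq_bigr => x xF.
  by rewrite gE // mulr_sumr; apply: eq_bigr => i _; ring.
apply: le_trans (cabs_sum _ _ _) _.
apply: le_trans (_ : \sum_(i < N) N%:R * M <= _).
  apply: ler_sum => i _; rewrite cabsM; have [->|wi] := eqVneq (w i) 0.
    by rewrite cabs0 mul0r mulr_ge0.
  by rewrite ler_pM ?cabs_ge0 ?wN ?main.
rewrite sumr_const card_ord -[X in X <= _]mulr_natr NE /M le_eqVlt; apply/orP; left; apply/eqP.
have -> : (2 + b)%:R * dg R F = dg R F + dg R F + b%:R * dg R F by rewrite natrD; ring.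
by rewrite !qpowD; ring.
Qed.

End LongRange.

(** * Kloosterman sums *)
Section Kloosterman.
Variables (R : realType) (K : finFieldType) (p : nat).
Variables (pK : p \in [pchar K]) (p_odd : odd p).
Local Notation C := R[i].
Local Notation q := #|K|.
Local Notation e := (e_mod R pK).
Implicit Types (F G P x y u v a b c : {poly K}) (f : {poly K} -> C).

Definition periodic F f := forall x y, F %| x - y -> f x = f y.
Definition rsum F f := \sum_(v : {poly_((size F).-1) K}) f v.

Lemma rsum_reindex F (T : finType) (h : T -> {poly K}) f : F != 0 -> periodic F f ->
  (forall t t', F %| h t - h t' -> t = t') -> #|T| = (q ^ (size F).-1)%N ->
  rsum F f = \sum_t f (h t).
Proof.
move=> F0 fF hinj cT; rewrite /rsum.
have sz x : x %% F \is a poly_of_size (size F).-1.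
  by rewrite qualifE /= -ltnS prednK ?size_poly_gt0 // ltn_modp.
pose g t : {poly_((size F).-1) K} := NPoly (sz (h t)).
have gh t : F %| (g t : {poly K}) - h t.
  by rewrite -opprB {1}(divp_eq (h t) F) addrK dvdpNr dvdp_mull.
have ginj : injective g.
  move=> t t' /(congr1 val) /= eq; apply: hinj.
  by apply/modp_eq0P; rewrite modpD modpN eq subrr.
have gbij : bijective g by apply: inj_card_bij => //; rewrite cT card_npoly.
rewrite (reindex g); last exact: onW_bij.
by apply: eq_bigr => t _; exact: fF.
Qed.

Lemma residue_inj F (v w : {poly_((size F).-1) K}) : F != 0 -> F %| (v : {poly K}) - w -> v = w.
Proof.
move=> F0 vw; apply: val_inj; apply/eqP; rewrite -subr_eq0; apply: contraT => vw0.
have := dvdp_leq vw0 vw; rewrite leqNgt; suff -> : (size ((v : {poly K}) - w)%R < size F)%N by [].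
apply: (@leq_ltn_trans (size F).-1); last by rewrite ltn_predL size_poly_gt0.
by rewrite (leq_trans (size_polyD _ _)) // size_polyN geq_max !size_npoly.
Qed.

Lemma rsum_shift F c f : F != 0 -> periodic F f -> rsum F (fun x => f (x + c)) = rsum F f.
Proof.
move=> F0 fF; apply/esym; apply: (rsum_reindex (h := fun v : {poly_((size F).-1) K} => (v : {poly K}) + c)) => //.
  by move=> t t'; rewrite opprD addrACA subrr addr0; exact: residue_inj.
by rewrite card_npoly.
Qed.

Lemma size_mul_pred F G : F != 0 -> G != 0 -> (size (F * G)%R).-1 = ((size F).-1 + (size G).-1)%N.
Proof. by move=> F0 G0; rewrite size_mul //; move: F0 G0; rewrite -!size_poly_gt0; plia. Qed.

Lemma rsum_mul F G f : F != 0 -> G != 0 -> periodic (F * G) f ->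
  rsum (F * G) f = rsum F (fun y => rsum G (fun z => f (y + F * z))).
Proof.
move=> F0 G0 fFG; rewrite /rsum pair_big /=.
apply: (rsum_reindex (h := fun t : {poly_((size F).-1) K} * {poly_((size G).-1) K} => (t.1 : {poly K}) + F * (t.2 : {poly K}))) => //.
- by rewrite mulf_neq0.
- move=> [y z] [y' z'] /= d.
  have e1 (Y Z Y' Z' : {poly K}) : Y + F * Z - (Y' + F * Z') = (Y - Y') + F * (Z - Z') by ring.
  rewrite e1 in d.
  have yy : y = y'.
    apply: (residue_inj F0); rewrite -(dvdp_addl _ (dvdp_mulr ((z : {poly K}) - z') (dvdpp F))).
    exact: dvdp_trans (dvdp_mulr _ (dvdpp _)) d.
  congr (_, _) => //; apply: (residue_inj G0); move: d; rewrite yy subrr add0r.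
  by rewrite dvdp_mul2l.
- by rewrite card_prod !card_npoly -expnD size_mul_pred.
Qed.

Lemma rsum_crt F G f : F != 0 -> G != 0 -> coprimep F G -> periodic (F * G) f ->
  rsum (F * G) f = rsum F (fun u => rsum G (fun v => f (u * G + v * F))).
Proof.
move=> F0 G0 FG fFG; rewrite /rsum pair_big /=.
apply: (rsum_reindex (h := fun t : {poly_((size F).-1) K} * {poly_((size G).-1) K} => (t.1 : {poly K}) * G + (t.2 : {poly K}) * F)) => //.
- by rewrite mulf_neq0.
- move=> [y z] [y' z'] /= d.
  have e1 (Y Z Y' Z' : {poly K}) : Y * G + Z * F - (Y' * G + Z' * F) = (Y - Y') * G + (Z - Z') * F by ring.
  rewrite e1 in d; congr (_, _).
    apply: (residue_inj F0); rewrite -(Gauss_dvdpl _ FG) -(dvdp_addl _ (dvdp_mull ((z : {poly K}) - z') (dvdpp F))).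
    exact: dvdp_trans (dvdp_mulr _ (dvdpp _)) d.
  apply: (residue_inj G0); rewrite coprimep_sym in FG.
  rewrite -(Gauss_dvdpl _ FG) -(dvdp_addr _ (dvdp_mull ((y : {poly K}) - y') (dvdpp G))).
  exact: dvdp_trans (dvdp_mull _ (dvdpp _)) d.
- by rewrite card_prod !card_npoly -expnD size_mul_pred.
Qed.

Lemma inv_mod_uniq F x y : F != 0 -> F %| x * y - 1 -> coprimep x F /\ F %| inv_mod F x - y.
Proof.
move=> F0 xy; have xF : coprimep x F.
  apply/Bezout_coprimepP; have /dvdpP[z zE] := xy.
  exists (y, - z); rewrite /= mulNr -zE; have -> : y * x - (x * y - 1) = 1 by ring.
  exact: eqpxx.
split=> //; have := inv_modP F0 xF => i1.
have -> : inv_mod F x - y = y * (x * inv_mod F x - 1) - inv_mod F x * (x * y - 1) by ring.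
by rewrite dvdp_sub ?dvdp_mull.
Qed.

Definition kloo_term a b F x := if coprimep x F then e F (a * inv_mod F x + b * x) else 0.
Definition kloo a b F := rsum F (kloo_term a b F).

Lemma kloo_termE a b F x y : F != 0 -> F %| x * y - 1 -> kloo_term a b F x = e F (a * y + b * x).
Proof.
move=> F0 xy; have [xF iy] := inv_mod_uniq F0 xy; rewrite /kloo_term xF.
by apply: e_mod_mod => //; rewrite opprD addrACA subrr addr0 -mulrBr dvdp_mull.
Qed.

Lemma coprimep_periodic F x y : F %| x - y -> coprimep x F = coprimep y F.
Proof.
move=> xy; rewrite -[LHS]coprimep_modl -[RHS]coprimep_modl.
by have /modp_eq0P := xy; rewrite modpD modpN => /eqP; rewrite subr_eq0 => /eqP->.
Qed.

Lemma kloo_term_periodic a b F : F != 0 -> periodic F (kloo_term a b F).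
Proof.
move=> F0 x y xy; have [xF|xF] := boolP (coprimep x F); last first.
  by rewrite /kloo_term -(coprimep_periodic xy) (negPf xF).
have i1 := inv_modP F0 xF.
have i2 : F %| y * inv_mod F x - 1.
  have -> : y * inv_mod F x - 1 = (x * inv_mod F x - 1) - (x - y) * inv_mod F x by ring.
  by rewrite dvdp_sub // dvdp_mulr.
rewrite (kloo_termE a b F0 i1) (kloo_termE a b F0 i2); apply: e_mod_mod => //.
by rewrite opprD addrACA subrr add0r -mulrBr dvdp_mull.
Qed.

Lemma exists_inv F x : F != 0 -> coprimep x F -> exists y, F %| x * y - 1.
Proof. by move=> F0 xF; exists (inv_mod F x); exact: inv_modP. Qed.

Lemma kloo_crt a b F G : F != 0 -> G != 0 -> coprimep F G ->
  exists c d, [/\ coprimep a F -> coprimep c F, coprimep a G -> coprimep d G &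
    kloo a b (F * G) = kloo c b F * kloo d b G].
Proof.
move=> F0 G0 FG; have GF : coprimep G F by rewrite coprimep_sym.
have [g gG] := exists_inv F0 GF; have [f fF] := exists_inv G0 FG.
have FG0 : F * G != 0 by rewrite mulf_neq0.
have gG' : F %| g * G - 1 by rewrite mulrC.
have fF' : G %| f * F - 1 by rewrite mulrC.
have [gF _] := inv_mod_uniq F0 gG'; have [fG _] := inv_mod_uniq G0 fF'.
exists (a * g ^+ 2), (a * f ^+ 2); split.
- by move=> aF; rewrite coprimepMl aF coprimep_expl.
- by move=> aG; rewrite coprimepMl aG coprimep_expl.
rewrite {1}/kloo (rsum_crt F0 G0 FG (kloo_term_periodic a b FG0)).
suff H u v : kloo_term a b (F * G) (u * G + v * F) =
    kloo_term (a * g ^+ 2) b F u * kloo_term (a * f ^+ 2) b G v.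
  rewrite /kloo /rsum mulr_suml; apply: eq_bigr => u _; rewrite mulr_sumr.
  by apply: eq_bigr => v _; exact: H.
have copE : coprimep (u * G + v * F) (F * G) = coprimep u F && coprimep v G.
  rewrite coprimepMr; congr andb.
    rewrite (@coprimep_periodic F _ (u * G)); last by rewrite addrAC subrr add0r dvdp_mull.
    by rewrite coprimepMl GF andbT.
  rewrite (@coprimep_periodic G _ (v * F)); last by rewrite addrK dvdp_mull.
  by rewrite coprimepMl FG andbT.
have [uF|uF] := boolP (coprimep u F); last first.
  by rewrite {1 2}/kloo_term copE (negPf uF) mul0r.
have [vG|vG] := boolP (coprimep v G); last first.
  by rewrite {1 3}/kloo_term copE (negPf vG) andbF mulr0.
have [u' uu'] := exists_inv F0 uF; have [v' vv'] := exists_inv G0 vG.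
rewrite (kloo_termE _ _ F0 uu') (kloo_termE _ _ G0 vv').
(* The inverse of u G + v F modulo F G: modulo F it is g u' since g G = 1, and symmetrically modulo
   G. *)
pose y := g ^+ 2 * u' * G + f ^+ 2 * v' * F.
have xy : F * G %| (u * G + v * F) * y - 1.
  rewrite Gauss_dvdp //; apply/andP; split.
    have -> : (u * G + v * F) * y - 1 = (u * u' - 1) * (G * g) ^+ 2 + (G * g - 1) * (G * g + 1)
       + F * ((u * G + v * F) * (f ^+ 2 * v') + v * (g ^+ 2 * u' * G)) by rewrite /y; ring.
    by rewrite !dvdp_add ?dvdp_mulr // dvdpp.
  have -> : (u * G + v * F) * y - 1 = (v * v' - 1) * (F * f) ^+ 2 + (F * f - 1) * (F * f + 1)
       + G * ((u * G + v * F) * (g ^+ 2 * u') + u * (f ^+ 2 * v' * F)) by rewrite /y; ring.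
  by rewrite !dvdp_add ?dvdp_mulr // dvdpp.
rewrite (kloo_termE _ _ FG0 xy).
have -> : a * y + b * (u * G + v * F) = (a * g ^+ 2 * u' + b * u) * G + (a * f ^+ 2 * v' + b * v) * F.
  by rewrite /y; ring.
by rewrite e_modD // e_modM // [F * G]mulrC e_modM.
Qed.

Lemma rsum_e_mod F u : F != 0 ->
  rsum F (fun v => e F (u * v)) = if F %| u then (q ^ (size F).-1)%:R else 0.
Proof. exact: sum_e_mod_full. Qed.

(** Since B divides A, the inverse of y + A z modulo A B is linear in z. The sum over z is thus a
    complete additive sum, nonzero only where the derivative b - a/y^2 vanishes modulo B. *)
Lemma kloo_inner A B a b y : A != 0 -> B != 0 -> B %| A ->
  rsum B (fun z => kloo_term a b (A * B) (y + A * z)) =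
  if coprimep y A && (B %| b - a * inv_mod (A * B) y ^+ 2)
  then (q ^ (size B).-1)%:R * kloo_term a b (A * B) y else 0.
Proof.
move=> A0 B0 BA; have AB0 : A * B != 0 by rewrite mulf_neq0.
have copAB x : coprimep x (A * B) = coprimep x A.
  by rewrite coprimepMr; have [xA|//] := boolP (coprimep x A); rewrite (coprimep_dvdl BA xA).
have copz z : coprimep (y + A * z) A = coprimep y A.
  by apply: coprimep_periodic; rewrite addrAC subrr add0r dvdp_mulr.
have [yA|yA] /= := boolP (coprimep y A); last first.
  by rewrite /rsum big1 // => z _; rewrite /kloo_term copAB copz (negPf yA).
set y' := inv_mod _ y; have yy' : A * B %| y * y' - 1 by apply: inv_modP; rewrite ?copAB.
set w := b - _.
have termE z : kloo_term a b (A * B) (y + A * z) = kloo_term a b (A * B) y * e B (w * z).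
  have inv' : A * B %| (y + A * z) * (y' - A * z * y' ^+ 2) - 1.
    have -> : (y + A * z) * (y' - A * z * y' ^+ 2) - 1 =
      (y * y' - 1) * (1 - A * z * y') - A * A * (z ^+ 2 * y' ^+ 2) by ring.
    by rewrite dvdp_sub // dvdp_mulr // dvdp_mul2l.
  rewrite (kloo_termE _ _ AB0 inv') (kloo_termE _ _ AB0 yy').
  have -> : a * (y' - A * z * y' ^+ 2) + b * (y + A * z) = (a * y' + b * y) + (w * z) * A.
    by rewrite /w; ring.
  by rewrite e_modD // [A * B]mulrC e_modM.
rewrite /rsum (eq_bigr _ (fun (v : {poly_((size B).-1) K}) _ => termE v)) -mulr_sumr.
rewrite -[\sum_v _]/(rsum B (fun v => e B (w * v))) rsum_e_mod //.
by case: ifP => _; rewrite ?mulr0 // mulrC.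
Qed.

Lemma two_neq0 : (2%:R : K) != 0.
Proof.
have pp : prime p := pcharf_prime pK; apply/negP => /eqP h2.
have : (p %| 2)%N by rewrite (dvdn_pcharf pK) h2.
by rewrite dvdn_prime2 // => /eqP p2; move: p_odd; rewrite p2.
Qed.

Lemma two_unit P x : P %| x *+ 2 -> P %| x.
Proof. by rewrite -scaler_nat dvdpZr // two_neq0. Qed.

(** P^h divides (y - z)(y + z); if P divided both factors it would divide 2 y, hence y, because 2 is
    invertible. *)
Lemma square_solutions P h a b y y' z z' : mprime P -> coprimep a P ->
  P ^+ h %| y * y' - 1 -> P ^+ h %| z * z' - 1 ->
  P ^+ h %| b - a * y' ^+ 2 -> P ^+ h %| b - a * z' ^+ 2 ->
  (P ^+ h %| y - z) || (P ^+ h %| y + z).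
Proof.
move=> pP aP yy' zz' yb zb; case: h yy' zz' yb zb => [|h]; first by rewrite expr0 !dvd1p.
set B := P ^+ _ => yy' zz' yb zb.
have cop x : coprimep P x -> coprimep B x by rewrite coprimep_pexpl.
have : B %| (y - z) * (y + z).
  have aB : coprimep B a by rewrite cop // coprimep_sym.
  rewrite -(Gauss_dvdpr _ aB).
  have -> : a * ((y - z) * (y + z)) =
    (b - a * y' ^+ 2) * (y ^+ 2 * z ^+ 2) - (b - a * z' ^+ 2) * (y ^+ 2 * z ^+ 2)
    + (y * y' - 1) * (a * z ^+ 2 * (y * y' + 1)) - (z * z' - 1) * (a * y ^+ 2 * (z * z' + 1)) by ring.
  by apply: dvdp_sub; [apply: dvdp_add; [apply: dvdp_sub; exact: dvdp_mulr|exact: dvdp_mulr]|exact: dvdp_mulr].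
have [Pd|nPd] := boolP (P %| y - z); last first.
  by rewrite Gauss_dvdpr ?cop ?mprime_coprime // => ->; rewrite orbT.
have [Ps|nPs] := boolP (P %| y + z); last first.
  by rewrite Gauss_dvdpl ?cop ?mprime_coprime // => ->.
have Py : P %| y.
  apply: two_unit; have -> : y *+ 2 = (y - z) + (y + z) by ring.
  by rewrite dvdp_add.
have PB : P %| B by rewrite dvdp_exp.
have : P %| 1.
  have -> : 1 = y * y' - (y * y' - 1) by ring.
  by rewrite dvdp_sub ?dvdp_mulr // (dvdp_trans PB).
by rewrite dvdp1 => /eqP sP; have := mprime_size pP; rewrite sP.
Qed.

Lemma conjc_sum I (r : seq I) (g : I -> C) : conjc (\sum_(i <- r) g i) = \sum_(i <- r) conjc (g i).
Proof. exact: (rmorph_sum (@conjc R)). Qed.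

(** Opening the square and shifting one variable by the other leaves a linear sum, which only the
    zero shift survives. *)
Lemma gauss_sum P c t : mprime P -> coprimep c P ->
  cabs (rsum P (fun w => e P (c * w ^+ 2 + t * w))) ^+ 2 = (q ^ (size P).-1)%:R.
Proof.
move=> pP cP; have P0 := mprime_neq0 pP.
pose g w := e P (c * w ^+ 2 + t * w).
have gper : periodic P g.
  move=> x y xy; apply: e_mod_mod => //.
  have -> : c * x ^+ 2 + t * x - (c * y ^+ 2 + t * y) = (x - y) * (c * (x + y) + t) by ring.
  exact: dvdp_mulr.
apply: (@complexI R); rewrite sqr_cabs rmorph_nat.
have cE (v : {poly K}) : conjc (g v) = e P (- (c * v ^+ 2 + t * v)) by rewrite e_modN.
rewrite {2}/rsum conjc_sum mulr_sumr.
pose G u v : C := e P (c * u ^+ 2 + t * u) * e P ((c * u *+ 2) * v).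
transitivity (\sum_(v : {poly_((size P).-1) K}) \sum_(u : {poly_((size P).-1) K}) G u v).
  apply: eq_bigr => v _; rewrite -(rsum_shift v P0 gper) /rsum mulr_suml.
  apply: eq_bigr => u _; rewrite [conjc _]cE /g /G /= -!e_modD //; congr (e P _).
  by move: (u : {poly K}) (v : {poly K}) => {}u {}v; ring.
have GE u : \sum_(v : {poly_((size P).-1) K}) G u v = e P (c * u ^+ 2 + t * u) * (if P %| u then (q ^ (size P).-1)%:R else 0).
  rewrite /G -mulr_sumr -[\sum_v _]/(rsum P (fun v => e P (c * u *+ 2 * v))) rsum_e_mod //.
  have -> // : (P %| c * u *+ 2) = (P %| u).
  apply/idP/idP => [/two_unit|Pu]; first by rewrite Gauss_dvdpr 1?coprimep_sym.
  by rewrite -mulrnAr -scaler_nat; apply/dvdp_mull; rewrite -mul_polyC; apply: dvdp_mull.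
rewrite exchange_big /= (bigD1 (0 : {poly_((size P).-1) K})) //= [X in _ + X]big1 ?addr0.
  by rewrite GE dvdp0 e_mod_dvd ?mul1r // !(mulr0, expr0n, addr0) dvdp0.
move=> u u0; rewrite GE; case: ifP; rewrite ?mulr0 // => Pu.
by move/eqP: u0; case; apply: (residue_inj P0); rewrite subr0.
Qed.

(** The critical points of a/y + b y modulo B. *)
Definition stationary a b B y := coprimep y B && (B %| b - a * inv_mod B y ^+ 2).

Lemma inv_mod_dvd F G x : F != 0 -> G != 0 -> G %| F -> coprimep x F ->
  G %| inv_mod F x - inv_mod G x.
Proof.
move=> F0 G0 GF xF; have [_ h] := inv_mod_uniq G0 (dvdp_trans GF (inv_modP F0 xF)).
by rewrite -opprB dvdpNr.
Qed.

Lemma dvdp_sub_sqr B a b x y : B %| x - y -> (B %| b - a * x ^+ 2) = (B %| b - a * y ^+ 2).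
Proof.
move=> d; rewrite -[LHS](dvdp_addl _ (dvdp_mull (a * (x + y)) d)).
by congr (_ %| _); ring.
Qed.

Lemma stationary_periodic a b B x y : B != 0 -> B %| x - y ->
  stationary a b B x = stationary a b B y.
Proof.
move=> B0 xy; rewrite /stationary -(coprimep_periodic xy).
have [xB|//] := boolP (coprimep x B); rewrite /=.
have i1 := inv_modP B0 xB.
have i2 : B %| y * inv_mod B x - 1.
  have -> : y * inv_mod B x - 1 = (x * inv_mod B x - 1) - (x - y) * inv_mod B x by ring.
  by rewrite dvdp_sub // dvdp_mulr.
have [_ d] := inv_mod_uniq B0 i2.
exact/esym/dvdp_sub_sqr.
Qed.

Lemma card_stationary P h a b : mprime P -> coprimep a P ->
  (#|[pred y : {poly_((size (P ^+ h)).-1) K} | stationary a b (P ^+ h) (y : {poly K})]| <= 2)%N.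
Proof.
move=> pP aP; set B := P ^+ h; have B0 : B != 0 by rewrite expf_neq0 // mprime_neq0.
set S := [pred y | _]; case: (pickP S) => [y0 Sy0|S0]; last first.
  by rewrite (eq_card0 S0).
have sz x : x %% B \is a poly_of_size (size B).-1.
  by rewrite qualifE /= -ltnS prednK ?size_poly_gt0 // ltn_modp.
apply: leq_trans (_ : #|pred2 y0 (NPoly (sz (- (y0 : {poly K}))))| <= 2)%N; last first.
  by rewrite card2; case: (_ != _).
apply: subset_leq_card; apply/fintype.subsetP => y; rewrite !inE => /andP[yB yb].
have /andP[y0B y0b] := Sy0.
have := square_solutions pP aP (inv_modP B0 yB) (inv_modP B0 y0B) yb y0b.
case/orP => d; first by rewrite (residue_inj B0 d) eqxx.
apply/orP; right; apply/eqP/(residue_inj B0) => /=.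
have -> : (y : {poly K}) - - (y0 : {poly K}) %% B = ((y : {poly K}) + (y0 : {poly K})) - (- (y0 : {poly K}) %% B - - (y0 : {poly K})) by ring.
by rewrite dvdp_sub // {2}(divp_eq (- (y0 : {poly K})) B) opprD addrCA subrr addr0 dvdpNr dvdp_mull.
Qed.

Lemma rsum_stationary P h a b (f : {poly K} -> C) (M : R) : mprime P -> coprimep a P ->
  0 <= M -> (forall y, stationary a b (P ^+ h) y -> cabs (f y) <= M) ->
  cabs (rsum (P ^+ h) (fun y => if stationary a b (P ^+ h) y then f y else 0)) <= 2 * M.
Proof.
move=> pP aP M0 fM; rewrite /rsum -big_mkcond /=; apply: le_trans (cabs_sum _ _ _) _.
apply: (@le_trans _ _ (\sum_(y : {poly_((size (P ^+ h)).-1) K} | stationary a b (P ^+ h) (y : {poly K})) M)).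
  by apply: ler_sum => y; exact: fM.
rewrite sumr_const -[X in X <= _]mulr_natl ler_wpM2r // (ler_nat _ _ 2).
exact: card_stationary.
Qed.

Lemma kloo_outer A B a b : A != 0 -> B != 0 -> B %| A -> (forall y, coprimep y B -> coprimep y A) ->
  kloo a b (A * B) = rsum A (fun y => if stationary a b B y then (q ^ (size B).-1)%:R * kloo_term a b (A * B) y else 0).
Proof.
move=> A0 B0 BA BcA; have AB0 : A * B != 0 by rewrite mulf_neq0.
rewrite /kloo (rsum_mul A0 B0 (kloo_term_periodic a b AB0)); apply: eq_bigr => y _.
rewrite (kloo_inner _ _ _ A0 B0 BA); rewrite /stationary.
have [yB|yB] := boolP (coprimep (y : {poly K}) B); last first.
  by have [yA|//] := boolP (coprimep (y : {poly K}) A); rewrite (coprimep_dvdl BA yA) in yB.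
rewrite (BcA _ yB) /=; set s := (B %| _); set t := (B %| _); suff -> : s = t by [].
have yAB : coprimep (y : {poly K}) (A * B) by rewrite coprimepMr BcA.
have d := inv_mod_dvd AB0 B0 (dvdp_mull A (dvdpp B)) yAB.
exact: dvdp_sub_sqr.
Qed.

Lemma cabs_kloo_term a b F x : cabs (kloo_term a b F x) <= 1.
Proof. by rewrite /kloo_term; case: ifP => _; rewrite ?cabs_e_mod ?cabs0 ?ler01. Qed.

Lemma kloo_even P h a b : mprime P -> coprimep a P ->
  cabs (kloo a b (P ^+ h * P ^+ h)) <= 2 * (q ^ (size (P ^+ h)).-1)%:R.
Proof.
move=> pP aP; have B0 : P ^+ h != 0 by rewrite expf_neq0 // mprime_neq0.
rewrite kloo_outer //; apply: rsum_stationary => // y _.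
by rewrite cabsM cabs_nat ler_piMr // cabs_kloo_term.
Qed.

Lemma rsum_ext F (f g : {poly K} -> C) : (forall y, f y = g y) -> rsum F f = rsum F g.
Proof. by move=> fg; apply: eq_bigr => y _. Qed.

(** For the modulus B P B the stationary phase is taken with A = B P. Each of the at most two
    stationary classes modulo B splits into the points y + B w with w modulo P, over which the phase
    is quadratic: a Gauss sum modulo P. *)
Lemma kloo_odd P h a b : mprime P -> coprimep a P ->
  cabs (kloo a b (P ^+ h.+1 * P * P ^+ h.+1)) <=
  2 * ((q ^ (size (P ^+ h.+1)).-1)%:R * Num.sqrt (q ^ (size P).-1)%:R).
Proof.
move=> pP aP; set B := P ^+ h.+1; have P0 := mprime_neq0 pP.
have B0 : B != 0 by rewrite expf_neq0.
have A0 : B * P != 0 by rewrite mulf_neq0.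
have F0 : B * P * B != 0 by rewrite mulf_neq0.
have cBP y : coprimep y B -> coprimep y P by rewrite coprimep_pexpr.
have BcA y : coprimep y B -> coprimep y (B * P) by move=> yB; rewrite coprimepMr yB cBP.
(* On stationary points the term is, by [kloo_inner], a sum over all z of values at y + B P z, which
   a shift of z leaves unchanged. *)
have per : periodic (B * P) (fun y => if stationary a b B y then (q ^ (size B).-1)%:R * kloo_term a b (B * P * B) y else 0).
  move=> x y xy; rewrite -(stationary_periodic a b B0 (dvdp_trans (dvdp_mulr P (dvdpp B)) xy)).
  case: ifP => // /andP[xB xb].
  have BA : B %| B * P by exact: dvdp_mulr.
  have := kloo_inner a b x A0 B0 BA; have := kloo_inner a b y A0 B0 BA.
  have kE z : stationary a b B z -> coprimep z (B * P) && (B %| b - a * inv_mod (B * P * B) z ^+ 2).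
    move=> /andP[zB zb]; rewrite BcA //=.
    have zAB : coprimep z (B * P * B) by rewrite coprimepMr BcA.
    have d := inv_mod_dvd F0 B0 (dvdp_mull (B * P) (dvdpp B)) zAB.
    by rewrite (dvdp_sub_sqr _ _ d).
  have sy : stationary a b B y by rewrite -(stationary_periodic a b B0 (dvdp_trans BA xy)) /stationary xB.
  rewrite !kE // /stationary ?xB // => <- <-.
  have [t xE] : exists t, x = y + B * P * t.
    by have /dvdpP[t tE] := xy; exists t; rewrite mulrC -tE addrC subrK.
  pose g z := kloo_term a b (B * P * B) (y + B * P * z).
  have gper : periodic B g.
    move=> z w zw; apply: kloo_term_periodic => //.
    by rewrite opprD addrACA subrr add0r -mulrBr dvdp_mul2l.
  rewrite -(rsum_shift t B0 gper); apply: rsum_ext => z; rewrite /g xE; congr kloo_term.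
  by rewrite -addrA -mulrDr [t + z]addrC.
rewrite kloo_outer //; last exact: dvdp_mulr.
rewrite (rsum_mul B0 P0 per).
pose f y := (q ^ (size B).-1)%:R * rsum P (fun w => kloo_term a b (B * P * B) (y + B * w)).
have -> : rsum B (fun y => rsum P (fun z => if stationary a b B (y + B * z) then (q ^ (size B).-1)%:R * kloo_term a b (B * P * B) (y + B * z) else 0))
  = rsum B (fun y => if stationary a b B y then f y else 0).
  apply: rsum_ext => y; rewrite /f /rsum mulr_sumr.
  under eq_bigr => w _.
    rewrite (@stationary_periodic a b B _ y) //; last by rewrite addrAC subrr add0r dvdp_mulr.
    over.
  by case: ifP => _ //; rewrite big1.
apply: (rsum_stationary (f := f) pP aP); first by rewrite mulr_ge0 ?sqrtr_ge0.
move=> y /andP[yB yb]; rewrite /f cabsM cabs_nat ler_wpM2l //.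
have yF : coprimep y (B * P * B) by rewrite coprimepMr BcA.
set y' := inv_mod (B * P * B) y; have yy' : B * P * B %| y * y' - 1 := inv_modP F0 yF.
have [t tE] : exists t, b - a * y' ^+ 2 = B * t.
  have d := inv_mod_dvd F0 B0 (dvdp_mull (B * P) (dvdpp B)) yF.
  have : B %| b - a * y' ^+ 2.
    by rewrite (dvdp_sub_sqr _ _ d).
  by case/dvdpP => t tE; exists t; rewrite tE mulrC.
have termE w : kloo_term a b (B * P * B) (y + B * w) =
    e (B * P * B) (a * y' + b * y) * e P ((a * y' ^+ 3) * w ^+ 2 + t * w).
  (* The inverse of y + B w to second order; the error is a multiple of B^3, and P divides B. *)
  have inv' : B * P * B %| (y + B * w) * (y' - B * w * y' ^+ 2 + B ^+ 2 * w ^+ 2 * y' ^+ 3) - 1.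
    have -> : (y + B * w) * (y' - B * w * y' ^+ 2 + B ^+ 2 * w ^+ 2 * y' ^+ 3) - 1 =
      (y * y' - 1) * (1 - B * w * y' + B ^+ 2 * w ^+ 2 * y' ^+ 2) + B * B * B * (w ^+ 3 * y' ^+ 3) by ring.
    apply: dvdp_add; [exact: dvdp_mulr|apply: dvdp_mulr].
    by rewrite dvdp_mul2r // dvdp_mul2l // /B exprS dvdp_mulr.
  rewrite (kloo_termE _ _ F0 inv').
  have -> : a * (y' - B * w * y' ^+ 2 + B ^+ 2 * w ^+ 2 * y' ^+ 3) + b * (y + B * w) =
    (a * y' + b * y) + ((b - a * y' ^+ 2) * (B * w) + a * y' ^+ 3 * w ^+ 2 * (B * B)) by ring.
  rewrite tE e_modD //; congr (_ * _).
  have -> : B * t * (B * w) + a * y' ^+ 3 * w ^+ 2 * (B * B) = (a * y' ^+ 3 * w ^+ 2 + t * w) * (B * B) by ring.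
  have -> : B * P * B = P * (B * B) by ring.
  by rewrite e_modM // mulf_neq0.
rewrite (rsum_ext _ termE) /rsum -mulr_sumr cabsM cabs_e_mod mul1r.
have y'P : coprimep (a * y' ^+ 3) P.
  rewrite coprimepMl aP coprimep_expl //.
  have [] // := @inv_mod_uniq P y' y P0 _.
  by rewrite mulrC; apply: dvdp_trans yy'; rewrite mulrAC dvdp_mull.
have := gauss_sum t pP y'P; rewrite /rsum; set g := cabs _ => gE.
by rewrite -gE sqrtr_sqr ger0_norm ?cabs_ge0.
Qed.

End Kloosterman.

(** * Kloosterman sums over finite fields and modulo primes *)

Section FieldKloosterman.
Variables (R : realType) (L : finFieldType) (psi : L -> R[i]).
Local Notation C := R[i].
Hypotheses (psiD : forall s t, psi (s + t) = psi s * psi t)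
  (psi_abs : forall s, cabs (psi s) = 1) (psi_nontriv : exists s, psi s != 1).
Implicit Types (a b s t : L) (f g : {poly L}).

(* [f'(0)/f(0)] and [f'(1)/f(1)] are additive in [f], so this is an even
   character modulo X^2 (X-1)^2, and on [X + c] it is a Kloosterman phase. *)
Let chi a b f : C := if (f.[0] != 0) && (f.[1] != 0)
  then psi (a * (f^`().[0] / f.[0]) + b * (f^`().[1] / f.[1])) else 0.
Let E : {poly L} := 'X ^+ 2 * ('X - 1) ^+ 2.

Let add0 : psi 0 = 1.
Proof.
have p0 : psi 0 != 0 by rewrite -cabs_eq0 psi_abs oner_eq0.
by apply: (mulfI p0); rewrite mulr1 -psiD addr0.
Qed.

Let sizeE : size E = 5%N.
Proof.
rewrite size_mul ?expf_neq0 ?polyX_eq0 ?polyXsubC_eq0 -1?polyC1 //.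
by rewrite size_exp_XsubC -['X]subr0 -polyC0 size_exp_XsubC.
Qed.

Let dvdE f : E %| f -> [/\ f.[0] = 0, f.[1] = 0, f^`().[0] = 0 & f^`().[1] = 0].
Proof.
case/dvdpP => g ->; rewrite /E !expr2 !derivM !derivB derivX derivC.
rewrite !(hornerM, hornerD, hornerN, hornerX, hornerC).
by split; ring.
Qed.

Let chi1 a b : chi a b 1 = 1.
Proof. by rewrite /chi !hornerC oner_eq0 /= derivC !hornerC !mul0r !mulr0 addr0 add0. Qed.

Let chiM a b f g : chi a b (f * g) = chi a b f * chi a b g.
Proof.
rewrite /chi !hornerM !mulf_eq0 !negb_or !derivM !hornerD !hornerM.
have [f0|] := eqVneq f.[0] 0; first by rewrite mul0r.
have [f1|] := eqVneq f.[1] 0; first by rewrite /= !andbF mul0r.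
have [g0|] := eqVneq g.[0] 0; first by rewrite mulr0.
have [g1|] := eqVneq g.[1] 0; first by rewrite /= mulr0.
move=> g1 g0 f1 f0 /=; rewrite -psiD; congr psi.
by field; apply/and4P; split.
Qed.

Let chiE a b f g : E %| f - g -> chi a b f = chi a b g.
Proof.
move=> /dvdE[]; rewrite derivB !hornerD !hornerN.
by move=> /subr0_eq h0 /subr0_eq h1 /subr0_eq h2 /subr0_eq h3; rewrite /chi h0 h1 h2 h3.
Qed.

Let chiZ a b c f : c != 0 -> chi a b (c *: f) = chi a b f.
Proof.
move=> c0; rewrite /chi derivZ !hornerZ !mulf_eq0 !(negPf c0) /=.
have [f0 //|] := eqVneq f.[0] 0; have [f1 //|] := eqVneq f.[1] 0 => f1 f0 /=.
by congr psi; field; rewrite c0 f0 f1.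
Qed.

Let chi_le1 a b f : cabs (chi a b f) <= 1.
Proof. by rewrite /chi; case: ifP => _; rewrite ?psi_abs ?cabs0 ?ler01. Qed.

Let chi_nontriv a b : b != 0 -> exists2 u, coprimep u E & chi a b u != 1.
Proof.
move=> b0; have [s ps] := psi_nontriv.
(* Here f(0) = f(1) = 1, f'(0) = 0 and f'(1) = s/b. *)
pose f : {poly L} := 1 + (s / b) *: ('X ^+ 2 * ('X - 1)).
exists f.
  have h : coprimep f ('X * ('X - 1)).
    apply/Bezout_coprimepP; exists (1, - ((s / b) *: 'X)) => /=.
    rewrite mul1r mulNr /f -scalerAl.
    by have -> : 1 + (s / b) *: ('X^2 * ('X - 1)) - (s / b) *: ('X * ('X * ('X - 1))) = 1 :> {poly L}; [rewrite mulrA addrK|exact: eqpxx].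
  by rewrite /E -exprMn coprimep_expr.
rewrite /chi /f derivD derivZ derivM derivXn derivB derivX derivC.
rewrite !(hornerM, hornerD, hornerN, hornerX, hornerC, horner_exp, hornerMn, hornerZ).
rewrite !(subrr, expr0n, expr1n, mul0r, mulr0, mulr1, addr0, add0r, subr0) /= oner_eq0 /=.
by rewrite divr1 mulrC divfK.
Qed.

(** At f = X + 1/(x-1) the two logarithmic derivatives are x - 1 and 1 - 1/x, so the degree 1 sum of
    [chi b (- a)] is the Kloosterman sum without x = 1, up to a phase. The modulus has degree 4, and
    the missing term raises the constant to 5. *)
Lemma field_kloosterman a b : a != 0 ->
  cabs (\sum_(x : L | x != 0) psi (a / x + b * x)) <= 5%:R * Num.sqrt #|L|%:R.
Proof.
move=> a0; have Na0 : - a != 0 by rewrite oppr_eq0.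
have E1 : (1 < size E)%N by rewrite sizeE.
have := cabs_sum_chi_deg1 E1 (chi1 b (- a)) (chiM b (- a)) (@chiE b (- a)) (@chiZ b (- a)) (chi_le1 b (- a)) (chi_nontriv b Na0).
rewrite sizeE /=.
have -> : \sum_(f <- mon L 1) chi b (- a) f = psi (- a - b) * \sum_(x : L | (x != 0) && (x != 1)) psi (a / x + b * x).
  rewrite sum_monXn expr1.
  have sz (x : L) : (x - 1)^-1%:P \is a poly_of_size 1 by rewrite qualifE /= size_polyC; case: (_ != 0).
  have hinj : injective (fun x => NPoly (sz x) : {poly_1 L}).
    by move=> x y /(congr1 val) /= /polyC_inj /invr_inj /addIr.
  have hbij := inj_card_bij hinj; rewrite card_npoly expn1 in hbij.
  rewrite (reindex _ (onW_bij _ (hbij (leqnn _)))) mulr_sumr [RHS]big_mkcond /=.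
  apply: eq_bigr => x _; rewrite /chi derivD derivX derivC !(hornerD, hornerX, hornerC) add0r addr0.
  have [->|x1] := eqVneq x 1; first by rewrite subrr invr0 eqxx andbF.
  have {}x1 : x - 1 != 0 by rewrite subr_eq0.
  rewrite invr_eq0 x1 andbT /=.
  have -> : 1 + (x - 1)^-1 = x / (x - 1) by field.
  rewrite mulf_eq0 invr_eq0 (negPf x1) orbF; case: ifPn => // x0.
  by rewrite !div1r invrK invf_div -psiD; congr psi; field.
rewrite cabsM psi_abs mul1r => h.
rewrite (bigD1 1) ?oner_eq0 //=; apply: le_trans (cabsD _ _) _; rewrite psi_abs.
apply: (@le_trans _ _ (1 + 4%:R * Num.sqrt #|L|%:R)); first by rewrite lerD2l.
have : (1 : R) <= Num.sqrt #|L|%:R by rewrite -[X in X <= _]sqrtr1 ler_wsqrtr // ler1n; apply/card_gt0P; exists 0.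
by move: (Num.sqrt _) => z z1; lra.
Qed.

End FieldKloosterman.

Section PrimeKloosterman.
Variables (R : realType) (K : finFieldType) (p : nat) (pK : p \in [pchar K]).
Hypothesis p_odd : odd p.
Local Notation C := R[i].
Local Notation q := #|K|.
Local Notation e := (e_mod R pK).
Implicit Types P x y a b c : {poly K}.

Lemma mprime_irr P : mprime P -> monic_irreducible_poly P.
Proof. by move=> /mprimeP[mP iP]; split. Qed.

Lemma kloo_prime P a b : mprime P -> coprimep a P ->
  cabs (kloo R pK a b P) <= 5%:R * Num.sqrt (q ^ (size P).-1)%:R.
Proof.
move=> pP aP; have hP := mprime_irr pP; have P0 := mprime_neq0 pP.
pose L : finFieldType := {poly %/ P with hP}.
have PE : mk_monic P = P by exact: mk_monicE.
have Lin (x : {poly K}) : P %| (in_qpoly P x : {poly K}) - x.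
  rewrite /in_qpoly /= PE -Pdiv.IdomainMonic.modpE; last exact: hP.2.
  by rewrite -opprB {1}(divp_eq x P) addrK dvdpNr dvdp_mull.
pose v (x : L) : {poly K} := (x : {poly %/ P with hP}).
have Lmul (x y : L) : P %| v (x * y) - v x * v y := Lin (v x * v y).
have Ladd (x y : L) : v (x + y) = v x + v y by [].
have L1 : v 1 = 1 by [].
have cL : #|L| = (q ^ (size P).-1)%N by rewrite card_qfpoly.
have v_inj (x y : L) : P %| v x - v y -> x = y.
  move=> d; have sv z : (size (v z) < size P)%N by apply: leq_trans (size_mk_monic _) _; rewrite PE.
  apply: val_inj; rewrite -[LHS](modp_small (sv x)) -[RHS](modp_small (sv y)).
  by apply/eqP; rewrite -subr_eq0 -modpN -modpD; apply/eqP/modp_eq0P.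
have v0 : v 0 = 0 by [].
pose w (x : {poly K}) : L := in_qpoly P x.
have {}Lin x : P %| v (w x) - x := Lin x.
pose psi (t : L) := e P (v t).
have psiD s t : psi (s + t) = psi s * psi t by rewrite /psi Ladd e_modD.
have psi_abs s : cabs (psi s) = 1 by exact: cabs_e_mod.
have vE (x : L) : x != 0 -> P %| v x * v x^-1 - 1.
  by move=> x0; rewrite -L1 -(mulfV x0) -opprB dvdpNr Lmul.
have v_cop (x : L) : coprimep (v x) P = (x != 0).
  have [->|x0] := eqVneq x 0; first by rewrite v0 coprime0p; apply/negbTE; rewrite -size_poly_eq1 gtn_eqF ?mprime_size.
  by have [] := inv_mod_uniq P0 (vE x x0).
have psi_nontriv : exists s, psi s != 1.
  apply: contrapT => noS; have all1 s : psi s = 1.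
    by apply/eqP; apply: contrapT => h; apply: noS; exists s; apply/negP.
  have := sum_e_mod_full R pK p_odd 1 P0.
  rewrite dvdp1; have /gtn_eqF := mprime_size pP; rewrite eq_sym => ->.
  under eq_bigr => u _ do rewrite mul1r -(e_mod_mod R pK P0 (Lin u)) -/(psi _) all1.
  by move/eqP; rewrite sumr_const card_npoly pnatr_eq0 expn_eq0 -leqn0 leqNgt (ltnW (finNzRing_gt1 K)).
have wa0 : w a != 0.
  by rewrite -v_cop -(@coprimep_periodic _ P a) // -opprB dvdpNr.
have := field_kloosterman psiD psi_abs psi_nontriv (w b) wa0; rewrite cL.
suff -> : kloo R pK a b P = \sum_(x : L | x != 0) psi (w a / x + w b * x) by [].
rewrite /kloo (rsum_reindex (h := v)) //; last exact: kloo_term_periodic.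
rewrite [RHS]big_mkcond; apply: eq_bigr => x _; have [->|x0] /= := eqVneq x 0.
  by have := v_cop 0; rewrite v0 eqxx /kloo_term => ->.
rewrite (kloo_termE _ _ _ _ P0 (vE x x0)); apply: e_mod_mod => //.
rewrite Ladd.
have key A B A' B' X X' : P %| A - A' * X' -> P %| B - B' * X -> P %| A' - a -> P %| B' - b ->
    P %| a * X' + b * X - (A + B).
  move=> h1 h2 h3 h4; have -> : a * X' + b * X - (A + B) =
    - (A - A' * X') - (B - B' * X) - (A' - a) * X' - (B' - b) * X by ring.
  by do 3?[apply: dvdp_sub]; rewrite ?dvdpNr //; exact: dvdp_mulr.
exact: key (Lmul _ _) (Lmul _ _) (Lin _) (Lin _).
Qed.

End PrimeKloosterman.

Section KloostermanBound.
Variables (R : realType) (K : finFieldType) (p : nat) (pK : p \in [pchar K]).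
Hypothesis p_odd : odd p.
Local Notation C := R[i].
Local Notation q := #|K|.
Local Notation e := (e_mod R pK).
Local Notation qpow := (qpow K).
Local Notation dg := (dg R).
Implicit Types F G P a b : {poly K}.

Lemma sqrt_cardX n : Num.sqrt (q ^ n)%:R = qpow (1 / 2 * n%:R) :> R.
Proof.
apply/eqP; rewrite -(@eqrXn2 _ 2) ?sqrtr_ge0 ?qpow_ge0 // sqr_sqrtr // qpowX -qpow_nat.
by apply/eqP; congr (qpow _); lra.
Qed.

Lemma cabs_kloo1 a b : cabs (kloo R pK a b 1) <= 1.
Proof.
rewrite /kloo /rsum size_poly1 /=; apply: le_trans (cabs_sum _ _ _) _.
apply: (@le_trans _ _ (\sum_(i : {poly_0 K}) 1)).
  by apply: ler_sum => i _; exact: cabs_kloo_term.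
by rewrite sumr_const card_npoly expn0.
Qed.

(** The factor 3 (k + 1), in the shape required by [growth], covers the 5 of a prime modulus and the
    2 of higher powers. *)
Lemma kloo_pow P k a b : mprime P -> (0 < k)%N -> coprimep a P ->
  cabs (kloo R pK a b (P ^+ k)) <= 3%:R * k.+1%:R * qpow (1 / 2 * (k%:R * dg P)).
Proof.
move=> pP k0 aP; have q0 := qpow_ge0 K (1 / 2 * (k%:R * dg P)).
have dgE h : (size (P ^+ h)%R).-1%:R = h%:R * dg P := dgX _ _ _.
have three x y : 2 <= x :> R -> 0 <= y -> 2 * y <= 3%:R * x * y by move=> ? ?; nra.
have [k1|k1] := eqVneq k 1%N.
  rewrite k1 expr1 [1%:R * dg P]mul1r; apply: le_trans (kloo_prime R pK p_odd b pP aP) _.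
  by rewrite sqrt_cardX; move: q0; rewrite k1 [1%:R * dg P]mul1r /dg; lra.
have k2 : 2 <= k.+1%:R :> R by rewrite ler_nat; lia.
apply: le_trans (three _ _ k2 q0).
have [h [kE|kE]] : exists h, k = (h + h)%N \/ k = (h.+1 + 1 + h.+1)%N.
  exists (if odd k then k./2.-1 else k./2).
  by have := odd_double_half k; case: odd => /=; [right|left]; lia.
- rewrite {1}kE exprD; apply: le_trans (kloo_even R pK p_odd h b pP aP) _.
  rewrite ler_wpM2l // -qpow_nat ler_qpow // dgE kE natrD.
  by lra.
rewrite {1}kE !exprD expr1; apply: le_trans (kloo_odd R pK p_odd h b pP aP) _.
rewrite ler_wpM2l // sqrt_cardX -qpow_nat -qpowD ler_qpow // dgE kE !natrD /dg.
by move: (h.+1%:R) (_.-1%:R) => y z; lra.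
Qed.

Lemma kloosterman eta : 0 < eta -> exists2 c : R, 1 <= c &
  forall F a b, F \is monic -> coprimep a F ->
    cabs (kloo R pK a b F) <= c * qpow ((1 / 2 + eta) * dg F).
Proof.
move=> eta0; have [c c1 Hc] := @growth R K 3%:R (1 / 2) eta (ler1n _ 3) eta0; exists c => // F a b mF aF.
have := Hc (fun N x => forall a b, coprimep a N -> cabs (kloo R pK a b N) <= x) 1 ler01 _ _ _ F mF a b aF.
rewrite mulr1; apply => {a b aF F mF}.
- by move=> N x y xy h a b aN; apply: le_trans xy; exact: h.
- by move=> a b _; exact: cabs_kloo1.
move=> P N k x pP mN PN k0 x0 HN a b; rewrite coprimepMr coprimep_pexpr // => /andP[aP aN].
have P0 := mprime_neq0 pP.
have copPN : coprimep (P ^+ k) N by rewrite coprimep_pexpl // mprime_coprime.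
have [c' [d [cP dN ->]]] := kloo_crt R pK p_odd a b (expf_neq0 k P0) (monic_neq0 mN) copPN.
rewrite cabsM ler_pM ?cabs_ge0 //; last exact/HN/dN.
apply: kloo_pow => //; have := cP; rewrite coprimep_pexpr // => h.
by have := h; rewrite !coprimep_pexpr //; apply.
Qed.

(** * Incomplete Kloosterman sums *)
Lemma sum_npoly_embed N r (V : nmodType) (f : {poly K} -> V) : (N <= r)%N ->
  \sum_(w : {poly_r K} | (size (w : {poly K}) <= N)%N) f w = \sum_(v : {poly_N K}) f v.
Proof.
move=> Nr; rewrite (reindex_onto (fun v : {poly_N K} => npolyp r v) (fun w : {poly_r K} => npolyp N w)) /=.
  apply: eq_big => [v|v _]; last by rewrite npolypK // (leq_trans (size_npoly v)).
  have sv := size_npoly v.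
  by rewrite !npolypK ?sv /=; [apply/eqP/val_inj; rewrite /= npolypK|exact: leq_trans Nr].
by move=> w sw; apply: val_inj; rewrite /= !npolypK // size_npoly.
Qed.

(** For N < r the indicator of X^N + v, deg v < N, is a mean of the q^(r-N) characters of frequency
    t with deg t < r - N, so completion loses nothing. For N >= r the sum consists of q^(N-r)
    complete ones. *)
Lemma cabs_incomplete F a N M : F \is monic -> 0 <= M ->
  (forall b, cabs (kloo R pK a b F) <= M) ->
  cabs (\sum_(y <- mon K N | coprimep y F) e F (a * inv_mod F y))
    <= M * Num.max 1 (qpow (N%:R - dg F)).
Proof.
move=> mF M0 HM; have F0 := monic_neq0 mF.
pose g := kloo_term R pK a 0 F.
have gE y : (if coprimep y F then e F (a * inv_mod F y) else 0) = g y.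
  by rewrite /g /kloo_term mul0r addr0.
have gF : periodic F g by exact: kloo_term_periodic.
rewrite big_mkcond /=; under eq_bigr do rewrite gE.
have [rN|Nr] := leqP (size F).-1 N.
  have sF : size F = (size F).-1.+1 by rewrite prednK ?size_poly_gt0.
  have gM y : g y = g (y %% F) by apply: gF; rewrite {1}(divp_eq y F) addrK dvdp_mull.
  rewrite -{1}(subnKC rN); under eq_bigr do rewrite gM.
  rewrite (sum_mon_mod _ _ sF) -[X in cabs X]mulr_natr cabsM cabs_nat ler_pM ?cabs_ge0 //; first exact: HM.
  by rewrite le_max -qpow_nat natrB // lexx orbT.
apply: (@le_trans _ _ (M * 1)); last by rewrite ler_wpM2l // le_max lexx.
rewrite sum_monXn mulr1; set r := (size F).-1 in Nr *.
have qr0 : 0 < (q ^ (r - N))%:R :> R by rewrite ltr0n expn_gt0 ltnW // finNzRing_gt1.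
rewrite -(ler_pM2l qr0) -[X in X * cabs _]cabs_nat -cabsM.
have -> : (q ^ (r - N))%:R * \sum_(v : {poly_N K}) g ('X^N + (v : {poly K})) =
   \sum_(t : {poly_(r - N) K}) e F (- ((t : {poly K}) * 'X^N)) * kloo R pK a t F.
  transitivity (rsum F (fun w => g (w + 'X^N) * \sum_(t : {poly_(r - N) K}) e F (w * (t : {poly K})))).
    rewrite -(sum_npoly_embed (r := r) (fun v => g ('X^N + v))) ?(ltnW Nr) // mulr_sumr /rsum big_mkcond /=.
    apply: eq_bigr => w _; rewrite sum_e_modE ?leq_subr // subKn ?(ltnW Nr) //.
    rewrite modp_small; last by rewrite (leq_ltn_trans (size_npoly w)) // ltn_predL size_poly_gt0.
    by case: ifP => _; rewrite ?mulr0 // addrC mulrC.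
  rewrite /rsum; under eq_bigr do rewrite mulr_sumr.
  rewrite exchange_big; apply: eq_bigr => t _; rewrite /kloo.
  rewrite -[RHS](_ : rsum F (fun w => e F (- ((t : {poly K}) * 'X^N)) * kloo_term R pK a t F w) = _); last by rewrite /rsum mulr_sumr.
  have per : periodic F (fun w => e F (- ((t : {poly K}) * 'X^N)) * kloo_term R pK a t F w).
    by move=> x y xy; congr (_ * _); exact: kloo_term_periodic xy.
  rewrite -(rsum_shift 'X^N F0 per); apply: eq_bigr => w _.
  rewrite /g /kloo_term; case: ifP => _; last by rewrite mul0r mulr0.
  by rewrite -!e_modD //; congr (e F _); clear per; move: (w : {poly K}) (t : {poly K}) => {}w {}t; ring.
apply: le_trans (cabs_sum _ _ _) _; rewrite mulrC.
apply: (@le_trans _ _ (\sum_(t : {poly_(r - N) K}) M)).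
  by apply: ler_sum => t _; rewrite cabsM cabs_e_mod mul1r.
by rewrite sumr_const card_npoly mulr_natr.
Qed.

End KloostermanBound.

(** * Bilinear forms *)
Section PowerMean.
Variable R : realType.

Lemma chebyshev_sum (I : finType) (P : pred I) (a : I -> R) k : (forall i, 0 <= a i) ->
  (\sum_(i | P i) a i) * (\sum_(i | P i) a i ^+ k) <= #|P|%:R * \sum_(i | P i) a i ^+ k.+1.
Proof.
move=> a0; rewrite -(ler_pM2l (ltr0Sn R 1)) -subr_ge0.
have -> : 2%:R * (#|P|%:R * \sum_(i | P i) a i ^+ k.+1) - 2%:R * ((\sum_(i | P i) a i) * (\sum_(i | P i) a i ^+ k)) =
   \sum_(i | P i) \sum_(j | P j) (a i - a j) * (a i ^+ k - a j ^+ k).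
  have e1 : \sum_(i | P i) \sum_(j | P j) (a i - a j) * (a i ^+ k - a j ^+ k) =
     \sum_(i | P i) \sum_(j | P j) (a i ^+ k.+1 + a j ^+ k.+1) - \sum_(i | P i) \sum_(j | P j) (a i * a j ^+ k + a j * a i ^+ k).
    rewrite -sumrB; apply: eq_bigr => i _; rewrite -sumrB; apply: eq_bigr => j _.
    by rewrite !exprS; ring.
  rewrite {}e1; congr (_ - _).
    under [RHS]eq_bigr do rewrite big_split /= sumr_const.
    rewrite big_split /= sumr_const sumrMnl -mulr2n -[RHS]mulr_natl.
    by congr (_ * _); exact: mulr_natl.
  under [RHS]eq_bigr do rewrite big_split /= -mulr_sumr -mulr_suml.
  rewrite big_split /= -mulr_suml -mulr_sumr.
  by move: (\sum_(i | P i) a i) (\sum_(i | P i) _) => x y; ring.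
apply: sumr_ge0 => i _; apply: sumr_ge0 => j _.
have [ij|ji] := leP (a i) (a j).
  by rewrite mulr_le0 // subr_le0 // lerXn2r ?nnegrE.
by rewrite mulr_ge0 // subr_ge0 ?lerXn2r ?nnegrE // ltW.
Qed.

Lemma power_mean (I : finType) (P : pred I) (a : I -> R) k : (forall i, 0 <= a i) ->
  (\sum_(i | P i) a i) ^+ k.+1 <= #|P|%:R ^+ k * \sum_(i | P i) a i ^+ k.+1.
Proof.
move=> a0; elim: k => [|k IH]; first by rewrite expr0 mul1r.
have s0 : 0 <= \sum_(i | P i) a i by apply: sumr_ge0.
rewrite exprS; apply: le_trans (ler_wpM2l s0 IH) _.
rewrite mulrCA [X in _ <= X * _]exprSr -mulrA ler_wpM2l ?exprn_ge0 //.
exact: chebyshev_sum.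
Qed.

Lemma cauchy_sum (I : finType) (a b : I -> R) :
  (\sum_i a i * b i) ^+ 2 <= (\sum_i a i ^+ 2) * (\sum_i b i ^+ 2).
Proof.
rewrite -(ler_pM2l (ltr0Sn R 1)) -subr_ge0.
have -> : 2%:R * ((\sum_i a i ^+ 2) * (\sum_i b i ^+ 2)) - 2%:R * (\sum_i a i * b i) ^+ 2 =
   \sum_i \sum_j (a i * b j - a j * b i) ^+ 2.
  have e1 : \sum_i \sum_j (a i * b j - a j * b i) ^+ 2 =
     \sum_i \sum_j (a i ^+ 2 * b j ^+ 2 + b i ^+ 2 * a j ^+ 2) - \sum_i \sum_j 2%:R * ((a i * b i) * (a j * b j)).
    rewrite -sumrB; apply: eq_bigr => i _; rewrite -sumrB; apply: eq_bigr => j _.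
    by ring.
  rewrite {}e1; congr (_ - _).
    under [RHS]eq_bigr do rewrite big_split /= -!mulr_sumr.
    rewrite big_split /= -!mulr_suml.
    by move: (\sum_i a i ^+ 2) (\sum_i b i ^+ 2) => x y; ring.
  under [RHS]eq_bigr do rewrite -!mulr_sumr.
  by rewrite -mulr_sumr -mulr_suml expr2.
by apply: sumr_ge0 => i _; apply: sumr_ge0 => j _; exact: sqr_ge0.
Qed.

End PowerMean.

Section Bilinear.
Variables (R : realType) (K : finFieldType) (p : nat) (pK : p \in [pchar K]).
Hypothesis p_odd : odd p.
Local Notation C := R[i].
Local Notation q := #|K|.
Local Notation e := (e_mod R pK).
Implicit Types (F : {poly K}) (S T : finType).

Definition tuples T (D : pred T) k : pred {ffun 'I_k -> T} := fun f => [forall i, D (f i)].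
Definition fsum T (x : T -> {poly K}) k (f : {ffun 'I_k -> T}) := \sum_i x (f i).
Definition energy F T (x : T -> {poly K}) (D : pred T) k : nat :=
  \sum_(f | tuples D (k := k) f) \sum_(g | tuples D (k := k) g) (F %| fsum x f - fsum x g)%R.

Lemma expr_sum_e_mod F T (x : T -> {poly K}) (c : T -> C) s k : F != 0 ->
  (\sum_t c t * e F (x t * s)) ^+ k = \sum_(f : {ffun 'I_k -> T}) (\prod_i c (f i)) * e F (fsum x f * s).
Proof.
move=> F0; rewrite -[LHS](_ : \prod_(i < k) \sum_t c t * e F (x t * s) = _); last first.
  by rewrite prodr_const card_ord.
rewrite bigA_distr_bigA /=; apply: eq_bigr => f _; rewrite big_split /=; congr (_ * _).
by rewrite /fsum mulr_suml e_mod_sum.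
Qed.

Lemma prod_indicator T (D : pred T) (c : T -> C) k (f : {ffun 'I_k -> T}) :
  (forall t, cabs (c t) <= (D t)%:R) -> cabs (\prod_i c (f i)) <= (tuples D f)%:R.
Proof.
move=> cD; rewrite cabs_prod; have [h|] := boolP (tuples D f).
  by rewrite prodr_ile1 // => i _; rewrite cabs_ge0 (le_trans (cD _)) // lern1; case: (D _).
rewrite negb_forall => /existsP[i Di]; rewrite (bigD1 i) //=.
have := cD (f i); rewrite (negPf Di) => h.
have -> : cabs (c (f i)) = 0 by apply/eqP; rewrite eq_le cabs_ge0 h.
by rewrite mul0r.
Qed.

Lemma moment_energy F T (x : T -> {poly K}) (D : pred T) (c : T -> C) k : F != 0 ->
  (forall t, cabs (c t) <= (D t)%:R) ->
  \sum_(s : {poly_((size F).-1) K}) cabs (\sum_t c t * e F (x t * (s : {poly K}))) ^+ (2 * k)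
    <= (q ^ (size F).-1)%:R * (energy F x D k)%:R.
Proof.
move=> F0 cD; set r := (size F).-1.
pose b (f : {ffun 'I_k -> T}) := \prod_i c (f i).
have sq (s : {poly K}) : (cabs (\sum_t c t * e F (x t * s)) ^+ (2 * k))%:C =
   \sum_f \sum_g b f * conjc (b g) * e F ((fsum x f - fsum x g) * s).
  rewrite exprM exprAC -cabsX sqr_cabs expr_sum_e_mod // mulr_suml.
  apply: eq_bigr => f _; rewrite conjc_sum mulr_sumr; apply: eq_bigr => g _.
  have cM (u v : C) : conjc (u * v) = conjc u * conjc v by exact: rmorphM.
  by rewrite cM -e_modN // mulrBl e_modD // mulrACA.
apply: (@le_trans _ _ (cabs ((\sum_(s : {poly_r K}) cabs (\sum_t c t * e F (x t * (s : {poly K}))) ^+ (2 * k))%:C))).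
  by rewrite cabs_real ler_norm.
rewrite rmorph_sum /=; under eq_bigr do rewrite sq.
rewrite exchange_big /=; apply: le_trans (cabs_sum _ _ _) _.
rewrite /energy natr_sum mulr_sumr [X in _ <= X]big_mkcond /=; apply: ler_sum => f _.
rewrite exchange_big /=; apply: le_trans (cabs_sum _ _ _) _.
have bD h : cabs (b h) <= (tuples D h)%:R by exact: prod_indicator.
have [fD|fD] := boolP (tuples D f); last first.
  rewrite big1 // => g _; rewrite -mulr_sumr !cabsM.
  have := bD f; rewrite (negPf fD) => h.
  have -> : cabs (b f) = 0 by apply/eqP; rewrite eq_le cabs_ge0 h.
  by rewrite !mul0r.
rewrite natr_sum mulr_sumr [X in _ <= X]big_mkcond /=; apply: ler_sum => g _.
rewrite -mulr_sumr (sum_e_mod_full R pK p_odd) // !cabsM cabs_conj.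
have [gD|gD] := boolP (tuples D g); last first.
  have := bD g; rewrite (negPf gD) => h.
  have -> : cabs (b g) = 0 by apply/eqP; rewrite eq_le cabs_ge0 h.
  by rewrite mulr0 mul0r.
have b1 h : cabs (b h) <= 1 by apply: le_trans (bD h) _; rewrite lern1; case: (tuples _ _).
have bb : cabs (b f) * cabs (b g) <= 1 by rewrite mulr_ile1 ?cabs_ge0.
case: ifP => _; last by rewrite cabs0 !mulr0.
by rewrite cabs_nat mulr1 ler_piMl.
Qed.

Lemma tuples_card T (D : pred T) k : #|tuples D (k := k)| = (#|D| ^ k)%N.
Proof.
rewrite -[k in RHS]card_ord -card_ffun_on; apply: eq_card => f.
by apply/forallP/ffun_onP => h i; exact: h.
Qed.

(** Hölder over s with exponent k+1 produces (k+1)-tuples of T, and Hölder over these tuples uses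
    exponent l+1. Cauchy-Schwarz over the residue of the tuple sum then separates its fibre sizes,
    whose squares give the energy of y, from a moment that gives the energy of x. *)
Lemma bilinear_moment F S T (x : S -> {poly K}) (y : T -> {poly K}) (DS : pred S) (DT : pred T)
    (al : S -> C) (be : T -> C) k l : F != 0 ->
  (forall s, cabs (al s) <= (DS s)%:R) -> (forall t, cabs (be t) <= (DT t)%:R) ->
  cabs (\sum_s \sum_t al s * be t * e F (x s * y t)) ^+ (2 * (k.+1 * l.+1)) <=
  #|DS|%:R ^+ (2 * (k * l.+1)) * #|DT|%:R ^+ (2 * (k.+1 * l)) *
   (energy F y DT k.+1)%:R * ((q ^ (size F).-1)%:R * (energy F x DS l.+1)%:R).
Proof.
move=> F0 alD beD; set r := (size F).-1.
pose V s := \sum_t be t * e F (y t * x s).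
(* The phase that turns V^(k+1) into its modulus, so that the moment is again a sum linear in the
   characters. *)
pose th s : C := if DS s then (if V s == 0 then 0 else conjc (V s ^+ k.+1) / (cabs (V s) ^+ k.+1)%:C) else 0.
have thV s : DS s -> (cabs (V s) ^+ k.+1)%:C = th s * V s ^+ k.+1.
  move=> Ds; rewrite /th Ds; have [->|V0] := eqVneq (V s) 0; first by rewrite cabs0 !expr0n mulr0.
  have cV : (cabs (V s) ^+ k.+1)%:C != 0 by rewrite -cabsX (inj_eq (@complexI R)) cabs_eq0 expf_neq0.
  have cc : (cabs (V s) ^+ k.+1)%:C * (cabs (V s) ^+ k.+1)%:C = V s ^+ k.+1 * conjc (V s ^+ k.+1).
    by rewrite -sqr_cabs cabsX [in RHS]rmorphXn.
  by rewrite mulrAC [conjc _ * _]mulrC -cc mulfK.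
have thD s : cabs (th s) <= (DS s)%:R.
  rewrite /th; case: ifP => Ds; last by rewrite cabs0.
  have [_|V0] := eqVneq (V s) 0; first by rewrite cabs0.
  have cV : cabs (V s) ^+ k.+1 != 0 by rewrite expf_neq0 // cabs_eq0.
  rewrite -[X in _ <= X](mulfV cV) cabsM cabs_conj cabsX.
  by rewrite -fmorphV cabs_real ger0_norm // invr_ge0 exprn_ge0 // cabs_ge0.
pose G (z : {poly K}) := \sum_s th s * e F (x s * z).
have Gper : periodic F (fun z => (cabs (G z))%:C).
  move=> z w zw; congr ((cabs _)%:C); apply: eq_bigr => s _; congr (_ * _).
  by apply: e_mod_mod => //; rewrite -mulrBr dvdp_mull.
have step1 : cabs (\sum_s \sum_t al s * be t * e F (x s * y t)) ^+ k.+1 <=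
    #|DS|%:R ^+ k * \sum_(f | tuples DT (k := k.+1) f) cabs (G (fsum y f)).
  apply: (@le_trans _ _ ((\sum_(s | DS s) cabs (V s)) ^+ k.+1)).
    rewrite lerXn2r ?nnegrE ?cabs_ge0 ?sumr_ge0 // => [s _|]; first exact: cabs_ge0.
    apply: le_trans (cabs_sum _ _ _) _; rewrite [X in _ <= X]big_mkcond; apply: ler_sum => s _.
    have -> : \sum_t al s * be t * e F (x s * y t) = al s * V s.
      by rewrite mulr_sumr; apply: eq_bigr => t _; rewrite -mulrA [x s * _]mulrC.
    have := alD s; rewrite cabsM; case: (DS s) => h; first by rewrite ler_piMl ?cabs_ge0.
    by have -> : cabs (al s) = 0; [apply/eqP; rewrite eq_le cabs_ge0 h|rewrite mul0r].
  apply: le_trans (power_mean _ _ _) _; first by move=> s; exact: cabs_ge0.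
  apply: ler_wpM2l; first by rewrite exprn_ge0.
  apply: (@le_trans _ _ (cabs (\sum_(s | DS s) (cabs (V s) ^+ k.+1))%:C)); first by rewrite cabs_real ler_norm.
  rewrite rmorph_sum /= (eq_bigr _ thV) big_mkcond /=.
  rewrite (eq_bigr (fun s => \sum_(f : {ffun 'I_k.+1 -> T}) (\prod_i be (f i)) * (th s * e F (x s * fsum y f)))); last first.
    move=> s _; transitivity (th s * V s ^+ k.+1); first by case: ifP => // Ds; rewrite /th Ds mul0r.
    rewrite /V expr_sum_e_mod // mulr_sumr; apply: eq_bigr => f _.
    by rewrite mulrCA [x s * _]mulrC.
  rewrite exchange_big /=; apply: le_trans (cabs_sum _ _ _) _; rewrite [X in _ <= X]big_mkcond.
  apply: ler_sum => f _; rewrite -mulr_sumr -/(G _) cabsM.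
  have := prod_indicator f beD; case: (tuples DT f) => h; first by rewrite ler_piMl ?cabs_ge0.
  by have -> : cabs (\prod_i be (f i)) = 0; [apply/eqP; rewrite eq_le cabs_ge0 h|rewrite mul0r].
pose W := \sum_(f | tuples DT (k := k.+1) f) cabs (G (fsum y f)).
have W0 : 0 <= W by apply: sumr_ge0 => f _; exact: cabs_ge0.
have sz z : z %% F \is a poly_of_size r by rewrite qualifE /= -ltnS prednK ?size_poly_gt0 // ltn_modp.
pose res z : {poly_r K} := NPoly (sz z).
have resE z : F %| z - (res z : {poly K}) by rewrite /= {1}(divp_eq z F) addrK dvdp_mull.
pose Nn (s : {poly_r K}) : nat := (\sum_(f | tuples DT (k := k.+1) f) (res (fsum y f) == s))%N.
pose N (s : {poly_r K}) : R := (Nn s)%:R.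
have step2 : W ^+ (2 * l.+1) <= (#|DT|%:R ^+ k.+1) ^+ (2 * l) *
    ((energy F y DT k.+1)%:R * ((q ^ r)%:R * (energy F x DS l.+1)%:R)).
  rewrite mulnC exprM.
  apply: (@le_trans _ _ (((#|DT|%:R ^+ k.+1) ^+ l * \sum_(s : {poly_r K}) N s * cabs (G s) ^+ l.+1) ^+ 2)).
    rewrite lerXn2r ?nnegrE ?exprn_ge0 //.
      rewrite mulr_ge0 ?exprn_ge0 // sumr_ge0 // => s _.
      by rewrite mulr_ge0 ?ler0n ?exprn_ge0 ?cabs_ge0.
    apply: le_trans (power_mean _ _ _) _; first by move=> s; exact: cabs_ge0.
    rewrite tuples_card natrX ler_wpM2l ?exprn_ge0 //.
    have -> : \sum_(s : {poly_r K}) N s * cabs (G s) ^+ l.+1 =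
       \sum_(s : {poly_r K}) \sum_(f | tuples DT (k := k.+1) f) (res (fsum y f) == s)%:R * cabs (G s) ^+ l.+1.
      by apply: eq_bigr => s _; rewrite /N natr_sum mulr_suml.
    rewrite exchange_big /=; apply: ler_sum => f _.
    rewrite (bigD1 (res (fsum y f))) //= eqxx mul1r big1 ?addr0; last first.
      by move=> s /negPf; rewrite eq_sym => ->; rewrite mul0r.
    by have /complexI -> := Gper _ _ (resE (fsum y f)).
  rewrite exprMn [(2 * l)%N]mulnC [in X in _ <= X * _]exprM ler_wpM2l ?exprn_ge0 //.
  apply: le_trans (cauchy_sum _ _) _.
  rewrite ler_pM ?sumr_ge0 // => [s _|s _||]; rewrite ?sqr_ge0 //.
    rewrite (eq_bigr (fun s => (Nn s ^ 2)%:R)); last by move=> s _; rewrite natrX.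
    rewrite -natr_sum ler_nat /energy /Nn.
    under eq_bigr => s _ do rewrite expnS expn1 big_distrlr /=.
    rewrite exchange_big /=; apply: leq_sum => f _; rewrite exchange_big /=; apply: leq_sum => g _.
    rewrite (bigD1 (res (fsum y f))) //= eqxx mul1n big1 ?addn0; last first.
      by move=> s /negPf; rewrite eq_sym => ->; rewrite mul0n.
    case: eqP => // rr; rewrite [(F %| _)%R](_ : _ = true) //.
    have := dvdp_sub (resE (fsum y f)) (resE (fsum y g)); rewrite rr.
    by rewrite opprB addrA subrK.
  under eq_bigr => s _ do rewrite -exprM mulnC.
  exact: moment_energy.
have -> : (2 * (k.+1 * l.+1) = k.+1 * (2 * l.+1))%N by rewrite mulnCA.
rewrite exprM; apply: (@le_trans _ _ ((#|DS|%:R ^+ k * W) ^+ (2 * l.+1))).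
  by rewrite lerXn2r ?nnegrE ?exprn_ge0 ?cabs_ge0 // mulr_ge0 ?exprn_ge0.
rewrite exprMn -exprM (_ : (k * (2 * l.+1) = 2 * (k * l.+1))%N); last by rewrite mulnCA.
rewrite -!mulrA ler_wpM2l ?exprn_ge0 //; apply: le_trans step2 _.
by rewrite -exprM (_ : (k.+1 * (2 * l) = 2 * (k.+1 * l))%N) // mulnCA.
Qed.

End Bilinear.

(** * Additive energy of inverses *)
Section Energy.
Variables (R : realType) (K : finFieldType).
Local Notation q := #|K|.
Local Notation dg := (dg R).
Implicit Types (F G P x y z s u v : {poly K}) (T : finType).

Definition monp m (v : {poly_m K}) : {poly K} := 'X^m + (v : {poly K}).

Lemma monp_inj m : injective (@monp m).
Proof. by move=> v w /addrI /val_inj. Qed.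

Lemma monp_mon m (v : {poly_m K}) : monp v \in mon K m.
Proof. exact: mem_monXn (size_npoly v). Qed.

Lemma size_monp m (v : {poly_m K}) : size (monp v) = m.+1.
Proof. by have /monP[] := monp_mon v. Qed.

Lemma dvdp_small F x : F %| x -> (size x < size F)%N -> x = 0.
Proof. by move=> Fx sx; apply/eqP; apply: contraTT sx => x0; rewrite -leqNgt dvdp_leq. Qed.

Lemma card_le_inj (S T : finType) (A : pred S) (h : S -> T) :
  {in A &, injective h} -> (#|A| <= #|T|)%N.
Proof. by move=> hA; rewrite -(card_in_image hA) max_card. Qed.

Lemma card_fibers (S T : finType) (A : pred S) (k : S -> T) :
  #|A| = (\sum_t #|[pred s | A s && (k s == t)]|)%N.
Proof.
by rewrite -sum1_card (partition_big k predT) //=; apply: eq_bigr => t _; rewrite sum1_card.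
Qed.

Lemma fiber_count m F s : F != 0 ->
  (#|[pred v : {poly_m K} | (F %| monp v - s)%R]| <= q ^ (m - (size F).-1))%N.
Proof.
move=> F0; set S := [pred v | _]; case: (pickP S) => [v0 Sv0|S0]; last by rewrite (eq_card0 S0).
have dS (v : {poly_m K}) : S v -> F %| (v : {poly K}) - (v0 : {poly K}).
  move=> Sv; have -> : (v : {poly K}) - (v0 : {poly K}) = (monp v - s) - (monp v0 - s).
    by rewrite /monp; move: (v : {poly K}) (v0 : {poly K}) => a b; ring.
  exact: dvdp_sub.
pose h (v : {poly_m K}) := npolyp (m - (size F).-1) (((v : {poly K}) - (v0 : {poly K})) %/ F).
have sz (v : {poly_m K}) : (size (((v : {poly K}) - (v0 : {poly K})) %/ F)%R <= m - (size F).-1)%N.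
  rewrite size_divp //; apply: leq_sub2r; apply: leq_trans (size_polyD _ _) _.
  by rewrite size_polyN geq_max !size_npoly.
rewrite -(card_npoly K (m - (size F).-1)); apply: (card_le_inj (h := h)) => v w Sv Sw /(congr1 val) /=; rewrite !npolypK ?sz // => eq.
apply: val_inj; apply: (addIr (- (v0 : {poly K}))).
by rewrite -[LHS](divpK (dS v Sv)) -[RHS](divpK (dS w Sw)) eq.
Qed.

(** v has V free coefficients, against the V - 1 top coefficients of s v mod F. *)
Lemma dirichlet F s V : F != 0 -> (0 < V)%N -> (V <= (size F).-1)%N ->
  exists v, [/\ v != 0, (size v <= V)%N & (size ((s * v) %% F)%R <= (size F).-1 - V.-1)%N].
Proof.
move=> F0 V0 Vr; set r := (size F).-1 in Vr *; pose k := (r - V.-1)%N.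
have sd (v : {poly K}) : (size (drop_poly k ((s * v) %% F)) <= V.-1)%N.
  rewrite size_drop_poly; have : (size ((s * v) %% F)%R < size F)%N by rewrite ltn_modp.
  by move: Vr V0; rewrite /k /r; move: (size F) (size ((s * v) %% F)%R) => c d; lia.
pose h (v : {poly_V K}) := npolyp V.-1 (drop_poly k ((s * (v : {poly K})) %% F)).
have : ~ injective h.
  move=> /leq_card; rewrite !card_npoly leqNgt ltn_exp2l ?finNzRing_gt1 //.
  by rewrite ltn_predL V0.
move=> /injectiveP /injectivePn[v [w vw /(congr1 val) /=]].
rewrite !npolypK // => eq; exists ((v : {poly K}) - (w : {poly K})); split.
- by rewrite subr_eq0; apply: contraNneq vw => vw; apply/eqP/val_inj.
- by rewrite (leq_trans (size_polyD _ _)) // size_polyN geq_max !size_npoly.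
rewrite mulrBr modpD modpN -(poly_take_drop k (_ %% F)) -(poly_take_drop k ((s * (w : {poly K})) %% F)) eq.
rewrite opprD addrACA subrr addr0 (leq_trans (size_polyD _ _)) // size_polyN geq_max.
by rewrite !size_take_poly.
Qed.

Lemma inv_mod_sub F x y : F != 0 -> coprimep x F -> coprimep y F ->
  (F %| inv_mod F x - inv_mod F y) = (F %| x - y).
Proof.
move=> F0 xF yF; have xx := inv_modP F0 xF; have yy := inv_modP F0 yF.
set x' := inv_mod F x in xx *; set y' := inv_mod F y in yy *.
apply/idP/idP => d.
  have -> : x - y = (x * x' - 1) * y - (y * y' - 1) * x - (x' - y') * (x * y) by ring.
  by do 2?[apply: dvdp_sub]; exact: dvdp_mulr.
have -> : x' - y' = (x * x' - 1) * y' - (y * y' - 1) * x' - (x - y) * (x' * y') by ring.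
by do 2?[apply: dvdp_sub]; exact: dvdp_mulr.
Qed.

Variable F : {poly K}.
Hypothesis mF : F \is monic.
Let F0 : F != 0. Proof. exact: monic_neq0. Qed.
Let r := (size F).-1.
Let sF : size F = r.+1. Proof. by rewrite prednK ?size_poly_gt0. Qed.

Definition invp m (v : {poly_m K}) := inv_mod F (monp v).
Definition copp m : pred {poly_m K} := fun v : {poly_m K} => coprimep (monp v) F.
Definition inv_energy m k := energy F (@invp m) (@copp m) k.

Lemma energy_scale m a k : coprimep a F ->
  energy F (fun v : {poly_m K} => a * invp v) (@copp m) k = inv_energy m k.
Proof.
move=> aF; apply: eq_bigr => f _; apply: eq_bigr => g _; rewrite /fsum -!mulr_sumr -mulrBr.
by rewrite Gauss_dvdpr // coprimep_sym.
Qed.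

Lemma inv_energy1 m : (inv_energy m 1 <= q ^ m * q ^ (m - r))%N.
Proof.
rewrite /inv_energy /energy; apply: (@leq_trans (\sum_(f | tuples (@copp m) (k := 1) f) q ^ (m - r))); last first.
  rewrite sum_nat_const leq_mul2r tuples_card expn1; apply/orP; right.
  by rewrite -(card_npoly K m) max_card.
apply: leq_sum => f /forallP fD; rewrite big_mkcond /=.
apply: leq_trans (fiber_count m (monp (f ord0)) F0).
rewrite -sum1_card [X in (_ <= X)%N]big_mkcond.
rewrite (reindex (fun v : {poly_m K} => [ffun _ : 'I_1 => v])); last first.
  exists (fun g : {ffun 'I_1 -> {poly_m K}} => g ord0) => g _; first by rewrite ffunE.
  by apply/ffunP => i; rewrite ffunE (ord1 i).
apply: leq_sum => v _ /=; case: ifP => // /forallP/(_ ord0); rewrite ffunE /copp => vF.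
rewrite /fsum !big_ord1 ffunE !inE inv_mod_sub //; last exact: fD.
by rewrite -dvdpNr opprB; case: (_ %| _).
Qed.

(** * Quadruples *)
Section Quadruples.
Variables m : nat.
Local Notation T := {poly_m K}.
Hypothesis mr : (m < r)%N.

Lemma monp_unique (v w : T) : F %| monp v - monp w -> v = w.
Proof.
move=> d; apply/monp_inj/eqP; rewrite -subr_eq0; apply/eqP/(dvdp_small d).
rewrite /monp opprD addrACA subrr add0r sF ltnS (leq_trans (size_polyD _ _)) // size_polyN geq_max.
by rewrite !(leq_trans (size_npoly _)) // ltnW.
Qed.

Definition solutions s : pred (T * T) :=
  fun g => [&& copp g.1, copp g.2 & F %| s - (invp g.1 + invp g.2)].

Lemma solutions_snd s (g h : T * T) : solutions s g -> solutions s h -> g.1 = h.1 -> g = h.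
Proof.
move=> /and3P[c1 c2 d] /and3P[c1' c2' d'] e1; rewrite [g]surjective_pairing [h]surjective_pairing e1.
congr (_, _); apply: monp_unique; rewrite -inv_mod_sub // -/(invp g.2) -/(invp h.2).
have -> : invp g.2 - invp h.2 = (s - (invp h.1 + invp h.2)) - (s - (invp g.1 + invp g.2)) by rewrite e1; ring.
exact: dvdp_sub.
Qed.

Lemma solutions_sym s g : solutions s g -> solutions s (g.2, g.1).
Proof. by case/and3P => c1 c2 d; rewrite /solutions /= c1 c2 [invp g.2 + _]addrC. Qed.

Lemma solutions_fst s (g h : T * T) : solutions s g -> solutions s h -> g.2 = h.2 -> g = h.
Proof.
move=> /solutions_sym sg /solutions_sym sh e2; have [] := solutions_snd sg sh e2.
by case: g h {sg sh e2} => ? ? [? ?] /= -> ->.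
Qed.

Lemma solutions_trivial s : (#|solutions s| <= q ^ m)%N.
Proof.
rewrite -(card_npoly K m); apply: (card_le_inj (h := fst)) => g h sg sh; exact: (@solutions_snd s).
Qed.

Lemma solutions_eq s u v (g : T * T) : F %| s * v - u -> solutions s g ->
  F %| u * monp g.1 * monp g.2 - v * (monp g.1 + monp g.2).
Proof.
move=> uv /and3P[c1 c2 d]; have i1 := inv_modP F0 c1; have i2 := inv_modP F0 c2.
move: i1 i2 d; rewrite -/(invp g.1) -/(invp g.2); move: (monp g.1) (monp g.2) (invp g.1) (invp g.2) => x y x' y' i1 i2 d.
have -> : u * x * y - v * (x + y) = (s - (x' + y')) * (v * x * y) - (s * v - u) * (x * y)
   + (x * x' - 1) * (v * y) + (y * y' - 1) * (v * x) by ring.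
by do 2?[apply: dvdp_add]; try apply: dvdp_sub; exact: dvdp_mulr.
Qed.

Variable h : nat.
Hypotheses (h1 : (h < r)%N).
(** The two entries bound, after division by F, the sizes of u x y and of v (x + y). *)
Let tn := maxn (m.*2 - h) (h.+1 + m - r).

(* A solution makes [u x y - v (x + y) = F t] with [t] of small degree, whence
   [(u x - v) (u y - v) = v^2 + u F t] and the divisor bound applies. *)
Lemma solutions_good s u v B : u != 0 -> (size v <= h.+1)%N -> (size u <= r - h)%N ->
  F %| s * v - u ->
  (forall N, N \is monic -> (size N <= (4 * r).+1)%N -> (count (fun d => (d %| N)%R) (monle K (4 * r)) <= B)%N) ->
  (#|solutions s| <= 2 + q ^ tn * (q * B))%N.
Proof.
move=> u0 sv su uv HB.
pose w (g : T * T) := u * monp g.1 * monp g.2 - v * (monp g.1 + monp g.2).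
have wF g : solutions s g -> F %| w g by exact: solutions_eq.
(* The solutions at which the product vanishes, where divisors give no control; there are at most
   two. *)
pose Z := [pred g : T * T | (u * monp g.1 == v) || (u * monp g.2 == v)].
rewrite -(cardID Z); apply: leq_add.
  pose b (g : T * T) := u * monp g.1 == v.
  have <- : #|{: bool}| = 2%N by rewrite card_bool.
  apply: (card_le_inj (h := b)) => g g' /andP[sg Zg] /andP[sg' Zg'].
  rewrite /b; case: eqP => [e1|n1]; case: eqP => [e2|n2] //= _.
    by apply: (solutions_snd sg sg'); apply/monp_inj/(mulfI u0); rewrite e1.
  move: Zg Zg'; rewrite !inE (negPf (introN eqP n1)) (negPf (introN eqP n2)) /= => /eqP e1 /eqP e2.
  by apply: (solutions_fst sg sg'); apply/monp_inj/(mulfI u0); rewrite e1.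
pose t g := w g %/ F.
have tE g : solutions s g -> w g = F * t g by move=> /wF Fw; rewrite mulrC divpK.
have szw g : (size (w g) <= tn + r)%N.
  apply: leq_trans (size_polyD _ _) _; rewrite size_polyN geq_max; apply/andP; split.
    have := size_polyMleq (u * monp g.1) (monp g.2); have := size_polyMleq u (monp g.1).
    rewrite !size_monp /tn; move: su h1; move: (size u) (size (u * _)%R) (size (u * _ * _)%R) => a b c; lia.
  have := size_polyMleq v (monp g.1 + monp g.2); have := size_polyD (monp g.1) (monp g.2).
  rewrite !size_monp maxnn /tn; move: sv h1; move: (size v) (size (monp _ + _)%R) (size (v * _)%R) => a b c; lia.
have szt g : (size (t g) <= tn)%N.
  by rewrite size_divp // leq_subLR addnC -/r szw.
pose A := [predD solutions s & Z].
pose z t := v ^+ 2 + u * F * t.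
have zE g : solutions s g -> (u * monp g.1 - v) * (u * monp g.2 - v) = z (t g).
  by move=> sg; rewrite /z -mulrA -tE // /w; ring.
have zsz (t' : {poly K}) : (size t' <= tn)%N -> (size (z t') <= (4 * r).+1)%N.
  move=> st; apply: leq_trans (size_polyD _ _) _; rewrite geq_max; apply/andP; split.
    have := size_polyMleq v v; rewrite -expr2; move: sv h1; move: (size v) (size (v ^+ 2)%R) => a b; lia.
  have := size_polyMleq (u * F) t'; have := size_polyMleq u F; rewrite sF.
  move: st su h1 mr; rewrite /tn; move: (size u) (size t') (size (u * F)%R) (size (u * F * t')%R) => a b c d; lia.
rewrite (card_fibers _ (fun g => npolyp tn (t g))); rewrite -(card_npoly K tn) -sum_nat_const; apply: leq_sum => t' _.
case: (pickP [pred g | A g && (npolyp tn (t g) == t')]) => [g0 /andP[/andP[nZ0 s0] /eqP t0']|h0]; last by rewrite eq_card0.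
have tT g : npolyp tn (t g) = t' -> t g = t' by move=> <-; rewrite npolypK.
have t0 := tT _ t0'.
have z0 : z t' != 0.
  rewrite -t0 -zE // mulf_neq0 // subr_eq0; apply: contra nZ0 => /eqP e1; rewrite !inE e1 eqxx ?orbT //.
pose N := (lead_coef (z t'))^-1 *: z t'.
have lz : lead_coef (z t') != 0 by rewrite lead_coef_eq0.
have mN : N \is monic by rewrite monicE lead_coefZ mulVf.
have sN : (size N <= (4 * r).+1)%N by rewrite size_scale ?invr_eq0 // zsz // size_npoly.
apply: leq_trans (leq_mul (leqnn q) (HB N mN sN)).
pose D := [seq d <- monle K (4 * r) | d %| N].
pose f (g : T * T) := (lead_coef (u * monp g.1 - v), (lead_coef (u * monp g.1 - v))^-1 *: (u * monp g.1 - v)).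
rewrite -size_filter -/D cardE -(size_map f) [q]cardE -(size_allpairs (fun c d => (c, d))).
apply: uniq_leq_size.
  rewrite map_inj_in_uniq ?enum_uniq // => g g'; rewrite !mem_enum => /andP[/andP[_ sg] /eqP/tT tg] /andP[/andP[_ sg'] /eqP/tT tg'] [e1 e2].
  have fz g2 : solutions s g2 -> t g2 = t' -> u * monp g2.1 - v != 0.
    by move=> s2 t2; apply: contraNneq z0 => e0; rewrite -t2 -zE // e0 mul0r.
  apply: (solutions_snd sg sg'); apply/monp_inj/(mulfI u0)/(addIr (- v)).
  have l1 : lead_coef (u * monp g.1 - v) != 0 by rewrite lead_coef_eq0 fz.
  by apply: (scalerI (invr_neq0 l1)); rewrite e2 e1.
move=> x0 /mapP[g]; rewrite mem_enum => /andP[/andP[_ sg] /eqP/tT tg] ->.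
have gz : u * monp g.1 - v != 0 by apply: contraNneq z0 => e0; rewrite -tg -zE // e0 mul0r.
have lg : lead_coef (u * monp g.1 - v) != 0 by rewrite lead_coef_eq0.
apply/allpairsP; exists (f g); split; rewrite /f /= ?mem_enum //.
rewrite mem_filter mem_monle monicE lead_coefZ mulVf // eqxx size_scale ?invr_eq0 //.
have dz : u * monp g.1 - v %| z t' by rewrite -tg -zE // dvdp_mulr.
rewrite /N dvdpZl ?invr_eq0 // dvdpZr ?invr_eq0 // dz /=.
by rewrite (leq_trans (dvdp_leq z0 dz)) // zsz // size_npoly.
Qed.

Lemma zero_case_arith a b c d : (c < d)%N -> (a <= c.+1)%N -> (0 < a)%N -> d.+1 = (b + a).-1 -> (d - c < b)%N.
Proof. clear; lia. Qed.

(** When the approximation has numerator 0, F divides (x + y) u with u short, so the large divisor F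
    / gcd(F, u) of F divides x + y. *)
Lemma zero_case (v w : T) u : copp v -> copp w -> u != 0 -> (size u <= h.+1)%N ->
  F %| (invp v + invp w) * u ->
  exists G, [/\ G \in monle K (4 * r), G %| F, (r - h < size G)%N & G %| monp v + monp w].
Proof.
move=> cv cw u0 su; have i1 := inv_modP F0 cv; have i2 := inv_modP F0 cw.
move: i1 i2; rewrite -/(invp v) -/(invp w).
move: (monp v) (monp w) (invp v) (invp w) => x y x' y' i1 i2 d.
have d2 : F %| (x + y) * u.
  have -> : (x + y) * u = (x' + y') * u * (x * y) - (x * x' - 1) * (u * y) - (y * y' - 1) * (u * x) by ring.
  by do 2?[apply: dvdp_sub]; exact: dvdp_mulr.
pose g := gcdp F u; have g0 : g != 0 by rewrite gcdp_eq0 negb_and F0.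
have FE := divpK (dvdp_gcdl F u); have uE := divpK (dvdp_gcdr F u).
rewrite -/g in FE uE; set G0 := F %/ g in FE; have G00 : G0 != 0 by move: F0; rewrite -FE; apply: contraNneq => ->; rewrite mul0r.
have cop : coprimep G0 (u %/ g) by rewrite coprimep_div_gcd // F0.
have dG : G0 %| x + y.
  by move: d2; rewrite -FE -uE mulrA dvdp_mul2r // Gauss_dvdpl.
have lG : lead_coef G0 != 0 by rewrite lead_coef_eq0.
have dF : G0 %| F by rewrite -FE dvdp_mulr.
exists ((lead_coef G0)^-1 *: G0); rewrite mem_monle monicE lead_coefZ mulVf // eqxx size_scale ?invr_eq0 //.
rewrite !dvdpZl ?invr_eq0 //; split => //.
  by rewrite /= (leq_trans (dvdp_leq F0 dF)) // sF ltnS leq_pmull.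
have sg : (size g <= h.+1)%N by rewrite (leq_trans _ su) // dvdp_leq // dvdp_gcdr.
have := size_mul G00 g0; rewrite FE sF; move: sg g0; rewrite -size_poly_gt0.
exact: (zero_case_arith h1).
Qed.

Definition pairf (U : finType) (g : U * U) : {ffun 'I_2 -> U} := [ffun i => if i == ord0 then g.1 else g.2].

Lemma sum_pairf (U : finType) (f : {ffun 'I_2 -> U} -> nat) : (\sum_g f g = \sum_(g : U * U) f (pairf g))%N.
Proof.
rewrite (reindex (@pairf U)) //; exists (fun g : {ffun 'I_2 -> U} => (g ord0, g ord_max)) => g _.
  by rewrite /pairf !ffunE; case: g.
by apply/ffunP => i; rewrite ffunE /=; case: i => [[|[|i]] hi] //=; congr (g _); apply: val_inj.
Qed.

Lemma tuples_pairf (U : finType) (D : pred U) g : tuples D (pairf g) = D g.1 && D g.2.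
Proof.
apply/forallP/andP => [hD|[h1' h2'] i]; last by rewrite ffunE; case: ifP.
by have := hD ord0; have := hD ord_max; rewrite !ffunE.
Qed.

Lemma fsum_pairf (U : finType) (x : U -> {poly K}) g : fsum x (pairf g) = x g.1 + x g.2.
Proof. by rewrite /fsum big_ord_recl big_ord1 !ffunE. Qed.

(** Pairs whose sum of inverses has a nonzero numerator have few companions by [solutions_good]. The
    remaining pairs have x + y divisible by one of at most B large divisors of F, hence are few, and
    the trivial count q^m is used for their companions. *)
Lemma inv_energy2_split B :
  (forall N, N \is monic -> (size N <= (4 * r).+1)%N -> (count (fun d => (d %| N)%R) (monle K (4 * r)) <= B)%N) ->
  (inv_energy m 2 <= q ^ m * q ^ m * (2 + q ^ tn * (q * B)) + B * (q ^ m * q ^ (m - (r - h))) * q ^ m)%N.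
Proof.
move=> HB; pose M := (2 + q ^ tn * (q * B))%N.
pose D := [seq G <- monle K (4 * r) | (G %| F) && (r - h < size G)%N].
pose bad (f : T * T) := has (fun G => G %| monp f.1 + monp f.2) D.
have -> : inv_energy m 2 = (\sum_(f : T * T | copp f.1 && copp f.2) #|solutions (invp f.1 + invp f.2)|)%N.
  rewrite /inv_energy /energy [LHS]big_mkcond sum_pairf [RHS]big_mkcond; apply: eq_bigr => f _.
  rewrite tuples_pairf; case: ifP => // _; rewrite big_mkcond sum_pairf -sum1_card [RHS]big_mkcond.
  apply: eq_bigr => g _; rewrite tuples_pairf !fsum_pairf unfold_in /solutions.
  by case: (copp g.1) => //; case: (copp g.2) => //=; case: ifP.
apply: (@leq_trans (\sum_(f : T * T | copp f.1 && copp f.2) (M + bad f * q ^ m))).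
  apply: leq_sum => f /andP[c1 c2].
  have [v [v0 sv su]] := dirichlet (invp f.1 + invp f.2) F0 (ltn0Sn h) h1.
  set u := (_ %% F) in su; have [u0|u0] := eqVneq u 0; last first.
    apply: leq_trans (leq_addr _ _); apply: (solutions_good u0 sv su _ HB).
    by rewrite /u {1}(divp_eq (_ * v) F) addrK dvdp_mull.
  have [G [GB GF Gs Gd]] := zero_case c1 c2 v0 sv (introT (modp_eq0P _ _) u0).
  have -> : bad f by apply/hasP; exists G => //; rewrite mem_filter GF Gs.
  by rewrite mul1n (leq_trans (solutions_trivial _)) // leq_addl.
rewrite big_split /= leq_add //.
  rewrite sum_nat_const leq_mul2r; apply/orP; right.
  by rewrite -!(card_npoly K m) -card_prod max_card.
rewrite -big_distrl /= leq_mul2r; apply/orP; right.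
apply: (@leq_trans (\sum_(f : T * T) \sum_(G <- D) (G %| monp f.1 + monp f.2)%R)).
  rewrite big_mkcond; apply: leq_sum => f _; case: ifP => // _.
  rewrite /bad; elim: (D) => [|G D' IH]; first by rewrite big_nil.
  by rewrite big_cons /=; case: (G %| _) => //; rewrite add0n.
rewrite exchange_big /=; apply: (@leq_trans (\sum_(G <- D) (q ^ m * q ^ (m - (r - h))))); last first.
  rewrite big_const_seq count_predT iter_addn_0 mulnC leq_mul2r; apply/orP; right.
  rewrite size_filter; apply: leq_trans (HB F mF _); last by rewrite sF ltnS leq_pmull.
  by apply: sub_count => G /andP[].
rewrite big_seq [X in (_ <= X)%N]big_seq; apply: leq_sum => G; rewrite mem_filter => /andP[/andP[GF sG] _].
rewrite -(pair_bigA _ (fun v w : T => nat_of_bool (G %| monp v + monp w)%R)) /=.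
rewrite -[X in (_ <= X * _)%N](card_npoly K m) -sum_nat_const; apply: leq_sum => v _.
have G0 : G != 0 by rewrite -size_poly_gt0 (leq_ltn_trans _ sG).
apply: leq_trans (_ : q ^ (m - (size G).-1) <= _)%N; last first.
  by rewrite leq_exp2l ?finNzRing_gt1 //; move: sG; move: (size G) => a; lia.
apply: leq_trans (fiber_count m (- monp v) G0); rewrite -sum1_card [X in (_ <= X)%N]big_mkcond.
by apply: leq_sum => w _; rewrite inE opprK addrC; case: (_ %| _).
Qed.

End Quadruples.
End Energy.

Section EnergyBounds.
Variables (R : realType) (K : finFieldType).
Local Notation q := #|K|.
Local Notation dg := (dg R).
Local Notation qpow := (@qpow R K).
Implicit Types (F G P x y z : {poly K}).

(** a takes each prime of z once. *)
Lemma square_kernel z : z \is monic -> (forall P, mprime P -> P %| z -> P ^+ 2 %| z) ->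
  exists a, [/\ a \is monic, a ^+ 2 %| z & forall P, mprime P -> P %| z -> P %| a].
Proof.
have [n] := ubnP (size z); elim: n z => // n IH z sz mz hz.
have [s1|s1] := leqP (size z) 1.
  exists 1; rewrite monic1 expr1n dvd1p; split => // P /mprime_size sP.
  by rewrite (monic_size_le1 mz s1).
have [P pP Pz] := exists_mprime s1; have [mP _] := mprimeP _ pP.
have [k [N [k0 mN PN zE]]] := exists_valuation pP mz Pz.
have P0 := mprime_neq0 pP.
have k2 : (1 < k)%N.
  case: k k0 zE => [//|[_ zE|//]]; have := hz P pP Pz.
  by rewrite zE expr1 expr2 dvdp_mul2l // (negPf PN).
have copP Q j : mprime Q -> Q %| N -> coprimep (Q ^+ j) (P ^+ k).
  move=> pQ QN; apply/coprimep_expl/coprimep_expr; rewrite mprime_coprime //.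
  by apply: contra PN => QP; rewrite -(mprime_dvd pQ pP QP).
have [||a [ma aN ha]] := IH N _ mN.
- move: sz; rewrite ltnS; apply: leq_trans; rewrite zE size_mul ?expf_neq0 ?monic_neq0 //.
  have := size_exp P k; have : (0 < (size P).-1 * k)%N by rewrite muln_gt0 mprime_deg_gt0.
  by move: ((size P).-1 * k)%N (size (P ^+ k)) (size N) => b c d; clear; lia.
- move=> Q pQ QN; have := hz Q pQ; rewrite zE dvdp_mull // => /(_ isT).
  by rewrite Gauss_dvdpr // copP.
exists (P * a); split; first by rewrite monicMl.
  by rewrite exprMn zE dvdp_mul // dvdp_exp2l.
move=> Q pQ; rewrite zE mprime_dvdM // => /orP[/mprime_dvdX|QN]; last by rewrite dvdp_mull // ha.
by move=> h; rewrite dvdp_mulr // h.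
Qed.

Definition radical a x : bool := `[<forall P, mprime P -> P %| x -> P %| a>].

Lemma prod_mon (I : finType) (X : I -> {poly K}) m (s : seq I) (D : pred I) :
  (forall i, X i \in mon K m) -> \prod_(i <- s | D i) X i \in mon K (m * count D s).
Proof.
move=> Xm; elim: s => [|i s IH]; first by rewrite big_nil muln0 mon0 inE.
rewrite big_cons /=; case: (D i) => //=; rewrite mulnDr muln1.
exact: monM.
Qed.

(* Clearing denominators turns the congruence into an equation, in which the
   primes of each factor divide another factor. *)
Lemma radical_exists F (I : finType) (X s : I -> {poly K}) m :
  (forall i, X i \in mon K m) -> (forall i, s i = 1 \/ s i = -1) -> (0 < m)%N -> F != 0 ->
  (m * #|I| <= (size F).-1)%N -> (forall i, coprimep (X i) F) ->
  F %| \sum_i s i * inv_mod F (X i) ->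
  exists2 a, a \in monle K ((m * #|I|) %/ 2) & forall i, radical a (X i).
Proof.
move=> Xm sE m0 F0 mF XF d.
pose Y i := \prod_(j | j != i) X j; pose z := \prod_j X j.
have zY i : z = X i * Y i by rewrite /z (bigD1 i).
have zm : z \in mon K (m * #|I|).
  by have := prod_mon (enum I) predT Xm; rewrite count_predT -cardE big_enum_cond.
have /monP[mz sz] := zm.
have sumY : \sum_i s i * Y i = 0.
  apply: (@dvdp_small K F).
    have -> : \sum_i s i * Y i = z * (\sum_i s i * inv_mod F (X i)) - \sum_i (s i * Y i) * (X i * inv_mod F (X i) - 1).
      rewrite mulr_sumr -sumrB; apply: eq_bigr => i _; rewrite (zY i).
      by move: (Y i) (X i) (s i) (inv_mod _ _) => a b c e; ring.
    apply: dvdp_sub; first exact: dvdp_mull.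
    by apply: (big_ind (fun x => F %| x)) => [||i _]; [exact: dvdp0|exact: dvdp_add|rewrite dvdp_mull // inv_modP].
  apply: (@leq_ltn_trans (size F).-1); last by rewrite ltn_predL size_poly_gt0.
  apply: (big_ind (fun x : {poly K} => size x <= (size F).-1)%N) => [|x y sx sy|i _]; first by rewrite size_poly0.
    by rewrite (leq_trans (size_polyD _ _)) // geq_max sx.
  have -> : size (s i * Y i) = size (Y i) by case: (sE i) => ->; rewrite ?mul1r // mulN1r size_polyN.
  apply: leq_trans mF; have Yi0 : Y i != 0 by apply: contraTneq (monic_neq0 mz) => Y0; rewrite (zY i) Y0 mulr0 eqxx.
  have /monP[mX sX] := Xm i.
  have := sz; rewrite (zY i) (size_mul (monic_neq0 mX) Yi0) sX.
  by move: m0; move: (m * _)%N (size (Y i)) => b c; lia.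
(* If P divides X_i, it divides every Y_j with j distinct from i, hence also Y_i because the signed
   sum is 0; so P^2 divides X_i Y_i = z. *)
have sq P : mprime P -> P %| z -> P ^+ 2 %| z.
  move=> pP Pz; have [i PX] : exists i, P %| X i.
    move: Pz; rewrite /z; elim/big_rec: _ => [|i x _ IH]; first by rewrite dvdp1 => /eqP s1; have := mprime_size pP; rewrite s1.
    by rewrite mprime_dvdM // => /orP[|//]; exists i.
  rewrite (zY i) expr2 dvdp_mul //.
  have PN : P %| s i * Y i.
    have -> : s i * Y i = - \sum_(j | j != i) s j * Y j.
      by apply/eqP; rewrite -addr_eq0; have := sumY; rewrite (bigD1 i) //= => ->.
    rewrite dvdpNr; apply: (big_ind (fun x => P %| x)) => [||j ji]; [exact: dvdp0|exact: dvdp_add|].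
    by rewrite dvdp_mull // /Y (bigD1 i) 1?eq_sym //= dvdp_mulr.
  by move: PN; case: (sE i) => ->; rewrite ?mul1r // mulN1r dvdpNr.
have [a [ma az ha]] := square_kernel mz sq.
exists a; last by move=> i; apply/asboolP => P pP PX; apply: ha => //; rewrite (zY i) dvdp_mulr.
rewrite mem_monle ma /=; have := dvdp_leq (monic_neq0 mz) az.
have := size_exp a 2; rewrite sz; move: (size (a ^+ 2)%R) (monic_neq0 ma); rewrite -size_poly_gt0.
move: (size a) (m * _)%N => b c e; clear; lia.
Qed.

(** Each solution has an a of degree at most k m containing the primes of all 2k coordinates, which
    are then counted independently. *)
Lemma energy_radical F m k : F \is monic -> (0 < m)%N -> (2 * (k * m) <= (size F).-1)%N ->
  (inv_energy F m k <= \sum_(a <- monle K (k * m)) (count (radical a) (mon K m)) ^ (2 * k))%N.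
Proof.
move=> mF m0 km; have F0 := monic_neq0 mF.
pose w a (f : {ffun 'I_k -> {poly_m K}}) : nat := (\prod_i radical a (monp (f i)))%N.
apply: (@leq_trans (\sum_f \sum_g \sum_(a <- monle K (k * m)) w a f * w a g)).
  rewrite /inv_energy /energy big_mkcond; apply: leq_sum => f _; case: ifP => // /forallP fD.
  rewrite big_mkcond; apply: leq_sum => g _; case: ifP => // /forallP gD.
  case: (boolP (F %| _)%R) => // d.
  pose X (i : 'I_k + 'I_k) := match i with inl j => monp (f j) | inr j => monp (g j) end.
  pose s (i : 'I_k + 'I_k) : {poly K} := match i with inl _ => 1 | inr _ => -1 end.
  have cI : (m * #|{: 'I_k + 'I_k}| = 2 * (k * m))%N by rewrite card_sum !card_ord; lia.
  have [||||| a am ha] := @radical_exists F _ X s m _ _ m0 F0 _ _ _.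
  - by case=> i; exact: monp_mon.
  - by case=> i; [left|right].
  - by rewrite cI.
  - by case=> i; [exact: fD|exact: gD].
  - rewrite big_sumType /=; move: d; rewrite /fsum; congr (_ %| _).
    by rewrite -sumrN; congr (_ + _); apply: eq_bigr => i _; rewrite ?mul1r // mulN1r.
  move: am; rewrite cI mulKn // => am; rewrite (big_rem a am) /= ltn_addr // muln_gt0.
  by apply/andP; split; rewrite /w prodn_gt0 // => i; rewrite lt0b; [exact: (ha (inl i))|exact: (ha (inr i))].
under eq_bigr do rewrite exchange_big /=.
rewrite exchange_big /=; apply: leq_sum => a _.
under eq_bigr do rewrite -big_distrr /=.
rewrite -big_distrl /= mulnn [(2 * k)%N]mulnC expnM leq_exp2r //.
rewrite -(bigA_distr_bigA (fun (_ : 'I_k) v => nat_of_bool (radical a (monp v)))) /= prod_nat_const card_ord.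
apply/eq_leq; congr (_ ^ _)%N.
rewrite (permP (perm_monXn K m)) count_map -sum1_count big_enum_cond [RHS]big_mkcond /=.
by apply: eq_bigr => v _; rewrite -/(monp v); case: (radical _ _).
Qed.

Lemma linear_qpow eta : 0 < eta -> exists2 c : R, 1 <= c & forall n, n.+1%:R <= c * qpow (eta * n%:R).
Proof.
move=> eta0; have [D HD] := @exp_beats_linear R 1 _ ler01 (qpow_gt1 K eta0).
exists D.+1%:R => [|n]; first by rewrite ler1n.
rewrite -qpowX; have y1 : 1 <= qpow eta ^+ n by rewrite exprn_ege1 // qpow_ge1 // ltW.
have [Dn|nD] := leqP D n.
  apply: le_trans (_ : 1 * n.+1%:R <= _); first by rewrite mul1r.
  by apply: le_trans (HD n Dn) _; rewrite ler_peMl ?(le_trans ler01) // ler1n.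
by rewrite -[X in X <= _]mulr1 ler_pM // ler_nat ltnS ltnW.
Qed.

(** About q^(k m) values of a, each with few polynomials of the same primes: up to q^(eta r), the
    order of the diagonal solutions. *)
Lemma energy_bound eta k0 : 0 < eta -> exists2 c : R, 1 <= c & forall F m k, F \is monic -> (0 < m)%N ->
  (k <= k0)%N -> (2 * (k * m) <= (size F).-1)%N ->
  (inv_energy F m k)%:R <= c * qpow ((k * m)%:R + eta * dg F).
Proof.
move=> eta0; have k0' : 0 < (4 * k0).+1%:R :> R by rewrite ltr0n.
have e1 : 0 < eta / (4 * k0).+1%:R by rewrite divr_gt0.
have e2 : 0 < eta / 2%:R by rewrite divr_gt0.
have [c1 c11 H1] := @radical_count_bound R K _ e1; have [c2 c21 H2] := linear_qpow e2.
exists (c2 * c1 ^+ (2 * k0)); first by rewrite mulr_ege1 // exprn_ege1.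
move=> F m k mF m0 kk km; have Fr : (size F).-1%:R = dg F :> R by [].
set r := (size F).-1 in km Fr.
have c10 : 0 <= c1 by apply: le_trans c11.
pose X := qpow (eta / (4 * k0).+1%:R * r%:R).
have X0 : 0 <= X by exact: qpow_ge0.
have cnt a : a \in monle K (k * m) -> (count (radical a) (mon K m))%:R ^+ (2 * k) <= c1 ^+ (2 * k0) * qpow (eta / 2%:R * r%:R).
  case: (posnP k) => [->|k1].
    move=> _; rewrite muln0 expr0 mulr_ege1 ?exprn_ege1 // qpow_ge1 // mulr_ge0 // ltW //.
  rewrite mem_monle => /andP[ma sa].
  apply: (@le_trans _ _ ((c1 * X) ^+ (2 * k))).
    rewrite lerXn2r ?nnegrE ?mulr_ge0 //; apply: le_trans (H1 a m ma) _.
    rewrite ler_wpM2l // ler_qpow // ler_wpM2l ?(ltW e1) // /dg -natrD ler_nat.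
    have : (m <= k * m)%N by rewrite leq_pmull.
    by move: sa km; clear; move: (size a) (k * m)%N => b d; lia.
  rewrite exprMn ler_pM ?exprn_ge0 //; first by rewrite ler_weXn2l // leq_mul.
  rewrite qpowX ler_qpow // mulrAC ler_wpM2r // mulrAC ler_pdivrMr // mulrAC -mulrA ler_wpM2l ?(ltW eta0) //.
  by rewrite ler_pdivlMr // -natrM ler_nat; clear -kk; lia.
have := energy_radical mF m0 km; rewrite -(ler_nat R) => h; apply: le_trans h _.
rewrite natr_sum; under eq_bigr do rewrite natrX.
rewrite big_seq_cond; apply: (@le_trans _ _ (\sum_(a <- monle K (k * m) | (a \in monle K (k * m)) && true) c1 ^+ (2 * k0) * qpow (eta / 2%:R * r%:R))).
  by apply: ler_sum => a /andP[am _]; exact: cnt.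
rewrite -big_seq_cond big_const_seq count_predT iter_addr addr0 -[X in X <= _]mulr_natr.
have sz : (size (monle K (k * m)))%:R <= (c2 * qpow (eta / 2%:R * r%:R)) * qpow (k * m)%:R.
  apply: (@le_trans _ _ ((k * m).+1%:R * qpow (k * m)%:R)).
    rewrite qpow_nat -natrM ler_nat -sum1_size sum_monle -[X in (_ <= X * _)%N]card_ord -sum_nat_const.
    apply: leq_sum => i _; rewrite [X in (X <= _)%N](sum1_size (mon K i)) size_mon.
    by rewrite leq_exp2l ?finNzRing_gt1 // -ltnS.
  rewrite ler_wpM2r ?qpow_ge0 //; apply: le_trans (H2 _) _.
  rewrite ler_wpM2l ?(le_trans ler01) // ler_qpow // ler_wpM2l ?(ltW e2) // ler_nat.
  by apply: leq_trans km; rewrite leq_pmull.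
rewrite addrC qpowD -Fr.
have -> : eta * r%:R = eta / 2%:R * r%:R + eta / 2%:R * r%:R by lra.
rewrite qpowD; apply: le_trans (ler_wpM2l _ sz) _; first by rewrite mulr_ge0 ?qpow_ge0 ?exprn_ge0.
by rewrite le_eqVlt; apply/orP; left; apply/eqP; ring.
Qed.

Lemma energy2_arith1 m r h : (r + m <= h * 2 + 1)%N -> (h * 2 <= r + m)%N -> (m < r)%N ->
  (maxn (m.*2 - h) (h.+1 + m - r) * 2 <= 3 * m - r + 1 * 2)%N.
Proof. by lia. Qed.

Lemma energy2_arith2 m r h : (r + m <= h * 2 + 1)%N -> (h * 2 <= r + m)%N -> (m < r)%N ->
  ((m - (r - h)) * 2 <= 3 * m - r + 0 * 2)%N.
Proof. by lia. Qed.

Lemma energy2_bound eta : 0 < eta -> exists2 c : R, 1 <= c & forall F m, F \is monic ->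
  (m < (size F).-1)%N -> (inv_energy F m 2)%:R <=
   c * qpow (eta * dg F) * (qpow (2%:R * m%:R) + qpow ((7%:R * m%:R - dg F) / 2%:R)).
Proof.
move=> eta0; have e1 : 0 < eta / 4%:R by rewrite divr_gt0.
have [c c1 Hc] := @divisor_bound R K _ e1.
exists (c * (3%:R + q%:R ^+ 2)); first by rewrite mulr_ege1 //; have := sqr_ge0 (q%:R : R); lra.
move=> F m mF mr; have Fr : (size F).-1%:R = dg F :> R by [].
set r := (size F).-1 in mr Fr; set b := c * qpow (eta * dg F).
have b1 : 1 <= b by rewrite mulr_ege1 // qpow_ge1 // mulr_ge0 // ltW.
pose B := Num.truncn b.
have Bb : B%:R <= b by rewrite truncn_le (le_trans ler01).
have HB N : N \is monic -> (size N <= (4 * r).+1)%N -> (count (fun d => (d %| N)%R) (monle K (4 * r)) <= B)%N.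
  move=> mN sN; rewrite truncn_ge_nat ?(le_trans ler01) //; apply: le_trans (Hc N (4 * r)%N mN) _.
  rewrite ler_wpM2l ?(le_trans ler01) // ler_qpow // -mulrA ler_wpM2l ?(ltW eta0) // mulrC ler_pdivrMr //.
  by rewrite mulrC -Fr /dg -natrM ler_nat -subn1 leq_subLR add1n.
(* Balances 2 m - h against h + m - r; both are then about (3 m - r)/2. *)
pose h := ((r + m) %/ 2)%N.
have hr : (h < r)%N by rewrite /h; lia.
have := inv_energy2_split mF mr hr HB; rewrite -(ler_nat R) => le1; apply: le_trans le1 _.
pose Y := qpow ((3%:R * m%:R - r%:R) / 2%:R).
have Y0 : 0 <= Y by exact: qpow_ge0.
have q1 : 1 <= q%:R :> R by rewrite ler1n ltnW // finNzRing_gt1.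
have h2 : (r + m <= h * 2 + 1)%N /\ (h * 2 <= r + m)%N by rewrite /h; lia.
have qmax (n1 n2 : nat) : (n1 * 2 <= 3 * m - r + n2 * 2)%N -> (q ^ n1)%:R <= q%:R ^+ n2 * (1 + Y).
  rewrite -(ler_nat R) natrM natrD natrM => le2; rewrite -natrX -[(q ^ n2)%:R]qpow_nat -qpow_nat mulrDr mulr1 -qpowD.
  have [r3|r3] := leqP r (3 * m).
    apply: le_trans (_ : qpow (n2%:R + (3%:R * m%:R - r%:R) / 2%:R) <= _); last by rewrite lerDr qpow_ge0.
    by rewrite ler_qpow //; move: le2; rewrite natrB // natrM; lra.
  apply: le_trans (_ : qpow n2%:R <= _); last by rewrite lerDl qpow_ge0.
  rewrite ler_qpow //; move: le2; have -> : (3 * m - r = 0)%N by apply/eqP; rewrite subn_eq0 ltnW.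
  by lra.
have t1 : (q ^ maxn (m.*2 - h) (h.+1 + m - (size F).-1))%:R <= q%:R ^+ 1 * (1 + Y).
  by apply: qmax; exact: (energy2_arith1 h2.1 h2.2 mr).
have t2 : (q ^ (m - (r - h)))%:R <= q%:R ^+ 0 * (1 + Y).
  by apply: qmax; exact: (energy2_arith2 h2.1 h2.2 mr).
rewrite expr1 in t1; rewrite expr0 mul1r in t2.
have -> : c * (3%:R + q%:R ^+ 2) * qpow (eta * dg F) * (qpow (2%:R * m%:R) + qpow ((7%:R * m%:R - dg F) / 2%:R))
  = (q ^ m)%:R * (q ^ m)%:R * (b * (3%:R + q%:R ^+ 2) * (1 + Y)).
  rewrite -!qpow_nat -qpowD (_ : m%:R + m%:R = 2%:R * m%:R) /b; last by ring.
  have -> : qpow ((7%:R * m%:R - dg F) / 2%:R) = qpow (2%:R * m%:R) * Y.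
    by rewrite /Y -qpowD -Fr; congr (qpow _); lra.
  by ring.
rewrite natrD !natrM natrD -/r !natrM.
move: t1 t2; set u := (q ^ maxn _ _)%:R; set v := (q ^ (m - _))%:R; set w := (q ^ m)%:R => t1 t2.
have w0 : 0 <= w by rewrite ler0n.
have v0 : 0 <= v by rewrite ler0n.
have -> : w * w * (2%:R + u * (q%:R * B%:R)) + B%:R * (w * v) * w = w * w * (2%:R + u * (q%:R * B%:R) + B%:R * v) by ring.
rewrite ler_wpM2l ?mulr_ge0 //.
have B0 : 0 <= B%:R :> R by rewrite ler0n.
have h3 : u * (q%:R * B%:R) <= (q%:R * (1 + Y)) * (q%:R * b).
  by rewrite ler_pM ?mulr_ge0 ?ler0n // ler_wpM2l.
have h4 : B%:R * v <= b * (1 + Y) by rewrite ler_pM.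
have h5 : 1 <= b * (1 + Y) by rewrite mulr_ege1 // lerDl.
apply: le_trans (lerD (lerD (lexx 2%:R) h3) h4) _.
rewrite -subr_ge0.
have -> : b * (3%:R + q%:R ^+ 2) * (1 + Y) - (2%:R + q%:R * (1 + Y) * (q%:R * b) + b * (1 + Y)) = 2%:R * (b * (1 + Y) - 1) by ring.
by rewrite mulr_ge0 // subr_ge0.
Qed.

End EnergyBounds.

(** * Bilinear sums of inverses *)
Section TypeTwo.
Variables (R : realType) (K : finFieldType) (p : nat) (pK : p \in [pchar K]).
Hypothesis p_odd : odd p.
Local Notation C := R[i].
Local Notation q := #|K|.
Local Notation e := (e_mod R pK).
Local Notation dg := (dg R).
Local Notation qpow := (@qpow R K).
Implicit Types (F a x : {poly K}) (al be : {poly K} -> C).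

Definition bil F a X Y al be : C :=
  \sum_(u <- mon K X | coprimep u F) \sum_(v <- mon K Y | coprimep v F)
    al u * be v * e F (a * inv_mod F u * inv_mod F v).

Lemma bil_sym F a X Y al be : bil F a X Y al be = bil F a Y X be al.
Proof.
rewrite /bil exchange_big /=; apply: eq_bigr => v _; apply: eq_bigr => u _.
by rewrite [al u * _]mulrC; congr (_ * e F _); ring.
Qed.

Lemma bil_moment F a X Y al be k l : F \is monic -> coprimep a F ->
  (forall x, cabs (al x) <= 1) -> (forall x, cabs (be x) <= 1) ->
  cabs (bil F a X Y al be) ^+ (2 * (k.+1 * l.+1)) <=
  (q ^ X)%:R ^+ (2 * (k * l.+1)) * (q ^ Y)%:R ^+ (2 * (k.+1 * l)) *
   (inv_energy F Y k.+1)%:R * ((q ^ (size F).-1)%:R * (inv_energy F X l.+1)%:R).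
Proof.
move=> mF aF al1 be1; have F0 := monic_neq0 mF.
pose alf (s : {poly_X K}) := if copp F s then al (monp s) else 0.
pose bef (s : {poly_Y K}) := if copp F s then be (monp s) else 0.
have -> : bil F a X Y al be = \sum_s \sum_t alf s * bef t * e F (a * invp F s * invp F t).
  rewrite /bil big_mkcond sum_monXn; apply: eq_bigr => s _.
  rewrite /alf /copp /monp; case: ifP => _; last by rewrite big1 // => t _; rewrite !mul0r.
  rewrite big_mkcond sum_monXn; apply: eq_bigr => t _.
  by rewrite /bef /copp /monp; case: ifP => _ //; rewrite mulr0 mul0r.
have alD s : cabs (alf s) <= (copp F s)%:R by rewrite /alf; case: ifP; rewrite ?cabs0.
have beD s : cabs (bef s) <= (copp F s)%:R by rewrite /bef; case: ifP; rewrite ?cabs0.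
have cD m : #|@copp K F m|%:R <= (q ^ m)%:R :> R by rewrite ler_nat -(card_npoly K m) max_card.
have := bilinear_moment pK p_odd (fun s : {poly_X K} => a * invp F s) (@invp K F Y) k l F0 alD beD.
move=> h; apply: le_trans h _.
rewrite (energy_scale _ _ aF) -/(inv_energy F Y k.+1) ler_wpM2r ?mulr_ge0 // ler_wpM2r // ler_pM ?exprn_ge0 //.
  by rewrite lerXn2r ?nnegrE.
by rewrite lerXn2r ?nnegrE.
Qed.

(** s is the exponent saved over the trivial bound q^(4 m), according to which term of
    [energy2_bound] dominates. *)
Lemma energy2_case (eta : R) : 0 < eta -> exists2 c : R, 1 <= c & forall F m, F \is monic ->
  (m < (size F).-1)%N -> exists2 s : R, s = 2%:R * m%:R \/ s = (m%:R + dg F) / 2%:R &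
    (inv_energy F m 2)%:R <= c * qpow (eta * dg F + 4%:R * m%:R - s).
Proof.
move=> eta0; have [c c1 Hc] := energy2_bound K eta0; exists (2%:R * c); first by lra.
move=> F m mF mr; have := Hc F m mF mr; set E := (inv_energy F m 2)%:R.
have c0 : 0 <= c by lra.
have H (x y s : R) : x <= y -> eta * dg F + 4%:R * m%:R - s = eta * dg F + y ->
    E <= c * qpow (eta * dg F) * (qpow x + qpow y) -> E <= 2%:R * c * qpow (eta * dg F + 4%:R * m%:R - s).
  move=> xy ->; rewrite qpowD => h; apply: le_trans h _.
  have -> : 2%:R * c * (qpow (eta * dg F) * qpow y) = c * qpow (eta * dg F) * (qpow y + qpow y) by ring.
  by rewrite ler_wpM2l ?mulr_ge0 ?qpow_ge0 // lerD2r ler_qpow.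
have [xy|xy] := leP (2%:R * m%:R : R) ((7%:R * m%:R - dg F) / 2%:R).
  by move=> h; exists ((m%:R + dg F) / 2%:R); [right|apply: (H _ _ _ xy) => //; lra].
rewrite addrC => h; exists (2%:R * m%:R); first by left.
by apply: (H _ _ _ (ltW xy)) => //; lra.
Qed.

Lemma le_root M (c x y : R) : (0 < M)%N -> 1 <= c -> 0 <= x ->
  x ^+ M <= c * qpow (M%:R * y) -> x <= c * qpow y.
Proof.
move=> M0 c1 x0 h; have c0 : 0 <= c by rewrite (le_trans ler01).
rewrite -(@ler_pXn2r _ M) ?nnegrE ?mulr_ge0 ?qpow_ge0 //.
apply: le_trans h _; rewrite exprMn qpowX [y * _]mulrC ler_wpM2r ?qpow_ge0 //.
exact: ler_eXnr.
Qed.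

(** The longer variable always enters through pairs, or singly when X >= r. The shorter one enters
    through k-tuples with k about r/(2Y) when it is short, where the energy is diagonal, and through
    pairs otherwise; mu bounds k. *)
Lemma type_two mu eps : 0 < mu -> mu <= 1 -> 0 < eps -> eps <= 1 -> exists2 c : R, 1 <= c &
  forall F a X Y al be, F \is monic -> coprimep a F ->
  (forall x, cabs (al x) <= 1) -> (forall x, cabs (be x) <= 1) ->
  (Y <= X)%N -> (0 < Y)%N -> mu * dg F <= Y%:R -> (1 / 2 + eps) * dg F <= X%:R + Y%:R ->
  cabs (bil F a X Y al be) <= c * qpow (X%:R + Y%:R - eps * mu / 64%:R * dg F).
Proof.
move=> mu0 mu1 eps0 eps1; have e8 : 0 < eps / 8%:R by rewrite divr_gt0.
pose k0 := Num.truncn (1 / mu).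
have [c1 c11 H1] := @energy_bound R K _ k0 e8; have [c2 c21 H2] := energy2_case e8.
have c1_0 : 0 <= c1 by lra.
have c2_0 : 0 <= c2 by lra.
exists (c1 * c2 * c2); first by rewrite mulr_ege1 ?mulr_ege1.
move=> F a X Y al be mF aF al1 be1 YX Y0 muY XY.
have F0 := monic_neq0 mF; have Fr : (size F).-1%:R = dg F :> R by [].
set r := (size F).-1 in Fr; set rho := dg F in muY XY Fr *.
have rho0 : 0 <= rho by rewrite -Fr.
have S0 := cabs_ge0 (bil F a X Y al be).
have C1 : 1 <= c1 * c2 * c2 by rewrite mulr_ege1 ?mulr_ege1.
have YX' : Y%:R <= X%:R :> R by rewrite ler_nat.
have em0 : 0 <= eps * rho by rewrite mulr_ge0 // ltW.
have mr0 : 0 <= mu * rho by rewrite mulr_ge0 // ltW.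
have emr : eps * mu * rho <= mu * rho by rewrite -mulrA ler_piMl.
have emr2 : eps * mu * rho <= eps * rho by rewrite mulrAC ler_piMr.
have Mn (n : nat) z : (q ^ n)%:R ^+ z = qpow (n%:R * z%:R) :> R by rewrite -qpow_nat qpowX.
have [rX|Xr] := leqP r X.
  apply: (@le_root 2) => //; have := bil_moment X Y 0 0 mF aF al1 be1.
  rewrite !(mul0n, muln0, muln1, expr0, mul1r) -/r => h; apply: le_trans h _.
  have hY := inv_energy1 mF Y; have hX := inv_energy1 mF X; rewrite -/r in hX hY.
  apply: (@le_trans _ _ (1 * qpow (2%:R * X%:R + Y%:R + (Y - r)%:R))).
    rewrite mul1r -natrM -natrM (_ : 2%:R * X%:R + Y%:R + (Y - r)%:R = (Y + (Y - r) + (r + (X + (X - r))))%N%:R).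
      by rewrite qpow_nat ler_nat !expnD leq_mul // leq_mul.
    by rewrite !natrD (natrB _ rX); ring.
  rewrite ler_pM ?qpow_ge0 // ler_qpow //.
  have [rY|Yr] := leqP r Y.
    have : mu * rho <= rho by rewrite ler_piMl.
    by rewrite natrB // Fr; lra.
  by rewrite (eqP (ltnW Yr : Y - r == 0)%N); lra.
have [sX sXE EX] := H2 F X mF Xr.
(* Y = r/6 is where both regimes lose their slack apart from eps: pairs need s_X + s_Y > r, and
   k-tuples need k Y + s_X > r, with s_X, s_Y the savings of [energy2_case] and k Y >= r/2 - Y. *)
have [Y6|Y6] := leqP r (6 * Y).
  have [sY sYE EY] := H2 F Y mF (leq_ltn_trans YX Xr).
  apply: (@le_root 8) => //; have := bil_moment X Y 1 1 mF aF al1 be1.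
  rewrite -/r => h; apply: le_trans h _; rewrite !Mn -!qpow_nat Fr.
  have Y6' : rho <= 6%:R * Y%:R by rewrite -Fr -natrM ler_nat.
  apply: (@le_trans _ _ (qpow (X%:R * 4%:R) * qpow (Y%:R * 4%:R) * (c2 * qpow (eps / 8%:R * rho + 4%:R * Y%:R - sY)) * (qpow rho * (c2 * qpow (eps / 8%:R * rho + 4%:R * X%:R - sX))))).
    by rewrite !ler_pM ?mulr_ge0 ?qpow_ge0.
  apply: (@le_trans _ _ (1 * c2 * c2 * qpow (X%:R * 4%:R + Y%:R * 4%:R + (eps / 8%:R * rho + 4%:R * Y%:R - sY) + (rho + (eps / 8%:R * rho + 4%:R * X%:R - sX))))).
    by rewrite !qpowD le_eqVlt; apply/orP; left; apply/eqP; ring.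
  rewrite ler_pM ?qpow_ge0 ?mulr_ge0 //; first by rewrite !ler_wpM2r.
  rewrite ler_qpow //; move: emr2 em0 XY YX' Y6'.
  have -> : (1 / 2 + eps) * rho = rho / 2%:R + eps * rho by lra.
  have -> : eps / 8%:R * rho = (eps * rho) / 8%:R by lra.
  have -> : eps * mu / 64%:R * rho = (eps * mu * rho) / 64%:R by lra.
  move: (eps * mu * rho) (eps * rho) => z w.
  by case: sXE => ->; case: sYE => ->; rewrite -/rho; lra.
pose k := (r %/ (2 * Y))%N.
have k1 : (0 < k)%N by rewrite divn_gt0 ?muln_gt0 // (leq_trans _ (ltnW Y6)) // leq_mul2r orbT.
have kY : (2 * (k * Y) <= r)%N by rewrite mulnCA leq_divM.
have kY2 : r%:R <= 2%:R * (k%:R * Y%:R) + 2%:R * Y%:R :> R.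
  have : (r < k.+1 * (2 * Y))%N by rewrite ltn_ceil // muln_gt0.
  by rewrite -!natrM -natrD ler_nat => /ltnW; rewrite mulSn; move=> h; apply: leq_trans h _; rewrite addnC leq_add2r mulnCA.
have kmu : k%:R * mu <= 1 / 2%:R.
  have rp : 0 < rho by rewrite -Fr ltr0n (leq_ltn_trans _ Xr).
  rewrite -(ler_pM2r rp) -mulrA mulrAC ler_pdivlMr // mulrC.
  apply: (@le_trans _ _ (2%:R * (k%:R * Y%:R))); first by rewrite ler_wpM2l // ler_wpM2l.
  by rewrite mul1r -Fr -!natrM ler_nat.
have kk : (k <= k0)%N.
  rewrite truncn_ge_nat ?divr_ge0 ?(ltW mu0) // ler_pdivlMr //; lra.
have EY := H1 F Y k mF Y0 kk kY.
have kp : k = k.-1.+1 by rewrite prednK.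
apply: (@le_root (2 * (k * 2))) => //; first by rewrite !muln_gt0 k1.
have := bil_moment X Y k.-1 1 mF aF al1 be1; rewrite -kp -/r => h; apply: le_trans h _.
rewrite !Mn -!qpow_nat Fr.
apply: (@le_trans _ _ (qpow (X%:R * (2 * (k.-1 * 2))%:R) * qpow (Y%:R * (2 * (k * 1))%:R) * (c1 * qpow ((k * Y)%:R + eps / 8%:R * rho)) * (qpow rho * (c2 * qpow (eps / 8%:R * rho + 4%:R * X%:R - sX))))).
  by rewrite !ler_pM ?mulr_ge0 ?qpow_ge0.
apply: (@le_trans _ _ (c1 * c2 * 1 * qpow (X%:R * (2 * (k.-1 * 2))%:R + Y%:R * (2 * (k * 1))%:R + ((k * Y)%:R + eps / 8%:R * rho) + (rho + (eps / 8%:R * rho + 4%:R * X%:R - sX))))).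
  by rewrite !qpowD le_eqVlt; apply/orP; left; apply/eqP; ring.
rewrite ler_pM ?qpow_ge0 ?mulr_ge0 //; first by rewrite ler_wpM2l ?mulr_ge0.
have kE : k.-1%:R = k%:R - 1 :> R by rewrite [in RHS]kp -natr1; ring.
have km2 : k%:R * mu * (eps * rho) <= 1 / 2%:R * (eps * rho) by rewrite ler_wpM2r.
have Y6' : 6%:R * Y%:R <= rho by rewrite -Fr -natrM ler_nat ltnW.
rewrite ler_qpow // muln1 !natrM kE; move: kY2 em0 XY YX' Y6' km2; rewrite Fr => kY2 em0' XY' YX2 Y62 km2.
have -> : 2%:R * (k%:R * 2%:R) * (X%:R + Y%:R - eps * mu / 64%:R * rho) =
  4%:R * (k%:R * X%:R) + 4%:R * (k%:R * Y%:R) - (k%:R * mu * (eps * rho)) / 16%:R by lra.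
have -> : X%:R * (2%:R * ((k%:R - 1) * 2%:R)) + Y%:R * (2%:R * k%:R) + (k%:R * Y%:R + eps / 8%:R * rho) +
   (rho + (eps / 8%:R * rho + 4%:R * X%:R - sX)) = 4%:R * (k%:R * X%:R) + 3%:R * (k%:R * Y%:R) + (eps * rho) / 4%:R + rho - sX by lra.
have XY2 : rho / 2%:R + eps * rho <= X%:R + Y%:R by lra.
move: kY2 em0' XY2 YX2 Y62 km2; clear -sXE; move: (k%:R * mu * (eps * rho)) (eps * rho) (k%:R * X%:R) (k%:R * Y%:R) => z w u v.
by case: sXE => ->; rewrite -/rho; lra.
Qed.

End TypeTwo.

(** * Vaughan's identity *)
Section Vaughan.
Variables (R : realType) (K : finFieldType).
Local Notation C := R[i].
Implicit Types (g : {poly K} -> C) (x d y : {poly K}).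
Local Notation mu := (fun d : {poly K} => (mobius d)%:~R : C).

Definition triple g n i j : C := if (i + j <= n)%N then
  \sum_(d1 <- mon K i) \sum_(d2 <- mon K j) \sum_(y <- mon K (n - i - j)) mu d1 * mu d2 * g (d1 * d2 * y)
  else 0.

Lemma triple_sym g n i j : triple g n i j = triple g n j i.
Proof.
rewrite /triple addnC; case: ifP => // _; rewrite exchange_big /=.
apply: eq_bigr => d2 _; apply: eq_bigr => d1 _; rewrite subnAC; apply: eq_bigr => y _.
by rewrite [mu d1 * _]mulrC [d1 * _]mulrC.
Qed.

(** Groups the second factor and y into a single variable of degree n - i. *)
Lemma triple_convolution g n i (w : nat -> C) : (i <= n)%N ->
  \sum_(j < n.+1) w j * triple g n i j = \sum_(d1 <- mon K i) \sum_(y <- mon K (n - i))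
    mu d1 * (\sum_(j < (n - i).+1) \sum_(d <- mon K j | d %| y) w j * mu d) * g (d1 * y).
Proof.
move=> ni; rewrite (bigID (fun j : 'I_n.+1 => (j < (n - i).+1)%N)) /= [X in _ + X]big1 ?addr0; last first.
  by move=> j; rewrite -leqNgt /triple => hj; rewrite ifF ?mulr0 //; apply/negbTE; rewrite -ltnNge; lia.
have le1 : ((n - i).+1 <= n.+1)%N by rewrite ltnS leq_subr.
rewrite -(big_ord_widen n.+1 (fun j => w j * triple g n i j) le1) /=.
transitivity (\sum_(j < (n - i).+1) \sum_(d1 <- mon K i) \sum_(d <- mon K j) \sum_(y <- mon K (n - i - j))
    w j * mu d1 * mu d * g (d1 * (d * y))).
  apply: eq_bigr => j _; rewrite /triple ifT; last by have := ltn_ord j; lia.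
  rewrite mulr_sumr; apply: eq_bigr => d1 _; rewrite mulr_sumr; apply: eq_bigr => d _.
  by rewrite mulr_sumr; apply: eq_bigr => y _; rewrite !mulrA.
rewrite exchange_big /=; apply: eq_bigr => d1 _.
pose H d y := w (size d).-1 * mu d1 * mu d * g (d1 * (d * y)).
have HE (j : nat) d y : d \in mon K j -> w j * mu d1 * mu d * g (d1 * (d * y)) = H d y.
  by move=> /monP[_ dj]; rewrite /H dj.
transitivity (\sum_(j < (n - i).+1) \sum_(d <- mon K j) \sum_(y <- mon K (n - i - j)) H d y).
  by apply: eq_bigr => j _; rewrite big_seq [RHS]big_seq; apply: eq_bigr => d dj; apply: eq_bigr => y _; exact: HE.
rewrite -exchange_mon_dvd; apply: eq_bigr => y _; rewrite mulr_sumr mulr_suml; apply: eq_bigr => j _.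
rewrite mulr_sumr mulr_suml big_seq_cond [RHS]big_seq_cond; apply: eq_bigr => d /andP[dj dy].
by rewrite -(HE j) // [d * _]mulrC divpK //; congr (_ * _); ring.
Qed.

(** The grouped variable carries the full divisor sum of the Möbius function, which vanishes unless
    that variable is 1. *)
Lemma triple_sum g n i : (i <= n)%N -> \sum_(j < n.+1) triple g n i j =
  if i == n then \sum_(x <- mon K n) mu x * g x else 0.
Proof.
move=> ni; under eq_bigr do rewrite -[triple _ _ _ _]mul1r.
rewrite (triple_convolution _ (fun=> 1)) //.
have H m y : y \in mon K m -> \sum_(j < m.+1) \sum_(d <- mon K j | d %| y) 1 * mu d = (m == 0)%N%:R.
  move=> yn; have /(congr1 (fun z : int => z%:~R : C)) := sum_mobius_dvd yn.
  move=> h; transitivity (((m == 0%N)%:R : int)%:~R : C); last by case: (m == 0%N).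
  rewrite -h rmorph_sum; apply: eq_bigr => j _.
  by rewrite rmorph_sum; apply: eq_bigr => d _; rewrite mul1r.
have [->|ne] := eqVneq i n.
  apply: eq_bigr => d1 _; rewrite subnn mon0 big_seq1 mulr1.
  by rewrite (H 0%N) ?mulr1 // mon0 inE.
rewrite big1 // => d1 _; rewrite big_seq big1 // => y /H ->.
by rewrite subn_eq0 leqNgt ltn_neqAle ne ni /= mulr0 mul0r.
Qed.

(* 1/zeta = (1/zeta - M)^2 zeta + 2 M - M^2 zeta, M being the part of degree <= U;
   the term 2 M does not contribute in degree n > U. *)
Lemma vaughan g n U : (U < n)%N -> \sum_(x <- mon K n) mu x * g x =
  (\sum_(i < n.+1 | (U < i)%N) \sum_(j < n.+1 | (U < j)%N) triple g n i j) -
  \sum_(i < n.+1 | (i <= U)%N) \sum_(j < n.+1 | (j <= U)%N) triple g n i j.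
Proof.
move=> Un; set S := LHS.
have spl (f : 'I_n.+1 -> C) : \sum_i f i = \sum_(i < n.+1 | (i <= U)%N) f i + \sum_(i < n.+1 | (U < i)%N) f i.
  by rewrite (bigID (fun i : 'I_n.+1 => (i <= U)%N)) /=; congr (_ + _); apply: eq_bigl => i; rewrite ltnNge.
have low : \sum_(i < n.+1 | (i <= U)%N) \sum_(j < n.+1) triple g n i j = 0.
  by rewrite big1 // => i iU; rewrite (triple_sum _ (leq_ord i)) (ltn_eqF (leq_ltn_trans iU Un)).
have high : \sum_(i < n.+1 | (U < i)%N) \sum_(j < n.+1) triple g n i j = S.
  rewrite (bigD1 ord_max) //= triple_sum // eqxx [X in _ + X]big1 ?addr0 // => i /andP[_ im].
  rewrite (triple_sum _ (leq_ord i)) ifF //; apply: contraNF im => /eqP im; exact/eqP/val_inj.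
rewrite -high (eq_bigr _ (fun (i : 'I_n.+1) _ => spl (fun j => triple g n i j))) big_split /= addrC.
(* The rows i <= U sum to 0, so by symmetry the mixed block is minus the block where both indices
   are at most U. *)
congr (_ + _); apply/eqP; rewrite -addr_eq0; apply/eqP.
rewrite exchange_big /= -big_split /= -[RHS]low; apply: eq_bigr => i _.
rewrite spl addrC; congr (_ + _); apply: eq_bigr => j _; exact: triple_sym.
Qed.

End Vaughan.

Section InverseSums.
Variables (R : realType) (K : finFieldType) (p : nat) (pK : p \in [pchar K]).
Hypothesis p_odd : odd p.
Local Notation C := R[i].
Local Notation q := #|K|.
Local Notation e := (e_mod R pK).
Local Notation dg := (dg R).
Local Notation qpow := (@qpow R K).
Local Notation mu := (fun d : {poly K} => (mobius d)%:~R : C).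
Implicit Types (F a x : {poly K}).

Definition einv F a x : C := if coprimep x F then e F (a * inv_mod F x) else 0.

Lemma cabs_einv F a x : cabs (einv F a x) <= 1.
Proof. by rewrite /einv; case: ifP; rewrite ?cabs_e_mod ?cabs0. Qed.

Lemma cabs_mu x : cabs (mu x) <= 1.
Proof. by rewrite cabs_int (_ : 1 = 1%:~R :> R) // ler_int mobius_le1. Qed.

Lemma sum_mon_const n (c : R) : \sum_(x <- mon K n) c = qpow n%:R * c.
Proof. by rewrite big_const_seq count_predT iter_addr addr0 size_mon qpow_nat mulr_natl. Qed.

Lemma einvM F a x y : F != 0 -> coprimep x F -> einv F a (x * y) = einv F (a * inv_mod F x) y.
Proof.
move=> F0 xF; rewrite /einv coprimepMl xF /=; case: ifP => // yF.
apply: e_mod_mod => //; have i1 := inv_modP F0 xF; have i2 := inv_modP F0 yF.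
have i3 : F %| x * y * (inv_mod F x * inv_mod F y) - 1.
  move: i1 i2; move: (inv_mod F x) (inv_mod F y) => x' y' i1 i2.
  have -> : x * y * (x' * y') - 1 = (x * x' - 1) * (y * y') + (y * y' - 1) by ring.
  by rewrite dvdp_add // dvdp_mulr.
have [_ d] := inv_mod_uniq F0 i3.
by rewrite -mulrA -mulrBr dvdp_mull.
Qed.

Lemma einvM0 F a x y : ~~ coprimep x F -> einv F a (x * y) = 0.
Proof. by move=> xF; rewrite /einv coprimepMl (negPf xF). Qed.

Lemma inv_mod_coprime F x : F != 0 -> coprimep x F -> coprimep (inv_mod F x) F.
Proof.
move=> F0 xF; have := inv_modP F0 xF; rewrite mulrC => h.
by have [] := inv_mod_uniq F0 h.
Qed.

(** For fixed d1, d2 the sum over y is an incomplete Kloosterman sum with a divided by d1 d2. *)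
Lemma type_one F a n i j M : F \is monic -> coprimep a F -> 0 <= M ->
  (forall b c, coprimep c F -> cabs (kloo R pK c b F) <= M) -> (i + j <= n)%N ->
  cabs (triple (einv F a) n i j) <= M * (qpow (i%:R + j%:R) + qpow (n%:R - dg F)).
Proof.
move=> mF aF M0 HM ijn; have F0 := monic_neq0 mF.
pose m := (n - i - j)%N; have mE : m%:R = n%:R - i%:R - j%:R :> R by rewrite /m -subnDA natrB // natrD; ring.
rewrite /triple ijn; apply: (@le_trans _ _ (\sum_(d1 <- mon K i) \sum_(d2 <- mon K j) M * Num.max 1 (qpow (m%:R - dg F)))).
  apply: le_trans (cabs_sum _ _ _) _; apply: ler_sum => d1 _; apply: le_trans (cabs_sum _ _ _) _; apply: ler_sum => d2 _.
  rewrite -mulr_sumr !cabsM.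
  have B0 : 0 <= M * Num.max 1 (qpow (m%:R - dg F)) by rewrite mulr_ge0 // le_max ler01.
  have mm : cabs (mu d1) * cabs (mu d2) <= 1 by rewrite mulr_ile1 ?cabs_ge0 // cabs_mu.
  rewrite -[X in _ <= X]mul1r ler_pM ?mulr_ge0 ?cabs_ge0 //.
  have [dF|dF] := boolP (coprimep (d1 * d2) F); last first.
    by rewrite big1 ?cabs0 // => y _; exact: einvM0.
  under eq_bigr do rewrite einvM //.
  have := @cabs_incomplete R K p pK p_odd F (a * inv_mod F (d1 * d2)) m M mF M0.
  rewrite [X in _ -> cabs X <= _]big_mkcond; apply => b; apply: HM.
  by rewrite coprimepMl aF inv_mod_coprime.
rewrite !sum_mon_const mulrA -qpowD mulrCA ler_wpM2l // maxr_pMr ?qpow_ge0 // mulr1 -qpowD mE.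
have -> : i%:R + j%:R + (n%:R - i%:R - j%:R - dg F) = n%:R - dg F :> R by ring.
by rewrite ge_max lerDl lerDr !qpow_ge0.
Qed.

(** The coefficient of the grouped variable is a partial divisor sum of the Möbius function, at most
    the number of divisors; dividing by D normalises it. *)
Lemma type_two_sum F a n U i (D : R) : F != 0 -> 0 < D -> (i <= n)%N ->
  (forall y, y \in mon K (n - i) -> (count (fun d => d %| y) (monle K (n - i)))%:R <= D) ->
  exists2 be : {poly K} -> C, (forall x, cabs (be x) <= 1) &
  \sum_(j < n.+1 | (U < j)%N) triple (einv F a) n i j = D%:C * bil pK F a i (n - i) (fun x => mu x) be.
Proof.
move=> F0 D0 ni HD; pose w (j : nat) : C := (U < j)%:R.
pose b y := \sum_(j < (n - i).+1) \sum_(d <- mon K j | d %| y) w j * mu d.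
have bD y : y \in mon K (n - i) -> cabs (b y) <= D.
  move=> my; apply: le_trans (HD y my); rewrite -sum1_count big_mkcond sum_monle natr_sum.
  apply: le_trans (cabs_sum _ _ _) _; apply: ler_sum => j _; rewrite -big_mkcond natr_sum.
  apply: le_trans (cabs_sum _ _ _) _; apply: ler_sum => d _; rewrite cabsM /w cabs_nat.
  by case: (U < j)%N; rewrite ?mul0r // mul1r cabs_mu.
exists (fun y => if y \in mon K (n - i) then b y / D%:C else 0) => [y|].
  case: ifP => my; last by rewrite cabs0.
  rewrite -fmorphV cabsM cabs_real ger0_norm ?invr_ge0 ?(ltW D0) // ler_pdivrMr // mul1r.
  exact: bD.
have Dc : D%:C != 0 :> C by rewrite (inj_eq (@complexI R) _ 0) gt_eqF.
transitivity (\sum_(j < n.+1) w j * triple (einv F a) n i j).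
  by rewrite big_mkcond; apply: eq_bigr => j _; rewrite /w; case: ifP; rewrite ?mul1r ?mul0r.
rewrite triple_convolution // /bil mulr_sumr [RHS]big_mkcond; apply: eq_bigr => d1 _.
case: ifP => d1F; last by rewrite big1 // => y _; rewrite einvM0 ?mulr0 // d1F.
rewrite mulr_sumr big_seq [RHS]big_seq_cond [RHS]big_mkcond [LHS]big_mkcond; apply: eq_bigr => y _.
case: ifP => //= yn; rewrite einvM // /einv; case: ifP => yF; last by rewrite mulr0.
rewrite -/(b y) mulrA; congr (_ * _); first by rewrite [D%:C * _]mulrCA [D%:C * _]mulrC divfK.
Qed.

Lemma middle_range eps A : 0 < eps -> eps <= 1 / 2 -> (0 < A)%N -> exists2 c : R, 1 <= c &
  exists2 d : R, 0 < d & forall F a n, F \is monic -> coprimep a F -> (0 < n)%N ->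
    (1 / 2 + eps) * dg F <= n%:R -> n%:R <= A%:R * dg F ->
    cabs (\sum_(x <- mon K n) mu x * einv F a x) <= c * qpow (n%:R * (1 - d)).
Proof.
move=> eps0 eps1 A0; have A0' : 0 < A%:R :> R by rewrite ltr0n.
(* With U <= nu r the short degrees add up to at most eps r/4; with another eps r/4 from the
   Kloosterman bound, the first exponent of [type_one] is r/2 + eps r/2, still eps r/2 below n. *)
pose nu := eps / 8%:R; have nu0 : 0 < nu by rewrite divr_gt0.
have nu1 : nu <= 1 by rewrite /nu; lra.
have eps1' : eps <= 1 by lra.
pose ka := eps * nu / 64%:R; have ka0 : 0 < ka by rewrite divr_gt0 // mulr_gt0.
have kae : ka <= eps / 2%:R.
  have : eps * nu <= eps * 1 by rewrite ler_wpM2l // ltW.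
  by rewrite /ka; move: (eps * nu) => z; lra.
(* Two factors q^(et n), for the number of terms and the divisor bound, cost at most ka r/4 because
   n <= A r. *)
pose et := ka / (8%:R * A%:R); have et0 : 0 < et by rewrite divr_gt0 // mulr_gt0.
have etA : et * A%:R = ka / 8%:R by rewrite /et; field; rewrite gt_eqF.
have e4 : 0 < eps / 4%:R by rewrite divr_gt0.
have [c1 c11 H1] := kloosterman pK p_odd e4.
have [c2 c21 H2] := type_two pK p_odd nu0 nu1 eps0 eps1'.
have [c3 c31 H3] := @divisor_bound R K _ et0.
have [c4 c41 H4] := linear_qpow K et0.
have [c10 c20 c30 c40] : [/\ 0 <= c1, 0 <= c2, 0 <= c3 & 0 <= c4] by split; lra.
exists (c4 * c3 * c2 + c4 * c4 * (2%:R * c1)).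
  have h1 : 1 <= c4 * c3 * c2 by rewrite !mulr_ege1.
  have h2 : 0 <= c4 * c4 * (2%:R * c1) by rewrite !mulr_ge0.
  lra.
exists (ka / (2%:R * A%:R)); first by rewrite divr_gt0 // mulr_gt0.
move=> F a n mF aF n0 lo hi; have F0 := monic_neq0 mF.
set rho := dg F in lo hi; have n0' : 0 < n%:R :> R by rewrite ltr0n.
have rho0 : 0 < rho by rewrite -(pmulr_rgt0 _ A0') (lt_le_trans n0').
have er0 : 0 <= eps * rho by rewrite mulr_ge0 // ltW.
have er1 : eps * rho <= rho / 2%:R by rewrite -[X in _ <= X]mulrC ler_wpM2r ?(ltW rho0) //; lra.
have lo' : rho / 2%:R + eps * rho <= n%:R by move: lo; lra.
pose U := Num.truncn (nu * rho).
have nr0 : 0 <= nu * rho by rewrite mulr_ge0 // ltW.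
have /andP[U1 U2] := truncn_itv nr0; rewrite -/U in U1 U2.
have nuE : nu * rho = (eps * rho) / 8%:R by rewrite /nu; lra.
rewrite nuE in U1 U2.
have Un : (U < n)%N by rewrite -(ltr_nat R); lra.
have sav (x : R) : x <= et * n%:R + et * n%:R + (n%:R - ka * rho) -> qpow x <= qpow (n%:R * (1 - ka / (2%:R * A%:R))).
  move=> xle; apply: ler_qpow; apply: le_trans xle _.
  have hi2 : n%:R / A%:R <= rho by rewrite ler_pdivrMr // mulrC.
  have h1 : ka / A%:R * n%:R <= ka * rho.
    have -> : ka / A%:R * n%:R = ka * (n%:R / A%:R) by field; rewrite gt_eqF.
    exact: ler_wpM2l (ltW ka0) _ _ hi2.
  have -> : n%:R * (1 - ka / (2%:R * A%:R)) = n%:R - (ka / A%:R * n%:R) / 2%:R by field; rewrite gt_eqF.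
  have -> : et * n%:R = (ka / A%:R * n%:R) / 8%:R by rewrite /et; field; rewrite gt_eqF.
  have h0 : 0 <= ka / A%:R * n%:R by apply: mulr_ge0 => //; apply/ltW/divr_gt0.
  by move: h0 h1; move: (ka / A%:R * n%:R) (ka * rho) => z w; lra.
rewrite (vaughan _ Un); apply: le_trans (cabsD _ _) _; rewrite cabsN mulrDl lerD //.
  pose B := c3 * qpow (et * n%:R) * (c2 * qpow (n%:R - ka * rho)).
  have B0 : 0 <= B by rewrite !mulr_ge0 ?qpow_ge0.
  have D0 : 0 < c3 * qpow (et * n%:R) by rewrite mulr_gt0 ?qpow_gt0 //; lra.
  apply: (@le_trans _ _ (n.+1%:R * B)).
    apply: le_trans (cabs_sum _ _ _) _.
    apply: (@le_trans _ _ (\sum_(i < n.+1) B)); last by rewrite sumr_const card_ord mulr_natl.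
    rewrite big_mkcond; apply: ler_sum => i _; case: ifP => // Ui.
    have ni : (i <= n)%N := leq_ord i.
    have [Un'|nU] := leqP (n - i) U.
      rewrite big1 ?cabs0 // => j Uj; rewrite /triple ifF //; apply/negbTE; rewrite -ltnNge.
      by rewrite -ltn_subLR // (leq_ltn_trans Un').
    have HD y : y \in mon K (n - i) -> (count (fun d => d %| y) (monle K (n - i)))%:R <= c3 * qpow (et * n%:R).
      move=> /monP[my sy]; apply: le_trans (H3 y _ my) _; rewrite ler_wpM2l // ler_qpow // ler_wpM2l ?(ltW et0) //.
      by rewrite /dg sy ler_nat leq_subr.
    have [be be1 ->] := type_two_sum a U F0 D0 ni HD.
    rewrite cabsM cabs_real ger0_norm ?(ltW D0) // ler_wpM2l ?(ltW D0) //.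
    have XY : i%:R + (n - i)%:R = n%:R :> R by rewrite -natrD subnKC.
    have YX : (n - i)%:R + i%:R = n%:R :> R by rewrite -natrD subnK.
    have big_ (m : nat) : (U < m)%N -> nu * dg F <= m%:R.
      by rewrite -(ler_nat R) -/rho nuE; move: U2; rewrite -natr1; lra.
    have [le|le] := leqP (n - i) i.
      have := H2 F a i (n - i)%N _ be mF aF cabs_mu be1 le (leq_ltn_trans (leq0n _) nU) (big_ _ nU).
      by rewrite XY; apply.
    rewrite bil_sym; have := H2 F a (n - i)%N i be _ mF aF be1 cabs_mu (ltnW le) (leq_ltn_trans (leq0n _) Ui) (big_ _ Ui).
    by rewrite YX; apply.
  apply: le_trans (ler_wpM2r B0 (H4 n)) _.
  have -> : c4 * qpow (et * n%:R) * B = c4 * c3 * c2 * qpow (et * n%:R + et * n%:R + (n%:R - ka * rho)).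
    by rewrite /B !qpowD; ring.
  by rewrite ler_wpM2l ?mulr_ge0 // sav.
pose B := 2%:R * c1 * qpow (n%:R - eps * rho / 2%:R).
have B0 : 0 <= B by rewrite !mulr_ge0 ?qpow_ge0.
apply: (@le_trans _ _ (n.+1%:R * (n.+1%:R * B))).
  apply: le_trans (cabs_sum _ _ _) _.
  apply: (@le_trans _ _ (\sum_(i < n.+1) (n.+1%:R * B))); last by rewrite sumr_const card_ord [X in _ <= X]mulr_natl.
  rewrite big_mkcond; apply: ler_sum => i _; case: ifP => [iU|_]; last by rewrite mulr_ge0.
  apply: le_trans (cabs_sum _ _ _) _.
  apply: (@le_trans _ _ (\sum_(j < n.+1) B)); last by rewrite sumr_const card_ord mulr_natl.
  rewrite big_mkcond; apply: ler_sum => j _; case: ifP => [jU|//].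
  have [ij|ij] := leqP (i + j) n; last first.
    by rewrite (_ : triple _ _ _ _ = 0) ?cabs0 // /triple ifF //; apply/negbTE; rewrite -ltnNge.
  have M0 : 0 <= c1 * qpow ((1 / 2 + eps / 4%:R) * rho) by rewrite mulr_ge0 ?qpow_ge0.
  apply: le_trans (type_one mF aF M0 (fun b c cF => H1 F c b mF cF) ij) _.
  have iU' : i%:R <= U%:R :> R by rewrite ler_nat.
  have jU' : j%:R <= U%:R :> R by rewrite ler_nat.
  have -> : B = c1 * (qpow (n%:R - eps * rho / 2%:R) + qpow (n%:R - eps * rho / 2%:R)) by rewrite /B; ring.
  rewrite -[X in X <= _]mulrA ler_wpM2l // mulrDr -!qpowD lerD // ler_qpow //.
    by have -> : (1 / 2 + eps / 4%:R) * rho = rho / 2%:R + (eps * rho) / 4%:R by [lra|lra]; lra.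
  by have -> : (1 / 2 + eps / 4%:R) * rho = rho / 2%:R + (eps * rho) / 4%:R by [lra|lra]; rewrite -/rho; lra.
have q0 := qpow_ge0 K (et * n%:R).
apply: (@le_trans _ _ ((c4 * qpow (et * n%:R)) * ((c4 * qpow (et * n%:R)) * B))).
  have h4 := H4 n; apply: ler_pM => //; first exact: mulr_ge0.
  exact: ler_wpM2r.
have -> : c4 * qpow (et * n%:R) * (c4 * qpow (et * n%:R) * B) = c4 * c4 * (2%:R * c1) * qpow (et * n%:R + et * n%:R + (n%:R - eps * rho / 2%:R)).
  by rewrite /B !qpowD; ring.
rewrite ler_wpM2l ?mulr_ge0 // sav // !lerD2l lerN2.
have : ka * rho <= eps / 2%:R * rho by rewrite ler_wpM2r ?(ltW rho0).
by lra.
Qed.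

End InverseSums.

(** * Even sums, all ranges of n, and the final sieve *)

Section Assembly.
Variables (R : realType) (K : finFieldType) (p : nat) (pK : p \in [pchar K]).
Hypothesis p_odd : odd p.
Local Notation C := R[i].
Local Notation q := #|K|.
Local Notation e := (e_mod R pK).
Local Notation dg := (dg R).
Local Notation qpow := (@qpow R K).
Local Notation mu := (fun d : {poly K} => (mobius d)%:~R : C).
Local Notation einv := (@einv R K p pK).
Implicit Types (F G a x : {poly K}).

Lemma einv_kloo F a x : einv F a x = kloo_term R pK a 0 F x.
Proof. by rewrite /einv /kloo_term mul0r addr0. Qed.

Lemma einv_periodic F a : F != 0 -> periodic F (einv F a).
Proof. by move=> F0 x y xy; rewrite !einv_kloo; exact: kloo_term_periodic xy. Qed.

Lemma einvE F a x y : F != 0 -> F %| x * y - 1 -> einv F a x = e F (a * y).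
Proof. by move=> F0 xy; rewrite einv_kloo (kloo_termE _ _ _ _ F0 xy) mul0r addr0. Qed.

Lemma einvZ F a x (h : K) : F != 0 -> h != 0 -> einv F a (h *: x) = einv F (h^-1 *: a) x.
Proof.
move=> F0 h0; have [xF|xF] := boolP (coprimep x F); last first.
  by rewrite /einv coprimepZl // (negPf xF).
have i := inv_modP F0 xF.
have i2 : F %| h *: x * (h^-1 *: inv_mod F x) - 1.
  by rewrite -scalerAl -scalerAr scalerA mulfV // scale1r.
by rewrite (einvE _ F0 i2) (einvE _ F0 i) -scalerAl -scalerAr.
Qed.

(** By [einvZ] this is the sum over all constant multiples of x, hence an even function of x, while
    [middle_range] applies to each term. *)
Definition even_sum F a x : C := \sum_(h : K | h != 0) einv F (h *: a) x.

Lemma even_sumZ F a x (c : K) : F != 0 -> c != 0 -> even_sum F a (c *: x) = even_sum F a x.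
Proof.
move=> F0 c0; rewrite /even_sum [RHS](reindex_inj (mulfI (invr_neq0 c0))) /=.
apply: eq_big => [h|h _]; first by rewrite mulf_eq0 invr_eq0 (negPf c0).
by rewrite einvZ // scalerA.
Qed.

Lemma cabs_even_sum F a x : cabs (even_sum F a x) <= q%:R.
Proof.
apply: le_trans (cabs_sum _ _ _) _.
apply: (@le_trans _ _ (\sum_(h : K) 1)); last by rewrite sumr_const.
rewrite big_mkcond; apply: ler_sum => h _; case: ifP => // _; exact: cabs_einv.
Qed.

Lemma even_sum_ncop F a x : ~~ coprimep x F -> even_sum F a x = 0.
Proof. by move=> xF; rewrite /even_sum big1 // => h _; rewrite /einv (negPf xF). Qed.

Lemma even_sumM F a x y : F != 0 -> coprimep x F -> even_sum F a (x * y) = even_sum F (a * inv_mod F x) y.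
Proof. by move=> F0 xF; apply: eq_bigr => h _; rewrite einvM // -scalerAl. Qed.

Lemma full_range eps : 0 < eps -> eps <= 1 / 2 -> exists2 c : R, 1 <= c &
  exists d : R, [/\ 0 < d, d <= 1 / 8%:R & forall F a n, F \is monic -> coprimep a F -> (0 < n)%N ->
    (1 / 2 + eps) * dg F <= n%:R ->
    cabs (\sum_(x <- mon K n) mu x * even_sum F a x) <= c * qpow (n%:R * (1 - d))].
Proof.
move=> eps0 eps1; have [c0 c00 [A H0]] := long_range R K.
(* Beyond n = (8A + 1) r the loss q^(A r) of [long_range] is at most q^(n/8), which leaves
   q^(7n/8). *)
have [c1 c11 [d1 d10 H1]] := middle_range pK p_odd eps0 eps1 (ltn0Sn (8 * A)).
have q1 : 1 <= q%:R :> R by rewrite ler1n ltnW // finNzRing_gt1.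
have q0 : 0 < q%:R :> R by lra.
exists (q%:R * (c1 + c0)); first by rewrite mulr_ege1 //; lra.
have h18 : 0 < 1 / 8%:R :> R by lra.
exists (Num.min d1 (1 / 8%:R)); split; first by rewrite lt_min d10.
  by rewrite ge_min lexx orbT.
move=> F a n mF aF n0 lo; have F0 := monic_neq0 mF; rewrite -mulrA.
have mono (d : R) : Num.min d1 (1 / 8%:R) <= d -> qpow (n%:R * (1 - d)) <= qpow (n%:R * (1 - Num.min d1 (1 / 8%:R))).
  by move=> le; rewrite ler_qpow // ler_wpM2l // lerD2l lerN2.
set T := qpow (n%:R * (1 - Num.min _ _)) in mono *; have T0 : 0 <= T by exact: qpow_ge0.
have [hi|hi] := leP n%:R ((8 * A).+1%:R * dg F).
  have -> : \sum_(x <- mon K n) mu x * even_sum F a x =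
      \sum_(h : K | h != 0) \sum_(x <- mon K n) mu x * einv F (h *: a) x.
    by rewrite exchange_big /=; apply: eq_bigr => x _; rewrite /even_sum mulr_sumr.
  apply: le_trans (cabs_sum _ _ _) _.
  apply: (@le_trans _ _ (\sum_(h : K) (c1 + c0) * T)); last by rewrite sumr_const -[X in X <= _]mulr_natl.
  rewrite big_mkcond; apply: ler_sum => h _; case: ifP => h0; last by rewrite mulr_ge0 //; lra.
  have haF : coprimep (h *: a) F by rewrite coprimepZl // h0.
  apply: le_trans (H1 F (h *: a) n mF haF n0 lo hi) _; rewrite ler_pM ?qpow_ge0 //; [lra|lra|].
  by apply: mono; rewrite ge_min lexx.
pose g x : C := even_sum F a x / q%:R.
have qC : q%:R != 0 :> C by rewrite pnatr_eq0 -lt0n ltnW // finNzRing_gt1.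
have -> : \sum_(x <- mon K n) mu x * even_sum F a x = q%:R * \sum_(x <- mon K n | coprimep x F) mu x * g x.
  rewrite mulr_sumr [RHS]big_mkcond; apply: eq_bigr => x _; case: ifP => xF.
    by rewrite /g [RHS]mulrCA [q%:R * _]mulrC divfK.
  by rewrite even_sum_ncop ?mulr0 // xF.
rewrite cabsM cabs_nat ler_wpM2l //.
have := H0 F g n F0 _ _ _; move=> h; apply: le_trans (h _ _ _) _.
- move=> x y xy; rewrite /g; congr (_ / _); apply: eq_bigr => k _; exact: einv_periodic xy.
- by move=> k x k0; rewrite /g even_sumZ.
- move=> x; rewrite /g cabsM -(rmorph_nat (real_complex R)) -fmorphV cabs_real ger0_norm ?invr_ge0 //.
  by rewrite ler_pdivrMr // mul1r cabs_even_sum.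
have t0 : 0 <= c0 * T by rewrite mulr_ge0.
apply: (@le_trans _ _ (c0 * T)); last by rewrite ler_wpM2r //; lra.
rewrite -mulrA ler_wpM2l // qpowX -qpowD; apply: le_trans (mono (1 / 8%:R) _); last by rewrite ge_min lexx orbT.
rewrite ler_qpow //; move: hi; rewrite -natr1 natrM.
have dg0 : 0 <= dg F by rewrite /dg.
have := mulr_ge0 (ler0n R A) dg0; move: dg0; rewrite mulrDl mul1r -mulrA.
by move: (A%:R * dg F) (dg F) => u v; lra.
Qed.

(** For m below (1/2 + eps/2) r the trivial q^m is written as q^(d m) q^(m(1-d)), and q^(d m) is
    absorbed in the constant. Working with eps/2 keeps this loss below the gain once n > (1/2 + eps)
    r. *)
Lemma sieved_range eps : 0 < eps -> eps <= 1 / 2 -> exists2 c : R, 1 <= c &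
  exists d : R, [/\ 0 < d, d <= 1 / 8%:R & forall F G a n, F \is monic -> G \is monic -> coprimep a F ->
    cabs (\sum_(x <- mon K n | coprimep x G) mu x * even_sum F a x)
      <= c * qpow (d * eps / 4%:R * dg G + d * (1 / 2 + eps / 2%:R) * dg F + n%:R * (1 - d))].
Proof.
move=> eps0 eps1; have e2 : 0 < eps / 2%:R by lra.
have e21 : eps / 2%:R <= 1 / 2 by lra.
have [c c1 [d [d0 d8 H]]] := full_range e2 e21.
have c0 : 0 <= c by lra.
have T32 : 3 / 2 <= qpow (1 - d) by apply: le_trans (three_halves R K) _; rewrite ler_qpow //; lra.
have et0 : 0 < d * eps / 4%:R by rewrite divr_gt0 // mulr_gt0.
have [C0 C01 HC] := mobius_sieve K T32 et0.
have q1 : 1 <= q%:R :> R by rewrite ler1n ltnW // finNzRing_gt1.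
exists (C0 * (c + q%:R)); first by rewrite mulr_ege1 //; lra.
exists d; split => // F G a n mF mG aF; have F0 := monic_neq0 mF.
(* Replacing d by P d divides the numerator by P, or gives 0 if P divides F, so the family is closed
   as the sieve requires. *)
pose Fam f := (exists2 b, coprimep b F & f = even_sum F b) \/ f = (fun _ => 0).
pose B := (c + q%:R) * qpow (d * (1 / 2 + eps / 2%:R) * dg F).
have dg0 : 0 <= dg F by rewrite /dg.
have dE0 : 0 <= d * (1 / 2 + eps / 2%:R) * dg F by rewrite !mulr_ge0 //; lra.
have B0 : 0 <= B by rewrite mulr_ge0 ?qpow_ge0 //; lra.
have := HC Fam B B0 _ _ G (even_sum F a) n mG _; move=> h; apply: le_trans (h _ _ _) _.
- move=> f P pP [[b bF ->]|->]; last by right.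
  have [PF|PF] := boolP (coprimep P F).
    left; exists (b * inv_mod F P); first by rewrite coprimepMl bF inv_mod_coprime.
    by apply/funext => x; exact: even_sumM.
  right; apply/funext => x; apply: even_sum_ncop; apply: contra PF; by rewrite coprimepMl; case/andP.
- move=> f m [[b bF ->]|->]; last first.
    rewrite big1 => [|x _]; last by rewrite mulr0.
    by rewrite cabs0; apply: mulr_ge0 => //; rewrite exprn_ge0 // qpow_ge0.
  rewrite qpowX [(1 - d) * _]mulrC /B.
  have [/andP[m0 lo]|nlo] := boolP ((0 < m)%N && ((1 / 2 + eps / 2%:R) * dg F <= m%:R)).
    apply: le_trans (H F b m mF bF m0 lo) _; rewrite ler_wpM2r ?qpow_ge0 //.
    apply: (@le_trans _ _ (c * 1)); first by rewrite mulr1.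
    by rewrite ler_pM ?qpow_ge1 //; lra.
  have mle : m%:R <= (1 / 2 + eps / 2%:R) * dg F.
    move: nlo; rewrite negb_and -leqNgt leqn0 -ltNge => /orP[/eqP ->|/ltW //].
    by rewrite mulr_ge0 //; lra.
  apply: (@le_trans _ _ (q%:R * qpow m%:R)).
    apply: le_trans (cabs_sum _ _ _) _; rewrite mulrC -sum_mon_const; apply: ler_sum => x _.
    by rewrite cabsM -[X in _ <= X]mul1r ler_pM ?cabs_ge0 ?cabs_mu ?cabs_even_sum.
  rewrite -mulrA ler_pM ?qpow_ge0 //; first by lra.
  rewrite -qpowD ler_qpow // mulrBr mulr1 addrCA -[X in X <= _]addr0 lerD2l subr_ge0 mulrC -mulrA.
  by rewrite ler_wpM2l // ltW.
- by left; exists a.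
by rewrite qpowX [(1 - d) * _]mulrC !qpowD /B le_eqVlt; apply/orP; left; apply/eqP; ring.
Qed.

Lemma sum_npolyS (V : nmodType) n (f : {poly K} -> V) :
  \sum_(x : {poly_n.+1 K}) f x = \sum_(x : {poly_n K}) f x + \sum_(h : K | h != 0) \sum_(y <- mon K n) f (h *: y).
Proof.
have sz (t : K * {poly_n K}) : t.1 *: 'X^n + (t.2 : {poly K}) \is a poly_of_size n.+1.
  rewrite qualifE /=; apply: leq_trans (size_polyD _ _) _; rewrite geq_max.
  by rewrite (leq_trans (size_scale_leq _ _)) ?size_polyXn // (leq_trans (size_npoly _)).
pose k t : {poly_n.+1 K} := NPoly (sz t).
have kinj : injective k.
  move=> [h v] [h' v'] /(congr1 val) /= E; have cv (w : {poly_n K}) : (w : {poly K})`_n = 0.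
    by rewrite nth_default // size_npoly.
  have hh : h = h'.
    by have := congr1 (fun P : {poly K} => P`_n) E; rewrite !coefD !coefZ coefXn eqxx !mulr1 !cv !addr0.
  by congr (_, _) => //; apply: val_inj; move: E; rewrite hh => /addrI.
have kbij : bijective k by apply: inj_card_bij kinj _; rewrite card_prod !card_npoly expnS.
rewrite (reindex k) /=; last exact: onW_bij.
rewrite -(pair_bigA _ (fun h (v : {poly_n K}) => f (h *: 'X^n + (v : {poly K})))) /= (bigD1 0) //=; congr (_ + _).
  by apply: eq_bigr => v _; rewrite scale0r add0r.
apply: eq_bigr => h h0; rewrite sum_monXn; have zinj : injective (fun v : {poly_n K} => h *: v).
  by move=> v w /(scalerI h0).
rewrite (reindex_inj zinj) /=; apply: eq_bigr => v _; by rewrite scalerDr.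
Qed.

Lemma sum_npoly_mon (V : nmodType) n (f : {poly K} -> V) :
  \sum_(x : {poly_n K}) f x = f 0 + \sum_(j < n) \sum_(h : K | h != 0) \sum_(y <- mon K j) f (h *: y).
Proof.
elim: n => [|n IH]; last by rewrite sum_npolyS IH big_ord_recr addrA.
rewrite big_ord0 addr0 (big_pred1 (0 : {poly_0 K})) // => x.
by apply/esym/eqP/val_inj/eqP; rewrite -size_poly_leq0 size_npoly.
Qed.

(* The fraction a/F in lowest terms has denominator F', while x stays coprime to
   the whole of F. *)
Lemma einv_gcd F a : F != 0 -> exists F' a', [/\ F' \is monic, coprimep a' F', dg F' <= dg F &
  forall x, coprimep x F -> e F (a * inv_mod F x) = einv F' a' x].
Proof.
move=> F0; pose g := gcdp a F; have g0 : g != 0 by rewrite gcdp_eq0 negb_and F0 orbT.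
have FE := divpK (dvdp_gcdr a F); have aE := divpK (dvdp_gcdl a F); rewrite -/g in FE aE.
set F1 := F %/ g in FE; set a1 := a %/ g in aE.
have F10 : F1 != 0 by apply: contraNneq F0 => e0; rewrite -FE e0 mul0r.
pose l := lead_coef F1; have l0 : l != 0 by rewrite lead_coef_eq0.
have cop : coprimep a1 F1 by rewrite coprimep_div_gcd // F0 orbT.
have F'0 : l^-1 *: F1 != 0 by rewrite scaler_eq0 invr_eq0 negb_or l0.
exists (l^-1 *: F1), (l^-1 *: a1); split.
- by rewrite monicE lead_coefZ mulVf.
- by rewrite coprimepZl ?coprimepZr ?invr_eq0.
- rewrite /dg size_scale ?invr_eq0 // ler_nat -FE size_mul //.
  by move: g0; rewrite -size_poly_gt0; move: (size F1) (size g) => b c; lia.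
move=> x xF; have FE' : F = (l^-1 *: F1) * (l *: g).
  by rewrite -scalerAl -scalerAr scalerA mulVf // scale1r.
have i : l^-1 *: F1 %| x * inv_mod F x - 1.
  by apply: dvdp_trans (inv_modP F0 xF); rewrite [X in _ %| X]FE' dvdp_mulr.
rewrite (einvE _ F'0 i); set y := inv_mod F x.
have lg0 : l *: g != 0 by rewrite scaler_eq0 negb_or l0.
transitivity (e ((l^-1 *: F1) * (l *: g)) (l^-1 *: a1 * y * (l *: g))); last by rewrite e_modM.
rewrite -FE'; congr (e F _); rewrite -aE -!scalerAl -!scalerAr scalerA mulVf // scale1r.
by rewrite mulrAC.
Qed.

End Assembly.

Theorem theorem2p2 (R : realType) (K : finFieldType) (p : nat)
    (pK : p \in [pchar K]) (p_odd : odd p) (eps : R) (eps_gt0 : 0 < eps) :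
  exists delta : R, 0 < delta /\
  exists C : R, forall (a F : {poly K}) (r n : nat),
    size F = r.+1 -> (0 < n)%N -> r%:R * (1 / 2 + eps) < n%:R :> R ->
    `| \sum_(x : {poly_n K} | coprimep x F)
         (mobius x)%:~R * e_mod R pK F (a * inv_mod F x) |
      <= (C * #|K|%:R `^ (n%:R * (1 - delta)))%:C.
Proof.
pose ep := Num.min eps (1 / 2).
have ep0 : 0 < ep by rewrite lt_min eps_gt0; lra.
have ep1 : ep <= 1 / 2 by rewrite ge_min lexx orbT.
have [c c1 [d [d0 d8 H]]] := sieved_range pK p_odd ep0 ep1.
have de0 : 0 < d * ep by rewrite mulr_gt0.
have de1 : 0 < d * ep / 8%:R by rewrite divr_gt0.
have [c4 c41 H4] := linear_qpow K de1.
(* Because n > (1/2 + ep) r, the losses in r leave a saving of d ep n/4; half of it absorbs the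
   factor n from the sum over degrees, the other half is delta. *)
exists (d * ep / 8%:R); split => //; exists (c * c4) => a F r n sF n0 lo.
have F0 : F != 0 by rewrite -size_poly_gt0 sF.
have lF : lead_coef F != 0 by rewrite lead_coef_eq0.
have [F' [a' [mF' aF' dF' E]]] := einv_gcd R pK p_odd a F0.
have F'0 := monic_neq0 mF'.
pose G := (lead_coef F)^-1 *: F; have mG : G \is monic by rewrite monicE lead_coefZ mulVf.
have xG x : coprimep x G = coprimep x F by rewrite coprimepZr ?invr_eq0.
rewrite normCE lecR -/(qpow K (n%:R * (1 - d * ep / 8%:R))).
have -> : \sum_(x : {poly_n K} | coprimep x F) (mobius x)%:~R * e_mod R pK F (a * inv_mod F x) =
   \sum_(j < n) \sum_(y <- mon K j | coprimep y G) (mobius y)%:~R * even_sum R pK F' a' y.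
  rewrite big_mkcond /= (sum_npoly_mon n (fun x => if coprimep x F then (mobius x)%:~R * e_mod R pK F (a * inv_mod F x) else 0)).
  rewrite [X in X + _](_ : _ = 0) ?add0r; last first.
    by rewrite (mobius_nsquarefree (@squarefree0 K)) mul0r; case: ifP.
  apply: eq_bigr => j _; rewrite exchange_big [RHS]big_mkcond big_seq [RHS]big_seq; apply: eq_bigr => y yj.
  have /monP[my _] := yj; rewrite xG; case: ifP => yF; last first.
    by rewrite big1 // => h h0; rewrite coprimepZl // yF.
  (* A leading coefficient h of x becomes the factor 1/h on a', hence the reindexing by inverses. *)
  rewrite /even_sum mulr_sumr [RHS](reindex_inj (@invr_inj K)) /=; apply: eq_big => [h|h h0]; first by rewrite invr_eq0.
  by rewrite coprimepZl // yF mobiusZ // E ?coprimepZl // einvZ.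
have dg0 : 0 <= dg R F' by rewrite /dg.
have rF : dg R F = r%:R by rewrite /dg sF.
have rG : dg R G = r%:R by rewrite /dg size_scale ?invr_eq0 // sF.
have lo' : (1 / 2 + ep) * r%:R <= n%:R.
  apply: le_trans (ltW lo); rewrite mulrC ler_wpM2l // lerD2l ge_min lexx //.
pose Z := d * ep / 4%:R * r%:R + d * (1 / 2 + ep / 2%:R) * r%:R + n%:R * (1 - d).
have ZE : d * ep / 8%:R * n%:R + Z <= n%:R * (1 - d * ep / 8%:R).
  have r0 : 0 <= r%:R :> R by [].
  have h1 : (1 / 2 + 3%:R / 4%:R * ep) * r%:R <= (1 - ep / 4%:R) * n%:R.
    apply: (@le_trans _ _ ((1 - ep / 4%:R) * ((1 / 2 + ep) * r%:R))); last by rewrite ler_wpM2l //; lra.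
    rewrite mulrA ler_wpM2r //.
    have : ep * ep <= ep * (1 / 2) by rewrite ler_wpM2l // ltW.
    by lra.
  have h2 := ler_wpM2l (ltW d0) h1; move: h2; rewrite /Z.
  have -> : d * ((1 / 2 + 3%:R / 4%:R * ep) * r%:R) = d * ep / 4%:R * r%:R + d * (1 / 2 + ep / 2%:R) * r%:R by lra.
  have -> : d * ((1 - ep / 4%:R) * n%:R) = d * n%:R - d * ep / 4%:R * n%:R by lra.
  by lra.
apply: le_trans (cabs_sum _ _ _) _.
apply: (@le_trans _ _ (\sum_(j < n) c * qpow K Z)).
  apply: ler_sum => j _; apply: le_trans (H F' G a' j mF' mG aF') _.
  have jn : (j : nat)%:R <= n%:R :> R by rewrite ler_nat ltnW.
  rewrite ler_wpM2l ?(le_trans ler01) // ler_qpow // rG !lerD //.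
    by rewrite ler_wpM2l ?rF -?rF // mulr_ge0 // ?(ltW d0) //; lra.
  by rewrite ler_wpM2r //; lra.
rewrite sumr_const card_ord -[X in X <= _]mulr_natl.
apply: (@le_trans _ _ (c4 * qpow K (d * ep / 8%:R * n%:R) * (c * qpow K Z))).
  apply: ler_wpM2r; first by rewrite mulr_ge0 ?qpow_ge0 // (le_trans ler01).
  by apply: le_trans (H4 n); rewrite ler_nat.
have -> : c4 * qpow K (d * ep / 8%:R * n%:R) * (c * qpow K Z) = c * c4 * qpow K (d * ep / 8%:R * n%:R + Z).
  by rewrite [qpow K (_ + Z)]qpowD; ring.
by rewrite ler_wpM2l ?ler_qpow // mulr_ge0 // (le_trans ler01).
Qed.
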